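(* Let $f:\mathbb{C}\to\mathbb{C}$ be a transcendental entire function of finite order, and let $a\in\mathbb{C}$ be a locally omitted value of $f$. Then $a$ is the projection of a logarithmic singularity of $f^{-1}$.
   Context: $B(a,r)$ denotes the open disc of radius $r$ centered at $a\in\mathbb{C}$. A point $a\in\mathbb{C}$ is locally omitted by $f$ if there exist $r>0$ and a connected component $G$ of $f^{-1}(B(a,r))$ such that $f(z)\neq a$ for all $z\in G$. One says that $a$ is the projection of a logarithmic singularity of $f^{-1}$ if there exist $r>0$ and a connected component $G$ of $f^{-1}(B(a,r))$ such that $f(z)\neq a$ for all $z\in G$ and the restriction $f:G\to B(a,r)\setminus\{a\}$ is a universal covering. An entire function $f$ has finite order if there are constants $C,\rho>0$ with $|f(z)|\le C\exp(|z|^{\rho})$ for all $z\in\mathbb{C}$. An entire function is transcendental if it is not a polynomial. *)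

(* Defs.v *)
From HB Require Import structures.
From mathcomp Require Import all_boot all_order all_algebra.
From mathcomp Require Import complex.
From mathcomp Require Import all_classical all_reals all_analysis.

Set Implicit Arguments.
Unset Strict Implicit.
Unset Printing Implicit Defensive.

Import Order.TTheory GRing.Theory Num.Theory.
Import numFieldNormedType.Exports.

Local Open Scope classical_set_scope.
Local Open Scope ring_scope.
Local Open Scope complex_scope.

(* The topology and norm that [R[i]] has as a [numFieldType]: the instances of
   mathcomp-analysis are keyed on [R[i]^o] and are not inferred on [R[i]]. *)
HB.instance Definition _ (R : realType) := NormedModule.copy R[i] R[i]^o.

Section Topology.
Context {E B : topologicalType}.

Definition homeomorphism_on (V : set E) (U : set B) (p : E -> B) : Prop :=
  [/\ set_bij V U p, {within V, continuous p} &
      exists q : B -> E, {in V, cancel p q} /\ {within U, continuous q}].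

(* [open (V : set (subspace A))] alone does not force [V `<=` A]: the points
   outside [A] are isolated in [subspace A]. *)
Definition relatively_open (T : topologicalType) (A V : set T) : Prop :=
  V `<=` A /\ open (V : set (subspace A)).

Definition evenly_covered (A : set E) (p : E -> B) (U : set B) : Prop :=
  exists Vs : set (set E),
    [/\ forall V, Vs V -> relatively_open A V,
        trivIset Vs id,
        \bigcup_(V in Vs) V = A `&` p @^-1` U &
        forall V, Vs V -> homeomorphism_on V U p].

Definition covering_on (A : set E) (D : set B) (p : E -> B) : Prop :=
  [/\ {within A, continuous p},
      p @` A = D &
      forall y, D y ->
        exists U : set B,
          [/\ U y, relatively_open D U & evenly_covered A p U]].

End Topology.

Section SimplyConnected.
Context (R : realType) {T : topologicalType}.

Definition path_in (A : set T) (x y : T) (g : R -> T) : Prop :=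
  [/\ {within `[0, 1], continuous g}, g @` `[0, 1] `<=` A, g 0 = x & g 1 = y].

Definition path_connected (A : set T) : Prop :=
  A !=set0 /\ forall x y, A x -> A y -> exists g, path_in A x y g.

(* [h (s, t)]: [s] is the path parameter, [t] the homotopy parameter. *)
Definition null_homotopic_in (A : set T) (x : T) (g : R -> T) : Prop :=
  exists h : R * R -> T,
    [/\ {within `[0, 1] `*` `[0, 1], continuous h},
        h @` (`[0, 1] `*` `[0, 1]) `<=` A,
        forall s, s \in `[0, 1] -> h (s, 0) = g s /\ h (s, 1) = x &
        forall t, t \in `[0, 1] -> h (0, t) = x /\ h (1, t) = x].

Definition simply_connected (A : set T) : Prop :=
  path_connected A /\
  forall x g, A x -> path_in A x x g -> null_homotopic_in A x g.

End SimplyConnected.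

Definition universal_covering_on (R : realType) (E B : topologicalType)
    (A : set E) (D : set B) (p : E -> B) : Prop :=
  covering_on A D p /\ simply_connected R A.

Definition is_component (T : topologicalType) (A G : set T) : Prop :=
  exists2 x, A x & G = connected_component A x.

Section Complex.
Context {R : realType}.
Implicit Types (f : R[i] -> R[i]) (a z : R[i]) (r : R).

Definition disc a r : set R[i] := ball a r%:C.

(* The increments in [derivable] are scalars of [R[i]], so that this is complex
   differentiability. *)
Definition entire f : Prop := forall z, derivable f z 1.

Definition polynomial_fun f : Prop :=
  exists p : {poly R[i]}, forall z, f z = p.[z].

Definition transcendental_entire f : Prop := entire f /\ ~ polynomial_fun f.

Definition finite_order f : Prop :=
  exists C rho : R, [/\ 0 < C, 0 < rho &
    forall z, Normc.normc (f z) <= C * expR (Normc.normc z `^ rho)].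

Definition locally_omitted f a : Prop :=
  exists (r : R) (G : set R[i]),
    [/\ 0 < r, is_component (f @^-1` disc a r) G & forall z, G z -> f z != a].

Definition logarithmic_singularity f a : Prop :=
  exists (r : R) (G : set R[i]),
    [/\ 0 < r, is_component (f @^-1` disc a r) G, forall z, G z -> f z != a &
        universal_covering_on R G (disc a r `\ a) f].

End Complex.

(* Main.v *)
(* Let F = f - a, let G be a component of |F| < r in which F has no zeros, and let v be a branch
   of log (r / F) on G; it exists since, by the maximum principle, G has no holes. Then v maps G
   to the right half-plane, and it remains to find M and a component C of {Re v > M} that v maps
   homeomorphically onto {Re w > M}; on C the map f = a + r exp (-v) is a universal covering of
   a punctured disc.

   Finite order enters through growth: positive harmonic functions in cones at a point w, composed
   with v, give subharmonic functions of polynomial growth with disjoint supports, and the number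
   of those is bounded. If two preimages of w had the same tracts over two cones, these tracts
   would enclose a tract over a third cone or a component of {|F| > const}, which are unbounded;
   so the number of preimages of w is bounded.

   Hence v is proper as a map to the right half-plane. Otherwise preimages of points close to some
   w run off to infinity; let s (w) be the logarithm of the discriminant of the preimages of w (in
   a coordinate that vanishes at infinity), so that s = -oo at points with fewer preimages than the
   maximum. By a capacity estimate s is finite on some circle around w, so the preimage of the
   circle is bounded, and F would be bounded near infinity.

   By properness every component of {Re v > M} is mapped onto {Re w > M}, so the number of these
   components is bounded. If it is maximal, no component C splits when M increases, and there is
   no critical point in C: two sectors of {Re v > Re v (z0)} at a critical point z0 would be
   joined in this set and enclose a component of {|F| > const}. So v is a proper local
   homeomorphism of C onto a half-plane, and it is injective by lifting of segments. *)

Require Import Defs.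
From mathcomp Require Import all_boot all_order all_algebra.
From mathcomp Require Import complex.
From mathcomp Require Import all_classical all_reals all_analysis.
From mathcomp Require Import ring lra zify.

Set Implicit Arguments.
Unset Strict Implicit.
Unset Printing Implicit Defensive.

Import Order.TTheory GRing.Theory Num.Theory.
Import numFieldNormedType.Exports.

Local Open Scope classical_set_scope.
Local Open Scope ring_scope.
Local Open Scope complex_scope.

Local Notation Re := complex.Re.
Local Notation Im := complex.Im.

(** * Norm and topology in real terms *)

Section Norm.
Context {R : realType}.
Implicit Types (z w y : R[i]) (x e : R).

(** The obstacle is plane topology: statements that some sets enclose a point have to be proved
    without curves. A point lies outside a compact set if it [escapes] it through an unbounded
    connected set. If [b] and [b'] both escape, [(z - b) / (z - b')] has a continuous logarithm on
    the compact set, and [two_sectors] refutes this by adding up the changes of its imaginary part.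
    The unbounded sets are components of [|F| > s] or tracts over a cone; compact connected unions
    of discs stand in for paths.

    Potential theory is condensed into one inequality, [capacity]: a function [s <= 0] that reaches
    [- L] on every circle of an annulus is at most [- L / 20] on the inner disc. It serves three
    times: for the decay of thin lumps, as a minimum modulus estimate that bounds [Re v] by a power
    of [|z|], and for the discriminant. Its constant is far from sharp, so the bounds on the numbers
    of tracts are crude; finiteness suffices, since afterwards only extremal counts are used. *)

Definition N z : R := Normc.normc z.
Arguments N z : simpl never.

Lemma N0 : N 0 = 0. Proof. exact: Normc.normc0. Qed.
Lemma N1 : N 1 = 1. Proof. exact: Normc.normc1. Qed.
Lemma N_ge0 z : 0 <= N z. Proof. by case: z => a b; rewrite /N sqrtr_ge0. Qed.
Lemma N_eq0 z : N z = 0 -> z = 0. Proof. exact: Normc.eq0_normc. Qed.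
Lemma N_gt0 z : z != 0 -> 0 < N z.
Proof. by move=> z0; rewrite lt_def N_ge0 andbT; apply: contra z0 => /eqP/N_eq0->. Qed.
Lemma N_gt0P z : (0 < N z) = (z != 0).
Proof. by apply/idP/idP => [|/N_gt0//]; apply: contraTN => /eqP ->; rewrite N0 ltxx. Qed.
Lemma NM z w : N (z * w) = N z * N w. Proof. exact: Normc.normcM. Qed.
Lemma NV z : N z^-1 = (N z)^-1. Proof. exact: Normc.normcV. Qed.
Lemma NX z n : N (z ^+ n) = N z ^+ n.
Proof. by elim: n => [|n IH]; rewrite ?expr0 ?N1 // !exprS NM IH. Qed.
Lemma NN z : N (- z) = N z. Proof. exact: normcN. Qed.
Lemma ND z w : N (z + w) <= N z + N w. Proof. exact: le_normcD. Qed.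
Lemma NB z w : N (z - w) <= N z + N w. Proof. by rewrite -(NN w) ND. Qed.
Lemma NC z w : N (z - w) = N (w - z). Proof. by rewrite -NN opprB. Qed.
Lemma NBD w z (y : R[i]) : N (z - y) <= N (z - w) + N (w - y).
Proof. by have := ND (z - w) (w - y); rewrite addrA subrK. Qed.
Lemma N_sub z w : N z - N w <= N (z - w).
Proof. by rewrite lerBlDr; have := ND (z - w) w; rewrite subrK. Qed.
Lemma N_sub_abs z w : `|N z - N w| <= N (z - w).
Proof. by rewrite ler_norml N_sub andbT lerNl opprB NC N_sub. Qed.
Lemma NReal x : N x%:C = `|x|.
Proof. by rewrite /N /= expr0n addr0 sqrtr_sqr. Qed.
Lemma NE z : N z = Num.sqrt (Re z ^+ 2 + Im z ^+ 2). Proof. by case: z. Qed.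
Lemma N2 z : N z ^+ 2 = Re z ^+ 2 + Im z ^+ 2.
Proof. by rewrite NE sqr_sqrtr // addr_ge0 ?sqr_ge0. Qed.
Lemma Re_le_N z : `|Re z| <= N z.
Proof. by rewrite NE -sqrtr_sqr ler_wsqrtr // lerDl sqr_ge0. Qed.
Lemma Im_le_N z : `|Im z| <= N z.
Proof. by rewrite NE -sqrtr_sqr ler_wsqrtr // lerDr sqr_ge0. Qed.
Lemma N_le_ReIm z : N z <= `|Re z| + `|Im z|.
Proof.
rewrite {1}(complexE z); apply: le_trans (ND _ _) _.
rewrite NM !NReal lerD2l; suff -> : N 'i = 1 by rewrite mul1r.
by rewrite /N /= expr0n expr1n add0r sqrtr1.
Qed.
Lemma NE_norm z : `|z| = (N z)%:C. Proof. by case: z. Qed.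
Lemma ReD z w : Re (z + w) = Re z + Re w. Proof. by case: z w => a b [c d]. Qed.
Lemma ImD z w : Im (z + w) = Im z + Im w. Proof. by case: z w => a b [c d]. Qed.
Lemma ReN z : Re (- z) = - Re z. Proof. by case: z. Qed.
Lemma ImN z : Im (- z) = - Im z. Proof. by case: z. Qed.
Lemma ReB z w : Re (z - w) = Re z - Re w. Proof. by rewrite ReD ReN. Qed.
Lemma ImB z w : Im (z - w) = Im z - Im w. Proof. by rewrite ImD ImN. Qed.
Lemma ReM z w : Re (z * w) = Re z * Re w - Im z * Im w. Proof. by case: z w => a b [c d]. Qed.
Lemma ImM z w : Im (z * w) = Re z * Im w + Im z * Re w. Proof. by case: z w => a b [c d]. Qed.
Lemma complex_eq z w : Re z = Re w -> Im z = Im w -> z = w.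
Proof. by case: z w => a b [c d] /= -> ->. Qed.
Lemma complex_ri z : z = Re z +i* Im z. Proof. by case: z. Qed.

Lemma nbhsCP z (A : set R[i]) :
  nbhs z A <-> exists2 e, 0 < e & forall y, N (y - z) < e -> A y.
Proof.
split.
- move=> /nbhs_ballP [[e e'] /=]; rewrite ltcE /= => /andP[/eqP -> e0] H.
  exists e => // y hy; apply: H; rewrite -ball_normE /ball_ /= NE_norm NC.
  by rewrite ltcE /= eqxx.
- move=> [e e0 H]; apply/nbhs_ballP; exists e%:C; first by rewrite /= ltcE /= eqxx.
  move=> y; rewrite -ball_normE /ball_ /= NE_norm NC ltcE /= => /andP[_ h].
  exact: H.
Qed.

Lemma openCP (A : set R[i]) :
  open A <-> forall z, A z -> exists2 e, 0 < e & forall y, N (y - z) < e -> A y.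
Proof.
by rewrite openE; split => [H z /H/nbhsCP//|H z /H/nbhsCP].
Qed.

Lemma discP (a : R[i]) (r : R) z : disc a r z <-> N (z - a) < r.
Proof.
by rewrite /disc -ball_normE /ball_ /= NE_norm NC ltcE /= eqxx.
Qed.

End Norm.

(** * Compactness, continuity and connectedness with real radii *)

Section Topology.
Context {R : realType}.
Implicit Types (z w y : R[i]) (x e d : R) (A B : set R[i]) (h : R[i] -> R[i]) (s : R[i] -> R).

Definition clN A := forall z, (forall e, 0 < e -> exists2 y, A y & N (y - z) < e) -> A z.
Definition bdN A := exists M : R, forall z, A z -> N z <= M.
Definition opN A := forall z, A z -> exists2 e, 0 < e & forall y, N (y - z) < e -> A y.
Definition rcont A s z :=
  forall e, 0 < e -> exists2 d, 0 < d & forall y, A y -> N (y - z) < d -> `|s y - s z| < e.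
Definition ccont A h z :=
  forall e, 0 < e -> exists2 d, 0 < d & forall y, A y -> N (y - z) < d -> N (h y - h z) < e.

Definition incr (f : nat -> nat) := forall k, (f k < f k.+1)%N.
Lemma incr_lt f : incr f -> forall m n, (m < n)%N -> (f m < f n)%N.
Proof.
move=> fi m; elim=> // n IH; rewrite ltnS leq_eqVlt => /orP[/eqP->//|/IH h].
exact: ltn_trans h (fi n).
Qed.
Lemma incr_ge f : incr f -> forall k, (k <= f k)%N.
Proof. by move=> fi; elim=> // k IH; apply: leq_ltn_trans IH (fi k). Qed.
Lemma incr_comp f g : incr f -> incr g -> incr (f \o g).
Proof. by move=> fi gi k /=; apply: incr_lt. Qed.

Definition tendsto (u : nat -> R[i]) l :=
  forall e, 0 < e -> exists K, forall k, (K <= k)%N -> N (u k - l) < e.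

Lemma tendsto_sub u l f : incr f -> tendsto u l -> tendsto (u \o f) l.
Proof.
move=> fi ul e /ul[K HK]; exists K => k Kk; apply: HK.
exact: leq_trans Kk (incr_ge fi k).
Qed.

Lemma cluster_point (u : nat -> R[i]) (M : R) : (forall k, N (u k) <= M) ->
  exists l, forall e, 0 < e -> forall m, exists2 k, (m <= k)%N & N (u k - l) < e.
Proof.
move=> uM; pose I := `[(- M)%R, M]%classic : set R.
have cI : compact I by exact: segment_compact.
pose U k : R * R := (Re (u k), Im (u k)).
have FI : (U @ \oo) (I `*` I).
  exists 0%N => // k _; split; rewrite /I /U /= in_itv /= -ler_norml.
    exact: le_trans (Re_le_N _) (uM k).
  exact: le_trans (Im_le_N _) (uM k).
have [p [_ clp]] := compact_setX cI cI _ FI.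
exists (p.1 +i* p.2) => e e0 m.
have e20 : 0 < e / 2 by rewrite divr_gt0.
have H1 : (U @ \oo) [set q | exists2 k, (m <= k)%N & q = U k].
  by exists m => // k /= mk; exists k.
have H2 : nbhs p (ball p (e / 2)) by apply: nbhsx_ballx.
have [q [[k mk ->] [/= h1 h2]]] := clp _ _ H1 H2.
exists k => //; apply: le_lt_trans (N_le_ReIm _) _.
rewrite ReB ImB [e]splitr ltrD //=.
  by rewrite distrC.
by rewrite distrC.
Qed.

Lemma bolzano (u : nat -> R[i]) (M : R) : (forall k, N (u k) <= M) ->
  exists l f, incr f /\ tendsto (u \o f) l.
Proof.
move=> /cluster_point[l Hl].
have H m (k : nat) : {j : nat | (m < j)%N /\ N (u j - l) < k.+1%:R^-1}.
  apply: cid; have [|j mj hj] := Hl k.+1%:R^-1 _ m.+1; first by rewrite invr_gt0.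
  by exists j.
pose fix f k := if k is k'.+1 then sval (H (f k') k) else sval (H 0%N 0%N).
have fi : incr f by move=> k /=; case: (svalP (H (f k) k.+1)).
exists l, f; split => // e e0.
exists (Num.bound e^-1).+1 => k Kk /=.
have -> : N (u (f k) - l) < e.
  have H1 : N (u (f k) - l) < k.+1%:R^-1.
    by case: k Kk => [|k] Kk; [case: (svalP (H 0%N 0%N))|case: (svalP (H (f k) k.+1))].
  apply: lt_trans H1 _; rewrite -[e]invrK ltf_pV2 ?posrE ?invr_gt0 //.
  apply: lt_le_trans (archi_boundP _) _; first by rewrite invr_ge0 ltW.
  by rewrite ler_nat; apply: leq_trans (leqnSn _) (leq_trans Kk _).
by [].
Qed.

Lemma cl_seq A (u : nat -> R[i]) l : clN A -> (forall k, A (u k)) -> tendsto u l -> A l.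
Proof.
by move=> cA Au ul; apply: cA => e /ul[K HK]; exists (u K) => //; apply: HK.
Qed.

Lemma rcont_seq A s (u : nat -> R[i]) l e : rcont A s l -> (forall k, A (u k)) -> tendsto u l ->
  0 < e -> exists K, forall k, (K <= k)%N -> `|s (u k) - s l| < e.
Proof.
move=> sc Au ul e0; have [d d0 Hd] := sc e e0.
by have [K HK] := ul d d0; exists K => k /HK; apply: Hd.
Qed.

Lemma EVTmax A s : clN A -> bdN A -> A !=set0 -> (forall z, A z -> rcont A s z) ->
  exists2 z, A z & forall y, A y -> s y <= s z.
Proof.
move=> cA [M AM] [a0 Aa0] sc.
have [bdd|] := pselect (exists b : R, forall z, A z -> s z <= b); last first.
  move=> nb; exfalso.
  have H (k : nat) : {z | A z /\ k%:R < s z}.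
    apply: cid; apply: contrapT => nz; apply: nb; exists k%:R => z Az.
    by rewrite leNgt; apply/negP => lt; apply: nz; exists z.
  pose u k := sval (H k).
  have Au k : A (u k) by case: (svalP (H k)).
  have [l [f [fi ul]]] := bolzano (fun k => AM _ (Au k)).
  have Al : A l by apply: cl_seq ul => // k; exact: Au.
  have [K HK] := rcont_seq (sc _ Al) (fun k => Au (f k)) ul ltr01.
  pose k := maxn K (Num.bound (`|s l| + 1)).
  have := HK k (leq_maxl _ _); rewrite ltr_norml => /andP[_ h1].
  have h2 : (f k)%:R < s (u (f k)) by case: (svalP (H (f k))).
  have h3 : `|s l| + 1 < (f k)%:R.
    apply: lt_le_trans (archi_boundP _) _; first by rewrite addr_ge0.
    rewrite ler_nat; apply: leq_trans (leq_maxr K _) (incr_ge fi _).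
  have := ler_norm (s l); lra.
pose S := [set s z | z in A].
have S0 : has_sup S.
  split; first by exists (s a0); exists a0.
  by case: bdd => b Hb; exists b => _ [z Az <-]; exact: Hb.
pose m := sup S.
have ik (k : nat) : (0 : R) < k.+1%:R^-1 by rewrite invr_gt0.
have H (k : nat) : {z | A z /\ m - k.+1%:R^-1 < s z}.
  apply: cid; have [_ [z Az <-] h] := sup_adherent (eps := k.+1%:R^-1) (ik k) S0.
  by exists z.
pose u k := sval (H k).
have Au k : A (u k) by case: (svalP (H k)).
have [l [f [fi ul]]] := bolzano (fun k => AM _ (Au k)).
have Al : A l by apply: cl_seq ul => // k; exact: Au.
exists l => // y Ay.
have sm : s y <= m by apply: ub_le_sup; [case: S0|exists y].
rewrite leNgt; apply/negP => lt.
have e0 : 0 < (s y - s l) / 2 by rewrite divr_gt0 // subr_gt0.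
have [K HK] := rcont_seq (sc _ Al) (fun k => Au (f k)) ul e0.
pose k := maxn K (Num.bound ((s y - s l) / 2)^-1).
have := HK k (leq_maxl _ _); rewrite ltr_norml => /andP[_ h1].
have h2 : m - (f k).+1%:R^-1 < s (u (f k)) by case: (svalP (H (f k))).
have h3 : (f k).+1%:R^-1 < (s y - s l) / 2.
  rewrite -[X in _ < X]invrK ltf_pV2 ?posrE ?invr_gt0 //.
  apply: lt_le_trans (archi_boundP _) _; first by rewrite invr_ge0 ltW.
  by rewrite ler_nat; apply: leq_trans (leq_maxr K _) (leq_trans (incr_ge fi _) _).
move: h2 h3; set q := _^-1 => h2 h3; lra.
Qed.

Lemma EVTmin A s : clN A -> bdN A -> A !=set0 -> (forall z, A z -> rcont A s z) ->
  exists2 z, A z & forall y, A y -> s z <= s y.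
Proof.
move=> cA bA A0 sc.
have [|z Az H] := @EVTmax A (fun z => - s z) cA bA A0.
  move=> z Az e /(sc z Az)[d d0 Hd]; exists d => // y Ay /(Hd y Ay).
  by rewrite -opprB normrN opprK addrC.
by exists z => // y /H; rewrite lerN2.
Qed.

Lemma unif_cont A s e : clN A -> bdN A -> (forall z, A z -> rcont A s z) -> 0 < e ->
  exists2 d, 0 < d & forall z y, A z -> A y -> N (y - z) < d -> `|s y - s z| < e.
Proof.
move=> cA [M AM] sc e0; apply: contrapT => nd.
have H (k : nat) : {p : R[i] * R[i] | [/\ A p.1, A p.2, N (p.2 - p.1) < k.+1%:R^-1 & e <= `|s p.2 - s p.1|]}.
  apply: cid; apply: contrapT => np; apply: nd; exists k.+1%:R^-1; first by rewrite invr_gt0.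
  move=> z y Az Ay zy; rewrite ltNge; apply/negP => le; apply: np; by exists (z, y).
pose u k := (sval (H k)).1; pose v k := (sval (H k)).2.
have Au k : A (u k) by case: (svalP (H k)).
have Av k : A (v k) by case: (svalP (H k)).
have [l [f [fi ul]]] := bolzano (fun k => AM _ (Au k)).
have Al : A l by apply: cl_seq ul => // k; exact: Au.
have vl : tendsto (v \o f) l.
  move=> d d0; have d20 : 0 < d / 2 by rewrite divr_gt0.
  have [K HK] := ul _ d20.
  exists (maxn K (Num.bound (d / 2)^-1)) => k; rewrite geq_max => /andP[/HK h1 h2].
  apply: le_lt_trans (NBD (u (f k)) _ _) _; rewrite [d]splitr ltrD //.
  have [_ _ h3 _] := svalP (H (f k)); apply: lt_trans h3 _.
  rewrite -[X in _ < X]invrK ltf_pV2 ?posrE ?invr_gt0 //.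
  apply: lt_le_trans (archi_boundP _) _; first by rewrite invr_ge0 ltW.
  by rewrite ler_nat (leq_trans h2) // (leq_trans (incr_ge fi k)).
have e20 : 0 < e / 2 by rewrite divr_gt0.
have [K1 HK1] := rcont_seq (sc _ Al) (fun k => Au (f k)) ul e20.
have [K2 HK2] := rcont_seq (sc _ Al) (fun k => Av (f k)) vl e20.
have := HK1 (maxn K1 K2) (leq_maxl _ _); have := HK2 (maxn K1 K2) (leq_maxr _ _).
have [_ _ _] := svalP (H (f (maxn K1 K2))).
rewrite -/(u _) -/(v _) !ltr_norml ler_normr => /orP[] h /andP[h1 h2] /andP[h3 h4]; lra.
Qed.

(** The continuation principle behind most connectedness arguments below: [P] is locally constant on
    [A], so the balls about points where it holds and about points where it fails are ambient open
    sets whose traces on [A] are complementary. *)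
Lemma connP A (P : R[i] -> Prop) : connected A ->
  (forall z, A z -> exists2 e, 0 < e & forall y, A y -> N (y - z) < e -> (P y <-> P z)) ->
  forall z y, A z -> A y -> P z -> P y.
Proof.
move=> cA H z y Az Ay Pz.
pose O (Q : R[i] -> Prop) : set R[i] := [set w | exists2 p, A p /\ Q p &
   exists2 e, N (w - p) < e & forall q, A q -> N (q - p) < e -> (P q <-> P p)].
have oO Q : open (O Q).
  apply/openCP => w [p [Ap Qp] [e we He]]; exists (e - N (w - p)); first by rewrite subr_gt0.
  move=> q hq; exists p => //; exists e => //.
  by apply: le_lt_trans (NBD w _ _) _; rewrite -ltrBrDr.
have OA Q w : A w -> Q w -> O Q w.
  move=> Aw Qw; have [e e0 He] := H w Aw; exists w => //; exists e => //.
  by rewrite subrr N0.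
have BA : A `&` O P = A.
  apply: cA; first by exists z; split => //; apply: OA.
    by exists (O P).
  exists (~` (O (fun q => ~ P q))); first exact: open_closedC.
  apply/seteqP; split => w [Aw].
    move=> [p [Ap Pp] [e we He]]; split => // -[p' [Ap' Pp'] [e' we' He']].
    by apply: Pp'; apply/(He' w Aw we'); apply/(He w Aw we).
  by move=> nO; split => //; apply: (OA) => //; apply: contrapT => nP; apply: nO; apply: OA.
have : (A `&` O P) y by rewrite BA.
by move=> [_ [p [Ap Pp] [e ye He]]]; apply/(He y Ay ye).
Qed.

Lemma connI A : (forall z y, A z -> A y -> exists B, [/\ connected B, B `<=` A, B z & B y]) ->
  connected A.
Proof.
move=> H.
have [->|/set0P[z Az]] := eqVneq A set0; first exact: connected0.
have -> : A = \bigcup_(B in [set B | [/\ connected B, B `<=` A & B z]]) B.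
  apply/seteqP; split => [y Ay|y [B [_ BA _] /BA//]].
  by have [B [c BA Bz By]] := H z y Az Ay; exists B.
apply: bigcup_connected; last by move=> B [].
by exists z => B [].
Qed.

Lemma connU A B : connected A -> connected B -> A `&` B !=set0 -> connected (A `|` B).
Proof. by move=> cA cB /connectedU; apply. Qed.

End Topology.

(** * Limits along filters *)

Section Limits.
Context {R : realType}.
Implicit Types (z w y l m : R[i]) (e d x : R).

(** One notion of limit for all purposes: at a point, relative to a set, along a real parameter, and
    on products. *)
Definition tC (T : Type) (F : set_system T) (h : T -> R[i]) l :=
  forall e, 0 < e -> F [set t | N (h t - l) < e].

Section Filter.
Context (T : Type) (F : set_system T) {FF : Filter F}.
Implicit Types h k : T -> R[i].

Lemma tC_cst l : tC F (fun=> l) l.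
Proof. by move=> e e0; apply: filterS (@filterT _ F _) => t _ /=; rewrite subrr N0. Qed.

Lemma tC_eq h k l : F [set t | h t = k t] -> tC F h l -> tC F k l.
Proof. by move=> hk hl e e0; apply: filterS2 hk (hl e e0) => t /= ->. Qed.

Lemma tCD h k l m : tC F h l -> tC F k m -> tC F (fun t => h t + k t) (l + m).
Proof.
move=> hl km e e0; have e20 : 0 < e / 2 by rewrite divr_gt0.
apply: filterS2 (hl _ e20) (km _ e20) => t /= h1 h2.
rewrite opprD addrACA; apply: le_lt_trans (ND _ _) _.
by rewrite [e]splitr ltrD.
Qed.

Lemma tCN h l : tC F h l -> tC F (fun t => - h t) (- l).
Proof. by move=> hl e e0; apply: filterS (hl e e0) => t /=; rewrite -opprD NN. Qed.

Lemma tCB h k l m : tC F h l -> tC F k m -> tC F (fun t => h t - k t) (l - m).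
Proof. by move=> hl km; apply: tCD => //; apply: tCN. Qed.

Lemma tCM h k l m : tC F h l -> tC F k m -> tC F (fun t => h t * k t) (l * m).
Proof.
move=> hl km e e0; pose b := 1 + N l + N m.
have b0 : 0 < b by rewrite /b; have := N_ge0 l; have := N_ge0 m; lra.
pose e' := Num.min 1 (e / b).
have e'0 : 0 < e' by rewrite lt_min ltr01 divr_gt0.
apply: filterS2 (hl _ e'0) (km _ e'0) => t /= h1 h2.
have -> : h t * k t - l * m = (h t - l) * (k t - m) + (h t - l) * m + l * (k t - m) by ring.
apply: le_lt_trans (ND _ _) _; apply: (@le_lt_trans _ _ (N (h t - l) * N (k t - m) + N (h t - l) * N m + N l * N (k t - m))).
  by rewrite -!NM lerD2r ND.
have e'1 : e' <= 1 by rewrite ge_min lexx.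
have e'e : e' * b <= e by rewrite -ler_pdivlMr // ge_min lexx orbT.
apply: lt_le_trans e'e; rewrite /b !mulrDr mulr1.
have := N_ge0 (h t - l); have := N_ge0 (k t - m); have := N_ge0 l; have := N_ge0 m.
set a := N (h t - l) in h1 *; set c := N (k t - m) in h2 * => *.
by nra.
Qed.

Lemma tCV h l : l != 0 -> tC F h l -> tC F (fun t => (h t)^-1) l^-1.
Proof.
move=> l0 hl e e0; have Nl := N_gt0 l0.
pose e' := Num.min (N l / 2) (e * N l ^+ 2 / 2).
have e'0 : 0 < e'.
  by rewrite lt_min divr_gt0 //= divr_gt0 // mulr_gt0 // exprn_gt0.
apply: filterS (hl _ e'0) => t /=; rewrite lt_min => /andP[h1 h2].
have h3 : N l / 2 < N (h t) by have := N_sub l (h t); rewrite NC; lra.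
have ht0 : h t != 0 by rewrite -N_gt0P; lra.
have -> : (h t)^-1 - l^-1 = (l - h t) / (h t * l) by field; rewrite l0.
rewrite !NM NV NM NC ltr_pdivrMr ?mulr_gt0 //; last by lra.
have : e * (N l ^+ 2 / 2) <= e * (N (h t) * N l).
  by rewrite ler_pM2l // expr2; nra.
by lra.
Qed.

Lemma tC_div h k l m : m != 0 -> tC F h l -> tC F k m -> tC F (fun t => h t / k t) (l / m).
Proof. by move=> m0 hl km; apply: tCM => //; apply: tCV. Qed.

Lemma tCX h l n : tC F h l -> tC F (fun t => h t ^+ n) (l ^+ n).
Proof.
move=> hl; elim: n => [|n IH]; first exact: tC_cst.
rewrite exprS; apply: tC_eq (tCM hl IH); by apply: filterS (@filterT _ F _) => t _ /=; rewrite exprS.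
Qed.

Lemma tC_sum (I : Type) (s : seq I) (h : I -> T -> R[i]) (l : I -> R[i]) :
  (forall i, tC F (h i) (l i)) -> tC F (fun t => \sum_(i <- s) h i t) (\sum_(i <- s) l i).
Proof.
move=> hl; elim: s => [|i s IH].
  by rewrite big_nil; apply: tC_eq (tC_cst 0); apply: filterS (@filterT _ F _) => t _ /=; rewrite big_nil.
rewrite big_cons; apply: tC_eq (tCD (hl i) IH).
by apply: filterS (@filterT _ F _) => t _ /=; rewrite big_cons.
Qed.

Lemma tC_Re h l : tC F h l -> (fun t => Re (h t)) @ F --> Re l.
Proof.
move=> hl; apply/cvgrPdist_lt => e e0; apply: filterS (hl _ e0) => t /= H.
by rewrite distrC -ReB; apply: le_lt_trans (Re_le_N _) H.
Qed.

Lemma tC_Im h l : tC F h l -> (fun t => Im (h t)) @ F --> Im l.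
Proof.
move=> hl; apply/cvgrPdist_lt => e e0; apply: filterS (hl _ e0) => t /= H.
by rewrite distrC -ImB; apply: le_lt_trans (Im_le_N _) H.
Qed.

Lemma tC_N h l : tC F h l -> (fun t => N (h t)) @ F --> N l.
Proof.
move=> hl; apply/cvgrPdist_lt => e e0; apply: filterS (hl _ e0) => t /= H.
by rewrite distrC; apply: le_lt_trans (N_sub_abs _ _) H.
Qed.

Lemma tC_ri (a b : T -> R) l : a @ F --> Re l -> b @ F --> Im l ->
  tC F (fun t => a t +i* b t) l.
Proof.
move=> /cvgrPdist_lt al /cvgrPdist_lt bl e e0; have e20 : 0 < e / 2 by rewrite divr_gt0.
apply: filterS2 (al _ e20) (bl _ e20) => t /= h1 h2.
apply: le_lt_trans (N_le_ReIm _) _; rewrite ReB ImB /= [e]splitr.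
by rewrite ltrD // distrC.
Qed.

Lemma tC_real (a : T -> R) x : a @ F --> x -> tC F (fun t => (a t)%:C) x%:C.
Proof. by move=> ax; apply: tC_ri => //=; exact: cvg_cst. Qed.

End Filter.

Lemma withinCP (A P : set R[i]) z :
  (within A (nbhs z)) P <-> exists2 e, 0 < e & forall y, A y -> N (y - z) < e -> P y.
Proof.
split=> [/nbhsCP[e e0 H]|[e e0 H]]; first by exists e => // y Ay /H; apply.
by apply/nbhsCP; exists e => // y /H H2 Ay; apply: H2.
Qed.

Lemma ccontP (A : set R[i]) h z : ccont A h z <-> tC (within A (nbhs z)) h (h z).
Proof.
split=> [H e e0|H e e0].
  by apply/withinCP; have [d d0 Hd] := H e e0; exists d => // y Ay /(Hd y Ay).
by have /withinCP[d d0 Hd] := H e e0; exists d.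
Qed.

Lemma rcontP (A : set R[i]) (s : R[i] -> R) z :
  rcont A s z <-> s @ (within A (nbhs z)) --> s z.
Proof.
split=> [H|/cvgrPdist_lt H e e0].
  apply/cvgrPdist_lt => e e0; apply/withinCP.
  by have [d d0 Hd] := H e e0; exists d => // y Ay /(Hd y Ay) /=; rewrite distrC.
by have /withinCP[d d0 Hd] := H e e0; exists d => // y Ay /(Hd y Ay) /=; rewrite distrC.
Qed.

Definition cc h z := tC (nbhs z) h (h z).

Lemma ccE h z : cc h z <-> forall e, 0 < e -> exists2 d, 0 < d & forall y, N (y - z) < d -> N (h y - h z) < e.
Proof. by split=> [H e e0|H e e0]; [have /nbhsCP := H e e0|apply/nbhsCP/H]. Qed.

Lemma cc_within A h z : cc h z -> ccont A h z.
Proof. by move=> /ccE H e /H[d d0 Hd]; exists d => // y _; exact: Hd. Qed.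

Lemma cc_id z : cc id z.
Proof. by apply/ccE => e e0; exists e. Qed.

Lemma tC_comp (T : Type) (F : set_system T) (k : T -> R[i]) h l : Filter F ->
  tC F k l -> cc h l -> tC F (fun t => h (k t)) (h l).
Proof.
move=> FF kl /ccE hl e /hl[d d0 Hd].
by apply: filterS (kl d d0) => t; exact: Hd.
Qed.

Lemma cc_comp k h z : cc k z -> cc h (k z) -> cc (fun y => h (k y)) z.
Proof. by move=> kz hz; apply: tC_comp kz hz. Qed.

End Limits.

(** * Complex derivatives *)

Section Derivatives.
Context {R : realType}.
Implicit Types (z w y l m : R[i]) (e d x t : R) (h k : R[i] -> R[i]) (p q : R -> R[i]).

(* Caratheodory form of the complex derivative and of the derivative of a path. *)
Definition der h z l :=
  exists g, [/\ forall y, h y - h z = g y * (y - z), cc g z & g z = l].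
Definition pder p t l :=
  exists g : R -> R[i], [/\ forall s, p s - p t = g s * (s - t)%:C, tC (nbhs t) g (g t) & g t = l].

Lemma der_cst l z : der (fun=> l) z 0.
Proof. by exists (fun=> 0); split => // [y|]; [rewrite subrr mul0r|exact: tC_cst]. Qed.
Lemma der_id z : der id z 1.
Proof. by exists (fun=> 1); split => // [y|]; [rewrite mul1r|exact: tC_cst]. Qed.
Lemma der_cc h z l : der h z l -> cc h z.
Proof.
move=> [g [hg gc _]]; rewrite /cc.
have H : tC (nbhs z) (fun y => h z + g y * (y - z)) (h z + g z * (z - z)).
  apply: tCD; first exact: tC_cst.
  apply: tCM => //; apply: tCB; [exact: cc_id|exact: tC_cst].
rewrite subrr mulr0 addr0 in H; apply: tC_eq H.
by apply: filterS (@filterT _ (nbhs z) _) => y _ /=; rewrite -hg addrC subrK.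
Qed.
Lemma derD h k z l m : der h z l -> der k z m -> der (fun y => h y + k y) z (l + m).
Proof.
move=> [g [hg gc <-]] [g' [hg' gc' <-]]; exists (fun y => g y + g' y); split => //.
  by move=> y; rewrite mulrDl -hg -hg'; ring.
exact: tCD.
Qed.
Lemma derM h k z l m : der h z l -> der k z m -> der (fun y => h y * k y) z (l * k z + h z * m).
Proof.
move=> dh dk; have hc := der_cc dh.
move: dh dk => [g [hg gc <-]] [g' [hg' gc' <-]]; exists (fun y => g y * k z + h y * g' y); split => //.
  move=> y; have -> : h y * k y - h z * k z = (h y - h z) * k z + h y * (k y - k z) by ring.
  by rewrite hg hg'; ring.
by apply: tCD; apply: tCM => //; exact: tC_cst.
Qed.
Lemma derZ c h z l : der h z l -> der (fun y => c * h y) z (c * l).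
Proof. by move=> dh; have := derM (der_cst c z) dh; rewrite mul0r add0r. Qed.
Lemma derN h z l : der h z l -> der (fun y => - h y) z (- l).
Proof.
move=> dh; have := derZ (-1) dh; rewrite mulN1r.
by under eq_fun do rewrite mulN1r.
Qed.
Lemma derB h k z l m : der h z l -> der k z m -> der (fun y => h y - k y) z (l - m).
Proof. by move=> dh dk; apply: derD => //; apply: derN. Qed.
Lemma derBc h c z l : der h z l -> der (fun y => h y - c) z l.
Proof. by move=> dh; have := derB dh (der_cst c z); rewrite subr0. Qed.
Lemma der_comp h k z l m : der k z m -> der h (k z) l -> der (fun y => h (k y)) z (l * m).
Proof.
move=> dk; have kc := der_cc dk; move: dk => [g [hg gc <-]] [g' [hg' gc' <-]].
exists (fun y => g' (k y) * g y); split => //; first by move=> y; rewrite hg' hg mulrA.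
by apply: tCM => //; apply: tC_comp gc'.
Qed.
Lemma derX h n z l : der h z l -> der (fun y => h y ^+ n.+1) z (l * h z ^+ n *+ n.+1).
Proof.
move=> dh; elim: n => [|n IH].
  by rewrite expr0 mulr1 mulr1n; under eq_fun do rewrite expr1.
have := derM dh IH; under eq_fun do rewrite -exprS.
congr der; rewrite [RHS]mulrS; congr (_ + _); rewrite mulrnAr; congr (_ *+ _).
by rewrite [in RHS]exprS; ring.
Qed.
Lemma derV h z l : h z != 0 -> der h z l -> der (fun y => (h y)^-1) z (- l / h z ^+ 2).
Proof.
move=> h0 dh; have hc := der_cc dh; move: dh => [g [hg gc <-]].
exists (fun y => if h y == 0 then (- (h z)^-1) / (y - z) else - g y / (h y * h z)); split.
- move=> y; case: eqP => [hy0|/eqP hy0].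
    rewrite hy0 invr0 sub0r divfK // subr_eq0; apply: contra h0 => /eqP <-.
    exact/eqP.
  have -> : (h y)^-1 - (h z)^-1 = - (h y - h z) / (h y * h z) by field; rewrite h0.
  by rewrite hg; ring.
- rewrite /cc (negbTE h0).
  have nz : \forall y \near z, h y != 0.
    have /nbhsCP[d d0 Hd] := hc _ (N_gt0 h0).
    apply/nbhsCP; exists d => // y /Hd /= H; apply: contraTN H => /eqP ->.
    by rewrite sub0r NN ltxx.
  have H : tC (nbhs z) (fun y => - g y / (h y * h z)) (- g z / (h z * h z)).
    apply: tC_div; first by rewrite mulf_neq0.
      exact: tCN.
    by apply: tCM => //; exact: tC_cst.
  by apply: tC_eq H; apply: filterS nz => y /= /negbTE ->.
- by rewrite (negbTE h0) expr2.
Qed.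
Lemma der_near h k z l : (\forall y \near z, h y = k y) -> der h z l -> der k z l.
Proof.
move=> /nbhsCP[d d0 hk] [g [hg gc gl]].
have hkz : h z = k z by apply: hk; rewrite subrr N0.
exists (fun y => if y == z then l else (k y - k z) / (y - z)); split; last by rewrite eqxx.
  move=> y; case: eqP => [->|/eqP yz]; first by rewrite !subrr mulr0.
  by rewrite divfK // subr_eq0.
rewrite /cc eqxx -gl; apply: tC_eq gc; apply/nbhsCP; exists d => // y yd /=.
case: eqP => [->//|/eqP yz].
by rewrite -hkz -hk // hg mulfK // subr_eq0.
Qed.

(** The factorization of [h] at [k w], evaluated at [k y], reads [y - w = g (k y) * (k y - k w)].
    Since [g (k y)] tends to [l != 0], its inverse is the difference quotient of [k]. *)
Lemma der_inv h k w l : cc k w -> (\forall y \near w, h (k y) = y) -> der h (k w) l -> l != 0 ->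
  der k w l^-1.
Proof.
move=> kc /nbhsCP[d d0 hk] [g [hg gc gl]] l0.
have gkc : tC (nbhs w) (fun y => g (k y)) (g (k w)) by apply: tC_comp gc.
have gkw : g (k w) != 0 by rewrite gl.
have nz : \forall y \near w, g (k y) != 0.
  have /nbhsCP[d' d'0 Hd] := gkc _ (N_gt0 gkw).
  apply/nbhsCP; exists d' => // y /Hd /= H; apply: contraTN H => /eqP ->.
  by rewrite sub0r NN ltxx.
have /nbhsCP[d2 d20 Hd2] := nz.
exists (fun y => if y == w then l^-1 else (k y - k w) / (y - w)); split; last by rewrite eqxx.
  move=> y; case: eqP => [->|/eqP yz]; first by rewrite !subrr mulr0.
  by rewrite divfK // subr_eq0.
rewrite /cc eqxx -gl; apply: tC_eq (tCV gkw gkc).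
apply/nbhsCP; exists (Num.min d d2); first by rewrite lt_min d0.
move=> y; rewrite lt_min => /andP[yd yd2] /=; case: eqP => [->|/eqP yw]; first by rewrite gl.
have := hg (k y); rewrite (hk y yd) (hk w); last by rewrite subrr N0.
move=> E; have kk : k y - k w != 0.
  by apply: contra yw => /eqP kk; rewrite kk mulr0 in E; rewrite -subr_eq0 E.
by rewrite E; field; rewrite kk Hd2.
Qed.

Lemma derivable_der h z : derivable h z 1 -> exists l, der h z l.
Proof.
move=> dh; pose l := lim ((fun y => y^-1 *: (h (y *: 1 + z) - h z)) @ 0^').
have hl : (fun y => y^-1 *: (h (y *: 1 + z) - h z)) @ 0^' --> l by exact: dh.
exists l; exists (fun y => if y == z then l else (h y - h z) / (y - z)); split; last by rewrite eqxx.
  move=> y; case: eqP => [->|/eqP yz]; first by rewrite !subrr mulr0.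
  by rewrite divfK // subr_eq0.
rewrite /cc eqxx => e e0.
have : nbhs l [set y | N (y - l) < e] by apply/nbhsCP; exists e.
move=> /hl; rewrite /fmap /= => /nbhsCP[d d0 Hd].
apply/nbhsCP; exists d => // y yd /=; case: eqP => [_|/eqP yz]; first by rewrite subrr N0.
have := Hd (y - z); rewrite subr0 => /(_ yd); rewrite subr_eq0 => /(_ yz).
by rewrite /GRing.scale /= mulr1 subrK [in X in X -> _]mulrC.
Qed.


Lemma pderE p t l : pder p t l <->
  is_derive t 1 (fun s => Re (p s)) (Re l) /\ is_derive t 1 (fun s => Im (p s)) (Im l).
Proof.
split.
- move=> [g [hg gc <-]]; split; apply/is_derive1_caratheodory.
    exists (fun s => Re (g s)); split => //; last exact: tC_Re.
    by move=> s; rewrite -ReB hg ReM /= mulr0 subr0.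
  exists (fun s => Im (g s)); split => //; last exact: tC_Im.
  by move=> s; rewrite -ImB hg ImM /= mulr0 add0r.
- move=> [/is_derive1_caratheodory[g1 [h1 c1 e1]] /is_derive1_caratheodory[g2 [h2 c2 e2]]].
  exists (fun s => g1 s +i* g2 s); split.
  + by move=> s; apply: complex_eq; rewrite ?ReB ?ImB ?ReM ?ImM /= ?h1 ?h2 mulr0 ?subr0 ?add0r.
  + exact: tC_ri.
  + by rewrite e1 e2 -complex_ri.
Qed.

Lemma pder_cont p t l : pder p t l -> tC (nbhs t) p (p t).
Proof.
move=> [g [hg gc _]].
have H : tC (nbhs t) (fun s => p t + g s * (s - t)%:C) (p t + g t * (t - t)%:C).
  apply: tCD; first exact: tC_cst.
  apply: tCM => //; apply: tC_real; apply: cvgB; [exact: cvg_id|exact: cvg_cst].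
rewrite subrr mulr0 addr0 in H; apply: tC_eq H.
by apply: filterS (@filterT _ (nbhs t) _) => s _ /=; rewrite -hg addrC subrK.
Qed.

Lemma pder_cst l t : pder (fun=> l) t 0.
Proof. by exists (fun=> 0); split => // [y|]; [rewrite subrr mul0r|exact: tC_cst]. Qed.
Lemma pder_id t : pder (fun s : R => s%:C) t 1.
Proof. by exists (fun=> 1); split => // [y|]; [rewrite mul1r rmorphB|exact: tC_cst]. Qed.
Lemma pderD p q t l m : pder p t l -> pder q t m -> pder (fun s => p s + q s) t (l + m).
Proof.
move=> [g [hg gc <-]] [g' [hg' gc' <-]]; exists (fun s => g s + g' s); split => //.
  by move=> s; rewrite mulrDl -hg -hg'; ring.
exact: tCD.
Qed.
Lemma pderM p q t l m : pder p t l -> pder q t m -> pder (fun s => p s * q s) t (l * q t + p t * m).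
Proof.
move=> dh dk; have hc := pder_cont dh.
move: dh dk => [g [hg gc <-]] [g' [hg' gc' <-]]; exists (fun s => g s * q t + p s * g' s); split => //.
  move=> s; have -> : p s * q s - p t * q t = (p s - p t) * q t + p s * (q s - q t) by ring.
  by rewrite hg hg'; ring.
by apply: tCD; apply: tCM => //; exact: tC_cst.
Qed.
Lemma pderZ c p t l : pder p t l -> pder (fun s => c * p s) t (c * l).
Proof. by move=> dh; have := pderM (pder_cst c t) dh; rewrite mul0r add0r. Qed.
Lemma pderB p q t l m : pder p t l -> pder q t m -> pder (fun s => p s - q s) t (l - m).
Proof.
move=> dh dk; have := pderD dh (pderZ (-1) dk); rewrite mulN1r.
by under eq_fun do rewrite mulN1r.
Qed.
Lemma pder_comp h p t l m : pder p t m -> der h (p t) l -> pder (fun s => h (p s)) t (l * m).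
Proof.
move=> dk; have kc := pder_cont dk; move: dk => [g [hg gc <-]] [g' [hg' gc' <-]].
exists (fun s => g' (p s) * g s); split => //; first by move=> s; rewrite hg' hg mulrA.
by apply: tCM => //; apply: tC_comp gc'.
Qed.

End Derivatives.

(** * Exponential and logarithm *)

Section Exponential.
Context {R : realType}.
Implicit Types (z w y l m : R[i]) (e d x t : R).

Definition ii : R[i] := 0 +i* 1.
Definition cis t : R[i] := cos t +i* sin t.
Definition cexp z : R[i] := (expR (Re z))%:C * cis (Im z).

Lemma cis0 : cis 0 = 1. Proof. by rewrite /cis cos0 sin0. Qed.
Lemma cisD s t : cis (s + t) = cis s * cis t.
Proof. by apply: complex_eq; rewrite ?ReM ?ImM /= ?cosD ?sinD //; ring. Qed.
Lemma N_cis t : N (cis t) = 1.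
Proof. by rewrite NE /= cos2Dsin2 sqrtr1. Qed.
Lemma cis_neq0 t : cis t != 0. Proof. by rewrite -N_gt0P N_cis. Qed.
Lemma cisN t : cis (- t) = (cis t)^-1.
Proof. by apply: (mulfI (cis_neq0 t)); rewrite -cisD subrr cis0 divff ?cis_neq0. Qed.
Lemma cis_2pi : cis (pi *+ 2) = 1. Proof. by rewrite /cis cos2pi sin2pi. Qed.
Lemma cis_pi : cis pi = -1. Proof. by rewrite /cis cospi sinpi; apply: complex_eq; rewrite //= oppr0. Qed.
Lemma cis_2pin (n : nat) : cis (pi *+ 2 *+ n) = 1.
Proof. by elim: n => [|n IH]; rewrite ?mulr0n ?cis0 // mulrS cisD cis_2pi mul1r IH. Qed.
Lemma cis_2piz (k : int) : cis (pi *+ 2 *~ k) = 1.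
Proof.
case: k => n; first by rewrite -pmulrn cis_2pin.
by rewrite NegzE mulrNz -pmulrn cisN cis_2pin invr1.
Qed.
Lemma cis_eq1 t : cis t = 1 -> exists k : int, t = pi *+ 2 *~ k.
Proof.
move=> t1; have pi2 : (0 : R) < pi *+ 2 by rewrite mulrn_wgt0 ?pi_gt0.
(* [k] is the integer nearest to [t / (2 pi)], so the remainder [y] satisfies [|y| <= pi], and [cos]
   is injective on the range of [|y|]. *)
pose k := Num.floor (t / (pi *+ 2) + 2^-1); exists k.
pose y := t - pi *+ 2 *~ k.
have y1 : cis y = 1 by rewrite /y cisD cisN cis_2piz invr1 mulr1.
have : k%:~R <= t / (pi *+ 2) + 2^-1 < k%:~R + 1.
  by rewrite -[X in _ < _ + X]/(1%:~R) -intrD; exact: floor_itv.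
have tE : t / (pi *+ 2) = y / (pi *+ 2) + k%:~R.
  rewrite /y -[pi *+ 2 *~ k]mulrzr mulrBl mulrAC divff ?gt_eqF //; ring.
rewrite tE => /andP[h1 h2].
have h3 : - 2^-1 <= y / (pi *+ 2) by lra.
have h4 : y / (pi *+ 2) < 2^-1 by lra.
rewrite ler_pdivlMr // in h3; rewrite ltr_pdivrMr // in h4.
have ypi : `|y| <= pi by rewrite ler_norml; lra.
have cy : cos `|y| = cos 0.
  have : cos y = 1 by move: y1; rewrite /cis => -[].
  by rewrite cos0; case: (ger0P y) => // _; rewrite cosN.
have : `|y| = 0.
  by apply: cos_inj cy; rewrite in_itv /= ?normr_ge0 ?ypi ?lexx ?pi_ge0.
by move/normr0_eq0/eqP; rewrite subr_eq0 => /eqP.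
Qed.

Lemma cexp0 : cexp 0 = 1. Proof. by rewrite /cexp expR0 cis0 mulr1. Qed.
Lemma cexpD z w : cexp (z + w) = cexp z * cexp w.
Proof. by rewrite /cexp ReD ImD expRD cisD rmorphM /=; ring. Qed.
Lemma N_cexp z : N (cexp z) = expR (Re z).
Proof. by rewrite /cexp NM N_cis mulr1 NReal gtr0_norm ?expR_gt0. Qed.
Lemma cexp_neq0 z : cexp z != 0. Proof. by rewrite -N_gt0P N_cexp expR_gt0. Qed.
Lemma cexpN z : cexp (- z) = (cexp z)^-1.
Proof. by apply: (mulfI (cexp_neq0 z)); rewrite -cexpD subrr cexp0 divff ?cexp_neq0. Qed.
Lemma cexpB z w : cexp (z - w) = cexp z / cexp w. Proof. by rewrite cexpD cexpN. Qed.
Lemma cexpMn z n : cexp (z *+ n) = cexp z ^+ n.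
Proof. by elim: n => [|n IH]; rewrite ?mulr0n ?cexp0 // mulrS cexpD IH exprS. Qed.
Definition tpi (k : int) : R[i] := 0 +i* (pi *+ 2 *~ k).
Lemma cexp_tpi k : cexp (tpi k) = 1. Proof. by rewrite /cexp /= expR0 cis_2piz mulr1. Qed.
Lemma cexp_eq1 z : cexp z = 1 -> exists k, z = tpi k.
Proof.
move=> z1; have R0 : Re z = 0.
  by apply: expR_inj; rewrite -N_cexp z1 N1 expR0.
have : cis (Im z) = 1 by move: z1; rewrite /cexp R0 expR0 mul1r.
by move=> /cis_eq1[k hk]; exists k; apply: complex_eq.
Qed.
Lemma cexp_eq z w : cexp z = cexp w -> exists k, z = w + tpi k.
Proof.
move=> zw; have /cexp_eq1[k hk] : cexp (z - w) = 1 by rewrite cexpB zw divff ?cexp_neq0.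
by exists k; rewrite -hk addrC subrK.
Qed.
Lemma tpi0 : tpi 0 = 0. Proof. by rewrite /tpi mulr0z. Qed.
Lemma N_tpi k : k != 0 -> pi *+ 2 <= N (tpi k).
Proof.
move=> k0; have pi0 : (0 : R) <= pi *+ 2 by rewrite mulrn_wge0 ?pi_ge0.
apply: le_trans (Im_le_N _); rewrite /= -mulrzr normrM ger0_norm // ler_peMr //.
by rewrite -intr_norm -[1]/(1%:~R) ler_int; lia.
Qed.
Lemma N_tpi_lt k : N (tpi k) < pi *+ 2 -> k = 0.
Proof. by move=> H; apply/eqP; apply: contraTT H => /N_tpi; rewrite leNgt. Qed.

Lemma pder_cis t : pder cis t (ii * cis t).
Proof.
apply/pderE; split => /=.
  have -> : (0 * cos t - 1 * sin t) = - sin t by ring.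
  exact: is_derive_cos.
have -> : (0 * sin t + 1 * cos t) = cos t by ring.
exact: is_derive_sin.
Qed.

Lemma der_cexp0 : der cexp 0 1.
Proof.
have [g [hg gc g0]] : exists g : R -> R, [/\ forall x, expR x - expR 0 = g x * (x - 0), {for 0, continuous g} & g 0 = 1].
  by apply/is_derive1_caratheodory; rewrite -[X in is_derive _ _ _ X]expR0; exact: is_derive_expR.
have [k [hk kc k0]] := pder_cis 0.
rewrite cis0 mulr1 in k0.
exists (fun y => if y == 0 then 1 else (cexp y - 1) / y); split; last by rewrite eqxx.
  move=> y; rewrite cexp0 subr0; case: eqP => [->|/eqP y0]; first by rewrite cexp0 subrr mulr0.
  by rewrite divfK.
rewrite /cc eqxx.
have ReC : (fun y => Re y) @ nbhs (0 : R[i]) --> (0 : R) by apply: (@tC_Re _ _ _ _ id 0); exact: cc_id.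
have ImC : (fun y => Im y) @ nbhs (0 : R[i]) --> (0 : R) by apply: (@tC_Im _ _ _ _ id 0); exact: cc_id.
have A1 : tC (nbhs (0 : R[i])) (fun y => (g (Re y))%:C) 1.
  have -> : (1 : R[i]) = (g 0)%:C by rewrite g0.
  by apply: tC_real; exact: (cvg_comp _ _ ReC gc).
have A2 : tC (nbhs (0 : R[i])) (fun y => cis (Im y)) 1.
  move=> e e0; have := pder_cont (pder_cis 0) e0; rewrite cis0; exact: ImC.
have A3 : tC (nbhs (0 : R[i])) (fun y => k (Im y)) ii.
  by move=> e e0; have := kc e e0; rewrite k0; exact: ImC.
have B1 : tC (nbhs (0 : R[i])) (fun y => (g (Re y))%:C * cis (Im y) - 1) (1 * 1 - 1).
  by apply: tCB; [exact: tCM|exact: tC_cst].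
have B2 : tC (nbhs (0 : R[i])) (fun y => k (Im y) - ii) (ii - ii).
  by apply: tCB => //; exact: tC_cst.
rewrite mulr1 subrr in B1; rewrite subrr in B2.
move=> e e0; have e20 : 0 < e / 2 by rewrite divr_gt0.
apply: filterS2 (B1 _ e20) (B2 _ e20) => y; rewrite /mkset !subr0 => h1 h2.
apply: (@le_lt_trans _ _ (N ((g (Re y))%:C * cis (Im y) - 1) + N (k (Im y) - ii))); last by rewrite [e]splitr ltrD.
case: eqP => [_|/eqP y0]; first by rewrite subrr N0 addr_ge0 ?N_ge0.
(* The error splits into a real and an imaginary increment, each with a coefficient tending to 0 and
   a factor bounded by [N y]; this replaces the Cauchy-Riemann equations. *)
have E : cexp y - 1 - y = ((g (Re y))%:C * cis (Im y) - 1) * (Re y)%:C + (k (Im y) - ii) * (Im y)%:C.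
  have e1 := hg (Re y); rewrite expR0 subr0 in e1.
  have e2 := hk (Im y); rewrite cis0 subr0 in e2.
  have -> : cexp y = ((g (Re y) * Re y) + 1)%:C * cis (Im y) by rewrite -e1 subrK.
  have yE : y = (Re y)%:C + ii * (Im y)%:C by rewrite {1}(complexE y).
  rewrite [X in _ - 1 - X]yE [(k _ - _) * _]mulrBl -e2 rmorphD rmorphM /=; ring.
have -> : (cexp y - 1) / y - 1 = (cexp y - 1 - y) / y by field.
rewrite E NM NV ler_pdivrMr ?N_gt0 // [leRHS]mulrDl; apply: le_trans (ND _ _) _.
by rewrite !NM !NReal lerD // ler_wpM2l ?N_ge0 // ?Re_le_N ?Im_le_N.
Qed.

Lemma der_cexp z : der cexp z (cexp z).
Proof.
have H : der (fun y => cexp z * cexp (y - z)) z (cexp z * 1).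
  apply: derZ; have := @der_comp _ cexp (fun y => y - z) z 1 1 (derBc z (der_id z)).
  by rewrite subrr mulr1; apply; exact: der_cexp0.
rewrite mulr1 in H; apply: der_near H.
by apply: filterS (@filterT _ (nbhs z) _) => y _ /=; rewrite -cexpD addrC subrK.
Qed.

(* The plane without the nonpositive reals. *)
Definition slit z := 0 < N z + Re z.
(** The half-angle formula [tan (t / 2) = sin t / (1 + cos t)], valid on the whole slit plane
    without a case distinction. *)
Definition Arg z : R := 2 * atan (Im z / (N z + Re z)).
Definition Log z : R[i] := ln (N z) +i* Arg z.

Lemma slit_neq0 z : slit z -> 0 < N z.
Proof. by rewrite /slit; have := Re_le_N z; rewrite ler_norml => /andP[_]; lra. Qed.

Lemma cexp_Log z : slit z -> cexp (Log z) = z.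
Proof.
move=> sz; have Nz := slit_neq0 sz; rewrite /cexp /= lnK ?posrE //.
set D := N z + Re z; pose q := Im z / D; have D0 : D != 0 by rewrite gt_eqF.
have n2 := N2 z.
have q2 : 1 + q ^+ 2 = 2 * N z / D.
  rewrite /q; apply: (mulIf (expf_neq0 2 D0)).
  have -> : (1 + (Im z / D) ^+ 2) * D ^+ 2 = D ^+ 2 + Im z ^+ 2 by field.
  have -> : 2 * N z / D * D ^+ 2 = 2 * N z * D by field.
  have -> : Im z ^+ 2 = N z ^+ 2 - Re z ^+ 2 by rewrite n2; ring.
  by rewrite /D; ring.
have q20 : 0 < 1 + q ^+ 2 by rewrite ltr_pwDl // sqr_ge0.
have c2 : cos (atan q) ^+ 2 = (1 + q ^+ 2)^-1.
  by rewrite cos_atan exprVn sqr_sqrtr // ltW.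
have cn0 : cos (atan q) != 0 by rewrite cos_atan invr_eq0 sqrtr_eq0 -ltNge.
have sc : sin (atan q) = q * cos (atan q).
  by have := @atanK R q; rewrite /tan => {2}<-; rewrite divfK.
have E1 : cos (Arg z) = Re z / N z.
  rewrite /Arg -/D -/q mulr_natl cos_mulr2n c2 q2 mulr2n /D; field.
  by rewrite gt_eqF //= gt_eqF.
have E2 : sin (Arg z) = Im z / N z.
  rewrite /Arg -/D -/q mulr_natl sin_mulr2n sc mulrCA -expr2 c2 q2 mulr2n /q /D; field.
  by rewrite gt_eqF //= gt_eqF.
by apply: complex_eq; rewrite ?ReM ?ImM /= ?E1 ?E2; field; rewrite gt_eqF.
Qed.

Lemma Im_Log z : - pi < Im (Log z) < pi.
Proof.
rewrite /= /Arg; set q := _ / _.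
have := atan_ltpi2 q; have := atan_gtNpi2 q; lra.
Qed.

Lemma Log_cexp w : - pi < Im w < pi -> slit (cexp w) /\ Log (cexp w) = w.
Proof.
move=> wpi; have sw : slit (cexp w).
  rewrite /slit N_cexp /cexp ReM /= mul0r subr0 -{1}[expR _]mulr1 -mulrDr mulr_gt0 ?expR_gt0 //.
  rewrite -ltrBlDl sub0r lt_neqAle cos_geN1 andbT; apply/eqP => H.
  have cw : cos `|Im w| = cos pi by rewrite cospi H; case: ger0P => // _; rewrite cosN.
  have wp : `|Im w| < pi by rewrite ltr_norml.
  have := cos_inj _ _ cw; rewrite !in_itv /= normr_ge0 pi_ge0 lexx (ltW wp) => /(_ isT isT).
  by move=> E; rewrite E ltxx in wp.
split => //; have [k hk] := cexp_eq (cexp_Log sw).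
suff k0 : k = 0 by rewrite hk k0 tpi0 addr0.
apply: contrapT => /eqP k0.
have := N_tpi k0; have -> : tpi k = Log (cexp w) - w by rewrite hk addrC addKr.
have Re0 : Re (Log (cexp w) - w) = 0 by rewrite hk addrC addKr.
have h1 := N_le_ReIm (Log (cexp w) - w); rewrite Re0 normr0 add0r ImB in h1.
have := Im_Log (cexp w) => h2 h3.
suff : `|Im (Log (cexp w)) - Im w| < pi *+ 2 by lra.
by rewrite ltr_norml mulr2n; move: h2 wpi; set a := Im _; set b := Im w; lra.
Qed.

Lemma Log_cont z : slit z -> cc Log z.
Proof.
move=> sz; have Nz := slit_neq0 sz.
have Nc : N @ nbhs z --> N z by apply: (tC_N (cc_id z)).
have Rc : (fun y => Re y) @ nbhs z --> Re z by apply: (tC_Re (cc_id z)).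
have Ic : (fun y => Im y) @ nbhs z --> Im z by apply: (tC_Im (cc_id z)).
apply: tC_ri => /=.
  exact: (cvg_comp _ _ Nc (continuous_ln Nz)).
rewrite /Arg; apply: cvgMr.
have Q : (fun y => Im y / (N y + Re y)) @ nbhs z --> Im z / (N z + Re z).
  apply: cvgM => //; apply: cvgV; first by rewrite gt_eqF.
  exact: cvgD.
exact: (cvg_comp _ _ Q (@continuous_atan R _)).
Qed.

Lemma slit_near z : slit z -> \forall y \near z, slit y.
Proof.
move=> sz; have Nc : (fun y => N y + Re y) @ nbhs z --> N z + Re z.
  by apply: cvgD; [apply: (tC_N (cc_id z))|apply: (tC_Re (cc_id z))].
exact: (cvgr_gt _ Nc _ sz).
Qed.

Lemma der_Log z : slit z -> der Log z z^-1.
Proof.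
move=> sz; apply: (@der_inv _ cexp).
- exact: Log_cont.
- by apply: filterS (slit_near sz) => y; exact: cexp_Log.
- by rewrite -[X in der _ _ X](cexp_Log sz); exact: der_cexp.
- by rewrite -N_gt0P slit_neq0.
Qed.

Lemma slit_Re z : 0 < Re z -> slit z.
Proof. by move=> h; rewrite /slit ltr_wpDl // N_ge0. Qed.
Lemma slit_near1 z : N (z - 1) < 1 -> slit z.
Proof.
move=> h; apply: slit_Re; have := Re_le_N (z - 1); rewrite ReB /= ler_norml => /andP[h1 _].
lra.
Qed.
Lemma Log1 : Log 1 = 0.
Proof. by rewrite /Log /Arg N1 ln1 mul0r atan0 mulr0. Qed.

End Exponential.

(** * Cauchy's theorem and formula *)

Section Integrals.
Context {R : realType}.
Implicit Types (z w y l m a b c : R[i]) (e d x t : R) (h k : R[i] -> R[i]) (p q : R -> R[i]).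

(** The base point [-1] makes the derivative two-sided at [0], where all later intervals of
    integration begin. *)
Lemma antiderivative (f : R -> R) : (forall t, {for t, continuous f}) ->
  exists F : R -> R, forall t, -1 < t -> is_derive t 1 F (f t).
Proof.
move=> fc; exists (fun x => (\int[lebesgue_measure]_(t in [set` `[-1, x]]) (f t))%R) => t t1.
have tt : t < t + 1 by rewrite ltrDl.
have fi : lebesgue_measure.-integrable `[-1, t + 1] (EFin \o f).
  by apply: continuous_compact_integrable; [exact: segment_compact|exact: continuous_subspaceT].
have [d1 d2] := @continuous_FTC1_closed _ f (-1) t (t + 1) tt fi t1 (fc t).
by constructor; [exact: d1|rewrite -derive1E; exact: d2].
Qed.

Definition pcont p := forall t, tC (nbhs t) p (p t).

Lemma pantider p : pcont p -> exists P : R -> R[i], forall t, -1 < t -> pder P t (p t).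
Proof.
move=> pc.
have [F1 H1] := antiderivative (fun t => tC_Re (pc t)).
have [F2 H2] := antiderivative (fun t => tC_Im (pc t)).
exists (fun t => F1 t +i* F2 t) => t t1; apply/pderE; split => /=; [exact: H1|exact: H2].
Qed.

Lemma is_derive_bound (f g : R -> R) (u v M : R) : u <= v ->
  (forall t, u <= t <= v -> is_derive t 1 f (g t)) -> (forall t, u <= t <= v -> g t <= M) ->
  f v - f u <= M * (v - u).
Proof.
move=> uv df gM; have [||t tuv ->] := @MVT_segment _ f g u v uv.
- by move=> t; rewrite in_itv /= => /andP[h1 h2]; apply: df; rewrite (ltW h1) ltW.
- apply: derivable_within_continuous => t; rewrite in_itv /= => tuv.
  by have [] := df t tuv.
- by rewrite ler_wpM2r ?subr_ge0 //; apply: gM; move: tuv; rewrite in_itv.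
Qed.

Lemma pder_bound (P p : R -> R[i]) (u v M : R) : u <= v ->
  (forall t, u <= t <= v -> pder P t (p t)) -> (forall t, u <= t <= v -> N (p t) <= M) ->
  N (P v - P u) <= M * (v - u).
Proof.
move=> uv dP pM; have [->|D0] := eqVneq (P v - P u) 0.
  have := pM u; rewrite lexx uv => /(_ isT) H; rewrite N0 mulr_ge0 ?subr_ge0 //.
  exact: le_trans (N_ge0 _) H.
(* A unit factor that rotates the increment onto the positive real axis, so that the real mean value
   theorem applies to one real part. *)
pose D := P v - P u; pose cD : R[i] := (Re D -i* Im D) / (N D)%:C.
have ND0 : N D != 0 by rewrite gt_eqF ?N_gt0.
have NcD : N cD = 1.
  rewrite NM NV NReal ger0_norm ?N_ge0 // (_ : N (Re D -i* Im D) = N D) ?divff //.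
  by rewrite !NE /= sqrrN.
have cDD : cD * D = (N D)%:C.
  apply: (mulIf (x := (N D)%:C)); first by rewrite -N_gt0P NReal normr_gt0.
  rewrite /cD mulrAC divfK; last by rewrite -N_gt0P NReal normr_gt0.
  by rewrite -rmorphM /= -expr2 N2; apply: complex_eq; rewrite ?ReM ?ImM /=; ring.
have := @is_derive_bound (fun t => Re (cD * P t)) (fun t => Re (cD * p t)) u v M uv.
rewrite -ReB -mulrBr -/D cDD /=; apply.
  by move=> t tuv; have /pderE[] := pderZ cD (dP t tuv).
move=> t tuv; apply: le_trans (ler_norm _) _; apply: le_trans (Re_le_N _) _.
by rewrite NM NcD mul1r pM.
Qed.

Lemma pder_const (P : R -> R[i]) (u v : R) : u <= v ->
  (forall t, u <= t <= v -> pder P t 0) -> P v = P u.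
Proof.
move=> uv dP; apply/eqP; rewrite -subr_eq0 -[_ == 0]negbK -N_gt0P -leNgt.
have := @pder_bound P (fun=> 0) u v 0 uv dP; rewrite mul0r; apply.
by move=> t _; rewrite N0.
Qed.

(** An integral is the increment of a chosen antiderivative; by [int0_eq] every other antiderivative
    on the interval gives the same value. *)
Definition prim p := get [set P : R -> R[i] | forall t, -1 < t -> pder P t (p t)].
Definition int0 p (b : R) := prim p b - prim p 0.

Lemma primP p : pcont p -> forall t, -1 < t -> pder (prim p) t (p t).
Proof. by move=> /pantider[P HP]; exact: (getI (P := [set P : R -> R[i] | forall t, -1 < t -> pder P t (p t)]) HP). Qed.

Lemma int0_eq p (P : R -> R[i]) (b : R) : pcont p -> 0 <= b ->
  (forall t, 0 <= t <= b -> pder P t (p t)) -> int0 p b = P b - P 0.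
Proof.
move=> pc b0 HP.
have H t : 0 <= t <= b -> pder (fun t => prim p t - P t) t 0.
  move=> tb; rewrite -(subrr (p t)); apply: pderB; last exact: HP.
  by apply: primP => //; case/andP: tb => t0 _; apply: lt_le_trans t0; rewrite ltrN10.
have E := pder_const b0 H; rewrite /int0; apply/eqP; rewrite -subr_eq0.
by apply/eqP; rewrite -(subrr (prim p 0 - P 0)) -{1}E; ring.
Qed.

Lemma pcont_cst l : pcont (fun=> l). Proof. by move=> t; exact: tC_cst. Qed.
Lemma pcontD p q : pcont p -> pcont q -> pcont (fun t => p t + q t).
Proof. by move=> pc qc t; exact: tCD. Qed.
Lemma pcontM p q : pcont p -> pcont q -> pcont (fun t => p t * q t).
Proof. by move=> pc qc t; exact: tCM. Qed.
Lemma pcontB p q : pcont p -> pcont q -> pcont (fun t => p t - q t).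
Proof. by move=> pc qc t; exact: tCB. Qed.
Lemma pcontX p n : pcont p -> pcont (fun t => p t ^+ n).
Proof. by move=> pc t; exact: tCX. Qed.
Lemma pcont_div p q : pcont p -> pcont q -> (forall t, q t != 0) -> pcont (fun t => p t / q t).
Proof. by move=> pc qc q0 t; exact: tC_div. Qed.

Lemma int0D p q (b : R) : pcont p -> pcont q -> 0 <= b ->
  int0 (fun t => p t + q t) b = int0 p b + int0 q b.
Proof.
move=> pc qc b0; rewrite (@int0_eq _ (fun t => prim p t + prim q t)) //; first by rewrite /int0; ring.
  exact: pcontD.
move=> t /andP[t0 _]; have t1 : -1 < t by apply: lt_le_trans t0; rewrite ltrN10.
by apply: pderD; apply: primP.
Qed.
Lemma int0Z l p (b : R) : pcont p -> 0 <= b -> int0 (fun t => l * p t) b = l * int0 p b.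
Proof.
move=> pc b0; rewrite (@int0_eq _ (fun t => l * prim p t)) //; first by rewrite /int0; ring.
  by apply: pcontM => //; exact: pcont_cst.
move=> t /andP[t0 _]; have t1 : -1 < t by apply: lt_le_trans t0; rewrite ltrN10.
by apply: pderZ; apply: primP.
Qed.
Lemma int0B p q (b : R) : pcont p -> pcont q -> 0 <= b ->
  int0 (fun t => p t - q t) b = int0 p b - int0 q b.
Proof.
move=> pc qc b0; rewrite (@int0_eq _ (fun t => prim p t - prim q t)) //; first by rewrite /int0; ring.
  exact: pcontB.
move=> t /andP[t0 _]; have t1 : -1 < t by apply: lt_le_trans t0; rewrite ltrN10.
by apply: pderB; apply: primP.
Qed.
Lemma int0_bound p (b M : R) : pcont p -> 0 <= b -> (forall t, 0 <= t <= b -> N (p t) <= M) ->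
  N (int0 p b) <= M * b.
Proof.
move=> pc b0 pM; rewrite -[b in leRHS]subr0; apply: pder_bound pM => // t /andP[t0 _].
by apply: primP => //; apply: lt_le_trans t0; rewrite ltrN10.
Qed.
Lemma int0_cst l (b : R) : 0 <= b -> int0 (fun=> l) b = l * b%:C.
Proof.
move=> b0; rewrite (@int0_eq _ (fun t => l * t%:C)) //.
- by rewrite mulr0 subr0.
- exact: pcont_cst.
- by move=> t _; rewrite -[X in pder _ _ X](mulr1 l); apply: pderZ; exact: pder_id.
Qed.

End Integrals.

(** * Integrals along segments and Goursat's theorem *)

Section Segments.
Context {R : realType}.
Implicit Types (z w y l m a b c : R[i]) (e d x t : R) (h k : R[i] -> R[i]) (X : set R[i]).

(** Clamping makes integrands along a segment continuous on the whole real line, as [primP]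
    demands. *)
Definition cl t : R := Num.max 0 (Num.min t 1).
Definition lerp a b t : R[i] := a + t%:C * (b - a).
Definition convx X := forall a b t, X a -> X b -> 0 <= t <= 1 -> X (lerp a b t).

Lemma cl_id t : 0 <= t <= 1 -> cl t = t.
Proof. by move=> /andP[t0 t1]; rewrite /cl (min_idPl t1) (max_idPr t0). Qed.
Lemma cl01 t : 0 <= cl t <= 1.
Proof. by rewrite /cl le_max lexx /= ge_max ler01 ge_min lexx orbT. Qed.
Lemma cl_cont t : {for t, continuous cl}.
Proof.
apply: continuous_max; first exact: cvg_cst.
apply: continuous_min; [exact: cvg_id|exact: cvg_cst].
Qed.
Lemma lerp0 a b : lerp a b 0 = a. Proof. by rewrite /lerp mul0r addr0. Qed.
Lemma lerp1 a b : lerp a b 1 = b. Proof. by rewrite /lerp mul1r addrC subrK. Qed.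
Lemma lerpC a b t : lerp a b t = lerp b a (1 - t).
Proof. by rewrite /lerp rmorphB /=; ring. Qed.
Lemma pder_lerp a b t : pder (lerp a b) t (b - a).
Proof.
rewrite -[X in pder _ _ X]add0r -[X in _ + X]mul1r -[X in X * _]/(1%:C).
apply: pderD; first exact: pder_cst.
have := pderM (pder_id t) (pder_cst (b - a) t).
by rewrite mulr0 addr0.
Qed.

Definition sint h a b t := h (lerp a b (cl t)).
Definition seg h a b := (b - a) * int0 (sint h a b) 1.

Section Conv.
Variables (X : set R[i]) (Xc : convx X).

Lemma sint_pcont h a b : X a -> X b -> (forall z, X z -> ccont X h z) -> pcont (sint h a b).
Proof.
move=> Xa Xb hc t; have Xt s : X (lerp a b (cl s)) by apply: Xc => //; exact: cl01.
have lc : tC (nbhs t) (fun s => lerp a b (cl s)) (lerp a b (cl t)).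
  apply: tCD; first exact: tC_cst.
  by apply: tCM; [apply: tC_real; exact: cl_cont|exact: tC_cst].
move=> e e0; have [d d0 Hd] := hc _ (Xt t) e e0.
by apply: filterS (lc d d0) => s; exact: Hd.
Qed.

Variable h : R[i] -> R[i].
Hypothesis hc : forall z, X z -> ccont X h z.

Lemma seg_antider a b : X a -> X b ->
  exists2 P : R -> R[i], (forall t, 0 <= t <= 1 -> pder P t ((b - a) * h (lerp a b t))) & seg h a b = P 1 - P 0.
Proof.
move=> Xa Xb; exists (fun t => (b - a) * prim (sint h a b) t); last by rewrite /seg /int0; ring.
move=> t t01; have := primP (sint_pcont Xa Xb hc) (t := t); rewrite /sint cl_id // => H.
by apply: pderZ; apply: H; case/andP: t01 => t0 _; apply: lt_le_trans t0; rewrite ltrN10.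
Qed.

Lemma seg_eq a b (P : R -> R[i]) : X a -> X b ->
  (forall t, 0 <= t <= 1 -> pder P t ((b - a) * h (lerp a b t))) -> seg h a b = P 1 - P 0.
Proof.
move=> Xa Xb HP; rewrite /seg -int0Z //; last exact: sint_pcont.
apply: int0_eq => // [|t t01]; last by rewrite /sint cl_id //; exact: HP.
by apply: pcontM; [exact: pcont_cst|exact: sint_pcont].
Qed.

Lemma pder_affine (P : R -> R[i]) l (u v t : R) : pder P (u + v * t) l ->
  pder (fun s => P (u + v * s)) t (v%:C * l).
Proof.
move=> [g [hg gc <-]]; exists (fun s => v%:C * g (u + v * s)); split => //.
  move=> s; rewrite hg (_ : (_ - _)%:C = v%:C * (s - t)%:C); first by ring.
  by rewrite -rmorphM /=; congr (_%:C); ring.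
apply: tCM; first exact: tC_cst.
move=> e e0; have H : (fun s : R => u + v * s) @ nbhs t --> u + v * t.
  by apply: cvgD; [exact: cvg_cst|apply: cvgMr; exact: cvg_id].
exact: (H _ (gc e e0)).
Qed.

Definition mid a b := lerp a b 2^-1.
Lemma midE a b : mid a b = (a + b) / 2.
Proof.
have -> : mid a b = a + (2^-1)%:C * (b - a) by [].
by rewrite fmorphV rmorph_nat; field.
Qed.
Lemma X_mid a b : X a -> X b -> X (mid a b).
Proof. by move=> Xa Xb; apply: Xc => //; rewrite invr_ge0 ler0n invf_le1 // ler1n. Qed.

Lemma seg_mid a b : X a -> X b -> seg h a b = seg h a (mid a b) + seg h (mid a b) b.
Proof.
move=> Xa Xb; have Xm := X_mid Xa Xb; have [P HP ->] := seg_antider Xa Xb.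
have half : (2^-1)%:C = 2^-1 :> R[i] by rewrite fmorphV rmorph_nat.
rewrite (@seg_eq a _ (fun t => P (0 + 2^-1 * t))) //; last first.
  move=> t /andP[t0 t1]; rewrite (_ : mid a b - a = (2^-1)%:C * (b - a)); last by rewrite midE half; field.
  rewrite -mulrA (_ : lerp a (mid a b) t = lerp a b (0 + 2^-1 * t)); last first.
    by rewrite /lerp midE add0r rmorphM /= half; field.
  apply: pder_affine; apply: HP; rewrite add0r mulr_ge0 ?invr_ge0 //=; lra.
rewrite (@seg_eq _ b (fun t => P (2^-1 + 2^-1 * t))) //; last first.
  move=> t /andP[t0 t1]; rewrite (_ : b - mid a b = (2^-1)%:C * (b - a)); last by rewrite midE half; field.
  rewrite -mulrA (_ : lerp (mid a b) b t = lerp a b (2^-1 + 2^-1 * t)); last first.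
    by rewrite /lerp midE rmorphD rmorphM /= half; field.
  by apply: pder_affine; apply: HP; lra.
rewrite !(mulr0, mulr1, addr0, add0r) (_ : 2^-1 + 2^-1 = 1); last by lra.
by ring.
Qed.

Lemma seg_rev a b : X a -> X b -> seg h b a = - seg h a b.
Proof.
move=> Xa Xb; have [P HP ->] := seg_antider Xa Xb.
rewrite (@seg_eq b a (fun t => P (1 + (-1) * t))) //; last first.
  move=> t /andP[t0 t1]; rewrite (_ : _ * _ = (-1)%:C * ((b - a) * h (lerp a b (1 + (-1) * t)))).
    by apply: pder_affine; apply: HP; lra.
  by rewrite (lerpC b a) mulN1r rmorphN /= ; ring.
by rewrite mulr1 mulr0 addr0 subrr opprB.
Qed.

Lemma seg_bound a b M : X a -> X b -> (forall t, 0 <= t <= 1 -> N (h (lerp a b t)) <= M) ->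
  N (seg h a b) <= M * N (b - a).
Proof.
move=> Xa Xb hM; rewrite /seg NM mulrC ler_wpM2r ?N_ge0 //.
rewrite -[M]mulr1; apply: int0_bound => //; first exact: sint_pcont.
by move=> t t01; rewrite /sint cl_id // hM.
Qed.

Lemma seg_refl a : X a -> seg h a a = 0.
Proof. by move=> Xa; rewrite /seg subrr mul0r. Qed.

End Conv.

Lemma seg_B X (Xc : convx X) h k a b : (forall z, X z -> ccont X h z) -> (forall z, X z -> ccont X k z) ->
  X a -> X b -> seg (fun z => h z - k z) a b = seg h a b - seg k a b.
Proof.
move=> hc kc Xa Xb; rewrite /seg -mulrBr; congr (_ * _); apply: int0B => //; exact: (sint_pcont Xc).
Qed.

Lemma seg_prim X (Xc : convx X) h H a b : (forall z, X z -> ccont X h z) -> X a -> X b ->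
  (forall z, X z -> der H z (h z)) -> seg h a b = H b - H a.
Proof.
move=> hc Xa Xb dH; rewrite (seg_eq Xc hc Xa Xb (P := fun t => H (lerp a b t))).
  by rewrite lerp0 lerp1.
by move=> t t01; rewrite mulrC; apply: pder_comp; [exact: pder_lerp|apply: dH; exact: Xc].
Qed.

Definition tri h a b c := seg h a b + seg h b c + seg h c a.
Definition peri a b c := N (a - b) + N (b - c) + N (c - a).

Lemma tri_split X (Xc : convx X) h a b c : (forall z, X z -> ccont X h z) -> X a -> X b -> X c ->
  tri h a b c = tri h a (mid a b) (mid c a) + tri h (mid a b) b (mid b c)
   + tri h (mid c a) (mid b c) c + tri h (mid b c) (mid c a) (mid a b).
Proof.
move=> hc Xa Xb Xc'; have Xm := X_mid Xc.
rewrite {1}/tri (seg_mid Xc hc Xa Xb) (seg_mid Xc hc Xb Xc') (seg_mid Xc hc Xc' Xa) /tri.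
rewrite (seg_rev Xc hc (Xm _ _ Xa Xb) (Xm _ _ Xc' Xa)) (seg_rev Xc hc (Xm _ _ Xb Xc') (Xm _ _ Xa Xb)).
rewrite (seg_rev Xc hc (Xm _ _ Xc' Xa) (Xm _ _ Xb Xc')).
ring.
Qed.

Lemma N_half z : N (z / 2) = N z / 2.
Proof. by rewrite NM NV -[2 in LHS](rmorph_nat (real_complex R)) NReal normr_nat. Qed.

Lemma peri_split a b c :
  [/\ peri a (mid a b) (mid c a) = peri a b c / 2, peri (mid a b) b (mid b c) = peri a b c / 2,
    peri (mid c a) (mid b c) c = peri a b c / 2 & peri (mid b c) (mid c a) (mid a b) = peri a b c / 2].
Proof.
rewrite /peri !midE; split; rewrite !mulrDl -!N_half.
- rewrite (_ : a - (a / 2 + b / 2) = (a - b) / 2); last by field.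
  rewrite (_ : a / 2 + b / 2 - _ = - ((c - b) / 2)) ?NN; last by field.
  rewrite (_ : c / 2 + a / 2 - a = (c - a) / 2) ?(NC c b); last by field.
  by congr (_ + _ + _); rewrite !N_half NC.
- rewrite (_ : a / 2 + b / 2 - b = (a - b) / 2); last by field.
  rewrite (_ : b - (b / 2 + c / 2) = (b - c) / 2); last by field.
  by rewrite (_ : b / 2 + c / 2 - _ = (c - a) / 2); last by field.
- rewrite (_ : c / 2 + a / 2 - _ = - ((b - a) / 2)) ?NN; last by field.
  rewrite (_ : b / 2 + c / 2 - _ = (b - c) / 2); last by field.
  rewrite (_ : c - _ = (c - a) / 2); last by field.
  by congr (_ + _ + _); rewrite !N_half NC.
- rewrite (_ : b / 2 + c / 2 - _ = - ((a - b) / 2)) ?NN; last by field.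
  rewrite (_ : c / 2 + a / 2 - _ = - ((b - c) / 2)) ?NN; last by field.
  by rewrite (_ : a / 2 + b / 2 - _ = - ((c - a) / 2)) ?NN; last by field.
Qed.

Definition holo (U : set R[i]) h := forall z, U z -> exists l, der h z l.

Lemma holo_cc U h z : holo U h -> U z -> cc h z.
Proof. by move=> hU /hU[l /der_cc]. Qed.

Lemma geo_small e M : 0 < e -> exists n : nat, M / 2 ^+ n < e.
Proof.
move=> e0; exists (Num.bound (`|M| / e)).
rewrite ltr_pdivrMr ?exprn_gt0 // mulrC -ltr_pdivrMr //.
apply: le_lt_trans (ler_norm _) _; rewrite normrM (gtr0_norm (x := e^-1)) ?invr_gt0 //.
apply: lt_le_trans (archi_boundP _) _; first by rewrite divr_ge0 // ltW.
by rewrite -natrX ler_nat ltnW // ltn_expl.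
Qed.

(** Bisection. Call a triangle bad if its integral exceeds [e] times the squared perimeter; one of
    its four quarters is again bad, since the perimeter halves. The bad triangles shrink to a point,
    near which [h] is affine up to a small error, and affine functions have primitives. *)
Theorem goursat X h a b c : convx X -> clN X -> holo X h -> X a -> X b -> X c -> tri h a b c = 0.
Proof.
move=> Xc Xcl hX Xa Xb Xc'.
have hc z : X z -> ccont X h z by move=> Xz; apply: cc_within; exact: (holo_cc hX).
apply: contrapT => /eqP tri0; have T0 := N_gt0 tri0.
pose D := peri a b c.
have D0 : 0 < D.
  rewrite lt_def /D /peri !addr_ge0 ?N_ge0 // andbT; apply: contra tri0 => D0; apply/eqP.
  have /N_eq0/eqP : N (a - b) = 0 by apply/eqP; have := N_ge0 (a - b); have := N_ge0 (b - c); have := N_ge0 (c - a); move/eqP: D0; lra.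
  have /N_eq0/eqP : N (b - c) = 0 by apply/eqP; have := N_ge0 (a - b); have := N_ge0 (b - c); have := N_ge0 (c - a); move/eqP: D0; lra.
  rewrite !subr_eq0 => /eqP <- /eqP ->.
  by rewrite /tri !(seg_refl _ Xb) !addr0.
(* The factor 2 makes the given triangle bad with strict inequality. *)
pose e : R := N (tri h a b c) / (2 * D ^+ 2).
have e0 : 0 < e by rewrite divr_gt0 // mulr_gt0 // exprn_gt0.
pose T := (R[i] * R[i] * R[i])%type.
pose bad (p : T) := [/\ X p.1.1, X p.1.2, X p.2 & e * peri p.1.1 p.1.2 p.2 ^+ 2 < N (tri h p.1.1 p.1.2 p.2)].
have step (p : T) : bad p -> exists q : T, [/\ bad q, peri q.1.1 q.1.2 q.2 = peri p.1.1 p.1.2 p.2 / 2 &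
    N (q.1.1 - p.1.1) <= peri p.1.1 p.1.2 p.2].
  case: p => [[u v] w] [/= Xu Xv Xw H].
  have [p1 p2 p3 p4] := peri_split u v w.
  have Xm := X_mid Xc.
  have half z : N (z / 2) <= N z by rewrite N_half; have := N_ge0 z; lra.
  have g1 := N_ge0 (u - v); have g2 := N_ge0 (v - w); have g3 := N_ge0 (w - u).
  apply: contrapT => nq.
  have K q : bad q -> N (q.1.1 - u) <= peri u v w -> peri q.1.1 q.1.2 q.2 = peri u v w / 2 -> False.
    by move=> bq h1 h2; apply: nq; exists q.
  have N1 : N (tri h u (mid u v) (mid w u)) <= e * (peri u v w / 2) ^+ 2.
    rewrite leNgt; apply/negP => lt; apply: (K (u, mid u v, mid w u)) => /=; last exact: p1.
      by split => //=; rewrite ?p1 //; exact: Xm.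
    by rewrite subrr N0 /peri !addr_ge0.
  have N2 : N (tri h (mid u v) v (mid v w)) <= e * (peri u v w / 2) ^+ 2.
    rewrite leNgt; apply/negP => lt; apply: (K (mid u v, v, mid v w)) => /=; last exact: p2.
      by split => //=; rewrite ?p2 //; exact: Xm.
    rewrite midE (_ : (u + v) / 2 - u = (v - u) / 2); last by field.
    by apply: le_trans (half _) _; rewrite NC /peri; lra.
  have N3 : N (tri h (mid w u) (mid v w) w) <= e * (peri u v w / 2) ^+ 2.
    rewrite leNgt; apply/negP => lt; apply: (K (mid w u, mid v w, w)) => /=; last exact: p3.
      by split => //=; rewrite ?p3 //; exact: Xm.
    rewrite midE (_ : (w + u) / 2 - u = (w - u) / 2); last by field.
    by apply: le_trans (half _) _; rewrite /peri; lra.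
  have N4 : N (tri h (mid v w) (mid w u) (mid u v)) <= e * (peri u v w / 2) ^+ 2.
    rewrite leNgt; apply/negP => lt; apply: (K (mid v w, mid w u, mid u v)) => /=; last exact: p4.
      by split => //=; rewrite ?p4 //; exact: Xm.
    rewrite midE (_ : (v + w) / 2 - u = (w - u) / 2 + (v - u) / 2); last by field.
    apply: le_trans (ND _ _) _; have h1 := half (w - u); have h2 := half (v - u).
    by rewrite (NC v u) in h2 *; rewrite /peri; lra.
  move: H; rewrite (tri_split Xc hc Xu Xv Xw); apply/negP; rewrite -leNgt.
  have E4 : e * peri u v w ^+ 2 = 4 * (e * (peri u v w / 2) ^+ 2) by field.
  rewrite E4; move: N1 N2 N3 N4; set t1 := tri _ _ _ _; set t2 := tri _ _ _ _; set t3 := tri _ _ _ _.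
  set t4 := tri _ _ _ _; set M := e * _ => N1 N2 N3 N4.
  by have := ND (t1 + t2 + t3) t4; have := ND (t1 + t2) t3; have := ND t1 t2; lra.
have bad0 : bad (a, b, c).
  split => //=; rewrite -/D /e; have -> : N (tri h a b c) / (2 * D ^+ 2) * D ^+ 2 = N (tri h a b c) / 2.
    by field; rewrite gt_eqF.
  by rewrite ltr_pdivrMr // mulr_natr mulr2n ltrDl.
pose nxt (p : {p : T | bad p}) : {p : T | bad p} :=
  let q := cid (step (sval p) (svalP p)) in exist bad (sval q) (let: And3 b _ _ := svalP q in b).
pose u (n : nat) := iter n nxt (exist bad (a, b, c) bad0).
pose A n := (sval (u n)).1.1; pose B n := (sval (u n)).1.2; pose E n := (sval (u n)).2.
have dA n : N (A n.+1 - A n) <= peri (A n) (B n) (E n).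
  rewrite /A /B /E /u iterS -/(u n); case: (u n) => p bp /=.
  by case: cid => q [].
have dP n : peri (A n.+1) (B n.+1) (E n.+1) = peri (A n) (B n) (E n) / 2.
  rewrite /A /B /E /u iterS -/(u n); case: (u n) => p bp /=.
  by case: cid => q [].
have un n : bad (sval (u n)) by case: (u n).
clearbody u.
have P_n n : peri (A n) (B n) (E n) = peri (A 0%N) (B 0%N) (E 0%N) / 2 ^+ n.
  elim: n => [|n IH]; first by rewrite expr0 divr1.
  by rewrite dP IH exprS invfM; ring.
set D0' := peri (A 0%N) (B 0%N) (E 0%N) in P_n.
have D0'0 : 0 <= D0' by rewrite /D0' /peri !addr_ge0 ?N_ge0.
have AA n (m0 : nat) : N (A (n + m0)%N - A n) <= 2 * (D0' / 2 ^+ n) - 2 * (D0' / 2 ^+ (n + m0)).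
  elim: m0 => [|m IH]; first by rewrite addn0 subrr N0 subrr.
  rewrite addnS; apply: le_trans (NBD (A (n + m)%N) _ _) _.
  have := dA (n + m)%N; rewrite P_n => h1.
  have -> : D0' / 2 ^+ (n + m).+1 = D0' / 2 ^+ (n + m) / 2 by rewrite exprS invfM; ring.
  by move: IH h1; set q := D0' / 2 ^+ (n + m); set r := D0' / _; lra.
have AX n : X (A n) by have [] := un n.
have pos n : 0 <= D0' / 2 ^+ n by rewrite divr_ge0 // exprn_ge0.
have [|l Hl] := @cluster_point R A (N (A 0%N) + 2 * D0').
  move=> k0; have := AA 0%N k0; rewrite expr0 divr1 add0n => h1.
  by have := N_sub (A k0) (A 0%N); have := pos k0; lra.
have lA n : N (l - A n) <= 2 * (D0' / 2 ^+ n).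
  rewrite leNgt; apply/negP => lt.
  have [k0 nk hk] := Hl (N (l - A n) - 2 * (D0' / 2 ^+ n)) (ltac:(by rewrite subr_gt0)) n.
  have := AA n (k0 - n)%N; rewrite subnKC // => h1.
  by have := NBD (A k0) l (A n); rewrite (NC l (A k0)); have := pos k0; lra.
have Xl : X l.
  by apply: Xcl => eps eps0; have [k0 _ hk] := Hl eps eps0 0%N; exists (A k0).
have [dl [g [hg gc gl]]] := hX l Xl.
(* With [q] the perimeter of the [n]-th triangle, its points lie within [4 * q] of [l], so its
   integral is at most [e / 8 * (4 * q) * q], half of what badness requires. *)
have e80 : 0 < e / 8 by rewrite divr_gt0.
have /nbhsCP[d d0 Hd] := gc _ e80.
have [n hn] := geo_small (4 * D0') d0.
set q := D0' / 2 ^+ n in P_n.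
have q4 : 4 * q < d by rewrite /q mulrA.
have q0 : 0 <= q by exact: pos.
have [XA XB XE] := un n; rewrite -/(A n) -/(B n) -/(E n) P_n => lt.
(* The affine part of [h] at [l] has the primitive [Aff], so subtracting it does not change the
   integral over the triangle. *)
pose aff z := h l + g l * (z - l).
have affc z : X z -> ccont X aff z.
  move=> _; apply: cc_within; apply: tCD; first exact: tC_cst.
  by apply: tCM; [exact: tC_cst|apply: tCB; [exact: cc_id|exact: tC_cst]].
pose Aff z := h l * z + g l * ((z - l) ^+ 2 / 2).
have dAff z : X z -> der Aff z (aff z).
  move=> _; rewrite /Aff /aff -[h l in X in der _ _ X]mulr1; apply: derD; first by apply: derZ; exact: der_id.
  apply: derZ; have := derM (derX 1 (derBc l (der_id z))) (der_cst (2^-1) z).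
  by rewrite (_ : _ * 2^-1 + _ = z - l) //; rewrite expr1; field.
have tri_h : tri h (A n) (B n) (E n) = tri (fun z => h z - aff z) (A n) (B n) (E n).
  rewrite /tri !(seg_B Xc hc affc) // !(seg_prim Xc affc _ _ dAff) //.
  by ring.
have hc2 z : X z -> ccont X (fun z => h z - aff z) z.
  by move=> Xz; apply/ccontP; apply: tCB; apply/ccontP; [exact: hc|exact: affc].
have near z : N (z - A n) <= q -> N (h z - aff z) <= e / 8 * (4 * q).
  move=> zA; have zl : N (z - l) <= 4 * q.
    by have := NBD (A n) z l; have := lA n; rewrite (NC l) -/q; lra.
  have -> : h z - aff z = (g z - g l) * (z - l).
    by rewrite /aff opprD addrA hg; ring.
  by rewrite NM ler_pM ?N_ge0 // ltW //; apply: Hd; exact: le_lt_trans zl q4.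
have peri_q := P_n n; rewrite -/q in peri_q.
have g1 := N_ge0 (A n - B n); have g2 := N_ge0 (B n - E n); have g3 := N_ge0 (E n - A n).
have nA z1 z2 t : N (z1 - A n) <= q -> N (z2 - A n) <= q -> 0 <= t <= 1 -> N (lerp z1 z2 t - A n) <= q.
  move=> h1 h2 /andP[t0 t1].
  have -> : lerp z1 z2 t - A n = (1 - t)%:C * (z1 - A n) + t%:C * (z2 - A n).
    by rewrite /lerp rmorphB /=; ring.
  apply: le_trans (ND _ _) _; rewrite !NM !NReal !ger0_norm ?subr_ge0 //.
  have : (1 - t) * N (z1 - A n) <= (1 - t) * q by rewrite ler_wpM2l // subr_ge0.
  have : t * N (z2 - A n) <= t * q by rewrite ler_wpM2l.
  by lra.
have AAn : N (A n - A n) <= q by rewrite subrr N0.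
have BAn : N (B n - A n) <= q by rewrite NC -peri_q /peri; lra.
have EAn : N (E n - A n) <= q by rewrite -peri_q /peri; lra.
have S1 := seg_bound Xc hc2 XA XB (fun t t01 => near _ (nA _ _ t AAn BAn t01)).
have S2 := seg_bound Xc hc2 XB XE (fun t t01 => near _ (nA _ _ t BAn EAn t01)).
have S3 := seg_bound Xc hc2 XE XA (fun t t01 => near _ (nA _ _ t EAn AAn t01)).
have : N (tri h (A n) (B n) (E n)) <= e / 8 * (4 * q) * q.
  rewrite tri_h /tri; move: S1 S2 S3; set s1 := seg _ _ _; set s2 := seg _ _ _; set s3 := seg _ _ _.
  rewrite (NC (B n)) (NC (E n) (B n)) (NC (A n) (E n)).
  set M := e / 8 * _; have : M * q = M * N (A n - B n) + M * N (B n - E n) + M * N (E n - A n).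
    by rewrite -!mulrDr -[_ + _ + _ in RHS]/(peri (A n) (B n) (E n)) peri_q.
  clearbody M; have := ND (s1 + s2) s3; have := ND s1 s2; clear; lra.
move=> Hfin; have eq0 : 0 <= e * q ^+ 2 by rewrite mulr_ge0 ?sqr_ge0 // ltW.
have := lt_le_trans lt Hfin; rewrite (_ : e / 8 * (4 * q) * q = e * q ^+ 2 / 2); last by field.
by move: eq0; set y := e * _; clear; lra.
Qed.

End Segments.

(** * Convex sets and primitives of functions holomorphic off one point *)

Section Cauchy.
Context {R : realType}.
Implicit Types (z w y l m a b c : R[i]) (e d x t r M : R) (h k : R[i] -> R[i]).

Definition oball z r : set R[i] := [set y | N (y - z) < r].
Definition cball z r : set R[i] := [set y | N (y - z) <= r].

Lemma cball_oball z r r' : r < r' -> cball z r `<=` oball z r'.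
Proof. by move=> rr y; rewrite /cball /oball /= => /le_lt_trans; apply. Qed.
Lemma oball_center z r : 0 < r -> oball z r z.
Proof. by rewrite /oball /= subrr N0. Qed.
Lemma lerp_sub a b w t : lerp a b t - w = (1 - t)%:C * (a - w) + t%:C * (b - w).
Proof. by rewrite /lerp rmorphB /=; ring. Qed.
Lemma N_lerp a b w t M : N (a - w) <= M -> N (b - w) <= M -> 0 <= t <= 1 -> N (lerp a b t - w) <= M.
Proof.
move=> h1 h2 /andP[t0 t1]; rewrite lerp_sub; apply: le_trans (ND _ _) _.
rewrite !NM !NReal !ger0_norm ?subr_ge0 //.
have : (1 - t) * N (a - w) <= (1 - t) * M by rewrite ler_wpM2l // subr_ge0.
have : t * N (b - w) <= t * M by rewrite ler_wpM2l.
by lra.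
Qed.
Lemma convx_cball z r : convx (cball z r).
Proof. by move=> a b t ha hb t01; apply: N_lerp. Qed.
Lemma convx_oball z r : convx (oball z r).
Proof.
move=> a b t ha hb t01; rewrite /oball /=.
apply: (@le_lt_trans _ _ (Num.max (N (a - z)) (N (b - z)))).
  by apply: N_lerp => //; rewrite le_max lexx ?orbT.
by rewrite gt_max; apply/andP.
Qed.
Lemma clN_cball z r : clN (cball z r).
Proof.
move=> y H; rewrite /cball /= leNgt; apply/negP => lt.
have [y' h1 h2] := H (N (y - z) - r) (ltac:(by rewrite subr_gt0)).
by have := NBD y' y z; rewrite (NC y y'); move: h1; rewrite /cball /=; lra.
Qed.
Lemma bdN_cball z r : bdN (cball z r).
Proof.
exists (r + N z) => y; rewrite /cball /= => h; have := N_sub y z; lra.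
Qed.
Lemma opN_oball z r : opN (oball z r).
Proof.
move=> y h; exists (r - N (y - z)); first by rewrite subr_gt0.
by move=> y' h'; have := NBD y y' z; rewrite /oball /=; lra.
Qed.
Lemma convxI (X Y : set R[i]) : convx X -> convx Y -> convx (X `&` Y).
Proof. by move=> cX cY a b t [Xa Ya] [Xb Yb] t01; split; [exact: cX|exact: cY]. Qed.
Lemma clNI (X Y : set R[i]) : clN X -> clN Y -> clN (X `&` Y).
Proof.
move=> cX cY y H; split; [apply: cX|apply: cY] => e /H[y' [h1 h2] h]; by exists y'.
Qed.
Lemma convx_half l x : convx [set z | x <= Re (l * z)].
Proof.
move=> a b t /= ha hb /andP[t0 t1].
have -> : l * lerp a b t = (1 - t)%:C * (l * a) + t%:C * (l * b) by rewrite /lerp rmorphB /=; ring.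
rewrite ReD !ReM /= !mul0r !subr0.
have : (1 - t) * x <= (1 - t) * Re (l * a) by rewrite ler_wpM2l // subr_ge0.
have : t * x <= t * Re (l * b) by rewrite ler_wpM2l.
by rewrite -!ReM; lra.
Qed.
Lemma clN_half l x : clN [set z | x <= Re (l * z)].
Proof.
move=> z H /=; rewrite leNgt; apply/negP => lt.
have l1 : 0 < N l + 1 by rewrite ltr_wpDl // N_ge0.
have [y /= h1 h2] := H ((x - Re (l * z)) / (N l + 1)) (ltac:(by rewrite divr_gt0 // subr_gt0)).
have : `|Re (l * y - l * z)| <= N l * N (y - z) by rewrite -NM mulrBr Re_le_N.
rewrite ReB ler_norml => /andP[_ h3].
have : N l * N (y - z) <= (N l + 1) * N (y - z) by rewrite ler_wpM2r ?N_ge0 // lerDl.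
by rewrite ltr_pdivlMr // mulrC in h2; lra.
Qed.

Lemma derI h g z : (\forall y \near z, h y - h z = g y * (y - z)) -> tC (nbhs z) g (g z) ->
  der h z (g z).
Proof.
move=> hg gc; exists (fun y => if y == z then g z else (h y - h z) / (y - z)); split; last by rewrite eqxx.
  move=> y; case: eqP => [->|/eqP yz]; first by rewrite !subrr mulr0.
  by rewrite divfK // subr_eq0.
rewrite /cc eqxx; apply: tC_eq gc; apply: filterS hg => y /=.
by case: eqP => [->//|/eqP yz] ->; rewrite mulfK // subr_eq0.
Qed.

Lemma der_segI X q (Q : R[i] -> R[i]) z : convx X -> (forall y, X y -> ccont X q y) -> X z -> cc q z ->
  (\forall y \near z, X y /\ Q y - Q z = seg q z y) -> der Q z (q z).
Proof.
move=> Xc qX Xz qc /nbhsCP[d d0 Hd].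
exists (fun y => if y == z then q z else (Q y - Q z) / (y - z)); split; last by rewrite eqxx.
  move=> y; case: eqP => [->|/eqP yz]; first by rewrite !subrr mulr0.
  by rewrite divfK // subr_eq0.
rewrite /cc eqxx; move/ccE: qc => qc; move=> e e0; have e20 : 0 < e / 2 by rewrite divr_gt0.
have [d' d'0 Hd'] := qc _ e20.
apply/nbhsCP; exists (Num.min d d'); first by rewrite lt_min d0.
move=> y; rewrite lt_min => /andP[yd yd'] /=; case: eqP => [_|/eqP yz]; first by rewrite subrr N0.
have [Xy ->] := Hd y yd.
pose k := fun _ : R[i] => q z.
have kc v : X v -> ccont X k v by move=> _; apply: cc_within; exact: tC_cst.
have E : seg q z y - q z * (y - z) = seg (fun v => q v - k v) z y.
  rewrite (seg_B Xc qX kc Xz Xy); congr (_ - _).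
  rewrite (seg_prim Xc kc Xz Xy (H := fun v => q z * v)); first by ring.
  by move=> v _; rewrite -[X in der _ _ X]mulr1; apply: derZ; exact: der_id.
have B : N (seg q z y - q z * (y - z)) <= e / 2 * N (y - z).
  rewrite E; apply: (seg_bound Xc) => //.
    by move=> v Xv; apply/ccontP; apply: tCB; apply/ccontP; [exact: qX|exact: kc].
  move=> t t01; apply/ltW/Hd'; apply: le_lt_trans yd'.
  by apply: N_lerp => //; rewrite subrr N0 N_ge0.
have -> : seg q z y / (y - z) - q z = (seg q z y - q z * (y - z)) / (y - z).
  by field; rewrite subr_eq0.
rewrite NM NV ltr_pdivrMr ?N_gt0 ?subr_eq0 //.
apply: le_lt_trans B _; rewrite ltr_pM2r ?N_gt0 ?subr_eq0 //.
by rewrite ltr_pdivrMr // mulr_natr mulr2n ltrDl.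
Qed.

(** The primitive is the segment integral from the exceptional point [w]. A triangle with vertex [w]
    can be halved towards [w] without changing its integral, as the part cut off avoids [w]; the
    integrals are bounded by the perimeters and tend to 0. *)
Lemma primitive_punctured q z0 r w : oball z0 r w ->
  (forall z, oball z0 r z -> cc q z) -> (forall z, oball z0 r z -> z != w -> exists l, der q z l) ->
  exists Q, forall z, oball z0 r z -> der Q z (q z).
Proof.
move=> wB qc qd; pose X := oball z0 r; have Xc : convx X := @convx_oball z0 r.
have qX y : X y -> ccont X q y by move=> Xy; apply: cc_within; exact: qc.
have key a b : X a -> X b -> N (b - a) < N (a - w) -> tri q w a b = 0.
  move=> Xa Xb.
  pose M := Num.max (N (w - z0)) (Num.max (N (a - z0)) (N (b - z0))).
  have Mr : M < r by rewrite !gt_max; apply/and3P; split.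
  have Kw : cball z0 M w by rewrite /cball /= le_max lexx.
  have Ka : cball z0 M a by rewrite /cball /= !le_max lexx orbT.
  have Kb : cball z0 M b by rewrite /cball /= !le_max lexx !orbT.
  have KX : cball z0 M `<=` X by exact: cball_oball.
  clearbody M => ab.
  have aw : a != w by apply: contraTN ab => /eqP ->; rewrite subrr N0 -leNgt N_ge0.
  have step u v : cball z0 M u -> cball z0 M v -> N (v - u) < N (u - w) ->
      tri q w u v = tri q w (mid w u) (mid w v).
    move=> Ku Kv uv; have uw : u - w != 0 by rewrite -N_gt0P; apply: le_lt_trans uv; exact: N_ge0.
    (* In the coordinate [Re (l * (z - w))] the point [u] is at 1, [v] at least at [1 - kap], and
       the two midpoints at least at [(1 - kap) / 2 > 0]. So the part cut off lies in a half-plane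
       that misses [w]. *)
    pose l := (u - w)^-1; pose kap := N (v - u) / N (u - w).
    have kap1 : kap < 1 by rewrite ltr_pdivrMr ?mul1r // N_gt0.
    pose Y := cball z0 M `&` [set z | Re (l * w) + (1 - kap) / 2 <= Re (l * z)].
    have Yc : convx Y by apply: convxI; [exact: convx_cball|exact: convx_half].
    have Ycl : clN Y by apply: clNI; [exact: clN_cball|exact: clN_half].
    have Yh : holo Y q.
      move=> z [Kz /= hz]; apply: qd; first exact: KX.
      by apply: contraTN hz => /eqP ->; rewrite -ltNge; move: kap1; clear; lra.
    have lu : l * u = l * w + 1 by rewrite -[1](mulVf uw) -/l; ring.
    have lv : `|Re (l * (v - u))| <= kap.
      by apply: le_trans (Re_le_N _) _; rewrite NM NV mulrC.
    have kap0 : 0 <= kap by rewrite divr_ge0 ?N_ge0.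
    have lvE : Re (l * v) = Re (l * w) + 1 + Re (l * (v - u)) by rewrite -(@ReD R _ 1) -ReD -lu; congr Re; ring.
    rewrite ler_norml in lv; case/andP: lv => lv _.
    have luE : Re (l * u) = Re (l * w) + 1 by rewrite lu ReD.
    have Xm := X_mid (@convx_cball z0 M).
    have Re_mid p : Re (l * mid w p) = (Re (l * w) + Re (l * p)) / 2.
      have -> : l * mid w p = (2^-1)%:C * (l * w + l * p) by rewrite midE fmorphV rmorph_nat; field.
      by rewrite ReM /= mul0r subr0 ReD mulrC.
    have Yu : Y u by split => //=; rewrite luE; move: kap0; clear; lra.
    have Yv : Y v by split => //=; rewrite lvE; move: kap0 kap1 lv; clear; lra.
    have Yu' : Y (mid w u) by split => /=; [exact: Xm|rewrite Re_mid luE; move: kap0; clear; lra].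
    have Yv' : Y (mid w v) by split => /=; [exact: Xm|rewrite Re_mid lvE; move: kap0 lv; clear; lra].
    have t1 := goursat Yc Ycl Yh Yu' Yu Yv; have t2 := goursat Yc Ycl Yh Yu' Yv Yv'.
    have Xw := KX _ Kw; have Xu := KX _ Ku; have Xv := KX _ Kv.
    have Xu' := KX _ (Xm _ _ Kw Ku); have Xv' := KX _ (Xm _ _ Kw Kv).
    have E3 : mid v w = mid w v by rewrite !midE addrC.
    rewrite /tri (seg_mid Xc qX Xw Xu) (seg_mid Xc qX Xv Xw) E3.
    move: t1 t2; rewrite /tri (seg_rev Xc qX Xu' Xv) (seg_rev Xc qX Xu' Xv').
    set s1 := seg q (mid w u) u; set s2 := seg q u v; set s3 := seg q (mid w u) v.
    set s4 := seg q v (mid w v); set s5 := seg q (mid w u) (mid w v) => t1 t2.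
    have -> : s5 = s3 + s4 by apply/eqP; rewrite -subr_eq0 -[X in _ == X]oppr0 -t2; apply/eqP; ring.
    have -> : s3 = s1 + s2 by apply/eqP; rewrite -subr_eq0 -[X in _ == X]oppr0 -t1; apply/eqP; ring.
    by ring.
  have [B HB] : exists B, forall z, cball z0 M z -> N (q z) <= B.
    have [||||z Kz Hz] := @EVTmax R (cball z0 M) (fun z => N (q z)).
    - exact: clN_cball.
    - exact: bdN_cball.
    - by exists w.
    - by move=> z Kz; apply/rcontP; apply: tC_N; apply/ccontP; apply: cc_within; apply: qc; exact: KX.
    by exists (N (q z)).
  have halves n : exists u v, [/\ cball z0 M u, cball z0 M v, N (v - u) < N (u - w),
      tri q w a b = tri q w u v & peri w u v = peri w a b / 2 ^+ n].
    elim: n => [|n [u [v [Ku Kv uv E P]]]]; first by exists a, b; rewrite expr0 divr1.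
    have Xm := X_mid (@convx_cball z0 M).
    exists (mid w u), (mid w v); split; [exact: Xm|exact: Xm| | |].
    - rewrite !midE (_ : (w + v) / 2 - _ = (v - u) / 2); last by field.
      rewrite (_ : (w + u) / 2 - w = (u - w) / 2); last by field.
      by rewrite !N_half ltr_pM2r // invr_gt0.
    - by rewrite E; exact: step.
    - have E3 : mid w v = mid v w by rewrite !midE addrC.
      by rewrite E3; have [-> _ _ _] := peri_split w u v; rewrite P exprS invfM; ring.
  apply/eqP; rewrite -[_ == 0]negbK -N_gt0P -leNgt leNgt; apply/negP => T0.
  have [n hn] := geo_small (B * peri w a b) T0.
  have [u [v [Ku Kv uv E P]]] := halves n.
  have B0 : 0 <= B by apply: le_trans (N_ge0 _) (HB w Kw).
  have KqX z : cball z0 M z -> ccont (cball z0 M) q z by move=> Kz; apply: cc_within; apply: qc; exact: KX.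
  have bnd p1 p2 : cball z0 M p1 -> cball z0 M p2 -> N (seg q p1 p2) <= B * N (p2 - p1).
    move=> K1 K2; apply: (seg_bound (@convx_cball z0 M)) => // t t01.
    by apply: HB; exact: convx_cball.
  have : N (tri q w a b) <= B * peri w u v.
    rewrite E /tri /peri !mulrDr (NC w u) (NC u v) (NC v w).
    have := bnd w u Kw Ku; have := bnd u v Ku Kv; have := bnd v w Kv Kw.
    set s1 := seg q w u; set s2 := seg q u v; set s3 := seg q v w.
    by have := ND (s1 + s2) s3; have := ND s1 s2; clear; lra.
  by rewrite P mulrA leNgt hn.
exists (seg q w) => z Xz.
have [d d0 Hd] := opN_oball Xz.
apply: (der_segI Xc qX Xz); first exact: qc.
have [->|zw] := eqVneq z w.
  apply/nbhsCP; have [d' d'0 Hd'] := opN_oball wB; exists d' => // y yd.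
  by split; [exact: Hd'|rewrite (seg_refl _ wB) subr0].
apply/nbhsCP; exists (Num.min d (N (z - w))); first by rewrite lt_min d0 N_gt0 // subr_eq0.
move=> y; rewrite lt_min => /andP[yd yz]; have Xy := Hd y yd; split => //.
have := key z y Xz Xy yz; rewrite /tri (seg_rev Xc qX wB Xy) => E.
by apply/eqP; rewrite -subr_eq0 -[X in _ == X]oppr0 -E; apply/eqP; ring.
Qed.

End Cauchy.

(** * Cauchy's formula and Taylor expansion with remainder *)

Section CauchyFormula.
Context {R : realType}.
Implicit Types (z w y l m a b c : R[i]) (e d x t r M : R) (h : R[i] -> R[i]) (k n : nat).

Definition twopi : R := pi *+ 2.
Lemma twopi_gt0 : 0 < twopi. Proof. by rewrite mulrn_wgt0 ?pi_gt0. Qed.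
Lemma twopi_ge0 : 0 <= twopi. Proof. exact: ltW twopi_gt0. Qed.
Hint Resolve twopi_gt0 twopi_ge0 : core.
Definition circ z0 r t : R[i] := z0 + r%:C * cis t.
Definition dcirc r t : R[i] := r%:C * (ii * cis t).

Lemma N_circ z0 r t : 0 <= r -> N (circ z0 r t - z0) = r.
Proof. by move=> r0; rewrite /circ addrC addKr NM N_cis mulr1 NReal ger0_norm. Qed.
Lemma N_dcirc r t : 0 <= r -> N (dcirc r t) = r.
Proof.
by move=> r0; rewrite /dcirc !NM N_cis NReal ger0_norm // (_ : N ii = 1) ?mulr1 // NE /= expr0n expr1n add0r sqrtr1.
Qed.
Lemma circ_2pi z0 r : circ z0 r twopi = circ z0 r 0.
Proof. by rewrite /circ /twopi cis_2pi cis0. Qed.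
Lemma pder_circ z0 r t : pder (circ z0 r) t (dcirc r t).
Proof.
rewrite -[X in pder _ _ X]add0r; apply: pderD; first exact: pder_cst.
by apply: pderZ; exact: pder_cis.
Qed.
Lemma pcont_circ z0 r : pcont (circ z0 r).
Proof. by move=> t; apply: pder_cont; exact: pder_circ. Qed.
Lemma pcont_dcirc r : pcont (dcirc r).
Proof.
apply: pcontM; first exact: pcont_cst.
apply: pcontM; first exact: pcont_cst.
by move=> t; apply: pder_cont; exact: pder_cis.
Qed.
Lemma pcont_comp h (p : R -> R[i]) : pcont p -> (forall t, cc h (p t)) -> pcont (fun t => h (p t)).
Proof. by move=> pc hc t; apply: tC_comp. Qed.

Lemma circ_int0 h H z0 r : (forall t, der H (circ z0 r t) (h (circ z0 r t))) ->
  (forall t, cc h (circ z0 r t)) -> int0 (fun t => h (circ z0 r t) * dcirc r t) twopi = 0.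
Proof.
move=> dH hc; rewrite (@int0_eq _ _ (fun t => H (circ z0 r t))) //.
- by rewrite circ_2pi subrr.
- by apply: pcontM; [apply: pcont_comp => //; exact: pcont_circ|exact: pcont_dcirc].
- by move=> t _; apply: pder_comp; [exact: pder_circ|exact: dH].
Qed.

Section Kernel.
Variables (z0 : R[i]) (r : R) (p : R -> R[i]) (M : R).
Hypotheses (pc : pcont p) (pM : forall t, N (p t) <= M).

Lemma pcont_kern w n : (forall t, circ z0 r t != w) -> pcont (fun t => p t / (circ z0 r t - w) ^+ n).
Proof.
move=> cw; apply: pcont_div => //; last by move=> t; rewrite expf_neq0 // subr_eq0.
apply: pcontX; apply: pcontB; [exact: pcont_circ|exact: pcont_cst].
Qed.

(** Differentiation under the integral sign: the difference quotient is itself the integral [g y] of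
    an explicit kernel, and the bound [K * N (y - w)] shows that [g] is continuous at [w]. *)
Lemma der_kernel w e : 0 < e -> (forall t, e <= N (circ z0 r t - w)) ->
  der (fun y => int0 (fun t => p t / (circ z0 r t - y)) twopi) w
    (int0 (fun t => p t / (circ z0 r t - w) ^+ 2) twopi).
Proof.
move=> e0 He.
pose g y := int0 (fun t => p t / ((circ z0 r t - y) * (circ z0 r t - w))) twopi.
have -> : int0 (fun t => p t / (circ z0 r t - w) ^+ 2) twopi = g w.
  by rewrite /g; under [in RHS]eq_fun do rewrite -expr2.
have ne y t : N (y - w) < e / 2 -> e / 2 <= N (circ z0 r t - y).
  by have := NBD y (circ z0 r t) w; have := He t; lra.
have e20 : 0 < e / 2 by rewrite divr_gt0.
have nz y t : N (y - w) < e / 2 -> circ z0 r t - y != 0.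
  by move=> /(ne y t) H; rewrite -N_gt0P; lra.
have ww : N (w - w) < e / 2 by rewrite subrr N0.
have cB y : pcont (fun t => circ z0 r t - y).
  by apply: pcontB; [exact: pcont_circ|exact: pcont_cst].
have c1 y : N (y - w) < e / 2 -> pcont (fun t => p t / (circ z0 r t - y)).
  by move=> yw; apply: pcont_div => // t; exact: nz.
have c2 y : N (y - w) < e / 2 -> pcont (fun t => p t / ((circ z0 r t - y) * (circ z0 r t - w))).
  move=> yw; apply: pcont_div => //; first exact: pcontM.
  by move=> t; rewrite mulf_neq0 ?nz.
apply: derI.
- apply/nbhsCP; exists (e / 2) => // y yw.
  rewrite -int0B //; [|exact: c1|exact: c1].
  rewrite /g mulrC -int0Z //; last exact: c2.
  congr int0; apply/funext => t; field.
  by rewrite !nz.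
- have M0 : 0 <= M by apply: le_trans (N_ge0 (p 0)) _.
  pose K := M / (e / 2 * e ^+ 2) * twopi.
  have K0 : 0 <= K by rewrite mulr_ge0 // divr_ge0 // mulr_ge0 ?exprn_ge0 // ltW.
  have gK y : N (y - w) < e / 2 -> N (g y - g w) <= K * N (y - w).
    move=> yw; rewrite /g -int0B //; [|exact: c2|exact: c2].
    have -> : (fun t => p t / ((circ z0 r t - y) * (circ z0 r t - w)) - p t / ((circ z0 r t - w) * (circ z0 r t - w)))
      = (fun t => (y - w) * (p t / ((circ z0 r t - y) * (circ z0 r t - w) ^+ 2))).
      by apply/funext => t; field; rewrite !nz.
    have c3 : pcont (fun t => p t / ((circ z0 r t - y) * (circ z0 r t - w) ^+ 2)).
      apply: pcont_div => //; first by apply: pcontM => //; exact: pcontX.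
      by move=> t; rewrite mulf_neq0 ?expf_neq0 ?nz.
    rewrite int0Z // NM mulrC ler_wpM2r ?N_ge0 //.
    apply: int0_bound => // t _; rewrite NM NV NM NX ler_pM ?invr_ge0 ?mulr_ge0 ?exprn_ge0 ?N_ge0 //.
    have h1 := ne y t yw; have h2 := He t.
    have n1 : 0 < N (circ z0 r t - y) by lra.
    have n2 : 0 < N (circ z0 r t - w) by lra.
    rewrite lef_pV2 ?posrE ?mulr_gt0 ?exprn_gt0 //.
    by rewrite ler_pM ?exprn_ge0 ?lerXn2r ?nnegrE // ltW.
  move=> d d0; apply/nbhsCP; exists (Num.min (e / 2) (d / (K + 1))).
    by rewrite lt_min e20 divr_gt0 // ltr_wpDl.
  move=> y; rewrite lt_min => /andP[yw yd].
  apply: le_lt_trans (gK y yw) _.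
  rewrite ltr_pdivlMr ?ltr_wpDl // in yd; have := N_ge0 (y - w).
  by move: yd; clear; lra.
Qed.
End Kernel.

(** The integral is constant in [w], since its derivative is the increment of a function around the
    closed circle; at the centre the integrand is the constant [ii]. *)
Lemma int_circ1 z0 r w : 0 < r -> N (w - z0) < r ->
  int0 (fun t => dcirc r t / (circ z0 r t - w)) twopi = twopi%:C * ii.
Proof.
move=> r0 wr.
have dist y : N (y - z0) < r -> forall t, r - N (y - z0) <= N (circ z0 r t - y).
  by move=> yr t; have := NBD y (circ z0 r t) z0; rewrite (N_circ _ _ (ltW r0)); lra.
have ne y : N (y - z0) < r -> forall t, circ z0 r t - y != 0.
  by move=> yr t; rewrite -N_gt0P; apply: lt_le_trans (dist y yr t); rewrite subr_gt0.
pose J y := int0 (fun t => dcirc r t / (circ z0 r t - y)) twopi.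
have dJ y : N (y - z0) < r -> der J y 0.
  move=> yr; have := @der_kernel z0 r (dcirc r) r (pcont_dcirc r) _ y (r - N (y - z0)) _ (dist y yr).
  rewrite -/J (_ : int0 _ _ = 0).
    by apply; [move=> t; rewrite N_dcirc // ltW|rewrite subr_gt0].
  rewrite (@int0_eq _ _ (fun t => - (circ z0 r t - y)^-1)) //.
  + by rewrite circ_2pi subrr.
  + by apply: pcont_kern => [|t]; [exact: pcont_dcirc|rewrite -subr_eq0 ne].
  + move=> t _; have d1 : der (fun v => v - y) (circ z0 r t) 1 := derBc y (der_id _).
    have := pder_comp (pder_circ z0 r t) (derN (derV (h := fun v => v - y) (ne y yr t) d1)).
    by rewrite (_ : - (- 1 / _) * dcirc r t = dcirc r t / (circ z0 r t - y) ^+ 2) //; field; rewrite ne.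
have -> : int0 (fun t => dcirc r t / (circ z0 r t - w)) twopi = J z0.
  have /= := @pder_const _ (fun t => J (lerp z0 w t)) 0 1 ler01.
  rewrite lerp0 lerp1; apply => t t01; rewrite -[X in pder _ _ X](mul0r (w - z0)).
  apply: pder_comp; first exact: pder_lerp.
  by apply: dJ; apply: convx_oball; rewrite // /oball /= subrr N0.
rewrite /J (_ : (fun t => _) = fun=> ii).
  by rewrite int0_cst // mulrC.
apply/funext => t; rewrite /circ addrC addKr /dcirc; field.
by rewrite cis_neq0 -N_gt0P NReal normr_gt0 gt_eqF.
Qed.

(** The difference quotient [g] of [h] at [w] is continuous at [w] and holomorphic elsewhere, so it
    has a primitive and its integral over the circle vanishes. *)
Lemma cauchy_formula h z0 r r' w : holo (oball z0 r') h -> 0 < r -> r < r' -> N (w - z0) < r ->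
  int0 (fun t => h (circ z0 r t) * dcirc r t / (circ z0 r t - w)) twopi = twopi%:C * ii * h w.
Proof.
move=> hh r0 rr' wr; have wB : oball z0 r' w by apply: lt_trans wr rr'.
have [dw Hdw] := hh w wB; have [g [hg gc gw]] := Hdw.
have gd z : oball z0 r' z -> z != w -> exists l, der g z l.
  move=> Bz zw; have [l hl] := hh z Bz.
  have zw0 : z - w != 0 by rewrite subr_eq0.
  have := derM (derBc (h w) hl) (derV (h := fun v => v - w) zw0 (derBc w (der_id z))).
  set l' := (X in der _ _ X) => Hl; exists l'; apply: der_near Hl.
  apply/nbhsCP; exists (N (z - w)); first by rewrite N_gt0.
  move=> y yz; rewrite hg mulfK // subr_eq0; apply: contraTN yz => /eqP ->.
  by rewrite NC ltxx.
have gcc z : oball z0 r' z -> cc g z.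
  move=> Bz; have [->//|zw] := eqVneq z w.
  by have [l /der_cc] := gd z Bz zw.
have [Q HQ] := primitive_punctured wB gcc gd.
have cB t : oball z0 r' (circ z0 r t) by rewrite /oball /= N_circ // ltW.
have I0 := circ_int0 (fun t => HQ _ (cB t)) (fun t => gcc _ (cB t)).
have ne t : circ z0 r t - w != 0.
  rewrite -N_gt0P; have := NBD w (circ z0 r t) z0; rewrite (N_circ _ _ (ltW r0)); lra.
have cB2 : pcont (fun t => circ z0 r t - w).
  by apply: pcontB; [exact: pcont_circ|exact: pcont_cst].
have pgc : pcont (fun t => g (circ z0 r t) * dcirc r t).
  by apply: pcontM; [apply: pcont_comp => [|t]; [exact: pcont_circ|exact: gcc]|exact: pcont_dcirc].
have p1 : pcont (fun t => dcirc r t / (circ z0 r t - w)) by apply: pcont_div => //; exact: pcont_dcirc.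
have -> : (fun t => h (circ z0 r t) * dcirc r t / (circ z0 r t - w)) =
  (fun t => g (circ z0 r t) * dcirc r t + h w * (dcirc r t / (circ z0 r t - w))).
  apply/funext => t; have -> : h (circ z0 r t) = h w + g (circ z0 r t) * (circ z0 r t - w).
    by rewrite -hg addrC subrK.
  by field; rewrite ne.
rewrite int0D //; last by apply: pcontM => //; exact: pcont_cst.
by rewrite I0 add0r int0Z // int_circ1 // mulrC.
Qed.

Lemma bound_circ h z0 r r' : holo (oball z0 r') h -> 0 <= r -> r < r' ->
  exists M, forall t, N (h (circ z0 r t)) <= M.
Proof.
move=> hh r0 rr'; have [||||z Kz Hz] := @EVTmax R (cball z0 r) (fun z => N (h z)).
- exact: clN_cball.
- exact: bdN_cball.
- by exists z0; rewrite /cball /= subrr N0.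
- move=> z Kz; apply/rcontP; apply: tC_N; apply/ccontP; apply: cc_within; apply: (holo_cc hh).
  exact: cball_oball Kz.
by exists (N (h z)) => t; apply: Hz; rewrite /cball /= N_circ.
Qed.

(** The remainders [T k] are the Cauchy integrals of [h / (circ - z0)^k], and the recursion comes
    from splitting [1 / (circ - w)]. All local theory is read off these remainders; no infinite
    series occurs. *)
Lemma taylor h z0 r r' : holo (oball z0 r') h -> 0 < r -> r < r' ->
  exists (c : nat -> R[i]) (T : nat -> R[i] -> R[i]),
  [/\ forall k w, oball z0 r w -> h w = \sum_(j < k) c j * (w - z0) ^+ j + (w - z0) ^+ k * T k w,
      forall k w, oball z0 r w -> T k w = c k + (w - z0) * T k.+1 w,
      forall k, holo (oball z0 r) (T k) &
      forall M, (forall t, N (h (circ z0 r t)) <= M) -> forall k w, oball z0 r w ->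
         N (T k w) <= M * r / (r ^+ k * (r - N (w - z0)))].
Proof.
move=> hh r0 rr'.
have r0' := ltW r0.
have cB t : oball z0 r' (circ z0 r t) by rewrite /oball /= N_circ.
have dist y : oball z0 r y -> forall t, r - N (y - z0) <= N (circ z0 r t - y).
  by move=> yr t; have := NBD y (circ z0 r t) z0; rewrite (N_circ _ _ (ltW r0)); lra.
have ne y : oball z0 r y -> forall t, circ z0 r t - y != 0.
  by move=> yr t; rewrite -N_gt0P; apply: lt_le_trans (dist y yr t); rewrite subr_gt0.
have ne0 := ne z0 (oball_center z0 r0).
pose ph (k : nat) t := h (circ z0 r t) * dcirc r t / (circ z0 r t - z0) ^+ k.
have phc k : pcont (ph k).
  apply: pcont_kern; last by move=> t; rewrite -subr_eq0 ne0.
  by apply: pcontM; [apply: pcont_comp => [|t]; [exact: pcont_circ|exact: (holo_cc hh)]|exact: pcont_dcirc].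
have cBc y : pcont (fun t => circ z0 r t - y).
  by apply: pcontB; [exact: pcont_circ|exact: pcont_cst].
have pkc k y : oball z0 r y -> pcont (fun t => ph k t / (circ z0 r t - y)).
  by move=> yr; apply: pcont_div => // t; exact: ne.
have phB M (HM : forall t, N (h (circ z0 r t)) <= M) k t : N (ph k t) <= M * r / r ^+ k.
  by rewrite /ph NM NV NX N_circ // ler_wpM2r ?invr_ge0 ?exprn_ge0 // NM N_dcirc // ler_wpM2r.
pose K := (twopi%:C * ii)^-1 : R[i].
have NII : N ii = 1 :> R by rewrite NE /= expr0n expr1n add0r sqrtr1.
have NK : N K = twopi^-1.
  by rewrite NV NM NReal gtr0_norm // NII mulr1.
have K0 : twopi%:C * ii != 0 :> R[i] by rewrite -N_gt0P NM NReal NII mulr1 gtr0_norm.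
pose T (k : nat) w := K * int0 (fun t => ph k t / (circ z0 r t - w)) twopi.
pose c (k : nat) := K * int0 (fun t => ph k t / (circ z0 r t - z0)) twopi.
have Trec k w : oball z0 r w -> T k w = c k + (w - z0) * T k.+1 w.
  move=> wr; rewrite /T /c mulrCA -mulrDr; congr (K * _).
  rewrite -int0Z //; last exact: pkc.
  rewrite -int0D //; first last.
  - by apply: pcontM; [exact: pcont_cst|exact: pkc].
  - by apply: pkc; exact: oball_center.
  congr int0; apply/funext => t; rewrite /ph exprS; field.
  by rewrite ne // ne0 expf_neq0 ?ne0.
have T0 w : oball z0 r w -> T 0%N w = h w.
  move=> wr; rewrite /T /ph; under eq_fun do rewrite expr0 divr1.
  by rewrite (cauchy_formula hh r0 rr' wr) mulrA mulVf // mul1r.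
exists c, T; split => //.
- elim=> [|k IH] w wr; first by rewrite big_ord0 add0r expr0 mul1r T0.
  by rewrite big_ord_recr /= (IH w wr) (Trec k w wr) exprS; ring.
- move=> k w wr; have [M HM] := bound_circ hh r0' rr'.
  have w0 : 0 < r - N (w - z0) by rewrite subr_gt0.
  have := der_kernel (phc k) (fun t => phB M HM k t) w0 (dist w wr).
  by move=> /(derZ K) H; eexists; exact: H.
- move=> M HM k w wr; rewrite /T NM NK mulrC ler_pdivrMr //.
  have w0 : 0 < r - N (w - z0) by rewrite subr_gt0.
  apply: int0_bound => // [|t _]; first exact: pkc.
  rewrite NM NV invfM mulrA ler_pM ?N_ge0 ?invr_ge0 ?N_ge0 //; first exact: phB.
  by rewrite lef_pV2 ?posrE //; [exact: dist|rewrite N_gt0 // ne].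
Qed.

Lemma mean_value h z0 r r' : holo (oball z0 r') h -> 0 < r -> r < r' ->
  int0 (fun t => h (circ z0 r t)) twopi = twopi%:C * h z0.
Proof.
move=> hh r0 rr'; have ii0 : ii != 0 :> R[i] by rewrite -N_gt0P NE /= expr0n expr1n add0r sqrtr1.
have cB t : oball z0 r' (circ z0 r t) by rewrite /oball /= N_circ // ltW.
apply: (mulfI ii0); rewrite -int0Z //; last first.
  by apply: pcont_comp => [|t]; [exact: pcont_circ|exact: (holo_cc hh)].
rewrite mulrA [ii * _]mulrC -(cauchy_formula hh r0 rr' (w := z0)) ?subrr ?N0 //.
congr int0; apply/funext => t; rewrite /circ /dcirc [_ + _ - _]addrC addKr; field.
by rewrite cis_neq0 -N_gt0P NReal normr_gt0 gt_eqF.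
Qed.

End CauchyFormula.

(** * Subharmonic functions *)

Section SubMean.
Context {R : realType}.
Implicit Types (z w y l a b : R[i]) (e d x t r M : R) (h : R[i] -> R[i]) (s : R[i] -> R) (k n : nat).

Definition rcc s z := rcont setT s z.
Lemma rccP s z : rcc s z <-> s @ nbhs z --> s z.
Proof.
split.
- move=> H; apply/cvgrPdist_lt => e /H[d d0 Hd]; apply/nbhsCP; exists d => // y /(Hd y I).
  by rewrite distrC.
- move/cvgrPdist_lt => H e /H /nbhsCP[d d0 Hd]; exists d => // y _ /Hd /=.
  by rewrite distrC.
Qed.
Lemma rcc_rcont A s z : rcc s z -> rcont A s z.
Proof. by move=> H e /H[d d0 Hd]; exists d => // y _; exact: Hd. Qed.
Lemma rcc_near s1 s2 z : (\forall y \near z, s1 y = s2 y) -> rcc s1 z -> rcc s2 z.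
Proof.
move=> /nbhsCP[d d0 Hd] H e /H[d' d'0 Hd']; exists (Num.min d d'); first by rewrite lt_min d0.
move=> y _; rewrite lt_min => /andP[h1 h2]; rewrite -!Hd ?subrr ?N0 //; exact: Hd'.
Qed.
Lemma rcc_Re h z : cc h z -> rcc (fun y => Re (h y)) z.
Proof. by move=> hc; apply/rccP; exact: tC_Re. Qed.
Lemma rcc_N h z : cc h z -> rcc (fun y => N (h y)) z.
Proof. by move=> hc; apply/rccP; exact: tC_N. Qed.
Lemma rccD s1 s2 z : rcc s1 z -> rcc s2 z -> rcc (fun y => s1 y + s2 y) z.
Proof. by move=> /rccP h1 /rccP h2; apply/rccP; exact: cvgD. Qed.
Lemma rccZ x s z : rcc s z -> rcc (fun y => x * s y) z.
Proof. by move=> /rccP h1; apply/rccP; exact: cvgMr. Qed.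
Lemma rcc_cst x z : rcc (fun=> x) z.
Proof. by apply/rccP; exact: cvg_cst. Qed.
Lemma rcc_ln s z : 0 < s z -> rcc s z -> rcc (fun y => ln (s y)) z.
Proof. by move=> s0 /rccP h1; apply/rccP; apply: (cvg_comp _ _ h1); exact: continuous_ln. Qed.

(* Sub-mean value property on small circles, the integral over the circle being the increment
   of an antiderivative [S]. *)
Definition smp s w := exists2 d, 0 < d & (forall y, N (y - w) < d -> rcc s y) /\
  forall r, 0 < r -> r < d -> forall S : R -> R,
    (forall t, -1 < t -> is_derive t 1 S (s (circ w r t))) -> twopi * s w <= S twopi - S 0.

Lemma circ_cont s w r : (forall t, rcc s (circ w r t)) -> forall t, {for t, continuous (fun t => s (circ w r t))}.
Proof.
move=> sc t; apply/cvgrPdist_lt => e e0; have [d d0 Hd] := sc t e e0.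
have := @pcont_circ R w r t d d0; apply: filterS => t' /(Hd _ I).
by rewrite distrC.
Qed.

Lemma circ_antider s w r d : 0 <= r -> r < d -> (forall y, N (y - w) < d -> rcc s y) ->
  exists S : R -> R, forall t, -1 < t -> is_derive t 1 S (s (circ w r t)).
Proof.
move=> r0 rd sc; apply: antiderivative; apply: circ_cont => t; apply: sc.
by rewrite N_circ.
Qed.

Lemma is_deriveB' (f g : R -> R) t (x y : R) : is_derive t 1 f x -> is_derive t 1 g y ->
  is_derive t 1 (fun u => f u - g u) (x - y).
Proof. by move=> h1 h2; apply: is_deriveB. Qed.

Lemma antider_le (f g S T : R -> R) : (forall t, 0 <= t <= twopi -> is_derive t 1 S (f t)) ->
  (forall t, 0 <= t <= twopi -> is_derive t 1 T (g t)) -> (forall t, 0 <= t <= twopi -> f t <= g t) ->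
  S twopi - S 0 <= T twopi - T 0.
Proof.
move=> HS HT fg.
have := @is_derive_bound R (fun t => S t - T t) (fun t => f t - g t) 0 twopi 0 (twopi_ge0) _ _.
rewrite mul0r => H; suff : S twopi - T twopi - (S 0 - T 0) <= 0 by lra.
apply: H => t t2; last by rewrite subr_le0 fg.
by apply: is_deriveB'; [exact: HS|exact: HT].
Qed.

Lemma m1_lt t : 0 <= t -> -1 < t :> R. Proof. lra. Qed.

(** Touching from above at [w] preserves the sub-mean value property. This treats maxima, and moduli
    at zeros, where no logarithm is available. *)
Lemma smp_ge s1 s2 w : smp s1 w -> (\forall y \near w, rcc s2 y /\ s1 y <= s2 y) -> s1 w = s2 w -> smp s2 w.
Proof.
move=> [d d0 [sc H]] /nbhsCP[d' d'0 Hd'] E; exists (Num.min d d'); first by rewrite lt_min d0.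
split=> [y|r r0]; first by rewrite lt_min => /andP[_ /Hd'[]].
rewrite lt_min => /andP[rd rd'] S HS.
have [S1 HS1] := circ_antider (ltW r0) rd sc.
rewrite -E; apply: le_trans (H r r0 rd S1 HS1) _.
apply: (antider_le (f := fun t => s1 (circ w r t)) (g := fun t => s2 (circ w r t))).
- by move=> t /andP[t0 _]; apply: HS1; exact: m1_lt.
- by move=> t /andP[t0 _]; apply: HS; exact: m1_lt.
- by move=> t _; have [] := Hd' (circ w r t) (ltac:(by rewrite N_circ // ltW)).
Qed.

Lemma smp_near s1 s2 w : (\forall y \near w, s1 y = s2 y) -> smp s1 w -> smp s2 w.
Proof.
move=> /nbhsCP[d d0 Hd] H1; have [d' d'0 [sc _]] := H1.
apply: (smp_ge H1); last by apply: Hd; rewrite subrr N0.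
apply/nbhsCP; exists (Num.min d d'); first by rewrite lt_min d0.
move=> y; rewrite lt_min => /andP[yd yd']; split; last by rewrite Hd.
apply: rcc_near (sc y yd'); apply/nbhsCP; exists (d - N (y - w)); first by rewrite subr_gt0.
by move=> v vy; apply: Hd; have := NBD y v w; lra.
Qed.

Lemma smpD s1 s2 w : smp s1 w -> smp s2 w -> smp (fun y => s1 y + s2 y) w.
Proof.
move=> [d d0 [sc H]] [d' d'0 [sc' H']]; exists (Num.min d d'); first by rewrite lt_min d0.
split=> [y|r r0].
  by rewrite lt_min => /andP[yd yd']; apply: rccD; [exact: sc|exact: sc'].
rewrite lt_min => /andP[rd rd'] S HS.
have [S1 HS1] := circ_antider (ltW r0) rd sc.
have [S2 HS2] := circ_antider (ltW r0) rd' sc'.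
have h1 := H r r0 rd S1 HS1; have h2 := H' r r0 rd' S2 HS2.
suff : S1 twopi - S1 0 <= (S twopi - S2 twopi) - (S 0 - S2 0) by rewrite mulrDr; lra.
apply: (antider_le (f := fun t => s1 (circ w r t)) (g := fun t => s1 (circ w r t) + s2 (circ w r t) - s2 (circ w r t)) (T := fun t => S t - S2 t)).
- by move=> t /andP[t0 _]; apply: HS1; exact: m1_lt.
- by move=> t /andP[t0 _]; apply: is_deriveB'; [apply: HS|apply: HS2]; exact: m1_lt.
- by move=> t _; rewrite addrK.
Qed.

Lemma smp_cst x w : smp (fun=> x) w.
Proof.
exists 1 => //; split=> [y _|r r0 r1 S HS]; first exact: rcc_cst.
have -> : twopi * x = x * twopi - x * 0 by rewrite mulr0 subr0 mulrC.
apply: (antider_le (f := fun=> x) (g := fun=> x) (S := fun t => x * t)) => // t /andP[t0 _].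
  rewrite -[X in is_derive _ _ _ X]mulr1; apply: is_deriveZ.
by apply: HS; exact: m1_lt.
Qed.

Lemma smp_Re h w r : 0 < r -> holo (oball w r) h -> smp (fun y => Re (h y)) w.
Proof.
move=> r0 hh; exists r => //; split=> [y yr|r1 r10 r1r S HS].
  by apply: rcc_Re; apply: (holo_cc hh).
have MV := mean_value hh r10 r1r.
have pc : pcont (fun t => h (circ w r1 t)).
  apply: pcont_comp => [|t]; first exact: pcont_circ.
  by apply: (holo_cc hh); rewrite /oball /= N_circ // ltW.
have : Re (int0 (fun t => h (circ w r1 t)) twopi) = twopi * Re (h w).
  by rewrite MV ReM /= mul0r subr0.
rewrite /int0 ReB => <-.
apply: (antider_le (f := fun t => Re (h (circ w r1 t))) (g := fun t => Re (h (circ w r1 t))) (S := fun t => Re (prim (fun t => h (circ w r1 t)) t))) => // t /andP[t0 _].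
  by have /pderE[] := primP pc (m1_lt t0).
by apply: HS; exact: m1_lt.
Qed.

(** Off the zeros [ln |h|] is harmonic, so [c] may have either sign. Dividing by [h w] moves the
    nearby values into the disc about 1, where [Log] is holomorphic. *)
Lemma smp_ln (c : R) h w r : 0 < r -> holo (oball w r) h -> h w != 0 -> smp (fun y => c * ln (N (h y))) w.
Proof.
move=> r0 hh hw0.
have hc : cc h w by apply: (holo_cc hh); exact: oball_center.
have /nbhsCP[d d0 Hd] : \forall y \near w, N (h y / h w - 1) < 1.
  have := tC_div hw0 hc (tC_cst (F := nbhs w) (h w)); rewrite divff // => H.
  exact: H _ _ ltr01.
pose r' := Num.min d r; have r'0 : 0 < r' by rewrite lt_min d0.
pose H y := c%:C * Log (h y / h w).
have Hh : holo (oball w r') H.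
  move=> y; rewrite /oball /= lt_min => /andP[yd yr].
  have [l hl] := hh y yr.
  have := der_comp (h := Log) (derM hl (der_cst (h w)^-1 y)) (der_Log (slit_near1 (Hd y yd))).
  by move=> /(derZ c%:C) K; eexists; exact: K.
have Hs := smpD (smp_Re r'0 Hh) (smp_cst (c * ln (N (h w))) w).
apply: smp_near Hs; apply/nbhsCP; exists r' => // y; rewrite lt_min => /andP[yd yr].
have n1 := slit_neq0 (slit_near1 (Hd y yd)).
have n0 := N_gt0 hw0.
rewrite /H ReM /= mul0r subr0 -mulrDr NM NV; congr (_ * _).
rewrite NM NV pmulr_lgt0 ?invr_gt0 // in n1.
by rewrite ln_div ?posrE // subrK.
Qed.

Lemma smp_N h w r : 0 < r -> holo (oball w r) h -> smp (fun y => N (h y)) w.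
Proof.
move=> r0 hh.
have nc : \forall y \near w, rcc (fun y => N (h y)) y.
  by apply/nbhsCP; exists r => // y yr; apply: rcc_N; apply: (holo_cc hh).
have [h0|h0] := eqVneq (h w) 0.
  apply: (smp_ge (smp_cst 0 w)); last by rewrite h0 N0.
  by apply: filterS nc => y H; split => //; exact: N_ge0.
(* A unit number with [u * h w = |h w|]; then [Re (u * h) <= |h|] with equality at [w]. *)
pose u : R[i] := (Re (h w) -i* Im (h w)) / (N (h w))%:C.
have nh := N_gt0 h0.
have nu : N u = 1.
  rewrite NM NV NReal gtr0_norm // (_ : N _ = N (h w)) ?divff ?gt_eqF //.
  by rewrite !NE /= sqrrN.
have uh : holo (oball w r) (fun y => u * h y).
  by move=> y /hh[l /(derZ u) H]; exists (u * l).
apply: (smp_ge (smp_Re r0 uh)).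
  apply: filterS nc => y H; split => //; apply: le_trans (ler_norm _) _.
  by apply: le_trans (Re_le_N _) _; rewrite NM nu mul1r.
have -> : u * h w = (N (h w))%:C; last by [].
apply: (mulIf (x := (N (h w))%:C)); first by rewrite -N_gt0P NReal normr_gt0 gt_eqF.
rewrite /u mulrAC divfK; last by rewrite -N_gt0P NReal normr_gt0 gt_eqF.
by rewrite -rmorphM /= -expr2 N2; apply: complex_eq; rewrite ?ReM ?ImM /=; ring.
Qed.

(** If the maximum exceeded [c], take the point with largest real part among the maximum points. The
    rightmost point of a small circle about it is no maximum point, so the mean over the circle is
    too small. Neither connectedness of [K] nor propagation of the maximum is involved. *)
Theorem max_principle (K : set R[i]) s c : clN K -> bdN K -> (forall z, K z -> rcont K s z) ->
  (forall z, K z -> s z <= c \/ smp s z /\ exists2 e, 0 < e & oball z e `<=` K) ->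
  forall z, K z -> s z <= c.
Proof.
move=> Kc Kb sc HK z0 Kz0.
have [zm Kzm zmax] := EVTmax Kc Kb (ex_intro _ z0 Kz0) sc.
apply: le_trans (zmax _ Kz0) _; rewrite leNgt; apply/negP => mc.
pose Z := [set z | K z /\ s z = s zm].
have Zc : clN Z.
  move=> z H.
  have Kz : K z by apply: Kc => e /H[y [Ky _] yz]; exists y.
  split => //; apply/eqP; rewrite -subr_eq0 -[_ == 0]negbK -normr_gt0 -leNgt leNgt; apply/negP => p0.
  have [d d0 Hd] := sc z Kz _ p0; have [y [Ky sy] yz] := H d d0.
  by have := Hd y Ky yz; rewrite sy distrC ltxx.
have Zb : bdN Z by case: Kb => M HM; exists M => z [/HM].
have [z1 [Kz1 sz1] z1max] : exists2 z, Z z & forall y, Z y -> Re y <= Re z.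
  apply: (EVTmax (s := fun y => Re y)) => //; first by exists zm.
  by move=> z _; apply: rcc_rcont; apply: (rcc_Re (h := id)); exact: cc_id.
case: (HK z1 Kz1); first by rewrite sz1; lra.
move=> [[d d0 [dc Hd]] [e e0 eK]].
pose r := Num.min d e / 2.
have r0 : 0 < r by rewrite divr_gt0 // lt_min d0.
have rde : r < Num.min d e by rewrite ltr_pdivrMr // mulr_natr mulr2n ltrDl lt_min d0.
have [rd re] : r < d /\ r < e by move: rde; rewrite lt_min => /andP.
have [S HS] := circ_antider (ltW r0) rd dc.
have := Hd r r0 rd S HS; rewrite sz1 leNgt => /negP; apply.
have cK t : K (circ z1 r t) by apply: eK; rewrite /oball /= N_circ // ltW.
have z1r : circ z1 r 0 = z1 + r%:C by rewrite /circ cis0 mulr1.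
have lt0 : s (circ z1 r 0) < s zm.
  rewrite lt_neqAle zmax ?andbT //; apply/eqP => E.
  have := z1max (circ z1 r 0) (conj (cK 0) E); rewrite z1r ReD /=; lra.
pose ep := (s zm - s (circ z1 r 0)) / 2.
have ep0 : 0 < ep by rewrite divr_gt0 // subr_gt0.
have sct : forall t, rcc s (circ z1 r t) by move=> t; apply: dc; rewrite N_circ // ltW.
have [tau tau0 Htau] : exists2 tau : R, 0 < tau & forall t, `|t| < tau -> `|s (circ z1 r 0) - s (circ z1 r t)| < ep.
  move: (@circ_cont s z1 r sct 0) => /cvgrPdist_lt /(_ _ ep0) /nbhs_ballP[tau /= tau0 H].
  by exists tau => // t tt; apply: H; rewrite /ball /= sub0r normrN.
pose ta := Num.min (tau / 2) twopi.
have ta0 : 0 < ta by rewrite lt_min twopi_gt0 divr_gt0.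
have tat : ta <= tau / 2 by rewrite ge_min lexx.
have ta2 : ta <= twopi by rewrite ge_min lexx orbT.
have B1 : S ta - S 0 <= (s zm - ep) * (ta - 0).
  apply: (@is_derive_bound R S (fun t => s (circ z1 r t))); first exact: ltW.
    by move=> t /andP[t0 _]; apply: HS; exact: m1_lt.
  move=> t /andP[t0 tt]; have := Htau t; rewrite ger0_norm // => /(_ ltac:(lra)).
  by rewrite ltr_norml => /andP[h1 h2]; move: h1 h2; rewrite /ep; clear; lra.
have B2 : S twopi - S ta <= s zm * (twopi - ta).
  apply: (@is_derive_bound R S (fun t => s (circ z1 r t))) => //.
    by move=> t /andP[t0 _]; apply: HS; apply: m1_lt; lra.
  by move=> t _; exact: zmax.
have : 0 < ep * ta by rewrite mulr_gt0.
by move: B1 B2; clear; lra.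
Qed.

End SubMean.

(** * Local behaviour of holomorphic functions *)

Section LocalTheory.
Context {R : realType}.
Implicit Types (z w y l a b : R[i]) (e d x t r M : R) (h q f : R[i] -> R[i]) (s : R[i] -> R) (k n : nat).

Lemma holo_sub (U V : set R[i]) h : U `<=` V -> holo V h -> holo U h.
Proof. by move=> UV H z /UV/H. Qed.
Lemma oball_in z y r d : N (y - z) + d <= r -> oball y d `<=` oball z r.
Proof. by move=> H v; rewrite /oball /= => vy; have := NBD y v z; lra. Qed.

(* [h - h z0] vanishes at [z0] to the order [k.+1]. *)
Definition order_form h z0 r k q :=
  [/\ holo (oball z0 r) q, q z0 != 0 & forall z, oball z0 r z -> h z = h z0 + (z - z0) ^+ k.+1 * q z].

Lemma pow_small x e : 0 <= x -> x < 1 -> 0 < e -> exists n, forall m, (n <= m)%N -> x ^+ m < e.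
Proof.
move=> x0 x1 e0.
have H := @cvg_geometric R 1 x (ltac:(by rewrite ger0_norm)).
move/cvgrPdist_lt: H => /(_ e e0) [n _ Hn]; exists n => m nm.
by have := Hn m nm; rewrite /= /geometric /= mul1r sub0r normrN ger0_norm // exprn_ge0.
Qed.

(** If all coefficients of positive index vanish, the remainder bound decays geometrically;
    otherwise the remainder at the first nonzero coefficient is the cofactor. *)
Lemma order_dichotomy h z0 r r' : holo (oball z0 r') h -> 0 < r -> r < r' ->
  (forall z, oball z0 r z -> h z = h z0) \/ exists k q, order_form h z0 r k q.
Proof.
move=> hh r0 rr'; have [c [T [H1 H2 H3 H4]]] := taylor hh r0 rr'.
have z0B : oball z0 r z0 by exact: oball_center.
have h0 : h z0 = c 0%N.
  by rewrite (H1 1%N z0 z0B) big_ord1 subrr expr0 expr1 mul0r addr0 mulr1.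
have [allz|] := pselect (forall k, c k.+1 = 0).
  left => z Bz; apply/eqP; rewrite -subr_eq0 -[_ == 0]negbK -N_gt0P -leNgt leNgt; apply/negP => D0.
  have [M HM] := bound_circ hh (ltW r0) rr'.
  pose x := N (z - z0) / r.
  have x0 : 0 <= x by rewrite divr_ge0 ?N_ge0 // ltW.
  have x1 : x < 1 by rewrite ltr_pdivrMr // mul1r.
  have zr : 0 < r - N (z - z0) by rewrite subr_gt0.
  have B n : N (h z - h z0) <= x ^+ n.+1 * (M * r / (r - N (z - z0))).
    rewrite (H1 n.+1 z Bz) big_ord_recl /= expr0 mulr1 -h0 big1 ?addr0; last first.
      by move=> i _; rewrite /bump /= add1n allz mul0r.
    rewrite addrC addKr NM NX.
    have -> : x ^+ n.+1 * (M * r / (r - N (z - z0))) = N (z - z0) ^+ n.+1 * (M * r / (r ^+ n.+1 * (r - N (z - z0)))).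
      by rewrite /x expr_div_n invfM; ring.
    by rewrite ler_wpM2l ?exprn_ge0 ?N_ge0 //; exact: H4.
  set C := M * r / _ in B.
  have C0 : 0 < `|C| + 1 by rewrite ltr_wpDl.
  have [n Hn] := pow_small x0 x1 (divr_gt0 D0 C0).
  have := Hn n.+1 (leqnSn n); rewrite ltr_pdivlMr // ltNge => /negP; apply.
  apply: le_trans (B n) _; rewrite ler_wpM2l ?exprn_ge0 //.
  by apply: le_trans (ler_norm C) _; rewrite lerDl.
move=> nz; right; have /existsNP[k0 hk0] := nz.
have ex : exists k, c k.+1 != 0 by exists k0; apply/eqP.
case: (ex_minnP ex) => k ck kmin; exists k, (T k.+1); split.
- exact: H3.
- by rewrite (H2 k.+1 z0 z0B) subrr mul0r addr0.
- move=> z Bz; rewrite (H1 k.+1 z Bz) big_ord_recl /= expr0 mulr1 -h0 big1 ?addr0 // => i _.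
  rewrite /bump /= add1n; have [->|ci] := eqVneq (c i.+1) 0; first by rewrite mul0r.
  by have := kmin i ci; rewrite leqNgt ltn_ord.
Qed.

Lemma order_isolated h z0 r k q : 0 < r -> order_form h z0 r k q ->
  exists2 d, 0 < d & d <= r /\ forall z, N (z - z0) < d -> q z != 0 /\ (z != z0 -> h z != h z0).
Proof.
move=> r0 [hq q0 hE].
have /nbhsCP[d d0 Hd] := (holo_cc hq (oball_center z0 r0)) _ (N_gt0 q0).
exists (Num.min d r); first by rewrite lt_min d0.
split; first by rewrite ge_min lexx orbT.
move=> z; rewrite lt_min => /andP[zd zr].
have qz : q z != 0 by apply: contraTN (Hd z zd) => /eqP /= ->; rewrite sub0r NN ltxx.
split => // zz; rewrite (hE z zr) -subr_eq0 addrC addKr mulf_neq0 // expf_neq0 // subr_eq0 //.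
Qed.

(** The Taylor disc about [z1] can be chosen to contain the given [z], so no chain of discs is
    needed. *)
Lemma entire_identity f z1 d : holo setT f -> 0 < d -> (forall z, N (z - z1) < d -> f z = f z1) ->
  forall z, f z = f z1.
Proof.
move=> hf d0 Hd z; pose r := N (z - z1) + 1.
have r0 : 0 < r by rewrite ltr_wpDl ?N_ge0.
have hh : holo (oball z1 (r + 1)) f by apply: holo_sub hf.
case: (order_dichotomy hh r0); first by rewrite ltrDl.
  by apply; rewrite /oball /= ltrDl.
move=> [k [q /(order_isolated r0)[d' d'0 [_ H]]]]; exfalso.
pose x := Num.min d d' / 2.
have m0 : 0 < Num.min d d' by rewrite lt_min d0.
have x0 : 0 < x by rewrite divr_gt0.
have xm : x < Num.min d d' by rewrite ltr_pdivrMr // mulr_natr mulr2n ltrDl.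
have [xd xd'] : x < d /\ x < d' by move: xm; rewrite lt_min => /andP.
have Nx : N (z1 + x%:C - z1) = x by rewrite addrC addKr NReal gtr0_norm.
have [_ /(_ _)/eqP] := H (z1 + x%:C) (ltac:(by rewrite Nx)).
by apply; [rewrite -subr_eq0 -N_gt0P Nx|apply: Hd; rewrite Nx].
Qed.

Lemma liouville f M : holo setT f -> (forall z, N (f z) <= M) -> forall z, f z = f 0.
Proof.
move=> hf fM z; apply/eqP; rewrite -subr_eq0 -[_ == 0]negbK -N_gt0P -leNgt leNgt; apply/negP => D0.
have M0 : 0 <= M by apply: le_trans (N_ge0 (f 0)) _.
(* Large enough that the Cauchy estimate [M * N z / (r - N z)] falls below [N (f z - f 0)]. *)
pose r := 2 * N z + 1 + 2 * M * N z / N (f z - f 0).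
have n0 := N_ge0 z.
have r1 : 2 * N z + 1 <= r by rewrite lerDl divr_ge0 ?N_ge0 // !mulr_ge0.
have r0 : 0 < r by apply: lt_le_trans r1; rewrite ltr_wpDl // mulr_ge0.
have hh : holo (oball 0 (r + 1)) f by apply: holo_sub hf.
have [c [T [H1 H2 H3 H4]]] := taylor hh r0 (ltac:(by rewrite ltrDl)).
have zB : oball 0 r z by rewrite /oball /= subr0; lra.
have B0 : oball 0 r (0 : R[i]) by exact: oball_center.
have E : f z - f 0 = z * T 1%N z.
  rewrite (H1 1%N z zB) (H1 1%N 0 B0) !big_ord1 !subrr !expr0 !expr1 subr0; ring.
have := H4 M (fun t => fM _) 1%N z zB; rewrite expr1 subr0 => H5.
have rz : 0 < r - N z by lra.
have H6 : M * r / (r * (r - N z)) = M / (r - N z) by field; rewrite !gt_eqF.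
rewrite H6 in H5.
have : N (f z - f 0) <= N z * (M / (r - N z)) by rewrite E NM ler_wpM2l.
rewrite mulrA ler_pdivlMr // leNgt => /negP; apply.
have rE : r * N (f z - f 0) = (2 * N z + 1) * N (f z - f 0) + 2 * M * N z.
  by rewrite /r; field; rewrite gt_eqF.
rewrite mulrBr [_ * r]mulrC rE; have : 0 <= M * N z by rewrite mulr_ge0.
have : 0 <= N z * N (f z - f 0) by rewrite mulr_ge0 // ltW.
by move: D0; clear; lra.
Qed.

Lemma poly_approx f (p e : R) : holo setT f -> 0 <= p -> 0 < e ->
  exists P : {poly R[i]}, forall w, N w <= p -> N (f w - P.[w]) < e.
Proof.
move=> hf p0 e0; pose r := 2 * p + 1.
have r0 : 0 < r by rewrite ltr_wpDl // mulr_ge0.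
have hh : holo (oball 0 (r + 1)) f by apply: holo_sub hf.
have r1 : r < r + 1 by rewrite ltrDl.
have [c [T [H1 H2 H3 H4]]] := taylor hh r0 r1.
have [M HM] := bound_circ hh (ltW r0) r1.
have M0 : 0 <= M by apply: le_trans (N_ge0 _) (HM 0).
have pr : 0 < r - p by rewrite /r; lra.
have x0 : 0 <= p / r by rewrite divr_ge0 // ltW.
have x1 : p / r < 1 by rewrite ltr_pdivrMr // mul1r /r; lra.
pose C := M * r / (r - p) + 1.
have C0 : 0 < C by rewrite ltr_wpDl // divr_ge0 ?mulr_ge0 // ltW.
have [n Hn] := pow_small x0 x1 (divr_gt0 e0 C0).
exists (\poly_(j < n) c j) => w wp.
have wB : oball 0 r w by rewrite /oball /= subr0 /r; lra.
rewrite horner_poly (H1 n w wB) subr0 addrAC subrr add0r NM NX.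
have := Hn n (leqnn n); rewrite ltr_pdivlMr // => Hn'.
apply: le_lt_trans Hn'; rewrite expr_div_n.
have := H4 M HM n w wB; rewrite subr0 => H5.
have rw : 0 < r - N w by rewrite /r; lra.
have H6 : M * r / (r ^+ n * (r - N w)) <= C / r ^+ n.
  have -> : M * r / (r ^+ n * (r - N w)) = M * r / (r - N w) / r ^+ n by rewrite invfM; ring.
  apply: ler_wpM2r; first by rewrite invr_ge0 exprn_ge0 // ltW.
  rewrite /C.
  apply: (@le_trans _ _ (M * r / (r - p))); last by rewrite lerDl.
  apply: ler_wpM2l; first by rewrite mulr_ge0 // ltW.
  by rewrite lef_pV2 ?posrE //; lra.
have -> : p ^+ n / r ^+ n * C = p ^+ n * (C / r ^+ n) by ring.
by apply: ler_pM; rewrite ?exprn_ge0 ?N_ge0 ?lerXn2r ?nnegrE ?N_ge0 //; exact: le_trans H5 H6.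
Qed.

(** Let [m] be the minimum of [|h - h z0|] on a small circle. If a value [w] within [m / 2] of
    [h z0] were omitted, [- ln |h - w|] would satisfy the maximum principle, yet be larger at the
    centre than on the circle. *)
Theorem open_mapping h z0 r k q p : 0 < r -> order_form h z0 r k q -> 0 < p ->
  exists2 d, 0 < d & forall w, N (w - h z0) < d -> exists2 z, N (z - z0) < p & h z = w.
Proof.
move=> r0 of0 p0; have [d0 d00 [dr Hd]] := order_isolated r0 of0.
have [hq _ hE] := of0.
have hh : holo (oball z0 r) h.
  move=> z zB; have [l hl] := hq z zB.
  have := derD (der_cst (h z0) z) (derM (derX k (derBc z0 (der_id z))) hl).
  set l' := (X in der _ _ X) => H; exists l'; apply: der_near H.
  have [e e0 He] := opN_oball zB; apply/nbhsCP; exists e => // y /He yB.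
  by rewrite (hE y yB).
pose p1 := Num.min p d0 / 2.
have m0 : 0 < Num.min p d0 by rewrite lt_min p0.
have p10 : 0 < p1 by rewrite divr_gt0.
have pm : p1 < Num.min p d0 by rewrite ltr_pdivrMr // mulr_natr mulr2n ltrDl.
have [pp pd] : p1 < p /\ p1 < d0 by move: pm; rewrite lt_min => /andP.
pose S := [set z | N (z - z0) = p1].
have hcc z : N (z - z0) <= p1 -> cc h z.
  by move=> zp; apply: (holo_cc hh); rewrite /oball /=; lra.
have [zm Sm mmin] : exists2 z, S z & forall y, S y -> N (h z - h z0) <= N (h y - h z0).
  apply: (@EVTmin R S (fun z => N (h z - h z0))).
  - move=> z H; apply/eqP; rewrite -subr_eq0 -[_ == 0]negbK -normr_gt0 -leNgt leNgt; apply/negP => g0.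
    have [y Sy yz] := H _ g0; have := N_sub_abs (z - z0) (y - z0).
    by rewrite (_ : z - z0 - (y - z0) = z - y) ?(NC z y) ?Sy ?leNgt ?yz //; ring.
  - by exists (p1 + N z0) => z; rewrite /S /= => <-; have := N_sub z z0; lra.
  - by exists (z0 + p1%:C); rewrite /S /= addrC addKr NReal gtr0_norm.
  - move=> z Sz; apply: rcc_rcont; apply: (rcc_N (h := fun y => h y - h z0)).
    by apply: tCB; [apply: hcc; rewrite Sz|exact: tC_cst].
pose m := N (h zm - h z0).
have mm : 0 < m.
  rewrite N_gt0 // subr_eq0; have [_] := Hd zm (ltac:(by rewrite Sm)); apply.
  by rewrite -subr_eq0 -N_gt0P Sm.
exists (m / 2); first by rewrite divr_gt0.
move=> w wm; apply: contrapT => nz.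
have hw z : N (z - z0) <= p1 -> h z - w != 0.
  move=> zp; rewrite subr_eq0; apply/negP => /eqP E; apply: nz; exists z => //; lra.
pose s z := (-1) * ln (N (h z - w)).
have sc z : N (z - z0) <= p1 -> rcc s z.
  move=> zp; apply: rccZ; apply: rcc_ln; first by rewrite N_gt0 // hw.
  by apply: (rcc_N (h := fun y => h y - w)); apply: tCB; [exact: hcc|exact: tC_cst].
have := @max_principle R (cball z0 p1) s (- ln (m / 2)) (@clN_cball R z0 p1) (@bdN_cball R z0 p1).
have H1 z : cball z0 p1 z -> rcont (cball z0 p1) s z by move=> zp; apply: rcc_rcont; exact: sc.
move=> /(_ H1) H; have /H/(_ z0) : forall z, cball z0 p1 z -> s z <= - ln (m / 2) \/ smp s z /\ exists2 e, 0 < e & oball z e `<=` cball z0 p1.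
  move=> z; rewrite /cball /= le_eqVlt => /orP[/eqP zp|zp]; [left|right].
    have nw : 0 < N (h z - w) by rewrite N_gt0 // hw // zp.
    rewrite /s mulN1r lerN2 ler_ln ?posrE ?divr_gt0 //.
    have := mmin z zp; rewrite -/m; have := NBD w (h z) (h z0); by move: wm; clear; lra.
  have g0 : 0 < p1 - N (z - z0) by rewrite subr_gt0.
  split; last first.
    by exists (p1 - N (z - z0)) => // y; rewrite /oball /cball /= => yz; have := NBD z y z0; lra.
  apply: (smp_ln (-1) g0); last by apply: hw; exact: ltW.
  move=> y; rewrite /oball /= => yz; have [l hl] := hh y (ltac:(by have := NBD z y z0; rewrite /oball /=; lra)).
  by exists l; exact: derBc.
have z00 : cball z0 p1 z0 by rewrite /cball /= subrr N0 ltW.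
move=> /(_ z00); rewrite /s mulN1r lerN2 leNgt => /negP; apply.
by rewrite ltr_ln ?posrE ?divr_gt0 // ?N_gt0 ?hw // NC.
Qed.

Lemma int_mul_nat_neq1 (n : nat) : (1 < n)%N -> forall j : int, 1 <> j%:~R * n%:R :> R.
Proof.
move=> n1 j E; have : (j * n%:Z)%:~R = 1%:~R :> R by rewrite intrM -pmulrn -E.
by move=> /intr_inj /(congr1 absz); rewrite abszM => /eqP; rewrite muln_eq1 => /andP[_ /eqP]; lia.
Qed.

Lemma cexp_surj z : z != 0 -> exists w, cexp w = z.
Proof.
move=> z0; have [sz|nsz] := pselect (slit z); first by exists (Log z); exact: cexp_Log.
have sN : slit (- z).
  move/negP: nsz; rewrite /slit NN ReN -leNgt => h; have := Re_le_N z; rewrite ler_norml => /andP[h1 _].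
  have nz := N_gt0 z0; lra.
exists (Log (- z) + (0 +i* pi)); rewrite cexpD (cexp_Log sN) /cexp /= expR0 cis_pi rmorph1; ring.
Qed.

(* Near a zero of order at least two of [h - h z0], a holomorphic root of [h - h z0]
   is an open map, whence two preimages. *)
Lemma two_preimages h z0 r k q p : 0 < r -> order_form h z0 r k.+1 q -> 0 < p ->
  forall d, 0 < d -> exists w z1 z2, [/\ N (w - h z0) < d, z1 != z2,
    N (z1 - z0) < p /\ N (z2 - z0) < p & h z1 = w /\ h z2 = w].
Proof.
move=> r0 [hq q0 hE] p0 d d0.
have /nbhsCP[d1 d10 Hd1] : \forall y \near z0, N (q y / q z0 - 1) < 1.
  have := tC_div q0 (holo_cc hq (oball_center z0 r0)) (tC_cst (F := nbhs z0) (q z0)); rewrite divff // => H.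
  exact: H _ _ ltr01.
have [W hW] := cexp_surj q0.
have [n nE n1] : exists2 n : nat, n = k.+2 & (1 < n)%N by exists k.+2.
rewrite -nE in hE.
have nn0 : n != 0%N by lia.
have n0 : (n%:R : R[i]) != 0 by rewrite pnatr_eq0.
pose g z := cexp ((W + Log (q z / q z0)) / n%:R).
pose psi z := (z - z0) * g z.
pose r1 := Num.min d1 r.
have r10 : 0 < r1 by rewrite lt_min d10.
have gn z : oball z0 r1 z -> g z ^+ n = q z.
  rewrite /oball /= lt_min => /andP[zd _]; rewrite /g -cexpMn; set X := W + _.
  rewrite -(mulr_natr (X / n%:R) n) divfK // /X.
  rewrite cexpD hW cexp_Log; first by rewrite mulrCA divff ?mulr1.
  by apply: slit_near1; exact: Hd1.
have hg : holo (oball z0 r1) g.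
  move=> z; rewrite /oball /= lt_min => /andP[zd zr].
  have [l hl] := hq z zr.
  have sl := slit_near1 (Hd1 z zd).
  have D1 := der_comp (h := Log) (derM hl (der_cst (q z0)^-1 z)) (der_Log sl).
  have D2 := derM (derD (der_cst W z) D1) (der_cst n%:R^-1 z).
  by have := der_comp D2 (der_cexp _); set l' := (X in der _ _ X) => D3; exists l'.
have ofp : order_form psi z0 r1 0 g.
  split => //; first exact: cexp_neq0.
  by move=> z _; rewrite /psi subrr mul0r add0r expr1.
pose p1 := Num.min p r1.
have p10 : 0 < p1 by rewrite lt_min p0.
have [e e0 He] := open_mapping r10 ofp p10.
have psi0 : psi z0 = 0 by rewrite /psi subrr mul0r.
pose t := Num.min (e / 2) (Num.min d 1 / 2).
have md : 0 < Num.min d 1 by rewrite lt_min d0 ltr01.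
have t0 : 0 < t by rewrite lt_min !divr_gt0.
have te : t < e by apply: le_lt_trans (_ : t <= e / 2) _; [rewrite ge_min lexx|rewrite ltr_pdivrMr // mulr_natr mulr2n ltrDl].
have t2 : t < Num.min d 1.
  by apply: le_lt_trans (_ : t <= Num.min d 1 / 2) _; [rewrite ge_min lexx orbT|rewrite ltr_pdivrMr // mulr_natr mulr2n ltrDl].
have [td t1] : t < d /\ t < 1 by move: t2; rewrite lt_min => /andP.
pose om : R[i] := cis (pi *+ 2 / n%:R).
have omn : om ^+ n = 1.
  rewrite /om -[RHS]cis_2pi; have E : forall j x, cis x ^+ j = cis (x *+ j).
    by elim=> [|j IH] x; rewrite ?expr0 ?mulr0n ?cis0 // exprS IH mulrS cisD.
  by rewrite E -(mulr_natr (pi *+ 2 / n%:R) n) divfK // pnatr_eq0.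
have om1 : om != 1.
  apply/negP => /eqP /cis_eq1[j]; rewrite -mulrzr => E.
  have E2 : (1 : R) = j%:~R * n%:R.
    apply: (mulfI (x := pi *+ 2)); first by rewrite gt_eqF // mulrn_wgt0 ?pi_gt0.
    by rewrite mulr1 mulrA -E divfK // pnatr_eq0.
  by apply: (@int_mul_nat_neq1 n n1 j).
have Nt : N (t%:C) = t by rewrite NReal gtr0_norm.
have [z1 z1p E1] := He t%:C (ltac:(by rewrite psi0 subr0 Nt)).
have [z2 z2p E2] := He (t%:C * om) (ltac:(by rewrite psi0 subr0 NM Nt N_cis mulr1)).
have hpsi z : N (z - z0) < p1 -> h z = h z0 + psi z ^+ n.
  rewrite lt_min => /andP[_ zr]; rewrite hE; last by move: zr; rewrite lt_min => /andP[].
  by rewrite /psi exprMn gn.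
exists (h z0 + t%:C ^+ n), z1, z2; split.
- rewrite addrC addKr NX Nt; apply: le_lt_trans td; have := ler_wiXn2l (ltW t0) (ltW t1) (ltnW n1).
  by rewrite expr1.
- apply: contra om1 => /eqP E; apply/eqP; move: E2; rewrite -E E1 => E2.
  by apply: (mulfI (x := t%:C)); [rewrite -N_gt0P Nt|rewrite mulr1 -E2].
- by move: z1p z2p; rewrite !lt_min => /andP[-> _] /andP[-> _].
- by rewrite (hpsi z1 z1p) (hpsi z2 z2p) E1 E2 exprMn omn mulr1.
Qed.

Lemma lipschitz q z0 r : holo (oball z0 r) q -> 0 < r ->
  exists2 L, 0 <= L & forall z y, N (z - z0) < r / 8 -> N (y - z0) < r / 8 -> N (q z - q y) <= L * N (z - y).
Proof.
move=> hq r0; have [||||zm Km HM] := @EVTmax R (cball z0 (r / 2)) (fun z => N (q z)).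
- exact: clN_cball.
- exact: bdN_cball.
- by exists z0; rewrite /cball /= subrr N0 divr_ge0 // ltW.
- move=> z; rewrite /cball /= => Kz; apply: rcc_rcont; apply: rcc_N; apply: (holo_cc hq).
  by rewrite /oball /=; lra.
pose M := N (q zm).
have M0 : 0 <= M by exact: N_ge0.
(* The remainder [T 1] about [y] is estimated on the circle of radius [r / 3], which stays within
   [r / 2] of [z0]; as [N (z - y) < r / 4], the distance left is more than [r / 12 > r / 16]. *)
exists (M / (r / 16)); first by rewrite divr_ge0 // ?divr_ge0 // ltW.
move=> z y zz yz.
have r40 : 0 < r / 3 by rewrite divr_gt0.
have r45 : r / 3 < r / 2 by lra.
have hy : holo (oball y (r / 2)) q by apply: holo_sub hq; apply: oball_in; lra.
have [c [T [H1 _ _ H4]]] := taylor hy r40 r45.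
have HMc t : N (q (circ y (r / 3) t)) <= M.
  apply: HM; rewrite /cball /=; have := NBD y (circ y (r / 3) t) z0.
  by rewrite N_circ ?(ltW r40) //; lra.
have zy : N (z - y) < r / 4 by have := NBD z0 z y; rewrite (NC z0 y); lra.
have zB : oball y (r / 3) z by rewrite /oball /=; lra.
have E : q z - q y = (z - y) * T 1%N z.
  rewrite (H1 1%N z zB) (H1 1%N y (oball_center y r40)) !big_ord1 !subrr !expr0 !expr1; ring.
rewrite E NM mulrC ler_wpM2r ?N_ge0 //.
apply: le_trans (H4 M HMc 1%N z zB) _.
have d0 : 0 < r / 3 - N (z - y) by lra.
have -> : M * (r / 3) / ((r / 3) ^+ 1 * (r / 3 - N (z - y))) = M / (r / 3 - N (z - y)).
  by rewrite expr1; field; rewrite !gt_eqF //; lra.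
by rewrite ler_wpM2l // lef_pV2 ?posrE ?divr_gt0 //; lra.
Qed.

(** Equal values give [(z - y) * q z = - (y - z0) * (q z - q y)]. Near [z0] the left side is at
    least [|z - y| * |q z0| / 2], and by the Lipschitz bound the right side is smaller. *)
Lemma local_inj h z0 r q : 0 < r -> order_form h z0 r 0 q ->
  exists2 d, 0 < d & forall z y, N (z - z0) < d -> N (y - z0) < d -> h z = h y -> z = y.
Proof.
move=> r0 [hq q0 hE]; have [L L0 HL] := lipschitz hq r0.
have nq := N_gt0 q0.
pose d := Num.min (r / 8) (N (q z0) / (2 * (L + 1))).
have L1 : 0 < 2 * (L + 1) by rewrite mulr_gt0 // ltr_wpDl.
have r80 : 0 < r / 8 by rewrite divr_gt0.
exists d; first by rewrite lt_min r80 divr_gt0.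
move=> z y; rewrite !lt_min => /andP[zr zd] /andP[yr yd] E.
have zB : oball z0 r z by rewrite /oball /=; lra.
have yB : oball z0 r y by rewrite /oball /=; lra.
apply/eqP; rewrite -subr_eq0 -[_ == 0]negbK -N_gt0P -leNgt leNgt; apply/negP => D0.
have : (z - y) * q z = - ((y - z0) * (q z - q y)).
  move: E; rewrite (hE z zB) (hE y yB) !expr1 => /addrI E.
  have -> : (z - y) * q z = (z - z0) * q z - (y - z0) * q z by ring.
  by rewrite E; ring.
move=> /(congr1 N); rewrite NN !NM => E2.
have h1 := HL z y zr yr.
have h2 := HL z z0 zr (ltac:(by rewrite subrr N0)).
have h3 : N (q z0) - L * N (z - z0) <= N (q z) by have := N_sub (q z0) (q z); rewrite NC; lra.
rewrite ltr_pdivlMr // in zd; rewrite ltr_pdivlMr // in yd.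
have n1 := N_ge0 (z - z0); have n2 := N_ge0 (y - z0).
have h4 : L * N (z - z0) <= N (q z0) / 2 by move: zd n1; clear; lra.
have h5 : N (y - z0) * L < N (q z0) / 2 by move: yd n2 nq; clear; nra.
have h6 : N (y - z0) * N (q z - q y) <= N (y - z0) * L * N (z - y) by rewrite -mulrA ler_wpM2l.
have : N (z - y) * (N (q z0) / 2) <= N (z - y) * N (q z) by rewrite ler_pM2l //; lra.
have : N (y - z0) * L * N (z - y) < N (q z0) / 2 * N (z - y) by rewrite ltr_pM2r.
by rewrite E2; move: h6; clear; lra.
Qed.

End LocalTheory.

(** * A capacity estimate *)

Section Capacity.
Context {R : realType}.
Implicit Types (z w y : R[i]) (e d x t r M L p : R) (s : R[i] -> R) (k n m i j : nat).

(** The bound [n! >= (n / e)^n] in logarithmic form; the induction rests on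
    [ln (1 + 1 / n) <= 1 / n]. *)
Lemma sum_ln_ge n : (0 < n)%N -> - n%:R <= \sum_(m < n) ln (m.+1%:R / n%:R) :> R.
Proof.
elim: n => // n IH _; have [->|n0] := posnP n.
  by rewrite big_ord1 divff ?pnatr_eq0 // ln1 oppr_le0.
have n0R : 0 < n%:R :> R by rewrite ltr0n.
have n1R : 0 < n.+1%:R :> R by rewrite ltr0n.
rewrite big_ord_recr /= divff ?pnatr_eq0 // ln1 addr0.
have -> : \sum_(m < n) ln (m.+1%:R / n.+1%:R) = \sum_(m < n) (ln (m.+1%:R / n%:R) - ln (n.+1%:R / n%:R)) :> R.
  apply: eq_bigr => m _; rewrite -ln_div ?posrE ?divr_gt0 //.
  by congr ln; field; rewrite !gt_eqF.
rewrite big_split /= sumr_const card_ord.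
have h1 : ln (n.+1%:R / n%:R) <= n%:R^-1 :> R.
  have -> : n.+1%:R / n%:R = 1 + n%:R^-1 :> R by rewrite -natr1 mulrDl divff ?gt_eqF // mul1r addrC.
  by apply: le_ln1Dx; apply: lt_trans (_ : 0 < _); rewrite ?ltrN10 ?invr_gt0.
have h2 : ln (n.+1%:R / n%:R) *+ n <= 1 :> R.
  by have := ler_wMn2r n h1; rewrite -(mulr_natr n%:R^-1 n) mulVf ?gt_eqF.
have := IH n0; rewrite mulNrn; move: h2; set a := (ln _) *+ n => h2; rewrite -(natr1 n); lra.
Qed.

Lemma sum_ln_ge' n j : (j <= n)%N -> - n%:R <= \sum_(m < j) ln (m.+1%:R / n%:R) :> R.
Proof.
case: n => [|n] jn; first by move: jn; rewrite leqn0 => /eqP ->; rewrite big_ord0 oppr0.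
apply: le_trans (sum_ln_ge (ltn0Sn n)) _.
rewrite -(subnKC jn) big_split_ord /= gerDl; apply: sumr_le0 => i _.
rewrite subnKC // -ln1 ler_ln ?posrE ?divr_gt0 // ler_pdivrMr // mul1r ler_nat.
by have := ltn_ord i; lia.
Qed.

Lemma sum_rev (f : nat -> R) j : \sum_(i < j) f (j - i)%N = \sum_(m < j) f m.+1.
Proof.
elim: j => [|j IH]; first by rewrite !big_ord0.
rewrite big_ord_recl big_ord_recr /= subn0 addrC; congr (_ + _); rewrite -IH.
by apply: eq_bigr => i _; rewrite /bump /= add1n subSS.
Qed.

(** On either side of [x] the grid points are at distances at least [1 / n, 2 / n, ...], which costs
    at most [n] by the factorial bound. The indices [j] and [j + 1] next to [x] are exempt: only the
    truncation [e] bounds them, whence [2 * ln e]. *)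
Lemma pot_lower n x e : (0 < n)%N -> 0 < e -> e <= 1 ->
  - 2 * n%:R + 2 * ln e <= \sum_(i < n) ln (Num.max `|x - i%:R / n%:R| e).
Proof.
move=> n0 e0 e1; have nR : 0 < n%:R :> R by rewrite ltr0n.
pose x' := Num.max x 0.
have x'0 : 0 <= x' by rewrite le_max lexx orbT.
(* Moving a negative [x] to 0 only decreases the distances to the grid. *)
have xx i : `|x' - i%:R / n%:R| <= `|x - i%:R / n%:R|.
  have i0 : 0 <= i%:R / n%:R :> R by rewrite divr_ge0.
  rewrite /x' /Num.max; case: ltP => // x0.
  by rewrite sub0r normrN ger0_norm // ler_normr opprB; apply/orP; right; lra.
pose j0 := Num.truncn (n%:R * x'); pose j := minn j0 n.
have nx0 : 0 <= n%:R * x' by rewrite mulr_ge0 // ltW.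
have := truncn_itv nx0; rewrite -/j0 => /andP[j0a j0b].
pose f m : R := ln (Num.max (m%:R / n%:R) e).
have mx (a : R) : 0 < Num.max a e by rewrite lt_max e0 orbT.
have fle m (b : R) : m%:R / n%:R <= b -> f m <= ln (Num.max b e).
  move=> my; rewrite /f ler_ln ?posrE ?lt_max ?e0 ?orbT //.
  by rewrite ge_max !le_max my lexx orbT.
have f0 : f 0%N = ln e by rewrite /f mul0r (max_idPr _) // ltW.
have fS m : ln (m.+1%:R / n%:R) <= f m.+1.
  by rewrite /f ler_ln ?posrE ?lt_max ?divr_gt0 // le_max lexx.
have jn : (j <= n)%N by rewrite geq_minr.
have jx : j%:R / n%:R <= x'.
  by rewrite ler_pdivrMr // mulrC; apply: le_trans j0a; rewrite ler_nat geq_minl.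
have left i : (i <= j)%N -> f (j - i)%N <= ln (Num.max `|x - i%:R / n%:R| e).
  move=> ij; apply: fle; apply: le_trans _ (xx i); apply: le_trans _ (ler_norm _).
  by rewrite natrB // mulrBl lerD2r jx.
have right i : (j < i)%N -> (i < n)%N -> f (i - j.+1)%N <= ln (Num.max `|x - i%:R / n%:R| e).
  move=> ji inn; apply: fle; apply: le_trans _ (xx i); rewrite distrC; apply: le_trans _ (ler_norm _).
  have jj : j = j0 by rewrite /j; lia.
  rewrite natrB // mulrBl lerD2l lerN2 ler_pdivlMr // mulrC jj; exact: ltW.
have lne : ln e <= 0 by rewrite -ln1 ler_ln ?posrE.
have A1 : - n%:R <= \sum_(i < j) ln (Num.max `|x - i%:R / n%:R| e).
  apply: le_trans (sum_ln_ge' jn) _; apply: (@le_trans _ _ (\sum_(i < j) f (j - i)%N)).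
    by rewrite sum_rev; apply: ler_sum => m _; exact: fS.
  by apply: ler_sum => i _; apply: left; exact: ltnW.
have [k nk] : exists k, n = (j + k)%N by exists (n - j)%N; rewrite subnKC.
have A2 : - n%:R + 2 * ln e <= \sum_(i < k) ln (Num.max `|x - (j + i)%:R / n%:R| e).
  case: k nk => [|k nk]; first by rewrite big_ord0 => _; move: nR lne; clear; lra.
  rewrite big_ord_recl /=.
  have B1 : ln e <= ln (Num.max `|x - (j + 0)%:R / n%:R| e) by rewrite -f0 addn0 -(subnn j); exact: left.
  suff : - n%:R + ln e <= \sum_(i < k) ln (Num.max `|x - (j + bump 0 i)%:R / n%:R| e).
    by move: B1; set a := ln (Num.max _ _); clear; lra.
  apply: (@le_trans _ _ (\sum_(i < k) f i)); last first.
    apply: ler_sum => i _; rewrite /bump /= add1n; have := @right (j + i.+1)%N.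
    rewrite (_ : (j + i.+1 - j.+1)%N = i); last by clear; lia.
    by apply; have := ltn_ord i; move: nk; clear; lia.
  case: k nk => [|k nk]; first by rewrite big_ord0 => _; move: nR lne; clear; lra.
  rewrite big_ord_recl /= f0 [leRHS]addrC lerD2r.
  have kn : (k <= n)%N by move: nk; clear; lia.
  apply: le_trans (sum_ln_ge' kn) _; apply: ler_sum => m _; rewrite /bump /= add1n; exact: fS.
have -> : \sum_(i < n) ln (Num.max `|x - i%:R / n%:R| e) =
   \sum_(i < j) ln (Num.max `|x - i%:R / n%:R| e) + \sum_(i < k) ln (Num.max `|x - (j + i)%:R / n%:R| e).
  by clear -nk; generalize (n%:R : R) => nn; rewrite nk big_split_ord.
by move: A1 A2; set a := \sum_(i < j) _; set b := \sum_(i < k) _; clear; lra.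
Qed.

Lemma ln2_bounds : 1 / 2 <= ln (2 : R) <= 1.
Proof.
have h1 : ln (1 + 1 : R) <= 1 by apply: le_ln1Dx; lra.
have h2 : ln (1 + (- (1 / 2)) : R) <= - (1 / 2) by apply: le_ln1Dx; lra.
rewrite (_ : 1 + - (1 / 2) = 2^-1) in h2; last by field.
rewrite lnV ?posrE // in h2.
rewrite (_ : 1 + 1 = 2) in h1; last by ring.
by apply/andP; split; lra.
Qed.

Lemma smp_sum (I : Type) (v : seq I) (F : I -> R[i] -> R) z : (forall i : I, smp (F i) z) ->
  smp (fun y => \sum_(i <- v) F i y) z.
Proof.
move=> H; elim: v => [|a v IH].
  by apply: smp_near (smp_cst 0 z); apply: filterS (@filterT _ (nbhs z) _) => y _; rewrite big_nil.
by apply: smp_near (smpD (H a) IH); apply: filterS (@filterT _ (nbhs z) _) => y _; rewrite big_cons.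
Qed.

Lemma rcc_sum (I : Type) (v : seq I) (F : I -> R[i] -> R) z : (forall i : I, rcc (F i) z) ->
  rcc (fun y => \sum_(i <- v) F i y) z.
Proof.
move=> H; elim: v => [|a v IH].
  by apply: rcc_near (rcc_cst 0 z); apply: filterS (@filterT _ (nbhs z) _) => y _; rewrite big_nil.
by apply: rcc_near (rccD (H a) IH); apply: filterS (@filterT _ (nbhs z) _) => y _; rewrite big_cons.
Qed.

Lemma rcontB A s1 s2 z : rcont A s1 z -> rcc s2 z -> rcont A (fun y => s1 y + s2 y) z.
Proof.
move=> h1 h2 e e0; have e2 : 0 < e / 2 by rewrite divr_gt0.
have [d d0 H] := h1 _ e2; have [d' d'0 H'] := h2 _ e2.
exists (Num.min d d'); first by rewrite lt_min d0.
move=> y Ay; rewrite lt_min => /andP[/(H _ Ay) k1 /(H' _ I) k2].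
by rewrite opprD addrACA [e in _ < e]splitr; apply: le_lt_trans (ler_normD _ _) _; rewrite ltrD.
Qed.

(* Comparison of [s] with a multiple of the logarithmic potential of [n] points of the
   set [s <= - L] spread evenly over the circles. *)
Theorem capacity s z0 p L : 0 < p -> 0 < L ->
  (forall z, cball z0 (10 * p) z -> rcont (cball z0 (10 * p)) s z) ->
  (forall z, cball z0 (10 * p) z -> s z <= 0) ->
  (forall z, oball z0 (10 * p) z -> - L < s z -> smp s z) ->
  (forall t, p <= t <= 2 * p -> exists2 z, N (z - z0) = t & s z <= - L) ->
  forall y, N (y - z0) <= 2 * p -> s y <= - (L / 20).
Proof.
move=> p0 L0 sc s0 ssmp sE y yp.
pose B := cball z0 (10 * p).
have e0 : 0 < L / 4 by rewrite divr_gt0.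
(* By uniform continuity, points with [s >= - 3 / 4 * L] keep the distance [d] from points with
   [s <= - L], so there the logarithms of the distances may be truncated at [eta]. *)
have [d d0 Hd] := unif_cont (@clN_cball R z0 (10 * p)) (@bdN_cball R z0 (10 * p)) sc e0.
pose eta := Num.min (d / p) 1.
have eta0 : 0 < eta by rewrite lt_min ltr01 andbT divr_gt0.
have eta1 : eta <= 1 by rewrite ge_min lexx orbT.
have etad : eta * p <= d by rewrite -ler_pdivlMr // ge_min lexx.
(* So many points that the two truncated terms [2 * ln eta] cost at most another [n]. *)
have [n n0 nE] : exists2 n : nat, (0 < n)%N & - 2 * ln eta <= n%:R.
  exists (Num.bound (- 2 * ln eta)).+1 => //.
  apply: le_trans (ler_norm _) _; apply: ltW; apply: lt_le_trans (archi_boundP _) _ => //.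
  rewrite ger0_norm ?ler_nat //.
  by have : ln eta <= 0 by [rewrite -ln1 ler_ln ?posrE]; lra.
have nR : 0 < n%:R :> R by rewrite ltr0n.
have Hze (i : 'I_n) : {z | N (z - z0) = p * (1 + i%:R / n%:R) /\ s z <= - L}.
  apply: cid; have [|z h1 h2] := sE (p * (1 + i%:R / n%:R)); last by exists z.
  have i0 : 0 <= i%:R / n%:R :> R by rewrite divr_ge0.
  have i1 : i%:R / n%:R <= 1 :> R by rewrite ler_pdivrMr // mul1r ler_nat ltnW.
  by apply/andP; split; nra.
pose ze (i : 'I_n) := sval (Hze i).
have ze1 (i : 'I_n) : N (ze i - z0) = p * (1 + i%:R / n%:R) by case: (svalP (Hze i)).
have ze2 (i : 'I_n) : s (ze i) <= - L by case: (svalP (Hze i)).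
have zeB (i : 'I_n) : N (ze i - z0) <= 2 * p.
  have i1 : i%:R / n%:R <= 1 :> R by rewrite ler_pdivrMr // mul1r ler_nat ltnW.
  by rewrite ze1; nra.
have zeK (i : 'I_n) : B (ze i) by rewrite /B /cball /=; have := zeB i; lra.
have [y1|y1] := leP (s y) (- (3 / 4 * L)); first by lra.
pose K := B `&` [set z | - (3 / 4 * L) <= s z].
have far z (i : 'I_n) : K z -> d <= N (z - ze i).
  move=> [Bz /= sz]; rewrite leNgt; apply/negP => lt.
  have := Hd (ze i) z (zeK i) Bz lt; have := ze2 i; rewrite ltr_norml => h1 /andP[h2 h3]; lra.
have farp z (i : 'I_n) : K z -> 0 < N (z - ze i) by move=> Kz; have := far z i Kz; lra.
pose pot z : R := \sum_(i < n) ln (N (z - ze i) / p).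
have potlow z : K z -> - 3 * n%:R <= pot z.
  move=> Kz; pose x := (N (z - z0) - p) / p.
  apply: (@le_trans _ _ (\sum_(i < n) ln (Num.max `|x - i%:R / n%:R| eta))).
    apply: le_trans (pot_lower x n0 eta0 eta1); move: nE; clear; lra.
  apply: ler_sum => i _; rewrite ler_ln ?posrE ?lt_max ?eta0 ?orbT ?divr_gt0 ?farp //.
  rewrite ge_max; apply/andP; split.
    rewrite ler_pdivlMr // -[p in leLHS]gtr0_norm // -normrM.
    have -> : (x - i%:R / n%:R) * p = N (z - z0) - N (ze i - z0).
      by rewrite ze1 /x; field; rewrite !gt_eqF.
    apply: le_trans (N_sub_abs _ _) _; rewrite (_ : z - z0 - _ = z - ze i) //; ring.
  by rewrite ler_pdivlMr //; apply: le_trans etad _; exact: far.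
have pot8 z : N (z - z0) = 10 * p -> n%:R * (3 * ln 2) <= pot z.
  move=> zp; rewrite mulr_natl -[n in _ *+ n]card_ord -sumr_const; apply: ler_sum => i _.
  have -> : 3 * ln 2 = ln (2 ^+ 3 : R) by rewrite lnXn // mulr_natl.
  have h : 8 * p <= N (z - ze i) by have := NBD (ze i) z z0; have := zeB i; lra.
  rewrite ler_ln ?posrE ?divr_gt0 ?exprn_gt0 //; last by lra.
  rewrite ler_pdivlMr //; lra.
have poty : pot y <= n%:R * (2 * ln 2).
  rewrite mulr_natl -[n in _ *+ n]card_ord -sumr_const; apply: ler_sum => i _.
  have -> : 2 * ln 2 = ln (2 ^+ 2 : R) by rewrite lnXn // mulr_natl.
  have Ky : K y by split; rewrite /B /cball /=; lra.
  rewrite ler_ln ?posrE ?divr_gt0 ?exprn_gt0 ?farp //.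
  have h : N (y - ze i) <= 4 * p by have := NBD z0 y (ze i); rewrite (NC z0); have := zeB i; lra.
  by rewrite ler_pdivrMr //; lra.
(* With this weight [psi] is at most [c = - L / 10 * 3 ln 2] on the outer circle, where distances
   are at least [8 * p], and at most [- 3 / 4 * L + 3 / 10 * L] where [s <= - 3 / 4 * L], which is
   below [c] as [ln 2 <= 1]. At [y] distances are at most [4 * p], so
   [s y <= - L / 10 * ln 2 <= - L / 20]. *)
pose lam := L / 10 / n%:R.
have lam0 : 0 < lam by rewrite !divr_gt0.
pose psi z := s z + (- lam) * pot z.
have Kc : clN K.
  move=> z H; have Bz : B z by apply: (@clN_cball R z0 (10 * p)) => e /H[v [Bv _] vz]; exists v.
  split => //=; rewrite leNgt; apply/negP => lt.
  have [d' d'0 Hd'] := sc z Bz _ (ltac:(by rewrite subr_gt0; exact: lt) : 0 < - (3 / 4 * L) - s z).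
  have [v [Bv /= sv] vz] := H _ d'0.
  by have := Hd' v Bv vz; rewrite ltr_norml => /andP[_]; lra.
have Kb : bdN K.
  by have [M HM] := @bdN_cball R z0 (10 * p); exists M => z [/HM].
have term_holo (i : 'I_n) r z : holo (oball z r) (fun v => (v - ze i) / p%:C).
  move=> v _; have := derM (derBc (ze i) (der_id v)) (der_cst (p%:C)^-1 v).
  by set l := (X in der _ _ X) => H; exists l.
have Np v : N v / p = N (v / p%:C) by rewrite NM NV NReal gtr0_norm.
have pne : p%:C != 0 :> R[i] by rewrite -N_gt0P NReal normr_gt0 gt_eqF.
have termc (i : 'I_n) z : K z -> rcc (fun v => ln (N (v - ze i) / p)) z.
  move=> Kz; apply: rcc_ln; first by rewrite divr_gt0 // farp.
  apply: rcc_near (rcc_N (der_cc (proj2_sig (cid (term_holo i 1 z z (oball_center z ltr01)))))).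
  by apply: filterS (@filterT _ (nbhs z) _) => v _; rewrite Np.
have potc z : K z -> rcc pot z by move=> Kz; apply: rcc_sum => i; exact: termc.
have KE z : K z -> rcont K psi z.
  move=> Kz; apply: rcontB; last by apply: rccZ; exact: potc.
  move=> e /(sc z Kz.1)[d' d'0 H]; exists d' => // v [Bv _]; exact: H.
have ln2 := ln2_bounds.
have lamn : lam * n%:R = L / 10 by rewrite /lam divfK // gt_eqF.
pose c := - (L / 10 * (3 * ln 2)).
have cL : - (9 / 20 * L) <= c by rewrite /c; case/andP: ln2 => _ ?; nra.
have Hmax : forall z, K z -> psi z <= c.
  apply: (max_principle Kc Kb KE) => z Kz; have [Bz sz] := Kz.
  have [zb|zb] := eqVneq (N (z - z0)) (10 * p).
    left; have := pot8 z zb; rewrite -(ler_pM2l lam0) (mulrA lam) lamn => h.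
    by have := s0 z Bz; rewrite /psi /c; lra.
  have [sz2|sz2] := leP (s z) (- (3 / 4 * L)).
    left; have := potlow z Kz; rewrite -(ler_pM2l lam0) (mulrCA lam) lamn => h.
    by apply: le_trans cL; rewrite /psi; lra.
  have zo : N (z - z0) < 10 * p by rewrite lt_neqAle zb.
  right; split; last first.
    have [d' d'0 Hd'] := sc z Bz _ (ltac:(by rewrite subr_gt0; exact: sz2) : 0 < s z - - (3 / 4 * L)).
    have g0 : 0 < 10 * p - N (z - z0) by rewrite subr_gt0.
    exists (Num.min d' (10 * p - N (z - z0))); first by rewrite lt_min d'0.
    move=> v; rewrite /oball /= lt_min => /andP[vd vB].
    have Bv : B v by rewrite /B /cball /=; have := NBD z v z0; lra.
    by split => //=; have := Hd' v Bv vd; rewrite ltr_norml => /andP[]; lra.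
  apply: smpD; first by apply: ssmp => //; lra.
  have E : (fun v => - lam * pot v) = (fun v => \sum_(i < n) (- lam) * ln (N ((v - ze i) / p%:C))).
    by apply/funext => v; rewrite mulr_sumr; apply: eq_bigr => i _; rewrite Np.
  rewrite E; apply: smp_sum => i; apply: (smp_ln _ ltr01); first exact: term_holo.
  by rewrite mulf_neq0 ?invr_neq0 // -N_gt0P farp.
have Ky : K y by split; rewrite /B /cball /=; lra.
have := Hmax y Ky; have : lam * pot y <= L / 10 * (2 * ln 2) by rewrite -lamn -mulrA ler_pM2l.
rewrite /psi /c => h1 h2; case/andP: ln2 => h3 _.
have : L * (1 / 2) <= L * ln 2 by rewrite ler_pM2l.
by move: h1 h2; clear; lra.
Qed.

End Capacity.

(** * Counting disjoint subharmonic functions *)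

Section Lumps.
Context {R : realType}.
Implicit Types (z w y : R[i]) (e d x t r M L p B : R) (k s : R[i] -> R) (n m j q J T : nat).

(* A subharmonic function living on a set without holes, i.e. on one tract; disjoint lumps of
   polynomial growth are bounded in number, as in the Denjoy-Carleman-Ahlfors theorem. *)
Definition lump k := [/\ forall z, 0 <= k z, forall z, rcc k z, forall z, 0 < k z -> smp k z &
  forall z0 t, 0 < t -> (forall z, N (z - z0) = t -> 0 < k z) ->
    forall z, N (z - z0) <= t -> 0 < k z].

(** Either [k] is positive on a whole circle of radius between [p] and [2 * p], hence inside it
    since its support has no holes, or every such circle carries a zero of [k] and [capacity]
    applies to [k - M] with [L = M]. *)
Lemma lump_thin k z0 p M : lump k -> 0 < p -> 0 < M ->
  (forall z, N (z - z0) <= 10 * p -> k z <= M) ->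
  (forall z, N (z - z0) <= p -> 0 < k z) \/ k z0 <= 19 / 20 * M.
Proof.
move=> [k0 kc ks kf] p0 M0 kM.
have [[t [tp tE]]|H] := pselect (exists t, p <= t <= 2 * p /\ forall z, N (z - z0) = t -> 0 < k z).
  case/andP: tp => tp _; left => z zp; apply: (kf z0 t); [lra|exact: tE|lra].
right; have := @capacity R (fun z => k z + - M) z0 p M p0 M0 _ _ _ _ z0.
rewrite subrr N0 => C; suff : k z0 - M <= - (M / 20) by lra.
apply: C => [z _|z /kM|z _|t tp|].
- by apply: rcontB; [exact: rcc_rcont (kc z)|exact: rcc_cst].
- by rewrite subr_le0.
- by move=> h; apply: smpD (smp_cst _ _); apply: ks; lra.
- apply: contrapT => H'; apply: H; exists t; split => // z zt.
  rewrite lt_neqAle k0 andbT; apply/eqP => kz; apply: H'; exists z => //; lra.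
- by rewrite mulr_ge0 ?ltW.
Qed.

(** As no disc of radius [p] lies in the support, each retreat by [10 * p] from the rim gains a
    factor [19 / 20]. *)
Lemma lump_decay k p M r : lump k -> 0 < p -> 0 < M ->
  (forall z, N z <= r -> exists2 y, N (y - z) <= p & k y = 0) ->
  (forall z, N z <= r -> k z <= M) ->
  forall j z, N z + 10 * p * j%:R <= r -> k z <= (19 / 20) ^+ j * M.
Proof.
move=> lk p0 M0 thin kM; elim=> [|j IH] z zr; first by rewrite mul1r; apply: kM; lra.
have jp : 0 <= 10 * p * j%:R by rewrite !mulr_ge0 // ltW.
rewrite -natr1 in zr.
have M'0 : 0 < (19 / 20) ^+ j * M by rewrite mulr_gt0 // exprn_gt0 // divr_gt0.
have kM' y : N (y - z) <= 10 * p -> k y <= (19 / 20) ^+ j * M.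
  by move=> yz; apply: IH; have := NBD z y 0; rewrite !subr0; lra.
have [fat|] := lump_thin lk p0 M'0 kM'; last by rewrite exprS mulrA.
have [|y yp ky] := thin z; first by lra.
by have := fat y yp; rewrite ky ltxx.
Qed.

(** Bookkeeping over the doubling radii [2^j * r]: a thin scale contributes the factor [g], a fat
    scale nothing. *)
Lemma lump_chain k (r g B : R) (fat : nat -> bool) T : 0 < g -> 0 < B -> 0 < r ->
  (forall j, ~~ fat j -> forall M, 0 < M -> (forall z, N z <= 2 ^+ j.+1 * r -> k z <= M) ->
     forall z, N z <= 2 ^+ j * r -> k z <= g * M) ->
  (forall z, N z <= 2 ^+ T * r -> k z <= B) ->
  forall z, N z <= r -> k z <= g ^+ (\sum_(j < T) ~~ fat j) * B.
Proof.
move=> g0 + r0 thin; elim: T B => [|T IH] B B0 kB z zr.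
  by rewrite big_ord0 mul1r; apply: kB; rewrite mul1r.
rewrite big_ord_recr /=; case: (boolP (fat T)) => /= [fT|fT].
  rewrite addn0; apply: IH => // w wT; apply: kB; apply: le_trans wT _.
  by rewrite exprS -mulrA ler_peMl ?mulr_ge0 ?exprn_ge0 ?ltW // ltr1n.
rewrite addn1 exprSr -mulrA; apply: IH; rewrite ?mulr_gt0 // => w wT.
by apply: (thin T).
Qed.

Lemma pow_le_eventually (g e : R) : 0 <= g < 1 -> 0 < e -> exists n0, forall n, (n0 <= n)%N -> g ^+ n <= e.
Proof. by move=> /andP[g0 g1] /(pow_small g0 g1)[n Hn]; exists n => m /Hn/ltW. Qed.

(* Every disc in question contains a point of one fixed grid, and the points of different sets
   are different. *)
Lemma fat_count n (k : 'I_n -> R[i] -> R) r J : 0 < r -> (0 < J)%N ->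
  (forall i i' z, 0 < k i z -> 0 < k i' z -> i = i') ->
  forall S : pred 'I_n, (forall i, S i -> exists2 z, N z <= 2 * r &
    forall y, N (y - z) <= r / (10 * J%:R) -> 0 < k i y) ->
  (#|S| <= (80 * J).+1 * (80 * J).+1)%N.
Proof.
move=> r0 J0 dis S HS.
have JR : 0 < J%:R :> R by rewrite ltr0n.
(* The spacing is half the radius of the discs, and the square of side [4 * r] is [80 * J] spacings
   wide. *)
pose e : R := r / (20 * J%:R); have e0 : 0 < e by rewrite divr_gt0 ?mulr_gt0.
have rE : r / (10 * J%:R) = e + e by rewrite /e; field; rewrite gt_eqF.
have rJ : r = 20 * J%:R * e by rewrite /e; field; rewrite gt_eqF.
have Hz i : exists z, S i -> N z <= 2 * r /\ forall y, N (y - z) <= r / (10 * J%:R) -> 0 < k i y.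
  by case: (boolP (S i)) => [/HS[z z1 z2]|_]; [exists z|exists 0].
pose c i := sval (cid (Hz i)).
have cP i : S i -> N (c i) <= 2 * r /\ forall y, N (y - c i) <= r / (10 * J%:R) -> 0 < k i y.
  exact: (svalP (cid (Hz i))).
pose tr (x : R) : nat := Num.truncn ((x + 2 * r) / e).
have trP x : `|x| <= 2 * r -> ((tr x)%:R * e - 2 * r <= x < (tr x)%:R * e - 2 * r + e) /\ (tr x < (80 * J).+1)%N.
  rewrite ler_norml => /andP[x1 x2].
  have h : 0 <= (x + 2 * r) / e by rewrite divr_ge0 ?(ltW e0) //; lra.
  have := truncn_itv h; rewrite -/(tr x) ler_pdivlMr // ltr_pdivrMr // -natr1 mulrDl mul1r => /andP[a b].
  split; first by apply/andP; split; lra.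
  rewrite ltnS -(ler_nat R) -(ler_pM2r e0); apply: le_trans a _.
  by rewrite natrM rJ; rewrite rJ in x2; lra.
pose gr (i : 'I_n) : 'I_(80 * J).+1 * 'I_(80 * J).+1 := (inord (tr (Re (c i))), inord (tr (Im (c i)))).
rewrite -[X in (_ <= X * X)%N]card_ord -card_prod -(@card_in_image _ _ gr S) ?max_card //.
move=> i i' Si Si' [/(congr1 val) /= E1 /(congr1 val) /= E2].
have [ci Hi] := cP i Si; have [ci' Hi'] := cP i' Si'.
have [a1 b1] := trP _ (le_trans (Re_le_N (c i)) ci).
have [a2 b2] := trP _ (le_trans (Im_le_N (c i)) ci).
have [a3 b3] := trP _ (le_trans (Re_le_N (c i')) ci').
have [a4 b4] := trP _ (le_trans (Im_le_N (c i')) ci').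
rewrite !inordK // in E1 E2; rewrite -E1 in a3; rewrite -E2 in a4.
pose g : R[i] := ((tr (Re (c i)))%:R * e - 2 * r) +i* ((tr (Im (c i)))%:R * e - 2 * r).
apply: (dis i i' g); [apply: Hi|apply: Hi']; rewrite rE; apply: le_trans (N_le_ReIm _) _;
  rewrite ReB ImB /=; apply: lerD; rewrite ler_norml; apply/andP; move: a1 a2 a3 a4; clear; move=> /andP[? ?] /andP[? ?] /andP[? ?] /andP[? ?]; split; lra.
Qed.

(** Among [T = 2 * S] doubling scales, each is fat for at most [P] lumps. If [n > 2 * P], some lump
    is thin at no fewer than [S] scales and gains [4^-(q+1)] at each, while growth up to radius
    [4^S * r] costs only [4^(q * S)] times a constant. Its value at a fixed point would be
    [O(4^-S)], which fails for large [S]. *)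
Lemma lumps_bounded q : exists n0, forall n (k : 'I_n -> R[i] -> R) (A : R),
  (forall i, lump (k i)) -> (forall i i' z, 0 < k i z -> 0 < k i' z -> i = i') ->
  (forall i, exists z, 0 < k i z) -> (forall i z, k i z <= A * (1 + N z) ^+ q) -> (n <= n0)%N.
Proof.
have g01 : 0 <= (19 / 20 : R) < 1 by apply/andP; split; lra.
have e40 : 0 < (4 ^+ q.+1)^-1 :> R by rewrite invr_gt0 exprn_gt0.
(* [J] retreats fit between two consecutive radii if [p] is [1 / (10 * J)] of the smaller one; [J]
   is chosen so that together they gain [4^-(q+1)]. *)
have [J1 HJ1] := pow_le_eventually g01 e40.
pose J := J1.+1; have J0 : (0 < J)%N by [].
pose g : R := (19 / 20) ^+ J; have g4 : g <= (4 ^+ q.+1)^-1 by apply: HJ1; exact: leqnSn.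
have g0 : 0 < g by rewrite exprn_gt0 // divr_gt0.
pose P := ((80 * J).+1 * (80 * J).+1)%N; exists (2 * P)%N => n k A lk dis pos growth.
rewrite leqNgt; apply/negP => nP.
pose z1 i := sval (cid (pos i)); have z1P i : 0 < k i (z1 i) := svalP (cid (pos i)).
pose r : R := 1 + \sum_i N (z1 i).
have r1 : 1 <= r by rewrite lerDl sumr_ge0 // => i _; exact: N_ge0.
have r0 : 0 < r by exact: lt_le_trans ltr01 r1.
have z1r i : N (z1 i) <= r.
  rewrite /r (bigD1 i) //=; have : 0 <= \sum_(j < n | j != i) N (z1 j) by rewrite sumr_ge0 // => j _; exact: N_ge0.
  lra.
have n0 : (0 < n)%N by lia.
pose A' := `|A| + 1; have A'0 : 0 < A' by rewrite /A'; have := normr_ge0 A; lra.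
pose D := A' * (1 + r) ^+ q; have D0 : 0 < D by rewrite mulr_gt0 // exprn_gt0 //; lra.
have g4' : 0 <= (4^-1 : R) < 1 by apply/andP; split; lra.
have HS i : exists S0, forall S, (S0 <= S)%N -> 4^-1 ^+ S <= k i (z1 i) / (2 * D).
  by apply: pow_le_eventually => //; rewrite divr_gt0 // mulr_gt0.
pose Si i := sval (cid (HS i)); have SiP i := svalP (cid (HS i)).
have [S SSi S0] : exists2 S, forall i, (Si i <= S)%N & (0 < S)%N.
  exists (\sum_i Si i).+1 => // i; rewrite (bigD1 i) //= -addnS; exact: leq_addr.
have [T TE] : exists T, T = (2 * S)%N by exists (2 * S)%N.
have T0 : (0 < T)%N by rewrite TE muln_gt0.
pose rad j : R := 2 ^+ j * r.
have rad0 j : 0 < rad j by rewrite mulr_gt0 // exprn_gt0.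
pose fat i j := `[< exists2 z, N z <= 2 * rad j & forall y, N (y - z) <= rad j / (10 * J%:R) -> 0 < k i y >].
have JR : 0 < J%:R :> R by rewrite ltr0n.
have thin i j : ~~ fat i j -> forall M, 0 < M -> (forall z, N z <= 2 ^+ j.+1 * r -> k i z <= M) ->
     forall z, N z <= 2 ^+ j * r -> k i z <= g * M.
  move=> /asboolPn nf M M0 kM z zr.
  have p0 : 0 < rad j / (10 * J%:R) by rewrite divr_gt0 // mulr_gt0.
  have rE : 2 ^+ j.+1 * r = 2 * rad j by rewrite exprS -mulrA.
  rewrite rE in kM.
  apply: (lump_decay (lk i) p0 M0 _ kM); last first.
    have -> : 10 * (rad j / (10 * J%:R)) * J%:R = rad j by field; rewrite pnatr_eq0.
    by rewrite -/(rad j) in zr; lra.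
  move=> w wr; apply: contrapT => H; apply: nf; exists w => // y yw.
  have [k0 _ _ _] := lk i; rewrite lt_neqAle k0 andbT; apply/eqP => ky; apply: H; by exists y.
have cnt : (\sum_(i < n) \sum_(j < T) fat i j <= T * P)%N.
  rewrite exchange_big /= -[T in (_ <= T * _)%N]card_ord -sum_nat_const.
  apply: leq_sum => j _; rewrite -big_mkcond /= sum1_card.
  apply: (fat_count (rad0 j) J0 dis) => i /asboolP; exact.
(* Double counting: the fat pairs number at most [T * P], too few for every lump to be fat at half
   of the scales. *)
have [i ai] : exists i : 'I_n, (2 * (\sum_(j < T) fat i j) < T)%N.
  apply: contrapT => H; have : (n * T <= 2 * (T * P))%N.
    apply: leq_trans (leq_mul (leqnn 2) cnt); rewrite big_distrr /=.
    rewrite -[n in (n * _ <= _)%N]card_ord -sum_nat_const; apply: leq_sum => i _.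
    by rewrite leqNgt; apply/negP => h; apply: H; exists i.
  by rewrite mulnCA (mulnC n) leq_pmul2l // leqNgt nP.
have sumT : ((\sum_(j < T) fat i j) + (\sum_(j < T) ~~ fat i j) = T)%N.
  rewrite -big_split /= -[RHS]card_ord -sum1_card; apply: eq_bigr => j _; by case: (fat i j).
have aS : (S <= \sum_(j < T) ~~ fat i j)%N by move: ai sumT TE; set a := bigop.body _ _ _; set b := bigop.body _ _ _; clear; lia.
have B0 : 0 < A' * (1 + rad T) ^+ q by rewrite mulr_gt0 // exprn_gt0 //; have := rad0 T; lra.
have kB z : N z <= 2 ^+ T * r -> k i z <= A' * (1 + rad T) ^+ q.
  move=> zr; apply: le_trans (growth i z) _; have z0 := N_ge0 z.
  have rT := rad0 T; have h : (1 + N z) ^+ q <= (1 + rad T) ^+ q by rewrite lerXn2r ?nnegrE //; move: z0 zr rT; rewrite -/(rad T); clear; lra.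
  apply: (@le_trans _ _ (A' * (1 + N z) ^+ q)); last by rewrite ler_pM2l.
  rewrite ler_wpM2r ?exprn_ge0 //; first by lra.
  by rewrite /A'; have := ler_norm A; lra.
have := lump_chain g0 B0 r0 (thin i) kB (z1r i).
have g1 : g <= 1 by rewrite exprn_ile1 ?divr_ge0 //; lra.
have gS : g ^+ (\sum_(j < T) ~~ fat i j) <= g ^+ S by rewrite ler_wiXn2l // ltW.
have gS' : g ^+ S <= (4 ^+ q.+1)^-1 ^+ S by rewrite lerXn2r ?nnegrE // ltW.
have T4 : 1 <= 2 ^+ T :> R by apply: exprn_ege1; rewrite ler1n.
have TE24 : 2 ^+ T = 4 ^+ S :> R by rewrite TE exprM; congr (_ ^+ _); ring.
have radq : (1 + rad T) ^+ q <= (4 ^+ S) ^+ q * (1 + r) ^+ q.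
  have h1 : 0 <= 1 + rad T by rewrite addr_ge0 // ltW.
  have h2 : 1 + rad T <= 4 ^+ S * (1 + r) by rewrite mulrDr mulr1 /rad TE24 lerD2r -TE24.
  by rewrite -exprMn lerXn2r ?nnegrE // (le_trans h1 h2).
apply/negP; rewrite -ltNge.
apply: (@le_lt_trans _ _ ((4 ^+ q.+1)^-1 ^+ S * (A' * ((4 ^+ S) ^+ q * (1 + r) ^+ q)))).
  apply: ler_pM; [exact: exprn_ge0 (ltW g0)|exact: ltW|exact: le_trans gS gS'|by rewrite ler_pM2l].
have -> : (4 ^+ q.+1)^-1 ^+ S * (A' * ((4 ^+ S) ^+ q * (1 + r) ^+ q)) = 4^-1 ^+ S * D.
  have h4 : (4 : R) ^+ S != 0 by rewrite expf_neq0.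
  rewrite exprS exprVn exprMn -!exprM (mulnC q) exprM.
  rewrite /D exprVn; field.
  by rewrite h4 expf_neq0.
have X0 : 0 < 4^-1 ^+ S :> R by rewrite exprn_gt0 // invr_gt0.
have XD := mulr_gt0 X0 D0.
have := SiP i S (SSi i); rewrite ler_pdivlMr; last by rewrite mulr_gt0.
move=> h; apply: (lt_le_trans _ h); by rewrite (mulrCA _ 2) ltr_pMl // ltr1n.
Qed.

End Lumps.

(** * Components and branches of the logarithm *)

Section Components.
Context {R : realType}.
Implicit Types (z w y b c : R[i]) (e d x t r M : R) (h F : R[i] -> R[i]) (A D G T U X : set R[i]).

Lemma conn_path (p : R -> R[i]) (u v : R) : (forall t, tC (nbhs t) p (p t)) ->
  connected (p @` [set t | u <= t <= v]).
Proof.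
move=> pc; apply: connected_continuous_connected.
  have -> : [set t | u <= t <= v] = [set` `[u, v]] by apply/seteqP; split => t /=; rewrite in_itv.
  exact: segment_connected.
apply: continuous_subspaceT => t B /nbhsCP[e e0 eB].
by apply: filterS (pc t e e0) => s; exact: eB.
Qed.

Lemma lerp_pcont z w t : tC (nbhs t) (lerp z w) (lerp z w t).
Proof. exact: pder_cont (pder_lerp z w t). Qed.

Lemma conn_convx X : convx X -> connected X.
Proof.
move=> Xc; apply: connI => z y Xz Xy; exists (lerp z y @` [set t | 0 <= t <= 1]); split.
- by apply: conn_path => t; exact: lerp_pcont.
- by move=> _ [t t01 <-]; exact: Xc.
- by exists 0; rewrite ?lerp0 //= lexx ler01.
- by exists 1; rewrite ?lerp1 //= lexx ler01.
Qed.

Lemma convx_setT : convx [set: R[i]]. Proof. by []. Qed.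

Lemma clE A z : closure A z <-> forall e, 0 < e -> exists2 y, A y & N (y - z) < e.
Proof.
split => [H e e0|H B /nbhsCP[e e0 eB]].
  have : nbhs z [set y | N (y - z) < e] by apply/nbhsCP; exists e.
  by move=> /H[y [Ay ye]]; exists y.
by have [y Ay ye] := H e e0; exists y; split => //; exact: eB.
Qed.

Lemma clN_closure A : clN (closure A).
Proof.
move=> z H; apply/clE => e e0; have e2 : 0 < e / 2 by rewrite divr_gt0.
have [y /clE/(_ _ e2)[w Aw wy] yz] := H _ e2; exists w => //.
by have := NBD y w z; lra.
Qed.

Lemma bdN_closure A : bdN A -> bdN (closure A).
Proof.
move=> [M HM]; exists (M + 1) => z /clE/(_ 1 ltr01)[y /HM yM yz].
by have := N_sub z y; rewrite NC in yz; lra.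
Qed.

Lemma clNU A D : clN A -> clN D -> clN (A `|` D).
Proof.
move=> cA cD z H; apply: contrapT => nz.
have [e e0 He] : exists2 e, 0 < e & forall y, A y -> e <= N (y - z).
  apply: contrapT => h; apply: nz; left; apply: cA => e e0; apply: contrapT => h'.
  by apply: h; exists e => // y Ay; rewrite leNgt; apply/negP => h''; apply: h'; exists y.
have [e' e'0 He'] : exists2 e, 0 < e & forall y, D y -> e <= N (y - z).
  apply: contrapT => h; apply: nz; right; apply: cD => e1 e10; apply: contrapT => h'.
  by apply: h; exists e1 => // y Ay; rewrite leNgt; apply/negP => h''; apply: h'; exists y.
have [|y [Ay|Dy] yz] := H (Num.min e e'); first by rewrite lt_min e0.
  by have := He y Ay; move: yz; rewrite lt_min => /andP[]; lra.
by have := He' y Dy; move: yz; rewrite lt_min => /andP[]; lra.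
Qed.

Lemma bdNU A D : bdN A -> bdN D -> bdN (A `|` D).
Proof.
move=> [M HM] [M' HM']; exists (Num.max M M') => z [/HM|/HM'] h; by rewrite le_max h ?orbT.
Qed.

Lemma opNC A : clN A -> opN (~` A).
Proof.
move=> cA z nz; apply: contrapT => h; apply: nz; apply: cA => e e0; apply: contrapT => h'.
by apply: h; exists e => // y ye Ay; apply: h'; exists y.
Qed.

Lemma comp_ball U z y e : 0 < e -> oball y e `<=` U -> connected_component U z y ->
  oball y e `<=` connected_component U z.
Proof.
move=> e0 eU Cy; rewrite (same_connected_component Cy).
by apply: connected_component_max => //; [exact: oball_center|exact: conn_convx (@convx_oball R y e)].
Qed.

Lemma comp_open U z : opN U -> opN (connected_component U z).
Proof.
move=> oU y Cy; have [e e0 He] := oU y (connected_component_sub Cy).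
by exists e => //; exact: comp_ball.
Qed.

Lemma comp_closure U z y : opN U -> U y -> closure (connected_component U z) y ->
  connected_component U z y.
Proof.
move=> oU Uy /clE cl; have [e e0 He] := oU y Uy; have [w Cw wy] := cl e e0.
apply: connected_component_trans Cw _; apply: connected_component_sym.
exact: (comp_ball e0 He (connected_component_refl Uy)).
Qed.

(** A chain of closed discs in place of a path: compactness is what logarithms and [escapes] ask
    for. *)
Lemma conn_compact U z (x y : R[i]) : opN U -> connected_component U z x -> connected_component U z y ->
  exists X, [/\ clN X, bdN X, connected X, X `<=` U & X x /\ X y].
Proof.
move=> oU; have cb w e := conj (@clN_cball R w e) (conj (@bdN_cball R w e) (conn_convx (@convx_cball R w e))).
move=> Cx Cy; pose P y := exists X, [/\ clN X, bdN X, connected X, X `<=` U & X x /\ X y].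
 apply: (connP (P := P) (@component_connected _ U z) _ Cx Cy) => [w Cw|]; last first.
  have bx : cball x 0 x by rewrite /cball /= subrr N0.
  exists (cball x 0); have [? [? ?]] := cb x 0; split => // w; rewrite /cball /= => w0.
  have /N_eq0/eqP : N (w - x) = 0 by apply/eqP; rewrite eq_le w0 N_ge0.
  by rewrite subr_eq0 => /eqP ->; exact: connected_component_sub Cx.
have [e e0 He] := oU w (connected_component_sub Cw); exists (e / 2); first by rewrite divr_gt0.
have [b1 [b2 b3]] := cb w (e / 2).
have bU : cball w (e / 2) `<=` U by move=> v; rewrite /cball /= => h; apply: He; lra.
have bw : cball w (e / 2) w by rewrite /cball /= subrr N0; lra.
move=> v Cv /ltW vw; have bv : cball w (e / 2) v by [].
by split=> -[X [X1 X2 X3 X4 [X5 X6]]]; exists (X `|` cball w (e / 2));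
  (split; [exact: clNU|exact: bdNU| |by move=> u [/X4|/bU]|by split; [left|right]]);
  (apply: connU => //; first [by exists v|by exists w]).
Qed.

Lemma unbd : ~ bdN [set: R[i]].
Proof. by move=> [M /(_ ((`|M| + 1)%:C) I)]; rewrite NReal ger0_norm ?addr_ge0 //; have := ler_norm M; lra. Qed.

Lemma boundary_point D z : opN D -> bdN D -> D z -> exists2 y, closure D y & ~ D y.
Proof.
move=> oD bD Dz; apply: contrapT => H; apply: unbd.
have cD y : closure D y -> D y by move=> cy; apply: contrapT => nD; apply: H; exists y.
suff : forall y, D y by case: bD => M HM A; exists M => y _; exact: HM.
move=> y; apply: (connP (P := D) (conn_convx convx_setT) _ (z := z)) => // w _.
have [Dw|nDw] := pselect (D w); first by have [e e0 He] := oD w Dw; exists e => // v _ /He ?; split.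
apply: contrapT => h; apply: nDw; apply: cD; apply/clE => e e0; apply: contrapT => h'.
apply: h; exists e => // v _ ve; split=> [Dv|Dw]; exfalso; apply: h'; [by exists v|by exists w; rewrite ?subrr ?N0].
Qed.

(* [b] is in the unbounded component of the complement, if [X] is compact. *)
Definition escapes X b := exists T, [/\ connected T, T b, ~ bdN T & forall z, T z -> ~ X z].

Lemma esc_far X M b : (forall z, X z -> N z <= M) -> 0 <= M -> M < N b -> escapes X b.
Proof.
move=> XM M0 bM; have b0 : 0 < N b by lra.
exists [set z | exists2 t, 1 <= t & z = t%:C * b]; split.
- apply: conn_convx => _ _ s [t t1 ->] [u u1 ->] /andP[s0 s1].
  exists (t + s * (u - t)).
    have h1 : 0 <= (1 - s) * (t - 1) by rewrite mulr_ge0 // subr_ge0.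
    have h2 : 0 <= s * (u - 1) by rewrite mulr_ge0 // subr_ge0.
    by move: h1 h2; clear; nra.
  by rewrite /lerp !(rmorphD, rmorphM, rmorphB) /=; ring.
- by exists 1 => //; rewrite mul1r.
- move=> [K HK]; have k0 : 0 <= `|K| / N b by rewrite divr_ge0 // ltW.
  have [t tE] : exists t, t = `|K| / N b + 1 by eexists.
  have t1 : 1 <= t by rewrite tE lerDr.
  have : N (t%:C * b) <= K by apply: HK; exists t.
  rewrite NM NReal ger0_norm ?(le_trans ler01) // tE mulrDl divfK ?gt_eqF //.
  by have := ler_norm K; lra.
- move=> _ [t t1 ->] /XM; rewrite NM NReal ger0_norm; [nra|lra].
Qed.

Lemma esc_open X : clN X -> opN (escapes X).
Proof.
move=> cX b [T [T1 T2 T3 T4]]; have [e e0 He] := opNC cX (T4 b T2).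
exists e => // y ye; exists (T `|` oball b e); split; last by move=> z [/T4|/He].
- by apply: connU => //; [exact: conn_convx (@convx_oball R b e)|exists b; split => //; exact: oball_center].
- by right.
- by move=> [M HM]; apply: T3; exists M => z Tz; apply: HM; left.
Qed.

(* By the maximum principle [N F < r] on the bounded components of the complement of [X]. *)
Lemma hull_in F r z0 X b : holo setT F -> clN X -> bdN X ->
  X `<=` connected_component [set z | N (F z) < r] z0 -> ~ escapes X b ->
  connected_component [set z | N (F z) < r] z0 b.
Proof.
move=> hF cX bX XG nesc; have [Xb|nXb] := pselect (X b); first exact: XG.
have oC := opNC cX.
pose D := connected_component (~` X) b.
have Db : D b by exact: connected_component_refl.
have oD : opN D by exact: comp_open.
have bD : bdN D.
  apply: contrapT => nb; apply: nesc; exists D; split => //; first exact: component_connected.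
  by move=> z /connected_component_sub.
have KX y : closure D y -> D y \/ X y.
  move=> cy; have [Xy|nXy] := pselect (X y); [by right|left; exact: comp_closure].
have [g cg nDg] := boundary_point oD bD Db.
have Xg : X g by case: (KX g cg).
have FN A z : rcont A (fun y => N (F y)) z by apply: rcc_rcont; apply: rcc_N; apply: holo_cc hF _.
have [m Xm mM] := EVTmax cX bX (ex_intro _ g Xg) (fun z _ => FN _ z).
have mr : N (F m) < r := connected_component_sub (XG m Xm).
have H y : closure D y -> N (F y) <= N (F m).
  apply: (max_principle (s := fun y => N (F y)) (c := N (F m)) (@clN_closure D) (bdN_closure bD)) => [z _|z]; first exact: FN.
  move=> cz; have [Dz|Xz] := KX z cz; [right|by left; exact: mM].
  split; first by apply: (smp_N ltr01) => w _; exact: hF.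
  have [e e0 He] := oD z Dz; exists e; first exact: e0.
  by move=> w wz; apply: (@subset_closure _ D); exact: He wz.
rewrite (same_connected_component (XG g Xg)).
have sub : closure D `<=` [set z | N (F z) < r] by move=> z cz; exact: le_lt_trans (H z cz) mr.
have cc : connected (closure D) by apply: connected_closure; exact: component_connected.
exact: (connected_component_max cg sub cc (@subset_closure _ D b Db)).
Qed.

End Components.

(** * Continuous logarithms on compact sets and their gluing *)

Section Logarithms.
Context {R : realType}.
Implicit Types (z w y b c : R[i]) (e d x t r M : R) (h k l F : R[i] -> R[i]) (A D G T U X : set R[i]).

Definition haslog X F := exists l, (forall z, X z -> ccont X l z) /\ forall z, X z -> cexp (l z) = F z.

Lemma ccontD X h k z : ccont X h z -> ccont X k z -> ccont X (fun y => h y + k y) z.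
Proof. by move=> /ccontP h1 /ccontP h2; apply/ccontP; exact: tCD. Qed.
Lemma ccontN X h z : ccont X h z -> ccont X (fun y => - h y) z.
Proof. by move=> /ccontP h1; apply/ccontP; exact: tCN. Qed.
Lemma ccont_cst X c z : ccont X (fun=> c) z.
Proof. by apply/ccontP; exact: tC_cst. Qed.
Lemma ccont_comp X h k z : ccont X k z -> cc h (k z) -> ccont X (fun y => h (k y)) z.
Proof. by move=> /ccontP h1 h2; apply/ccontP; exact: tC_comp. Qed.
Lemma ccont_sub X D h z : D `<=` X -> ccont X h z -> ccont D h z.
Proof. by move=> DX H e /H[d d0 Hd]; exists d => // y /DX; exact: Hd. Qed.

Lemma haslog_eq X h k : (forall z, X z -> h z = k z) -> haslog X h -> haslog X k.
Proof. by move=> E [l [l1 l2]]; exists l; split => // z Xz; rewrite -E ?l2. Qed.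
Lemma haslog_cst X c : c != 0 -> haslog X (fun=> c).
Proof. by move=> /cexp_surj[w wc]; exists (fun=> w); split => // z _; exact: ccont_cst. Qed.
Lemma haslogM X h k : haslog X h -> haslog X k -> haslog X (fun z => h z * k z).
Proof.
move=> [l [l1 l2]] [m [m1 m2]]; exists (fun z => l z + m z).
by split => z Xz; [apply: ccontD; [exact: l1|exact: m1]|rewrite cexpD l2 ?m2].
Qed.
Lemma haslogV X h : haslog X h -> haslog X (fun z => (h z)^-1).
Proof.
by move=> [l [l1 l2]]; exists (fun z => - l z); split => z Xz; [apply: ccontN; exact: l1|rewrite cexpN l2].
Qed.
Lemma haslog_near1 X h : (forall z, X z -> ccont X h z) -> (forall z, X z -> N (h z - 1) < 1) ->
  haslog X h.
Proof.
move=> hc h1; exists (fun z => Log (h z)); split => z Xz; last by rewrite cexp_Log // slit_near1 ?h1.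
by apply: ccont_comp (hc z Xz) _; apply: Log_cont; apply: slit_near1; exact: h1.
Qed.

(** Two logarithms differ by values [tpi k], which are at least [2 pi] apart, so a continuous
    difference is locally constant. *)
Lemma log_uniq X h k : connected X -> (forall z, X z -> ccont X h z) -> (forall z, X z -> ccont X k z) ->
  (forall z, X z -> cexp (h z) = cexp (k z)) -> forall z y, X z -> X y -> h y - k y = h z - k z.
Proof.
move=> cX hc kc E z y Xz Xy.
apply: (connP (P := fun y => h y - k y = h z - k z) cX _ Xz Xy) => // w Xw.
have [d d0 Hd] := hc w Xw 1 ltr01; have [d' d'0 Hd'] := kc w Xw 1 ltr01.
exists (Num.min d d'); first by rewrite lt_min d0.
move=> v Xv; rewrite lt_min => /andP[vd vd']; suff -> : h v - k v = h w - k w by [].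
have [a Ha] := cexp_eq (E w Xw); have [b Hb] := cexp_eq (E v Xv).
have e1 : h v - k v = tpi b by rewrite Hb; ring.
have e2 : h w - k w = tpi a by rewrite Ha; ring.
have : N (h v - k v - (h w - k w)) < 2.
  have -> : h v - k v - (h w - k w) = (h v - h w) - (k v - k w) by ring.
  by apply: le_lt_trans (NB _ _) _; have := Hd v Xv vd; have := Hd' v Xv vd'; lra.
have tpiB : tpi b - tpi a = tpi (b - a) :> R[i].
  by apply: complex_eq; rewrite ?ReB ?ImB /= ?subr0 // mulrzBr.
rewrite e1 e2 tpiB => lt.
have /eqP : b - a = 0.
  by apply: (@N_tpi_lt R); apply: lt_le_trans lt _; rewrite mulr2n; have := pi_ge2 R; lra.
by rewrite subr_eq0 => /eqP ->.
Qed.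

(** For a zero far out, [z - b' = - b' * (1 - z / b')] has the logarithm given by [Log]. The zero is
    then moved along the unbounded connected set [T] to [b]: a displacement smaller than the
    distance to [X] multiplies by a quotient within 1 of 1. *)
Lemma haslog_lin X b : clN X -> bdN X -> escapes X b -> haslog X (fun z => z - b).
Proof.
move=> cX [M0 XM0] [T [T1 T2 T3 T4]].
pose M1 : R := `|M0| + 1; have M10 : 0 < M1 by rewrite /M1; have := normr_ge0 M0; lra.
have XM z : X z -> N z < M1 by move=> /XM0; rewrite /M1; have := ler_norm M0; lra.
have near1 (u v : R[i]) : (forall z, X z -> N (v - u) < N (z - v)) -> haslog X (fun z => (z - u) / (z - v)).
  move=> H; have ne z : X z -> z - v != 0.
    by move=> /H h; rewrite -N_gt0P; exact: le_lt_trans (N_ge0 _) h.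
  apply: haslog_near1 => z Xz; last first.
    have -> : (z - u) / (z - v) - 1 = (v - u) / (z - v) by field; exact: ne.
    by rewrite NM NV ltr_pdivrMr ?mul1r ?H // N_gt0P ne.
  apply: cc_within; have [m hm] : exists m, der (fun z => (z - u) / (z - v)) z m; last exact: der_cc hm.
  by eexists; apply: derM; [exact: derBc (der_id z)|apply: (derV (h := fun y => y - v)) (derBc _ (der_id z)); exact: ne].
have trans (u v : R[i]) : (forall z, X z -> N (v - u) < N (z - v)) ->
    (haslog X (fun z => z - u) <-> haslog X (fun z => z - v)).
  move=> H; have ne z : X z -> z - v != 0.
    by move=> /H h; rewrite -N_gt0P; exact: le_lt_trans (N_ge0 _) h.
  have ne' z : X z -> z - u != 0.
    move=> Xz; rewrite -N_gt0P; have := H z Xz; have := NBD u z v; rewrite (NC v u); lra.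
  split=> HL; [have := haslogM HL (haslogV (near1 u v H))|have := haslogM HL (near1 u v H)];
    apply: haslog_eq => z Xz; field; rewrite ?ne ?ne' //.
have [b' Tb' b'M] : exists2 b', T b' & 2 * M1 < N b'.
  apply: contrapT => h; apply: T3; exists (2 * M1) => z Tz; rewrite leNgt; apply/negP => h'.
  by apply: h; exists z.
apply: (connP (P := fun b => haslog X (fun z => z - b)) T1 _ Tb' T2) => [w Tw|]; last first.
  have b0 : b' != 0 by rewrite -N_gt0P; lra.
  have : haslog X (fun z => 1 - z / b').
    apply: haslog_near1 => z Xz; last first.
      have -> : 1 - z / b' - 1 = - (z / b') by ring.
      by rewrite NN NM NV ltr_pdivrMr ?N_gt0P // mul1r; have := XM z Xz; lra.
    apply: cc_within; have := derB (der_cst 1 z) (derM (der_id z) (der_cst b'^-1 z)); exact: der_cc.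
  have b1 : - b' != 0 by rewrite oppr_eq0.
  move=> /(haslogM (haslog_cst X b1)); apply: haslog_eq => z _; field; exact: b0.
have [e e0 He] := opNC cX (T4 w Tw); exists e => // v Tv vw.
have h z : X z -> e <= N (z - w) by move=> Xz; rewrite leNgt; apply/negP => /He.
by apply: trans => z /h ez; rewrite (NC w v); apply: lt_le_trans vw ez.
Qed.

Lemma haslog_poly X (P : {poly R[i]}) : P != 0 -> clN X -> bdN X ->
  (forall b, root P b -> escapes X b) -> haslog X (fun z => P.[z]).
Proof.
move=> P0 cX bX HP; have [rs E] := closed_field_poly_normal P.
have HP' b : b \in rs -> escapes X b.
  move=> brs; apply: HP; rewrite E rootZ ?lead_coef_eq0 //.
  by rewrite root_prod_XsubC.
have : haslog X (fun z => lead_coef P * \prod_(b <- rs) (z - b)).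
  apply: haslogM; first by apply: haslog_cst; rewrite lead_coef_eq0.
  elim: rs HP' {E} => [|b rs IH] HP'.
    by apply: haslog_eq (haslog_cst X (oner_neq0 _)) => z _; rewrite big_nil.
  have := haslogM (haslog_lin cX bX (HP' b (mem_head _ _))) (IH (fun b' hb => HP' b' (@mem_behead _ (b :: rs) _ hb))).
  by apply: haslog_eq => z _; rewrite big_cons.
apply: haslog_eq => z _; rewrite [in RHS]E hornerZ horner_prod; congr (_ * _).
by apply: eq_bigr => b _; rewrite hornerXsubC.
Qed.

(* Runge-type argument: on the hull of [X] the function [F] has no zeros, hence neither has a
   polynomial close to [F] there, so all roots of the latter can be joined to infinity off [X]. *)
Theorem haslog_omitted F r z0 X : holo setT F -> clN X -> bdN X ->
  X `<=` connected_component [set z | N (F z) < r] z0 ->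
  (forall z, connected_component [set z | N (F z) < r] z0 z -> F z != 0) -> haslog X F.
Proof.
move=> hF cX bX XG F0; have [->|/set0P[x0 Xx0]] := eqVneq X set0.
  by exists (fun=> 0); split => z.
have [M0 HM0] := bX; pose M : R := `|M0| + 1.
have M1 : 0 <= M by rewrite /M addr_ge0.
have XM z : X z -> N z <= M by move=> /HM0; rewrite /M; have := ler_norm M0; lra.
pose E := ~` (escapes X).
have XE z : X z -> E z by move=> Xz [T [_ Tz _ /(_ z Tz)]].
have EM z : E z -> N z <= M by move=> Ez; rewrite leNgt; apply/negP => h; apply: Ez; exact: esc_far h.
have EG z : E z -> connected_component [set z | N (F z) < r] z0 z by exact: hull_in.
have cE : clN E.
  move=> z H esc; have [e e0 He] := esc_open cX esc; have [y Ey yz] := H e e0.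
  by apply: Ey; exact: He.
have FN A z : rcont A (fun y => N (F y)) z by apply: rcc_rcont; apply: rcc_N; apply: holo_cc hF _.
have [m Em mM] := EVTmin cE (ex_intro _ M EM) (ex_intro _ x0 (XE _ Xx0)) (fun z _ => FN _ z).
have m0 : 0 < N (F m) by rewrite N_gt0P; apply: F0; exact: EG.
have [P HP] := poly_approx hF M1 m0.
have HE z : E z -> N (F z - P.[z]) < N (F z) by move=> Ez; apply: lt_le_trans (HP z (EM z Ez)) _; exact: mM.
have PE z : E z -> P.[z] != 0.
  by move=> Ez; apply/eqP => Pz; have := HE z Ez; rewrite Pz subr0 ltxx.
have P0 : P != 0 by apply/eqP => Pz; have := PE m Em; rewrite Pz horner0 eqxx.
have HL : haslog X (fun z => P.[z]).
  apply: haslog_poly => // b rb; apply: contrapT => nb; have := PE b nb.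
  by rewrite (rootP rb) eqxx.
have HL2 : haslog X (fun z => P.[z] / F z).
  have fx z : X z -> F z != 0 by move=> /XE/EG; exact: F0.
  apply: haslog_near1 => z Xz; last first.
    have -> : P.[z] / F z - 1 = - ((F z - P.[z]) / F z) by field; exact: fx.
    by rewrite NN NM NV ltr_pdivrMr ?N_gt0P ?fx // mul1r; apply: HE; exact: XE.
  apply: cc_within; apply: tC_div; [exact: fx| |exact: holo_cc hF _].
  have E' : horner P = (fun y => \sum_(i < size P) P`_i * y ^+ i) by apply/funext => y; rewrite horner_coef.
  by rewrite E'; apply: tC_sum => i; apply: tCM; [exact: tC_cst|apply: tCX; exact: cc_id].
have := haslogM HL (haslogV HL2); apply: haslog_eq => z Xz.
by rewrite invf_div mulrC divfK //; apply: PE; exact: XE.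
Qed.

(** The value at [y] is defined by any compact connected subset of [G] joining [x] to [y]. It is
    independent of the choice because the union of two such sets is again compact and carries a
    logarithm with which both can be compared. *)
Lemma glue_log G (x : R[i]) F : opN G -> G x -> connected G -> (forall z, G z -> F z != 0) -> holo G F ->
  (forall X, clN X -> bdN X -> X `<=` G -> haslog X F) ->
  exists2 v, forall z, G z -> cexp (v z) = F z & holo G v.
Proof.
move=> oG Gx cG F0 hF HL; have [v0 v0E] := cexp_surj (F0 x Gx).
pose Rel y w := exists X l, [/\ clN X /\ bdN X, connected X /\ X `<=` G, X x /\ X y,
   (forall z, X z -> ccont X l z) /\ (forall z, X z -> cexp (l z) = F z) & l x = v0 /\ l y = w].
have uniq y w w' : Rel y w -> Rel y w' -> w = w'.
  move=> [X [l [[X1 X2] [X3 X4] [X5 X6] [l1 l2] [l3 <-]]]] [X' [l' [[Y1 Y2] [Y3 Y4] [Y5 Y6] [k1 k2] [k3 <-]]]].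
  have [m [m1 m2]] : haslog (X `|` X') F by apply: HL; [exact: clNU|exact: bdNU|move=> z [/X4|/Y4]].
  have u1 : l y - m y = l x - m x.
    apply: (log_uniq X3 l1) => // z Xz; last by rewrite l2 // m2 //; left.
    by apply: (@ccont_sub (X `|` X')); [move=> ? ?; left|apply: m1; left].
  have u2 : l' y - m y = l' x - m x.
    apply: (log_uniq Y3 k1) => // z Xz; last by rewrite k2 // m2 //; right.
    by apply: (@ccont_sub (X `|` X')); [move=> ? ?; right|apply: m1; right].
  have : l y - m y = l' y - m y by rewrite u1 u2 l3 k3.
  by move/addIr.
have GE : connected_component G x = G by exact: connected_component_id.
have mk X : clN X -> bdN X -> connected X -> X `<=` G -> X x ->
    exists l, [/\ forall z, X z -> ccont X l z, forall z, X z -> cexp (l z) = F z & forall y, X y -> Rel y (l y)].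
  move=> X1 X2 X3 X4 X5; have [l [l1 l2]] := HL X X1 X2 X4.
  have k1 z : X z -> ccont X (fun z => l z + (v0 - l x)) z.
    by move=> Xz; apply: ccontD; [exact: l1|exact: ccont_cst].
  have k2 z : X z -> cexp (l z + (v0 - l x)) = F z.
    by move=> Xz; rewrite cexpD l2 // cexpB v0E l2 // divff ?mulr1 // F0.
  exists (fun z => l z + (v0 - l x)); split => // y Xy.
  exists X, (fun z => l z + (v0 - l x)); split => //; split => //; ring.
have ex y : exists w, G y -> Rel y w.
  have [Gy|nGy] := pselect (G y); last by exists 0.
  have [X [X1 X2 X3 X4 [X5 X6]]] : exists X, [/\ clN X, bdN X, connected X, X `<=` G & X x /\ X y].
    by apply: (@conn_compact _ G x) => //; rewrite GE.
  by have [l [_ _ lR]] := mk X X1 X2 X3 X4 X5; exists (l y) => _; exact: lR.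
pose v y := sval (cid (ex y)); have vP y : G y -> Rel y (v y) := svalP (cid (ex y)).
exists v => y Gy; first by have [X [l [_ _ [_ Xy] [_ l2] [_ <-]]]] := vP y Gy; exact: l2.
have [e e0 He] := oG y Gy.
have Fy0 := F0 y Gy; have Fc := holo_cc hF Gy.
have Ny : 0 < N (F y) by rewrite N_gt0P.
have [d d0 Hd] := iffLR (ccE F y) Fc _ Ny.
pose p := Num.min (e / 2) (d / 2); have p0 : 0 < p by rewrite lt_min !divr_gt0.
have pe z : cball y p z -> G z.
  by rewrite /cball /= /p le_min => /andP[h _]; apply: He; lra.
have pd z : cball y p z -> N (F z / F y - 1) < 1.
  rewrite /cball /= /p le_min => /andP[_ h]; have -> : F z / F y - 1 = (F z - F y) / F y by field.
  by rewrite NM NV ltr_pdivrMr // mul1r; apply: Hd; lra.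
have [X [X1 X2 X3 X4 [X5 X6]]] : exists X, [/\ clN X, bdN X, connected X, X `<=` G & X x /\ X y].
  by apply: (@conn_compact _ G x) => //; rewrite GE.
have cbc := conn_convx (@convx_cball R y p).
have cby : cball y p y by rewrite /cball /= subrr N0 ltW.
have [l [l1 l2 lR]] : exists l, [/\ forall z, (X `|` cball y p) z -> ccont (X `|` cball y p) l z,
   forall z, (X `|` cball y p) z -> cexp (l z) = F z & forall z, (X `|` cball y p) z -> Rel z (l z)].
  apply: mk; [exact: clNU (@clN_cball R y p)|exact: bdNU (@bdN_cball R y p)| |by move=> z [/X4|/pe]|by left].
  by apply: connU => //; exists y.
(* An explicit holomorphic logarithm near [y]; it agrees with the glued one at [y], hence on the
   disc, which yields the derivative. *)
pose k z := v y + Log (F z / F y).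
have lv z : cball y p z -> l z = v z by move=> h; apply: (uniq z); [apply: lR; right|apply: vP; exact: pe].
have der_q z : cball y p z -> exists m, der k z m.
  move=> hz; have [m hm] := hF z (pe z hz).
  have := derD (der_cst (v y) z) (der_comp (derM hm (der_cst (F y)^-1 z)) (der_Log (slit_near1 (pd z hz)))).
  by set u := (X in der _ _ X) => H; exists u.
have kE z : cball y p z -> l z = k z.
  move=> hz; have : l z - k z = l y - k y.
    apply: (log_uniq cbc) => // w hw.
    - by apply: (@ccont_sub (X `|` cball y p)); [move=> ? ?; right|apply: l1; right].
    - by have [m /der_cc hm] := der_q w hw; exact: cc_within.
    - have vy : cexp (v y) = F y by rewrite -lv // l2 //; right.
      rewrite l2; last by right.
      by rewrite /k cexpD vy cexp_Log; [rewrite mulrC divfK|exact: slit_near1 (pd w hw)].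
  by rewrite {2}/k divff // Log1 addr0 (lv y cby) subrr => /eqP; rewrite subr_eq0 => /eqP.
have [m hm] := der_q y cby; exists m; apply: der_near hm.
by apply/nbhsCP; exists p => // z /ltW hz; rewrite -kE // lv.
Qed.

End Logarithms.

(** * Separation by two sectors *)

Section TwoSectors.
Context {R : realType}.
Implicit Types (z w y b c : R[i]) (e d s t r th al be : R) (h k l F : R[i] -> R[i]) (X : set R[i]).

Lemma slit_Im w : Im w != 0 -> slit w.
Proof.
move=> Iw; have I2 : 0 < Im w ^+ 2 by rewrite lt_neqAle eq_sym sqrf_eq0 Iw sqr_ge0.
have := N2 w; have := N_ge0 w; rewrite /slit => n0 n2; rewrite ltNge; apply/negP => h.
by move: I2 n0 n2 h; clear; move: (N w) (Re w) (Im w ^+ 2) => n a b; nra.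
Qed.

Lemma cos_lt1 th : th != 0 -> `|th| < pi *+ 2 -> cos th < 1 /\ (sin th = 0 -> cos th = -1).
Proof.
move=> th0 th2; have ne : cos th != 1.
  apply/eqP => c1; have s0 : sin th = 0.
    by apply/eqP; rewrite -sqrf_eq0; apply/eqP; have := cos2Dsin2 th; rewrite c1; lra.
  have [k kE] : exists k : int, th = pi *+ 2 *~ k by apply: cis_eq1; rewrite /cis c1 s0.
  have P0 : 0 < pi *+ 2 :> R by rewrite mulrn_wgt0 ?pi_gt0.
  have := th2; rewrite kE -mulrzr normrM (gtr0_norm P0) gtr_pMr // -intr_norm -[1]/(1%:~R) ltr_int => k1.
  have k0 : k = 0 by lia.
  by move: th0; rewrite kE k0 mulr0z eqxx.
split; first by rewrite lt_neqAle ne cos_le1.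
move=> s0; have := cos2Dsin2 th; rewrite s0 expr0n addr0 => /eqP; rewrite sqrf_eq1 (negbTE ne) /=.
by move/eqP.
Qed.

(** The value could leave the slit plane only if [cis th] were a positive real, that is, if [th]
    were a multiple of [2 pi]. *)
Lemma slit_ray e s th : 0 < e -> 0 <= s -> th != 0 -> `|th| < pi *+ 2 ->
  slit (e%:C - s%:C * cis th).
Proof.
move=> e0 s0 th0 /(cos_lt1 th0)[c1 sc].
have [sin0|sin0] := eqVneq (sin th) 0.
  by apply: slit_Re; rewrite ReB ReM /= (sc sin0) mul0r; nra.
have [s00|s00] := eqVneq s 0.
  by apply: slit_Re; rewrite s00 ReB ReM /=; lra.
apply: slit_Im; rewrite ImB ImM /= mul0r addr0 sub0r oppr_eq0.
by rewrite mulf_neq0.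
Qed.

Lemma Log_ray e th th' : 0 < e -> th' = th + pi \/ th' = th - pi -> `|th'| < pi ->
  slit (- (e%:C * cis th)) /\ Im (Log (- (e%:C * cis th))) = th'.
Proof.
move=> e0 E; rewrite ltr_norml => h.
have -> : - (e%:C * cis th) = cexp (ln e +i* th').
  rewrite /cexp /= lnK ?posrE //; case: E => ->; rewrite cisD ?cisN cis_pi ?invrN ?invr1; ring.
by have [h1 ->] := @Log_cexp R (ln e +i* th') h.
Qed.

Definition ray z0 al e : set R[i] := (fun s => circ z0 s al) @` [set s | 0 <= s <= e].

Lemma conn_ray z0 al e : connected (ray z0 al e).
Proof.
apply: conn_path => t; apply: (pder_cont (l := cis al)).
have := pderD (pder_cst z0 t) (pderM (pder_id t) (pder_cst (cis al) t)).
by rewrite mulr0 addr0 mul1r add0r.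
Qed.

Lemma ray_bdcl z0 al e : clN (ray z0 al e) /\ bdN (ray z0 al e).
Proof.
split; last first.
  exists (N z0 + `|e|) => _ [s /andP[s0 se] <-]; apply: le_trans (ND _ _) _; rewrite lerD2l.
  by rewrite NM N_cis mulr1 NReal ger0_norm // (le_trans se) // ler_norm.
move=> z H; pose w := (z - z0) / cis al.
have wE : z = z0 + w * cis al by rewrite /w divfK ?cis_neq0 // addrC subrK.
have near d : 0 < d -> exists s, [/\ 0 <= s, s <= e & N (s%:C - w) < d].
  move=> d0; have [_ [s /andP[s0 se] <-] sz] := H d d0; exists s; split => //.
  by move: sz; rewrite /circ wE opprD addrACA subrr add0r -mulrBl NM N_cis mulr1.
have Iw : Im w = 0.
  apply: contrapT => /eqP nz; have [s [_ _ h]] := near `|Im w| (ltac:(by rewrite normr_gt0)).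
  by have := Im_le_N (s%:C - w); rewrite ImB /= sub0r normrN; lra.
have Rw : 0 <= Re w <= e.
  apply/andP; split; rewrite leNgt; apply/negP => lt.
    have [s [s0 _ h]] := near (- Re w) (ltac:(by rewrite oppr_gt0)).
    by have := Re_le_N (s%:C - w); rewrite ReB /= ler_norml => /andP[]; lra.
  have [s [_ se h]] := near (Re w - e) (ltac:(by rewrite subr_gt0)).
  by have := Re_le_N (s%:C - w); rewrite ReB /= ler_norml => /andP[]; lra.
exists (Re w) => //; rewrite /circ [RHS]wE; congr (_ + _ * _).
by apply: complex_eq; rewrite /= ?Iw.
Qed.

(* The argument of [(z - b)/(z - b')] returns to itself along [X] up to a small error,
   while along the two rays it changes by about [2 pi]. *)
Theorem two_sectors X z0 (al1 be al2 be' : R) e : clN X -> bdN X -> connected X -> ~ X z0 -> 0 < e ->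
  al1 < be < al2 -> al2 < be' < al1 + pi *+ 2 -> X (circ z0 e al1) -> X (circ z0 e al2) ->
  exists2 d, 0 < d & forall t, 0 < t < d ->
    escapes (X `|` (ray z0 al1 e `|` ray z0 al2 e)) (circ z0 t be) ->
    escapes (X `|` (ray z0 al1 e `|` ray z0 al2 e)) (circ z0 t be') -> False.
Proof.
move=> cX bX conX Xz0 e0 /andP[a1b ba2] /andP[a2b' b'a1] X1 X2.
have pi0 : 0 < pi :> R := pi_gt0 R.
have [dl dl0 Hdl] := opNC cX Xz0.
have Xfar z : X z -> dl <= N (z - z0) by move=> Xz; rewrite leNgt; apply/negP => /Hdl.
rewrite mulr2n in b'a1.
have half0 : 0 < 1 / 2 :> R by rewrite divr_gt0.
have LR th th' : th' = th + pi \/ th' = th - pi -> `|th'| < pi -> exists2 d, 0 < d &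
    forall t, 0 < t < d -> `|Im (Log (t%:C - e%:C * cis th)) - th'| < 1 / 2.
  move=> E h; have [sl <-] := Log_ray e0 E h.
  have [d d0 Hd] := iffLR (ccE _ _) (Log_cont sl) _ half0.
  exists d => // t /andP[t0 td]; rewrite -ImB; apply: le_lt_trans (Im_le_N _) _; apply: Hd.
  by rewrite opprK subrK NReal gtr0_norm.
(* Limits for [t -> 0] of the four arguments along the rays. Only [al2 - be] is positive and is
   shifted by [- pi]; the others are shifted by [+ pi], so their alternating sum is [2 pi]. *)
have [d1 d10 H1] := LR (al1 - be) (al1 - be + pi) (or_introl erefl) (ltac:(rewrite ltr_norml; apply/andP; split; lra)).
have [d2 d20 H2] := LR (al1 - be') (al1 - be' + pi) (or_introl erefl) (ltac:(rewrite ltr_norml; apply/andP; split; lra)).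
have [d3 d30 H3] := LR (al2 - be) (al2 - be - pi) (or_intror erefl) (ltac:(rewrite ltr_norml; apply/andP; split; lra)).
have [d4 d40 H4] := LR (al2 - be') (al2 - be' + pi) (or_introl erefl) (ltac:(rewrite ltr_norml; apply/andP; split; lra)).
have [d5 d50 H5] := iffLR (ccE _ _) (Log_cont (@slit_near1 R 1 (ltac:(by rewrite subrr N0)))) _ half0.
(* On [X], at distance at least [dl] from [z0], the quotient [(z - b) / (z - b')] is within [d6] of
   1 once [b] and [b'] are close to [z0], so [Log] of it is a logarithm less than [1 / 2] in
   modulus. *)
pose d6 := Num.min d5 1; have d60 : 0 < d6 by rewrite lt_min d50 ltr01.
exists (Num.min (Num.min (Num.min d1 d2) (Num.min d3 d4)) (Num.min (dl / 2) (d6 * dl / 4))).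
  by rewrite !lt_min d10 d20 d30 d40 /= !divr_gt0 // mulr_gt0.
move=> t /andP[t0]; rewrite !lt_min => /andP[/andP[/andP[t1 t2] /andP[t3 t4]] /andP[t5 t6]].
set Gm := X `|` _; set b := circ z0 t be; set b' := circ z0 t be' => esc esc'.
have clG : clN Gm by apply: clNU => //; apply: clNU; exact: (ray_bdcl _ _ _).1.
have bdG : bdN Gm by apply: bdNU => //; apply: bdNU; exact: (ray_bdcl _ _ _).2.
have [l [lc lE]] := haslogM (haslog_lin clG bdG esc) (haslogV (haslog_lin clG bdG esc')).
have nb w : escapes Gm w -> forall z, Gm z -> z - w != 0.
  by move=> [T [_ Tw _ TG]] z Gz; rewrite subr_eq0; apply/eqP => zw; apply: (TG w Tw); rewrite -zw.
have Nb th : N (circ z0 t th - z0) = t by rewrite N_circ // ltW.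
have qX z : X z -> N ((z - b) / (z - b') - 1) < d6.
  move=> Xz; have nz := nb b' esc' z (or_introl Xz).
  have -> : (z - b) / (z - b') - 1 = (b' - b) / (z - b') by field.
  rewrite NM NV ltr_pdivrMr ?N_gt0P //.
  have u1 : N (b' - b) <= 2 * t.
    by have := NBD z0 b' b; rewrite (NC z0) (Nb be') (Nb be); lra.
  have u2 : dl / 2 < N (z - b').
    by have := NBD b' z z0; rewrite (Nb be'); have := Xfar z Xz; lra.
  have : d6 * (dl / 2) < d6 * N (z - b') by rewrite ltr_pM2l.
  by lra.
have q1 z : X z -> N ((z - b) / (z - b') - 1) < 1 /\ N (Log ((z - b) / (z - b'))) < 1 / 2.
  move=> /qX; rewrite lt_min => /andP[h1 h2]; split => //.
  by have := H5 _ h1; rewrite Log1 subr0.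
have XG : X `<=` Gm by move=> z; left.
have qc z : Gm z -> cc (fun z => (z - b) / (z - b')) z.
  move=> Gz; apply: tC_div; first exact: nb.
    by apply: (der_cc (derBc b (der_id z))).
  by apply: (der_cc (derBc b' (der_id z))).
have step1 : l (circ z0 e al1) - l (circ z0 e al2) =
    Log ((circ z0 e al1 - b) / (circ z0 e al1 - b')) - Log ((circ z0 e al2 - b) / (circ z0 e al2 - b')).
  have h : l (circ z0 e al1) - Log ((circ z0 e al1 - b) / (circ z0 e al1 - b')) =
           l (circ z0 e al2) - Log ((circ z0 e al2 - b) / (circ z0 e al2 - b')).
    apply: (log_uniq (k := fun z => Log ((z - b) / (z - b'))) conX) => // z Xz.
    - exact: ccont_sub XG (lc z (XG z Xz)).
    - by apply: cc_within; apply: cc_comp (qc z (XG z Xz)) _; apply: Log_cont; apply: slit_near1; exact: (q1 z Xz).1.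
    - by rewrite lE ?cexp_Log //; [apply: slit_near1; exact: (q1 z Xz).1|exact: XG].
  by rewrite -[l (circ z0 e al1)](subrK (Log ((circ z0 e al1 - b) / (circ z0 e al1 - b')))) h; ring.
have rayE al : ray z0 al e `<=` Gm -> al - be != 0 -> `|al - be| < pi *+ 2 -> al - be' != 0 ->
   `|al - be'| < pi *+ 2 -> l (circ z0 e al) - l z0 =
   Log (t%:C - e%:C * cis (al - be)) - Log (t%:C - e%:C * cis (al - be')).
  move=> rG n1 n2 n3 n4.
  (* An explicit logarithm of the quotient along the ray: [circ z0 s al - circ z0 t th = - cis th *
     (t - s * cis (al - th))], and [N (z - z0)] recovers the parameter [s]. *)
  pose k z := 0 +i* (be - be') + (Log (t%:C - (N (z - z0))%:C * cis (al - be)) - Log (t%:C - (N (z - z0))%:C * cis (al - be'))).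
  have ze : circ z0 e al \in ray z0 al e by rewrite inE; exists e => //=; rewrite lexx ltW.
  have zz : ray z0 al e z0 by exists 0 => /=; rewrite ?lexx ?ltW // /circ mul0r addr0.
  have Nc s : 0 <= s -> N (circ z0 s al - z0) = s by exact: N_circ.
  have kz0 : k z0 = 0 +i* (be - be') by rewrite /k subrr N0 !mul0r !subr0 subrr addr0.
  have : l (circ z0 e al) - k (circ z0 e al) = l z0 - k z0.
    apply: (log_uniq (@conn_ray z0 al e)) => //; last by rewrite inE in ze.
    - by move=> z rz; exact: ccont_sub rG (lc z (rG z rz)).
    - move=> z rz; apply: cc_within.
      have c1 th : th != 0 -> `|th| < pi *+ 2 -> cc (fun z => Log (t%:C - (N (z - z0))%:C * cis th)) z.
        move=> m1 m2; apply: (cc_comp (k := fun z => t%:C - (N (z - z0))%:C * cis th)).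
          apply: tCB; first exact: tC_cst.
          apply: tCM; last exact: tC_cst.
          by apply: tC_real; apply: tC_N; exact: (der_cc (derBc z0 (der_id z))).
        by apply: Log_cont; apply: slit_ray => //; exact: N_ge0.
      apply: tCD; first exact: tC_cst.
      by apply: tCB; exact: c1.
    - move=> z rz; rewrite lE; last exact: rG.
      have nz := nb b' esc' z (rG z rz).
      case: rz nz => s /andP[s0 se] <- nz.
      rewrite /k Nc // cexpD cexpB !cexp_Log; [|by apply: slit_ray|by apply: slit_ray].
      rewrite {1}/cexp /= expR0 mul1r cisD cisN.
      have zb th : circ z0 s al - circ z0 t th = - cis th * (t%:C - s%:C * cis (al - th)).
        by rewrite /circ cisD cisN; field; exact: cis_neq0.
      have nz' := nz; rewrite /b' zb mulf_eq0 negb_or in nz'; case/andP: nz' => _ nz'.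
      by rewrite /b /b' !zb; field; rewrite nz' !cis_neq0.
  rewrite kz0 {1}/k Nc ?ltW // => h.
  have -> : l (circ z0 e al) = l z0 - (0 +i* (be - be')) + (0 +i* (be - be') + (Log (t%:C - e%:C * cis (al - be)) - Log (t%:C - e%:C * cis (al - be')))).
    by rewrite -h subrK.
  ring.
have R1 := rayE al1 (fun z hz => or_intror (or_introl hz)) (ltac:(rewrite lt_eqF //; lra)) (ltac:(rewrite ltr_norml mulr2n; apply/andP; split; lra)) (ltac:(rewrite lt_eqF //; lra)) (ltac:(rewrite ltr_norml mulr2n; apply/andP; split; lra)).
have R2 := rayE al2 (fun z hz => or_intror (or_intror hz)) (ltac:(rewrite gt_eqF //; lra)) (ltac:(rewrite ltr_norml mulr2n; apply/andP; split; lra)) (ltac:(rewrite lt_eqF //; lra)) (ltac:(rewrite ltr_norml mulr2n; apply/andP; split; lra)).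
have : Im (l (circ z0 e al1) - l z0 - (l (circ z0 e al2) - l z0)) = Im (l (circ z0 e al1) - l (circ z0 e al2)).
  by congr Im; ring.
rewrite step1 R1 R2 !ImB.
(* Two errors from [X] and four from the rays, each below [1 / 2], add up to less than 3, whereas
   the alternating sum is [2 pi >= 4]. *)
have i1 := le_lt_trans (Im_le_N _) (q1 _ X1).2; have i2 := le_lt_trans (Im_le_N _) (q1 _ X2).2.
have k1 := H1 t (ltac:(by rewrite t0)); have k2 := H2 t (ltac:(by rewrite t0)).
have k3 := H3 t (ltac:(by rewrite t0)); have k4 := H4 t (ltac:(by rewrite t0)).
have p2 := pi_ge2 R.
move: i1 i2 k1 k2 k3 k4 p2; rewrite !ltr_norml; clear.
move=> /andP[? ?] /andP[? ?] /andP[? ?] /andP[? ?] /andP[? ?] /andP[? ?] ? ?; lra.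
Qed.

End TwoSectors.

(** * Tracts *)

Section Tracts.
Context {R : realType}.
Implicit Types (z w y b c x : R[i]) (e d s r A B : R) (k l F v : R[i] -> R[i]) (G X W T : set R[i]) (u : R[i] -> R) (q : nat).

Definition ext W u z : R := if `[< W z >] then u z else 0.

Lemma ext_in W u z : W z -> ext W u z = u z.
Proof. by move=> Wz; rewrite /ext asboolT. Qed.
Lemma ext_out W u z : ~ W z -> ext W u z = 0.
Proof. by move=> Wz; rewrite /ext asboolF. Qed.

Lemma ext_near W u z : opN W -> W z -> \forall y \near z, u y = ext W u y.
Proof.
move=> oW Wz; have [e e0 He] := oW z Wz; apply/nbhsCP; exists e => // y /He Wy.
by rewrite ext_in.
Qed.

Lemma ext_rcc W u : opN W -> (forall z, W z -> rcc u z) ->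
  (forall z, ~ W z -> closure W z -> forall e, 0 < e ->
     exists2 d, 0 < d & forall y, W y -> N (y - z) < d -> `|u y| < e) ->
  forall z, rcc (ext W u) z.
Proof.
move=> oW uc ub z; have [Wz|nWz] := pselect (W z); first exact: rcc_near (ext_near u oW Wz) (uc z Wz).
move=> e e0; have [cW|ncW] := pselect (closure W z).
  have [d d0 Hd] := ub z nWz cW e e0; exists d => // y _ yz; rewrite (ext_out u nWz) subr0.
  by have [Wy|nWy] := pselect (W y); [rewrite ext_in //; exact: Hd|rewrite ext_out // normr0].
have [d d0 Hd] : exists2 d, 0 < d & forall y, N (y - z) < d -> ~ W y.
  apply: contrapT => h; apply: ncW; apply/clE => d d0; apply: contrapT => h'.
  by apply: h; exists d => // y yz Wy; apply: h'; exists y.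
by exists d => // y _ /Hd nWy; rewrite !ext_out // subrr normr0.
Qed.

Lemma ext_smp W u z : opN W -> W z -> smp u z -> smp (ext W u) z.
Proof. by move=> oW Wz; apply: smp_near; exact: ext_near. Qed.

Lemma rcc_max u (c' : R) z : rcc u z -> rcc (fun y => Num.max (u y) c') z.
Proof.
move=> uc e e0; have [d d0 Hd] := uc e e0; exists d => // y _ /(Hd y I).
rewrite !ltr_norml => /andP[h1 h2]; apply/andP.
by rewrite /Num.max; case: (ltP (u y) c') => ?; case: (ltP (u z) c') => ?; split; lra.
Qed.

(* [G] is a component of [N F < r] without zeros of [F], and [v] is a branch of [log (r / F)],
   which maps [G] to the right half-plane. *)
Record tract F r G v : Prop := Tract {
  tr_r : 0 < r;
  tr_F : holo setT F;
  tr_nc : exists z, F z != F 0;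
  tr_op : opN G;
  tr_conn : connected G;
  tr_sub : forall z, G z -> N (F z) < r;
  tr_exp : forall z, G z -> cexp (v z) = r%:C / F z;
  tr_holo : holo G v;
  tr_max : forall T z, connected T -> T z -> G z -> T `<=` [set z | N (F z) < r] -> T `<=` G;
  tr_hull : forall X b, clN X -> bdN X -> X `<=` G -> ~ escapes X b -> G b }.

Lemma tract_exists F r x : 0 < r -> holo setT F -> (exists z, F z != F 0) -> N (F x) < r ->
  (forall z, connected_component [set z | N (F z) < r] x z -> F z != 0) ->
  exists v, tract F r (connected_component [set z | N (F z) < r] x) v.
Proof.
move=> r0 hF Fnc Fx F0; set G := connected_component _ x.
have FN z : rcc (fun y => N (F y)) z by apply: rcc_N; apply: holo_cc hF _.
have oU : opN [set z | N (F z) < r].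
  move=> z /= zr; have [d d0 Hd] := FN z _ (ltac:(by rewrite subr_gt0; exact: zr) : 0 < r - N (F z)).
  by exists d => // y /(Hd y I); rewrite ltr_norml => /andP[_]; lra.
have oG : opN G by exact: comp_open.
have Gx : G x by exact: connected_component_refl.
have cG : connected G by exact: component_connected.
have GU z : G z -> N (F z) < r := @connected_component_sub _ _ _ z.
have [l lE lh] : exists2 l, forall z, G z -> cexp (l z) = F z & holo G l.
  apply: (glue_log oG Gx cG F0) => [z _|X X1 X2 X3]; first exact: hF.
  exact: haslog_omitted X3 F0.
exists (fun z => (ln r)%:C - l z); split => //.
- move=> z Gz; rewrite cexpB lE // {1}/cexp /= lnK ?posrE // cis0 mulr1 //.
- move=> z Gz; have [m hm] := lh z Gz; exists (0 - m); apply: derB hm; exact: der_cst.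
- move=> T z cT Tz Gz TU; rewrite /G (same_connected_component Gz); exact: connected_component_max.
- by move=> X b X1 X2 X3; exact: hull_in.
Qed.

Section Facts.
Variables (F : R[i] -> R[i]) (r : R) (G : set R[i]) (v : R[i] -> R[i]).
Hypothesis H : tract F r G v.

Lemma tr_N z : G z -> N (F z) = r * expR (- Re (v z)).
Proof.
move=> Gz; have r0 := tr_r H; have := congr1 N (tr_exp H Gz); rewrite N_cexp NM NV NReal gtr0_norm // => E.
rewrite expRN E invf_div mulrC divfK //; by rewrite gt_eqF.
Qed.

Lemma tr_Re z : G z -> 0 < Re (v z).
Proof.
move=> Gz; have := tr_sub H Gz; rewrite tr_N // gtr_pMr ?(tr_r H) // -[X in _ < X]expR0 ltr_expR.
by rewrite oppr_lt0.
Qed.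

Lemma tr_cl z : closure G z -> N (F z) < r -> G z.
Proof.
move=> /clE cz Fz.
have FNz := rcc_N (holo_cc (z := z) (tr_F H) I).
have [d d0 Hd] := FNz _ (ltac:(by rewrite subr_gt0; exact: Fz) : 0 < r - N (F z)).
have [y Gy yz] := cz d d0.
apply: (tr_max H (conn_convx (@convx_oball R z d)) yz Gy); last exact: oball_center.
by move=> w /(Hd w I); rewrite ltr_norml => /andP[_] /=; lra.
Qed.

(** At boundary points of [G] the modulus of [F] is at least [r], so [Re v] tends to 0 there, and
    the sets [Re v >= e] have no limit points outside [G]. This keeps limits of preimages inside
    [G]. *)
Lemma tr_clRe z e : 0 < e -> closure [set y | G y /\ e <= Re (v y)] z -> G z /\ e <= Re (v z).
Proof.
move=> e0 /clE cz; have r0 := tr_r H.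
have cG : closure G z by apply/clE => d /cz[y [Gy _] yz]; exists y.
have Fz : N (F z) <= r * expR (- e).
  rewrite leNgt; apply/negP => lt.
  have FNz := rcc_N (holo_cc (z := z) (tr_F H) I).
  have [d d0 Hd] := FNz _ (ltac:(by rewrite subr_gt0; exact: lt) : 0 < N (F z) - r * expR (- e)).
  have [y [Gy ey] yz] := cz d d0; have := Hd y I yz; rewrite tr_N // ltr_norml => /andP[h _].
  have : r * expR (- Re (v y)) <= r * expR (- e) by rewrite ler_pM2l // ler_expR lerN2.
  lra.
have Gz : G z.
  apply: tr_cl => //; apply: le_lt_trans Fz _; rewrite gtr_pMr // -[X in _ < X]expR0 ltr_expR; lra.
by split => //; move: Fz; rewrite tr_N // ler_pM2l // ler_expR lerN2.
Qed.

Lemma tr_order z : G z -> exists (p : R) (k : nat) (g : R[i] -> R[i]), [/\ 0 < p, oball z p `<=` G & order_form v z p k g].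
Proof.
move=> Gz; have [e e0 He] := tr_op H Gz.
have hv : holo (oball z e) v by apply: holo_sub (tr_holo H).
have e2 : 0 < e / 2 by lra.
have sub : oball z (e / 2) `<=` G by move=> y hy; apply: He; move: hy; rewrite /oball /=; lra.
have [cst|[k [q ord]]] := order_dichotomy hv e2 (ltac:(lra) : e / 2 < e); last by exists (e / 2), k, q.
exfalso; have FE y : N (y - z) < e / 2 -> F y = F z.
  move=> yz; have := tr_exp H (sub y yz); rewrite cst // (tr_exp H Gz).
  move=> /mulfI E; apply/esym/invr_inj; apply: E.
  by rewrite -N_gt0P NReal normr_gt0 gt_eqF // (tr_r H).
have [w /eqP] := tr_nc H; apply.
by rewrite (entire_identity (tr_F H) e2 FE) (entire_identity (tr_F H) e2 FE).
Qed.

Lemma tr_cc z : G z -> cc v z. Proof. exact: holo_cc (tr_holo H). Qed.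

(** By the maximum principle the components of [|F| > s] are unbounded, and [X] misses them. *)
Lemma tr_esc X s b : (forall z, X z -> N (F z) <= s) -> s < N (F b) -> escapes X b.
Proof.
move=> Xs sb; set U := [set z | s < N (F z)].
have FN (A : set R[i]) z : rcont A (fun y => N (F y)) z by apply: rcc_rcont; apply: rcc_N; apply: holo_cc (tr_F H) _.
have oU : opN U.
  move=> z /= zr; have [d d0 Hd] := FN setT z _ (ltac:(by rewrite subr_gt0; exact: zr) : 0 < N (F z) - s).
  by exists d => // y /(Hd y I); rewrite ltr_norml /U /= => /andP[]; lra.
pose T := connected_component U b; have Tb : T b by exact: connected_component_refl.
have TU : T `<=` U by exact: connected_component_sub.
exists T; split => //; first exact: component_connected.
  move=> bT; suff : N (F b) <= s by lra.
  apply: (max_principle (s := fun y => N (F y)) (c := s) (@clN_closure _ T) (bdN_closure bT)).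
  - by move=> z _; exact: FN.
  - move=> z cz; have [|lt] := leP (N (F z)) s; [by left|right].
    split; first by apply: (smp_N ltr01) => w _; exact: (tr_F H).
    have Tz : T z by exact: comp_closure.
    have [e e0 He] := comp_open oU Tz; exists e; first exact: e0.
    by move=> w wz; apply: (@subset_closure _ T); exact: He wz.
  - exact: (@subset_closure _ T).
by move=> z /TU sz /Xs; rewrite leNgt => /negP; apply; exact: sz.
Qed.

Lemma tr_unbounded (x : R) : exists2 z, x < N z & r < N (F z).
Proof.
apply: contrapT => h; have Fr z : x < N z -> N (F z) <= r.
  by move=> xz; rewrite leNgt; apply/negP => h'; apply: h; exists z.
have FN (A : set R[i]) z : rcont A (fun y => N (F y)) z by apply: rcc_rcont; apply: rcc_N; apply: holo_cc (tr_F H) _.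
have ne : cball (0 : R[i]) `|x| !=set0 by exists 0; rewrite /cball /mkset subr0 N0 normr_ge0.
have [m _ mM] := EVTmax (@clN_cball R 0 `|x|) (@bdN_cball R 0 `|x|) ne (fun z _ => FN _ z).
have [z /eqP] := tr_nc H; apply; apply: (liouville (M := Num.max r (N (F m))) (tr_F H)) => y.
rewrite le_max; have [/Fr ->//|yx] := ltP x (N y).
by rewrite mM ?orbT // /cball /= subr0; apply: le_trans yx (ler_norm _).
Qed.

Lemma tr_ext_rcc z : rcc (ext G (fun y => Re (v y))) z.
Proof.
apply: ext_rcc; first exact: (tr_op H).
  by move=> y Gy; apply: rcc_Re; exact: tr_cc.
move=> y nGy cy e e0; have r0 := tr_r H.
have Fy : r <= N (F y) by rewrite leNgt; apply/negP => h; apply: nGy; exact: tr_cl.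
have lt : 0 < r - r * expR (- e).
  by rewrite subr_gt0 gtr_pMr // -[X in _ < X]expR0 ltr_expR oppr_lt0.
have [d d0 Hd] := rcc_N (holo_cc (z := y) (tr_F H) I) lt; exists d => // w Gw wy.
rewrite gtr0_norm ?tr_Re //; have := Hd w I wy; rewrite ltr_norml => /andP[h _].
have : r * expR (- e) < N (F w) by lra.
by rewrite tr_N // ltr_pM2l // ltr_expR ltrN2.
Qed.

(** A minimum modulus estimate. If [F] were small somewhere on every circle of radius between [p]
    and [2 * p], [capacity], applied to [ln |F|] truncated below, would make [F] too small at the
    fixed point [p0]. On the remaining circle [Re v = ln (r / |F|)] is bounded, and the maximum
    principle carries the bound inside. *)
Lemma tr_growth B q : 0 <= B -> (forall z, N (F z) <= expR (B * (1 + N z) ^+ q)) ->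
  exists2 A, 0 <= A & forall z, G z -> Re (v z) <= A * (1 + N z) ^+ q.
Proof.
move=> B0 FB; have r0 := tr_r H.
have [p0 p01 Fp0] : exists2 p0, N p0 <= 1 & F p0 != 0.
  apply: contrapT => h; have Fz y : N (y - 0) < 1 -> F y = F 0.
    have E w : N w <= 1 -> F w = 0 by move=> w1; apply/eqP; apply: contrapT => /negP w0; apply: h; exists w.
    by rewrite subr0 => /ltW/E ->; rewrite E // N0.
  have [z /eqP] := tr_nc H; apply; exact: (entire_identity (tr_F H) ltr01 Fz).
have Np : 0 < N (F p0) by rewrite N_gt0P.
pose A := `|ln r| + 19 * (B * 11 ^+ q) + 20 * `|ln (N (F p0))| + 1.
have A0 : 0 <= A by rewrite /A !addr_ge0 // ?mulr_ge0 ?exprn_ge0.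
exists A => // z Gz; pose p := Num.max (N z) 1.
have p1 : 1 <= p by rewrite le_max lexx orbT.
have zp : N z <= p by rewrite le_max lexx.
have p00 : 0 < p by lra.
have [Bd BdE] : exists Bd, Bd = B * (1 + 10 * p) ^+ q by eexists.
have Bd0 : 0 <= Bd by rewrite BdE mulr_ge0 // exprn_ge0 //; lra.
have FBd y : N y <= 10 * p -> N (F y) <= expR Bd.
  move=> yp; apply: le_trans (FB y) _; rewrite ler_expR BdE ler_wpM2l // lerXn2r ?nnegrE //; have := N_ge0 y; lra.
have lp : ln (N (F p0)) <= Bd.
  by rewrite -[Bd]expRK ler_ln ?posrE ?expR_gt0 // FBd //; lra.
(* Just large enough that [- (L / 20)] is less than [ln |F p0| - Bd]. *)
pose L := 20 * (Bd - ln (N (F p0))) + 1; have L0 : 0 < L by rewrite /L; lra.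
have [t [/andP[t1 t2] tE]] : exists t, p <= t <= 2 * p /\ forall y, N y = t -> expR (Bd - L) < N (F y).
  apply: contrapT => h.
  pose s y := ln (Num.max (N (F y)) (expR (Bd - L))) - Bd.
  have mx y : 0 < Num.max (N (F y)) (expR (Bd - L)) by rewrite lt_max expR_gt0 orbT.
  have sc (A' : set R[i]) y : rcont A' s y.
    apply: rcc_rcont; apply: rccD (rcc_cst _ _); apply: rcc_ln => //.
    by apply: rcc_max; apply: rcc_N; apply: holo_cc (tr_F H) _.
  suff : s p0 <= - (L / 20).
    have : ln (N (F p0)) <= ln (Num.max (N (F p0)) (expR (Bd - L))) by rewrite ler_ln ?posrE // le_max lexx.
    by rewrite /s /L; lra.
  apply: (@capacity R s 0 p L p00 L0) => [y _|y|y _ sy|t tp|]; last by rewrite subr0; lra.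
  - exact: sc.
  - rewrite /cball /= subr0 => yp; rewrite /s subr_le0 -[X in _ <= X]expRK ler_ln ?posrE ?expR_gt0 //.
    by rewrite ge_max FBd // ler_expR; lra.
  - have Fy : expR (Bd - L) < N (F y).
      rewrite ltNge; apply/negP => le; move: sy; rewrite /s (max_idPr le) expRK; lra.
    have FNy := rcc_N (holo_cc (z := y) (tr_F H) I).
    have [d d0 Hd] := FNy _ (ltac:(by rewrite subr_gt0; exact: Fy) : 0 < N (F y) - expR (Bd - L)).
    have ne : F y != 0 by rewrite -N_gt0P; apply: lt_trans Fy; exact: expR_gt0.
    apply: (smp_near (s1 := fun w => 1 * ln (N (F w)) + - Bd)).
      apply/nbhsCP; exists d => // w /(Hd w I); rewrite ltr_norml => /andP[h1 _].
      have lt : expR (Bd - L) < N (F w) by lra.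
      by rewrite /s mul1r (max_idPl (ltW lt)).
    apply: smpD (smp_cst _ _); apply: (smp_ln 1 ltr01) ne.
    by move=> w _; exact: (tr_F H).
  - apply: contrapT => h2; apply: h; exists t; split => // y yt.
    rewrite ltNge; apply/negP => le; apply: h2; exists y; first by rewrite subr0.
    rewrite /s (max_idPr le) expRK; lra.
pose c1 : R := Num.max 0 (ln r - (Bd - L)).
have [c10 c1E] : 0 <= c1 /\ ln r - (Bd - L) <= c1 by rewrite /c1 !le_max !lexx orbT.
have t0 : 0 < t by lra.
have sub y d : N y + d <= t -> oball y d `<=` cball 0 t.
  by move=> yd w; rewrite /oball /cball /= subr0; have := NBD y w 0; rewrite !subr0; lra.
(* Extended by 0, [Re v] is continuous, and where it exceeds [c1 >= 0] it is harmonic, so the bound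
   on the circle holds in the disc. *)
have Hc : ext G (fun y => Re (v y)) z <= c1.
  apply: (max_principle (s := ext G (fun y => Re (v y))) (c := c1) (@clN_cball R 0 t) (@bdN_cball R 0 t)).
  - by move=> y _; apply: rcc_rcont; exact: tr_ext_rcc.
  - rewrite /cball => y /=; rewrite subr0 => yt.
    have [le|lt] := leP (ext G (fun y => Re (v y)) y) c1; first by left.
    have Gy : G y by apply: contrapT => nG; move: lt; rewrite ext_out //; lra.
    have [yt'|yt'] := eqVneq (N y) t.
      exfalso; move: lt; rewrite (ext_in (fun y => Re (v y)) Gy) ltNge => /negP; apply; apply: le_trans c1E; have := tE y yt'; rewrite tr_N // => h.
      have : Bd - L < ln r - Re (v y).
        by rewrite -ltr_expR expRD expRN lnK ?posrE // -expRN.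
      lra.
    right; split.
      apply: ext_smp => //; first exact: (tr_op H).
      have [e e0 He] := tr_op H Gy; apply: (smp_Re e0); apply: holo_sub (tr_holo H); exact: He.
    by exists (t - N y); [rewrite subr_gt0 lt_neqAle yt'|apply: sub; rewrite addrC subrK].
  - by rewrite /cball /= subr0; lra.
rewrite ext_in // in Hc; apply: le_trans Hc _.
have z0 := N_ge0 z.
have e1 : 1 <= (1 + N z) ^+ q by apply: exprn_ege1; lra.
have p2 : p <= 1 + N z by rewrite /p ge_max; apply/andP; split; lra.
have BdA : Bd <= B * 11 ^+ q * (1 + N z) ^+ q.
  rewrite BdE -mulrA -exprMn ler_wpM2l // lerXn2r ?nnegrE //; lra.
have cE : c1 <= `|ln r| + (19 * Bd + 20 * `|ln (N (F p0))| + 1).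
  rewrite /c1 ge_max; have := normr_ge0 (ln r); have := normr_ge0 (ln (N (F p0))).
  have := ler_norm (ln r); have := ler_norm (- ln (N (F p0))); rewrite normrN => *.
  by apply/andP; split; rewrite /L; lra.
apply: le_trans cE _; rewrite /A.
have n1 := normr_ge0 (ln r); have n2 := normr_ge0 (ln (N (F p0))).
have m1 := ler_peMr n1 e1; have m2 := ler_peMr n2 e1.
by move: e1 BdA m1 m2; clear; move: ((1 + N z) ^+ q) `|ln r| `|ln (N (F p0))| (B * 11 ^+ q) => X a b D *; nra.
Qed.

End Facts.
End Tracts.

(** * Finite valence *)

Section Valence.
Context {R : realType}.
Implicit Types (z w y b d : R[i]) (e s t : R) (h : R[i] -> R[i]) (S X D T W : set R[i]).

Lemma Im_Re w : Im w = Re (- ii * w).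
Proof. by rewrite /ii; case: w => a b /=; ring. Qed.

Lemma cl_ge D (g : R[i] -> R) z : rcc g z -> (forall y, D y -> 0 <= g y) -> closure D z -> 0 <= g z.
Proof.
move=> gc gD /clE cz; rewrite leNgt; apply/negP => lt.
have [d d0 Hd] := gc _ (ltac:(by rewrite oppr_gt0; exact: lt) : 0 < - g z).
have [y Dy yz] := cz d d0; have := Hd y I yz; have := gD y Dy.
by rewrite ltr_norml => h1 /andP[_]; lra.
Qed.

Lemma disc_nesc z0 t b : 0 < t -> N (b - z0) <= t -> ~ escapes [set z | N (z - z0) = t] b.
Proof.
move=> t0 bt [T [cT Tb nT TX]].
have ne y : T y -> N (y - z0) != t by move=> Ty; apply/eqP; exact: TX.
have bt' : N (b - z0) < t by rewrite lt_neqAle ne.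
apply: nT; exists (t + N z0) => z Tz; have : N (z - z0) < t.
  apply: (connP (P := fun z => N (z - z0) < t) cT _ Tb Tz bt') => y Ty.
  have g0 : 0 < `|N (y - z0) - t| by rewrite normr_gt0 subr_eq0 ne.
  exists `|N (y - z0) - t| => // w Tw wy.
  have := NBD y w z0; have := NBD w y z0; rewrite (NC y w).
  move: wy; have [h|h] := ltP (N (y - z0)) t.
    by rewrite ltr0_norm ?subr_lt0 // => *; split => // _; lra.
  by rewrite ger0_norm ?subr_ge0 // => *; split => // ?; lra.
by have := NBD z0 z 0; rewrite !subr0; lra.
Qed.

Section Fix.
Variables (F : R[i] -> R[i]) (r : R) (G : set R[i]) (v : R[i] -> R[i]).
Hypothesis H : tract F r G v.

(** Bounded points with [v] close to [w] accumulate, and [tr_clRe] keeps the limit in [G], where [v]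
    is continuous. *)
Lemma tr_lim (P : set R[i]) w (x Rb : R) : 0 < x ->
  (forall e, 0 < e -> exists z, [/\ G z, P z, x <= Re (v z), N z <= Rb & N (v z - w) < e]) ->
  exists z, [/\ G z, v z = w & closure P z].
Proof.
move=> x0 Hz.
have e0 n : 0 < n.+1%:R^-1 :> R by rewrite invr_gt0 ltr0n.
pose zs n := sval (cid (Hz _ (e0 n))).
have zP n : [/\ G (zs n), P (zs n), x <= Re (v (zs n)), N (zs n) <= Rb & N (v (zs n) - w) < n.+1%:R^-1].
  exact: (svalP (cid (Hz _ (e0 n)))).
have [|z zcl] := @cluster_point R zs Rb; first by move=> n; have [] := zP n.
have cz : closure [set y | G y /\ x <= Re (v y)] z.
  apply/clE => e e1; have [n _ nz] := zcl e e1 0%N; exists (zs n) => //.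
  by have [] := zP n.
have [Gz _] := tr_clRe H x0 cz.
exists z; split => //; last first.
  by apply/clE => e e1; have [n _ nz] := zcl e e1 0%N; exists (zs n) => //; have [] := zP n.
apply: contrapT => /eqP; rewrite -subr_eq0 -N_gt0P => nw.
have nw2 : 0 < N (v z - w) / 2 by rewrite divr_gt0.
have [d d0 Hd] := iffLR (ccE v z) (tr_cc H Gz) _ nw2.
have [m mE] := ltr_add_invr nw2; rewrite add0r in mE.
have [n mn nz] := zcl d d0 m.
have [_ _ _ _ h1] := zP n; have h2 := Hd _ nz.
have h3 : n.+1%:R^-1 <= m.+1%:R^-1 :> R by rewrite lef_pV2 ?posrE ?ltr0n // ler_nat.
have h4 := NBD (v (zs n)) (v z) w; rewrite (NC (v z) (v (zs n))) in h4.
have h5 := lt_trans (lt_le_trans h1 h3) mE.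
by move: h2 h4 h5; clear; move: (N (v (zs n) - w)) (N (v (zs n) - v z)) (N (v z - w)) => a1 a2 a3; lra.
Qed.

Definition over S : set R[i] := [set z | G z /\ S (v z)].

Lemma over_open S : opN S -> opN (over S).
Proof.
move=> oS z [Gz Sz]; have [e e0 He] := oS _ Sz; have [d d0 Hd] := tr_op H Gz.
have [d' d'0 Hd'] := iffLR (ccE v z) (tr_cc H Gz) _ e0.
exists (Num.min d d'); first by rewrite lt_min d0.
by move=> y; rewrite lt_min => /andP[/Hd ? /Hd' ?]; split => //; exact: He.
Qed.

(** The image of the component is open by the open mapping theorem and relatively closed in [S] by
    the boundedness hypothesis. *)
Lemma comp_onto S (x : R) b : opN S -> connected S -> 0 < x -> (forall w, S w -> x <= Re w) ->
  over S b ->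
  (forall w, S w -> exists e Rb : R, 0 < e /\
     forall z, connected_component (over S) b z -> N (v z - w) < e -> N z <= Rb) ->
  forall w, S w -> exists2 z, connected_component (over S) b z & v z = w.
Proof.
move=> oS cS x0 Sx Ob prop w Sw; set D := connected_component _ b in prop *.
have DO z : D z -> over S z := @connected_component_sub _ _ _ z.
have oD : opN D by apply: comp_open; exact: over_open.
apply: (connP (P := fun w => exists2 z, D z & v z = w) cS _ (z := v b)) => //; last 2 first.
- by case: Ob.
- by exists b => //; exact: connected_component_refl.
move=> w1 Sw1; have [[z Dz zw]|nP] := pselect (exists2 z, D z & v z = w1).
  have [Gz _] := DO z Dz; have [p [k [g [p0 _ ord]]]] := tr_order H Gz.
  have [e e0 He] := oD z Dz; have [d d0 Hd] := open_mapping p0 ord e0.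
  exists d => // w2 _; rewrite -zw => /Hd[y yz yw]; split=> _; first by exists z.
  by exists y => //; exact: He.
apply: contrapT => h; apply: nP; have [e [Rb [e0 He]]] := prop w1 Sw1.
have [|z [Gz zw cz]] := @tr_lim D w1 x Rb x0.
  move=> e1 e10; apply: contrapT => h'; apply: h; exists (Num.min e e1); first by rewrite lt_min e0.
  move=> w2 Sw2; rewrite lt_min => /andP[we we1]; split=> [[z Dz zw]|[z Dz zw]]; exfalso; apply: h'; exists z.
    have [Gz Sz] := DO z Dz; split => //; [exact: Sx|by apply: He; rewrite ?zw|by rewrite zw].
  have [Gz Sz] := DO z Dz; split => //; [exact: Sx|by apply: He; rewrite ?zw // subrr N0|by rewrite zw subrr N0].
exists z => //; apply: comp_closure cz; first exact: over_open.
by split => //; rewrite zw.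
Qed.

(** A bounded component would be mapped onto [S], but its closure is a compact subset of [G], on
    which [|v|] is bounded. *)
Lemma comp_unbounded S (x : R) b : opN S -> connected S -> 0 < x -> (forall w, S w -> x <= Re w) ->
  over S b -> ~ bdN S -> ~ bdN (connected_component (over S) b).
Proof.
move=> oS cS x0 Sx Ob uS bD; set D := connected_component _ b in bD.
have Db : D b by exact: connected_component_refl.
have onto := comp_onto oS cS x0 Sx Ob.
have {}onto w : S w -> exists2 z, D z & v z = w.
  by apply: onto => w1 _; case: bD => M HM; exists 1, M; split => // z Dz _; exact: HM.
have cG z : closure D z -> G z.
  move=> /clE cz; have : closure [set y | G y /\ x <= Re (v y)] z.
    apply/clE => e /cz[y Dy yz]; exists y => //; have [? ?] := connected_component_sub Dy.
    by split => //; exact: Sx.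
  by case/(tr_clRe H x0).
have ne : closure D !=set0 by exists b; exact: (@subset_closure _ D).
have [m _ mM] := EVTmax (s := fun z => N (v z)) (@clN_closure _ D) (bdN_closure bD) ne
   (fun z cz => @rcc_rcont _ _ _ _ (rcc_N (tr_cc H (cG z cz)))).
apply: uS; exists (N (v m)) => w /onto[z Dz <-]; apply: mM; exact: (@subset_closure _ D).
Qed.

(* The translate to [w] of a convex cone of opening [pi/4]; on it [Im ((d (y - w))^4)] is
   positive, and it vanishes on the sides. *)
Definition cone d w : set R[i] := [set y | 0 < Im (d * (y - w)) /\ 0 < Re (d * (y - w)) - Im (d * (y - w))].

Lemma cone_open d w : opN (cone d w).
Proof.
move=> y [y1 y2]; have c : cc (fun u => d * (u - w)) y by exact: (der_cc (derZ d (derBc w (der_id y)))).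
pose m := Num.min (Im (d * (y - w))) ((Re (d * (y - w)) - Im (d * (y - w))) / 2).
have m0 : 0 < m by rewrite lt_min y1 divr_gt0.
have [e e0 He] := iffLR (ccE _ y) c m m0; exists e => // u /He hu.
have := le_lt_trans (Re_le_N _) hu; have := le_lt_trans (Im_le_N _) hu.
rewrite ReB ImB !lt_min !ltr_norml => /andP[/andP[a1 a2] /andP[a3 a4]] /andP[/andP[a5 a6] /andP[a7 a8]].
split; lra.
Qed.

Section Cones.
Variables (d : R[i]) (A : R) (q : nat).
(** The cone stays away from the vertical directions, so on its tracts [|v z - w|] is controlled by
    [Re (v z)], to which the growth bound applies. *)
Hypothesis hd : forall w, cone d 0 w -> N w <= 4 * Re w.
Hypothesis growth : forall z, G z -> Re (v z) <= A * (1 + N z) ^+ q.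

Lemma cone_Re w y : cone d w y -> N (y - w) <= 4 * (Re y - Re w) /\ Re w < Re y.
Proof.
move=> c; have c' : cone d 0 (y - w) by case: c => *; split; rewrite subr0.
have := hd c'; rewrite ReB => h; split => //.
rewrite -subr_gt0; suff : 0 < N (y - w) by lra.
rewrite N_gt0P; apply/eqP => yw; case: c; rewrite yw mulr0 /=; lra.
Qed.

Definition conefun w z : R := Im ((d * (v z - w)) ^+ 4).

Lemma conefunE w z : conefun w z = 4 * Re (d * (v z - w)) * Im (d * (v z - w)) *
  (Re (d * (v z - w)) - Im (d * (v z - w))) * (Re (d * (v z - w)) + Im (d * (v z - w))).
Proof. rewrite /conefun; move: (d * (v z - w)) => u; rewrite (_ : u ^+ 4 = u * u * u * u); last by ring.
by rewrite !(ImM, ReM); ring. Qed.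

Lemma cone_holo w z : G z -> exists2 e, 0 < e & [/\ oball z e `<=` G,
  holo (oball z e) (fun y => - ii * (d * (v y - w)) ^+ 4),
  holo (oball z e) (fun y => - (- ii * (d * (v y - w)))) &
  holo (oball z e) (fun y => - (d * (v y - w) - - ii * (d * (v y - w))))].
Proof.
move=> Gz; have [e e0 He] := tr_op H Gz.
have [e' e'0 He'] : exists2 e, 0 < e & oball z e `<=` G by exists e.
pose g y := d * (v y - w) + - (d * (v y - w)) * ii.
have hg y : oball z e y -> exists m, der (fun y => d * (v y - w)) y m.
  by move=> /He/(tr_holo H)[m hm]; exists (d * m); apply: derZ; exact: derBc.
exists e => //; split.
- exact: He.
- by move=> y /hg[m hm]; eexists; apply: derZ; exact: (derX 3 hm).
- by move=> y /hg[m hm]; eexists; apply: derN; apply: derZ; exact: hm.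
- by move=> y /hg[m hm]; eexists; apply: derN; apply: derB; [exact: hm|apply: derZ; exact: hm].
Qed.

Lemma cone_cl w z D : G z -> D `<=` [set z | cone d w (v z)] -> closure D z ->
  0 <= Im (d * (v z - w)) /\ 0 <= Re (d * (v z - w)) - Im (d * (v z - w)).
Proof.
move=> Gz Dc cz; have [e e0 [_ _ h2 h3]] := cone_holo w Gz.
have c2 := rcc_Re (holo_cc h2 (oball_center z e0)); have c3 := rcc_Re (holo_cc h3 (oball_center z e0)).
have c2' := rccZ (-1) c2; have c3' := rccZ (-1) c3.
have E2 y : -1 * Re (- (- ii * (d * (v y - w)))) = Im (d * (v y - w)) by rewrite ReN -Im_Re; ring.
have E3 y : -1 * Re (- (d * (v y - w) - - ii * (d * (v y - w)))) = Re (d * (v y - w)) - Im (d * (v y - w)).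
  by rewrite ReN ReB -Im_Re; ring.
split.
  by have := cl_ge c2' _ cz; rewrite E2; apply => y /Dc[/ltW]; rewrite E2.
by have := cl_ge c3' _ cz; rewrite E3; apply => y /Dc[_ /ltW]; rewrite E3.
Qed.

(** The function vanishes on the boundary of the tract because one of the two side conditions
    becomes an equality there. There are no holes: the disc of a circle in the tract lies in [G] by
    [tr_hull], and the two linear forms that bound the cone stay positive in it by the maximum
    principle. *)
Lemma cone_lump w b : 0 < Re w -> lump (ext (connected_component (over (cone d w)) b) (conefun w)).
Proof.
move=> w0; set W := over (cone d w); set D := connected_component W b.
have oW : opN W by apply: over_open; exact: cone_open.
have oD : opN D by exact: comp_open.
have DW z : D z -> W z := @connected_component_sub _ _ _ z.
have pos z : D z -> 0 < conefun w z.
  by move=> /DW[_ [h1 h2]]; rewrite conefunE !mulr_gt0 //; lra.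
have cf z : G z -> rcc (conefun w) z.
  move=> Gz; have [e e0 [_ h _ _]] := cone_holo w Gz.
  apply: rcc_near (rcc_Re (holo_cc h (oball_center z e0))).
  by apply: filterS (@filterT _ (nbhs z) _) => y _; rewrite -Im_Re.
have in_pos z : 0 < ext D (conefun w) z -> D z.
  by move=> h; apply: contrapT => nD; move: h; rewrite ext_out // ltxx.
split.
- by move=> z; have [Dz|nD] := pselect (D z); [rewrite ext_in // ltW // pos|rewrite ext_out].
- apply: ext_rcc => // [z /DW[Gz _]|z nD cz e e0]; first exact: cf.
  have Gz : G z.
    have : closure [set y | G y /\ Re w <= Re (v y)] z.
      move/clE: cz => cz; apply/clE => e1 /cz[y /DW[Gy cy] yz]; exists y => //.
      by split => //; have [_ /ltW] := cone_Re cy.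
    by case/(tr_clRe H w0).
  have [||h1 h2] := @cone_cl w z D Gz => //; first by move=> y /DW[].
  have z0 : conefun w z = 0.
    have nc : ~ cone d w (v z) by move=> c; apply: nD; apply: comp_closure cz.
    have [i00|i0] := eqVneq (Im (d * (v z - w))) 0; first by rewrite conefunE i00; ring.
    rewrite conefunE; have -> : Re (d * (v z - w)) - Im (d * (v z - w)) = 0; last by ring.
    apply/eqP; apply: contrapT => /negP ne; apply: nc; split; rewrite lt_neqAle eq_sym ?i0 ?ne //.
  have [d' d'0 Hd'] := cf z Gz e e0; exists d' => // y _ yz.
  by have := Hd' y I yz; rewrite z0 subr0.
- move=> z /in_pos Dz; apply: ext_smp => //.
  have [e e0 [_ h _ _]] := cone_holo w (DW z Dz).1.
  apply: smp_near (smp_Re e0 h).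
  by apply: filterS (@filterT _ (nbhs z) _) => y _; rewrite -Im_Re.
- move=> z0 t t0 circ_pos b' b't.
  have circD z : N (z - z0) = t -> D z by move=> /circ_pos/in_pos.
  pose X := [set z | N (z - z0) = t].
  have cX : clN X.
    move=> z h; apply: contrapT => /eqP ne; have g0 : 0 < `|N (z - z0) - t| by rewrite normr_gt0 subr_eq0.
    have [y /= yt yz] := h _ g0; have := N_sub_abs (y - z0) (z - z0); rewrite yt distrC.
    rewrite (_ : y - z0 - (z - z0) = y - z); [lra|ring].
  have bX : bdN X by exists (t + N z0) => z /= zt; have := NBD z0 z 0; rewrite !subr0 zt.
  have XG : X `<=` G by move=> z /circD/DW[].
  have cbG : cball z0 t `<=` G by move=> z zt; apply: (tr_hull H cX bX XG); exact: disc_nesc.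
  have neX : X !=set0 by exists (circ z0 t 0); rewrite /X /= N_circ // ltW.
  have pos_in (g : R[i] -> R[i]) : (forall z, G z -> exists2 e, 0 < e & holo (oball z e) g) ->
     (forall z, X z -> Re (g z) < 0) -> forall z, cball z0 t z -> Re (g z) < 0.
    move=> hg gX z zt.
    have gc y : G y -> rcc (fun y => Re (g y)) y.
      by move=> /hg[e e0 he]; exact: rcc_Re (holo_cc he (oball_center y e0)).
    have [m Xm mM] := EVTmax (s := fun y => Re (g y)) cX bX neX (fun y Xy => @rcc_rcont _ _ _ _ (gc y (XG y Xy))).
    apply: le_lt_trans (gX m Xm).
    apply: (max_principle (s := fun y => Re (g y)) (@clN_cball R z0 t) (@bdN_cball R z0 t)) => //.
      by move=> y yt; apply: rcc_rcont; apply: gc; exact: cbG.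
    move=> y yt; have [yt'|yt'] := eqVneq (N (y - z0)) t; first by left; exact: mM.
    right; have [e e0 he] := hg y (cbG y yt); split; first exact: smp_Re he.
    exists (t - N (y - z0)); first by rewrite subr_gt0 lt_neqAle yt'.
    by move=> u; rewrite /oball /cball /=; have := NBD y u z0; lra.
  have cbW : cball z0 t `<=` W.
    move=> z zt; split; first exact: cbG.
    split.
      have := pos_in (fun y => - (- ii * (d * (v y - w)))); rewrite -oppr_lt0 => h.
      have := h _ _ z zt; rewrite ReN -Im_Re; apply.
        by move=> y Gy; have [e e0 [_ _ h2 _]] := cone_holo w Gy; exists e.
      by move=> y /circD/DW[_ [h1 _]]; rewrite ReN -Im_Re oppr_lt0.
    have := pos_in (fun y => - (d * (v y - w) - - ii * (d * (v y - w)))); rewrite -oppr_lt0 => h.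
    have := h _ _ z zt; rewrite ReN ReB -Im_Re; apply.
      by move=> y Gy; have [e e0 [_ _ _ h2]] := cone_holo w Gy; exists e.
    by move=> y /circD/DW[_ [_ h2]]; rewrite ReN ReB -Im_Re oppr_lt0.
  have [m Xm] := neX.
  have Db' : D b'.
    rewrite /D (same_connected_component (circD m Xm)).
    apply: (connected_component_max _ cbW (conn_convx (@convx_cball R z0 t))) => //.
    by rewrite /cball /= Xm.
  by rewrite ext_in // pos.
Qed.

(** Distinct tracts over one cone carry disjoint lumps; since [conefun] is of degree 4 in [v], their
    growth exponent is [4 * q], independently of [w]. *)
Lemma cone_count : exists n0 : nat, forall w n (b : 'I_n -> R[i]), 0 < Re w ->
  (forall i, over (cone d w) (b i)) ->
  (forall i j, connected_component (over (cone d w)) (b i) (b j) -> i = j) -> (n <= n0)%N.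
Proof.
have [n0 Hn0] := @lumps_bounded R (4 * q); exists n0 => w n b w0 Ob dis.
pose D i := connected_component (over (cone d w)) (b i).
have DW i z : D i z -> over (cone d w) z := @connected_component_sub _ _ _ z.
have in_pos i z : 0 < ext (D i) (conefun w) z -> D i z.
  by move=> h; apply: contrapT => nD; move: h; rewrite ext_out // ltxx.
apply: (Hn0 n (fun i => ext (D i) (conefun w)) ((N d * 4) ^+ 4 * A ^+ 4)) => [i|i j z|i|i z].
- exact: cone_lump.
- move=> /in_pos hi /in_pos hj; apply: dis.
  by apply: connected_component_trans hi _; exact: connected_component_sym.
- exists (b i); rewrite ext_in; last exact: connected_component_refl.
  by have [_ [h1 h2]] := Ob i; rewrite conefunE !mulr_gt0 //; lra.
- have Rhs : 0 <= (N d * 4) ^+ 4 * A ^+ 4 * (1 + N z) ^+ (4 * q).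
    apply: mulr_ge0; last by apply: exprn_ge0; have := N_ge0 z; lra.
    by apply: mulr_ge0; exact: exprn_even_ge0.
  have [Dz|nD] := pselect (D i z); last by rewrite ext_out.
  rewrite ext_in //; have [Gz cz] := DW i z Dz.
  have [c1 c2] := cone_Re cz.
  apply: le_trans (ler_norm _) _; apply: le_trans (Im_le_N _) _; rewrite NX NM mulnC exprM -!exprMn.
  have le : N d * N (v z - w) <= N d * 4 * A * (1 + N z) ^+ q.
    rewrite -!mulrA ler_wpM2l ?N_ge0 //; apply: le_trans c1 _; rewrite ler_pM2l //.
    by have := growth Gz; lra.
  have ge0 : 0 <= N d * N (v z - w) by rewrite mulr_ge0 ?N_ge0.
  by rewrite lerXn2r ?nnegrE // (le_trans ge0 le).
Qed.

End Cones.

(** To leave [v z] in the direction [ps], leave [z] in the direction [(ps - ph) / (k + 1)], where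
    [ph] is an argument of the leading coefficient. The tolerance [1 / 10] is small enough for every
    cone condition used later. *)
Lemma local_rays_order z (p : R) k (g : R[i] -> R[i]) : 0 < p -> oball z p `<=` G -> order_form v z p k g ->
  exists ph e : R, 0 < e /\ forall ps s, 0 < s <= e ->
  G (circ z s ((ps - ph) / k.+1%:R)) /\
  exists (t : R) u, [/\ 0 < t, N u <= 1 / 10 & v (circ z s ((ps - ph) / k.+1%:R)) - v z = t%:C * (cis ps + u)].
Proof.
move=> p0 pG [gh g0 gE].
have [lg lgE] := cexp_surj g0.
have Ng : 0 < N (g z) by rewrite N_gt0P.
have e0 : 0 < N (g z) / 10 by rewrite divr_gt0.
have [d d0 Hd] := iffLR (ccE g z) (holo_cc gh (oball_center z p0)) _ e0.
exists (Im lg), (Num.min p d / 2); split; first by rewrite divr_gt0 // lt_min p0.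
move=> ps s /andP[s0]; set z1 := circ z s _ => sp.
have z1z : N (z1 - z) = s by rewrite N_circ // ltW.
have [sp1 sd1] : s < p /\ s < d.
  have [m1 m2] : Num.min p d <= p /\ Num.min p d <= d by rewrite !ge_min !lexx orbT.
  have m3 : 0 < Num.min p d by rewrite lt_min p0.
  by split; lra.
have z1p : oball z p z1 by rewrite /oball /= z1z.
split; first exact: pG.
exists (s ^+ k.+1 * N (g z)), (cis ps * ((g z1 - g z) / g z)); split.
- by rewrite mulr_gt0 // exprn_gt0.
- rewrite NM N_cis mul1r NM NV ler_pdivrMr //.
  by have := Hd z1 (ltac:(by rewrite z1z)); lra.
- rewrite gE // addrC addKr.
  have -> : cis ps + cis ps * ((g z1 - g z) / g z) = cis ps * (g z1 / g z) by field.
  have -> : z1 - z = s%:C * cis ((ps - Im lg) / k.+1%:R) by rewrite /z1 /circ addrC addKr.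
  have cX th (n : nat) : cis th ^+ n = cis (th * n%:R).
    elim: n => [|n IH]; first by rewrite mulr0 cis0.
    by rewrite exprS IH -cisD -natr1 mulrDr mulr1 addrC.
  rewrite exprMn cX divfK ?pnatr_eq0 //.
  have gE' : g z = (N (g z))%:C * cis (Im lg) by rewrite -lgE N_cexp.
  have -> : (s ^+ k.+1 * N (g z))%:C = s%:C ^+ k.+1 * (N (g z))%:C :> R[i] by rewrite rmorphM rmorphXn.
  rewrite cisD cisN; rewrite [in RHS]gE' NM N_cis mulr1 NReal (gtr0_norm Ng).
  have NC0 : (N (g z))%:C != 0 :> R[i] by rewrite -N_gt0P NReal gtr0_norm.
  by field; rewrite NC0 cis_neq0.
Qed.

Lemma local_rays z : G z -> exists (kp ph e : R), [/\ 1 <= kp, 0 < e & forall ps s, 0 < s <= e ->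
  G (circ z s ((ps - ph) / kp)) /\
  exists (t : R) u, [/\ 0 < t, N u <= 1 / 10 & v (circ z s ((ps - ph) / kp)) - v z = t%:C * (cis ps + u)]].
Proof.
move=> Gz; have [p [k [g [p0 pG ord]]]] := tr_order H Gz.
have [ph [e [e0 hr]]] := local_rays_order p0 pG ord.
by exists k.+1%:R, ph, e; split => //; rewrite ler1n.
Qed.

End Fix.
End Valence.

(** * Separation of preimages by their tracts over two cones *)

Section FiniteValence.
Context {R : realType}.
Implicit Types (z w y b d : R[i]) (e s t : R) (S X D T W : set R[i]).

(** [pick] depends only on the predicate [e i], hence only on the class of [i], so it selects one
    representative per class. *)
Lemma reps m (e : rel 'I_m) (n0 : nat) : reflexive e -> symmetric e -> transitive e ->
  (forall n (s : 'I_n -> 'I_m), (forall i j, e (s i) (s j) -> i = j) -> (n <= n0)%N) ->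
  exists2 rep : 'I_m -> 'I_m, (forall i j, rep i = rep j -> e i j) & (#|rep @: [set: 'I_m]%SET| <= n0)%N.
Proof.
move=> er es et Hn; pose rep i := odflt i [pick j | e i j].
have eR i : e i (rep i) by rewrite /rep; case: pickP => //= /(_ i); rewrite er.
have repE i j : e i j -> rep i = rep j.
  move=> eij; rewrite /rep; have E : e i =1 e j by move=> k; apply: (left_trans es et).
  rewrite (eq_pick E); case: pickP => //= /(_ j); by rewrite er.
exists rep => [i j rij|].
  by apply: (et _ _ _ (eR i)); rewrite rij es.
apply: (Hn _ (fun i => enum_val i)) => i j h; apply: enum_val_inj; move: h.
have /imsetP[a _ ->] := enum_valP i; have /imsetP[c _ ->] := enum_valP j.
by move=> h; apply: repE; apply: (et _ _ _ (eR a)); apply: (et _ _ _ h); rewrite es.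
Qed.

Lemma cos_pi4 : cos (pi / 4) = sin (pi / 4) :> R /\ 7 / 10 <= sin (pi / 4) :> R.
Proof.
have p0 := pi_gt0 R; have h : cos (pi / 4) = sin (pi / 4) :> R.
  by rewrite -cosBpihalf -cosN; congr cos; field.
have c0 : 0 < cos (pi / 4) :> R by apply: cos_gt0_pihalf; apply/andP; split; lra.
split=> //; have := cos2Dsin2 (pi / 4 : R); rewrite h in c0 *; move: (sin _) c0; clear => x x0 E.
by rewrite leNgt; apply/negP => lt; nra.
Qed.

Lemma convx_cone d w : convx (cone d w).
Proof.
move=> a b t [a1 a2] [b1 b2] /andP[t0 t1]; rewrite /cone /= lerp_sub.
have -> : d * ((1 - t)%:C * (a - w) + t%:C * (b - w)) = (1 - t)%:C * (d * (a - w)) + t%:C * (d * (b - w)) by ring.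
move: (d * (a - w)) (d * (b - w)) a1 a2 b1 b2 => a' b'; rewrite !(ReD, ImD, ReM, ImM) /=.
rewrite !mul0r !subr0 !addr0 => a1 a2 b1 b2.
have pos (x y : R) : 0 < x -> 0 < y -> 0 < (1 - t) * x + t * y.
  move=> x0 y0; have [->|t0'] := eqVneq t 0; first by rewrite subr0 mul1r mul0r addr0.
  by apply: ltr_wpDl; rewrite ?mulr_ge0 ?subr_ge0 ?(ltW x0) // mulr_gt0 // lt_neqAle eq_sym t0'.
split; first exact: pos.
by have := pos _ _ a2 b2; rewrite !mulrBr; lra.
Qed.

(* The cones [x/2 < y < 3x], [-3x < y < -x/2] and [-2x/5 < y < 3x/7]: the third one separates
   the other two. *)
Definition dir1 : R[i] := 2 +i* (-1).
Definition dir2 : R[i] := 1 +i* 3.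
Definition dir3 : R[i] := 5 +i* 2.

Lemma coneE1 w y : cone dir1 w y <-> 0 < 2 * Im (y - w) - Re (y - w) /\ 0 < 3 * Re (y - w) - Im (y - w).
Proof.
rewrite /cone /= /dir1 ReM ImM /=; move: (y - w) => u.
by split=> -[h1 h2]; split; lra.
Qed.
Lemma coneE2 w y : cone dir2 w y <-> 0 < Im (y - w) + 3 * Re (y - w) /\ 0 < - Re (y - w) - 2 * Im (y - w).
Proof.
rewrite /cone /= /dir2 ReM ImM /=; move: (y - w) => u.
by split=> -[h1 h2]; split; lra.
Qed.
Lemma coneE3 w y : cone dir3 w y <-> 0 < 5 * Im (y - w) + 2 * Re (y - w) /\ 0 < 3 * Re (y - w) - 7 * Im (y - w).
Proof.
rewrite /cone /= /dir3 ReM ImM /=; move: (y - w) => u.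
by split=> -[h1 h2]; split; lra.
Qed.

Lemma abs_le (x y : R) : - y <= x <= y -> `|x| <= y. Proof. by rewrite ler_norml. Qed.

Lemma dir1_N w : cone dir1 0 w -> N w <= 4 * Re w.
Proof.
rewrite coneE1 subr0 => -[h1 h2]; apply: le_trans (N_le_ReIm _) _.
have a1 : `|Re w| <= Re w by apply: abs_le; apply/andP; split; lra.
have a2 : `|Im w| <= 3 * Re w by apply: abs_le; apply/andP; split; lra.
lra.
Qed.
Lemma dir2_N w : cone dir2 0 w -> N w <= 4 * Re w.
Proof.
rewrite coneE2 subr0 => -[h1 h2]; apply: le_trans (N_le_ReIm _) _.
have a1 : `|Re w| <= Re w by apply: abs_le; apply/andP; split; lra.
have a2 : `|Im w| <= 3 * Re w by apply: abs_le; apply/andP; split; lra.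
lra.
Qed.
Lemma dir3_N w : cone dir3 0 w -> N w <= 4 * Re w.
Proof.
rewrite coneE3 subr0 => -[h1 h2]; apply: le_trans (N_le_ReIm _) _.
have a1 : `|Re w| <= Re w by apply: abs_le; apply/andP; split; lra.
have a2 : `|Im w| <= 3 * Re w by apply: abs_le; apply/andP; split; lra.
lra.
Qed.

Lemma cone3_dis w y : cone dir3 w y -> cone dir1 w y \/ cone dir2 w y -> False.
Proof.
rewrite coneE1 coneE2 coneE3; move: (y - w) => u [h1 h2] h; suff : Re u < Re u by rewrite ltxx.
case: h => -[h3 h4]; lra.
Qed.

Lemma cone3_unbd w : ~ bdN (cone dir3 w).
Proof.
move=> [M HM]; pose t := `|M| + N w + 1.
have t0 : 0 < t by rewrite /t; have := normr_ge0 M; have := N_ge0 w; lra.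
have E : w + t%:C - w = t%:C by rewrite addrC addKr.
have c : cone dir3 w (w + t%:C) by rewrite coneE3 E /=; split; lra.
have := HM _ c; have := NB (w + t%:C) w; rewrite E NReal gtr0_norm // /t; have := ler_norm M; lra.
Qed.

Section Fix.
Variables (F : R[i] -> R[i]) (r : R) (G : set R[i]) (v : R[i] -> R[i]).
Hypothesis H : tract F r G v.

(** Local data at [z]: rays in the directions [pi / 4], [- pi / 4] and [0] of [v - v z], one into
    each of the three cones, and one in the direction [pi], along which [|F|] exceeds [|F z|]. *)
Definition four_rays z kp ph e := [/\ 1 <= kp, 0 < e & forall s, 0 < s <= e ->
  [/\ over G v (cone dir1 (v z)) (circ z s ((pi / 4 - ph) / kp)),
      over G v (cone dir2 (v z)) (circ z s ((- (pi / 4) - ph) / kp)),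
      over G v (cone dir3 (v z)) (circ z s ((0 - ph) / kp)) &
      Re (v (circ z s ((pi - ph) / kp))) < Re (v z) /\ G (circ z s ((pi - ph) / kp))]].

Lemma four_rays_ex z : G z -> exists kp ph e, four_rays z kp ph e.
Proof.
move=> /(local_rays H)[kp [ph [e [kp1 e0 Hr]]]]; exists kp, ph, e; split => // s se.
have [c4 c7] := cos_pi4.
have Nu u : N u <= 1 / 10 -> [/\ - (1 / 10) <= Re u, Re u <= 1 / 10, - (1 / 10) <= Im u & Im u <= 1 / 10].
  move=> h; have := le_trans (Re_le_N u) h; have := le_trans (Im_le_N u) h.
  by rewrite !ler_norml => /andP[? ?] /andP[? ?].
have ReZ t u : Re (t%:C * u) = t * Re u by rewrite ReM /= mul0r subr0.
have ImZ t u : Im (t%:C * u) = t * Im u by rewrite ImM /= mul0r addr0.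
have pos t (x : R) : 0 < t -> 0 < x -> 0 < t * x by exact: mulr_gt0.
split.
- have [G1 [t [u [t0 /Nu[u1 u2 u3 u4] E]]]] := Hr (pi / 4) s se.
  split => //; rewrite coneE1 E ReZ ImZ ReD ImD /= c4; move: (sin _) c7 => c c7.
  have := pos t (2 * (c + Im u) - (c + Re u)) t0; have := pos t (3 * (c + Re u) - (c + Im u)) t0.
  by move=> h1 h2; split; [move: (h2 (ltac:(lra)))|move: (h1 (ltac:(lra)))]; lra.
- have [G1 [t [u [t0 /Nu[u1 u2 u3 u4] E]]]] := Hr (- (pi / 4)) s se.
  split => //; rewrite coneE2 E ReZ ImZ ReD ImD /= cosN sinN c4; move: (sin _) c7 => c c7.
  have := pos t ((- c + Im u) + 3 * (c + Re u)) t0; have := pos t (- (c + Re u) - 2 * (- c + Im u)) t0.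
  by move=> h1 h2; split; [move: (h2 (ltac:(lra)))|move: (h1 (ltac:(lra)))]; lra.
- have [G1 [t [u [t0 /Nu[u1 u2 u3 u4] E]]]] := Hr 0 s se.
  split => //; rewrite coneE3 E ReZ ImZ ReD ImD /= cos0 sin0.
  have := pos t (5 * (0 + Im u) + 2 * (1 + Re u)) t0; have := pos t (3 * (1 + Re u) - 7 * (0 + Im u)) t0.
  by move=> h1 h2; split; [move: (h2 (ltac:(lra)))|move: (h1 (ltac:(lra)))]; lra.
- have [G1 [t [u [t0 /Nu[u1 u2 u3 u4] E]]]] := Hr pi s se.
  split => //; rewrite -subr_lt0 -ReB E ReZ ReD /= cospi pmulr_rlt0 //; lra.
Qed.

(** The common tracts over the first two cones, linked through [z2], and the two rays at [z1]
    surround one of the directions [0] and [pi] at [z1]. But the former enters an unbounded tract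
    over the third cone, and the latter a component of [|F| > const]. *)
Lemma no_double z1 z2 kp1 ph1 e1 kp2 ph2 e2 : G z1 -> G z2 -> z1 != z2 -> v z1 = v z2 ->
  four_rays z1 kp1 ph1 e1 -> four_rays z2 kp2 ph2 e2 ->
  connected_component (over G v (cone dir1 (v z1)))
     (circ z1 e1 ((pi / 4 - ph1) / kp1)) (circ z2 e2 ((pi / 4 - ph2) / kp2)) ->
  connected_component (over G v (cone dir2 (v z1)))
     (circ z1 e1 ((- (pi / 4) - ph1) / kp1)) (circ z2 e2 ((- (pi / 4) - ph2) / kp2)) -> False.
Proof.
move=> G1 G2 z12 v12 [k1 e10 r1] [k2 e20 r2] C1 C2.
have oW d : opN (over G v (cone d (v z1))) by apply: (over_open H); exact: cone_open.
have eself (e : R) : 0 < e -> 0 < e <= e by move=> ->; rewrite lexx.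
have [ov1 ov2 _ _] := r1 e1 (eself _ e10).
have [X1 [X1c X1b X1n X1s [X1x X1y]]] := conn_compact (oW dir1) (connected_component_refl ov1) C1.
have [X2 [X2c X2b X2n X2s [X2x X2y]]] := conn_compact (oW dir2) (connected_component_refl ov2) C2.
set a1 := (pi / 4 - ph1) / kp1 in C1 X1x X1y ov1 *; set a2 := (- (pi / 4) - ph1) / kp1 in C2 X2x X2y ov2 *.
set c1 := (pi / 4 - ph2) / kp2 in C1 X1x X1y *; set c2 := (- (pi / 4) - ph2) / kp2 in C2 X2x X2y *.
(* Compact and connected through [z2], and avoiding [z1]: it lies over the two cones except at [z2],
   while [v z1] is the common apex. *)
pose X := (X1 `|` ray z2 c1 e2) `|` (X2 `|` ray z2 c2 e2).
have rE z al e : 0 <= e -> ray z al e z /\ ray z al e (circ z e al).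
  move=> e0; split; [exists 0|exists e] => //=; rewrite ?lexx ?e0 //.
  by rewrite /circ mul0r addr0.
have [rz rt] := rE z2 c1 e2 (ltW e20); have [rz' rt'] := rE z2 c2 e2 (ltW e20).
have clX : clN X by apply: clNU; apply: clNU => //; exact: (ray_bdcl _ _ _).1.
have bdX : bdN X by apply: bdNU; apply: bdNU => //; exact: (ray_bdcl _ _ _).2.
have cnX : connected X.
  apply: connU; last by exists z2; split; right.
    by apply: connU => //; [exact: conn_ray|exists (circ z2 e2 c1)].
  by apply: connU => //; [exact: conn_ray|exists (circ z2 e2 c2)].
have nc d : ~ cone d (v z1) (v z1) by move=> [h _]; move: h; rewrite subrr mulr0 /= ltxx.
pose Y := [set z | over G v (cone dir1 (v z1)) z \/ over G v (cone dir2 (v z1)) z \/ v z = v z1].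
have rayY z kp ph e : four_rays z kp ph e -> v z = v z1 ->
    ray z ((pi / 4 - ph) / kp) e `<=` Y /\ ray z ((- (pi / 4) - ph) / kp) e `<=` Y.
  move=> [_ _ rr] vz; split=> _ [s /andP[s0 se] <-]; (have [->|s0'] := eqVneq s 0;
    first by right; right; rewrite /circ mul0r addr0).
    by left; rewrite -vz; have [] := rr s (ltac:(by rewrite lt_neqAle eq_sym s0' s0)).
  by right; left; rewrite -vz; have [] := rr s (ltac:(by rewrite lt_neqAle eq_sym s0' s0)).
have R2 := rayY z2 kp2 ph2 e2 (And3 k2 e20 r2) (esym v12).
have R1 := rayY z1 kp1 ph1 e1 (And3 k1 e10 r1) erefl.
have XY : X `<=` Y.
  by move=> z [[/X1s|/R2.1//]|[/X2s|/R2.2//]]; [left|right; left].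
have nX : ~ X z1.
  have nr al e kp ph : four_rays z2 kp ph e -> 0 < e -> (forall s, 0 < s <= e -> exists d, over G v (cone d (v z1)) (circ z2 s al)) -> ~ ray z2 al e z1.
    move=> _ e0 hh [s /andP[s0 se] E]; have [s00|s0'] := eqVneq s 0.
      by move: E z12; rewrite s00 /circ mul0r addr0 => ->; rewrite eqxx.
    have [d [_ cd]] := hh s (ltac:(by rewrite lt_neqAle eq_sym s0' s0)).
    by rewrite E in cd; exact: nc cd.
  have fr2 := And3 k2 e20 r2.
  move=> [[/X1s[_ /nc]//|]|[/X2s[_ /nc]//|]]; (apply: (nr _ _ _ _ fr2 e20) => s hs).
    by exists dir1; rewrite v12; have [] := r2 s hs.
  by exists dir2; rewrite v12; have [] := r2 s hs.
have p0 := pi_gt0 R.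
have kp0 : 0 < kp1 by lra.
have ki0 : 0 < kp1^-1 by rewrite invr_gt0.
have ki1 : kp1^-1 <= 1 by rewrite invf_le1.
(* In the image the directions are [- pi / 4 < 0 < pi / 4 < pi], spanning [5 / 4 * pi]; dividing by
   [kp1 >= 1] keeps the span below a full turn. *)
have lt12 : a2 < (0 - ph1) / kp1 < a1 by rewrite /a1 /a2 !ltr_pM2r //; apply/andP; split; lra.
have lt34 : a1 < (pi - ph1) / kp1 < a2 + pi *+ 2.
  apply/andP; split; first by rewrite /a1 ltr_pM2r //; lra.
  rewrite -ltrBlDl /a2 -mulrBl (_ : pi - ph1 - (- (pi / 4) - ph1) = 5 / 4 * pi); last by field.
  apply: (@le_lt_trans _ _ (5 / 4 * pi * 1)); first by rewrite ler_pM2l // mulr_gt0.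
  by rewrite mulr2n; lra.
have [d d0 Hd] := two_sectors clX bdX cnX nX e10 lt12 lt34 (or_intror (or_introl X2x)) (or_introl (or_introl X1x)).
pose t := Num.min e1 (d / 2).
have [t0 te td] : [/\ 0 < t, t <= e1 & t < d].
  split; [by rewrite lt_min e10 divr_gt0|by rewrite ge_min lexx|rewrite gt_min; apply/orP; right; lra].
have [_ _ ov3 [ov4 ov5]] := r1 t (ltac:(by rewrite t0 te)).
set Gm := X `|` (ray z1 a2 e1 `|` ray z1 a1 e1) in Hd.
have GmY : Gm `<=` Y by move=> z [/XY//|[/R1.2//|/R1.1//]].
have v0 : 0 < Re (v z1) := tr_Re H G1.
(* The point in the direction [0] escapes through its tract over the third cone, which is disjoint
   from the first two; the point in the direction [pi] escapes by [tr_esc]. *)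
apply: (Hd t (ltac:(by rewrite t0 td))).
  exists (connected_component (over G v (cone dir3 (v z1))) (circ z1 t ((0 - ph1) / kp1))); split.
  - exact: component_connected.
  - exact: connected_component_refl.
  - apply: (comp_unbounded H (cone_open (d := dir3) (w := v z1)) (conn_convx (@convx_cone dir3 (v z1))) v0) => //.
      by move=> w /(cone_Re dir3_N)[_ /ltW].
    exact: cone3_unbd.
  - move=> z /connected_component_sub[_ cz] /GmY[[_ c]|[[_ c]|c]].
    + exact: cone3_dis cz (or_introl c).
    + exact: cone3_dis cz (or_intror c).
    + by rewrite c in cz; exact: nc cz.
apply: (tr_esc H (s := r * expR (- Re (v z1)))).
  have le z : G z -> Re (v z1) <= Re (v z) -> N (F z) <= r * expR (- Re (v z1)).
    by move=> Gz h; rewrite (tr_N H Gz) ler_pM2l ?(tr_r H) // ler_expR lerN2.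
  have GY z : X1 z \/ X2 z \/ v z = v z1 -> G z -> Re (v z1) <= Re (v z).
    move=> [/X1s[_ /(cone_Re dir1_N)[_ /ltW]]//|[/X2s[_ /(cone_Re dir2_N)[_ /ltW]]//|->//]].
  move=> z Gmz; have [Gz Rz] : G z /\ Re (v z1) <= Re (v z).
    have Yr w : Y w -> (v w = v z1 -> G w) -> G w /\ Re (v z1) <= Re (v w).
      by move=> [[? /(cone_Re dir1_N)[_ /ltW]]|[[? /(cone_Re dir2_N)[_ /ltW]]|E]] // /(_ E); rewrite E.
    apply: Yr; first exact: GmY.
    have rG y al e : G y -> v y = v z1 -> (forall s, 0 < s <= e -> G (circ y s al)) -> ray y al e `<=` G.
      move=> Gy vy hG _ [s /andP[s0 se] <-]; have [->|s0'] := eqVneq s 0; first by rewrite /circ mul0r addr0.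
      by apply: hG; rewrite lt_neqAle eq_sym s0' s0.
    move=> _; case: Gmz => [[[/X1s[]//|]|[/X2s[]//|]]|[|]]; (apply: rG => // s hs);
      [have [[]] := r2 s hs|have [_ []] := r2 s hs|have [_ []] := r1 s hs|have [[]] := r1 s hs]; done.
  exact: le.
by rewrite (tr_N H ov5) ltr_pM2l ?(tr_r H) // ltr_expR ltrN2.
Qed.

(** A preimage is determined by its pair of tracts over the first two cones, so the product of the
    two tract bounds works for every [w]. *)
Theorem finite_valence (A : R) q : (forall z, G z -> Re (v z) <= A * (1 + N z) ^+ q) ->
  exists n0 : nat, forall m (p : 'I_m -> R[i]) w, injective p -> (forall i, G (p i) /\ v (p i) = w) -> (m <= n0)%N.
Proof.
move=> growth; have [n1 H1] := cone_count H dir1_N growth; have [n2 H2] := cone_count H dir2_N growth.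
exists (n1 * n2)%N => m p w pinj pw; case: m p pinj pw => [|m] p pinj pw; first by [].
have Hx i : exists x : R * R * R, four_rays (p i) x.1.1 x.1.2 x.2.
  by have [kp [ph [e h]]] := four_rays_ex (pw i).1; exists (kp, ph, e).
pose x i := sval (cid (Hx i)); have xP i : four_rays (p i) (x i).1.1 (x i).1.2 (x i).2 := svalP (cid (Hx i)).
have w0 : 0 < Re w by rewrite -(pw ord0).2; exact: (tr_Re H (pw ord0).1).
pose b1 i := circ (p i) (x i).2 ((pi / 4 - (x i).1.2) / (x i).1.1).
pose b2 i := circ (p i) (x i).2 ((- (pi / 4) - (x i).1.2) / (x i).1.1).
have Ob i : over G v (cone dir1 w) (b1 i) /\ over G v (cone dir2 w) (b2 i).
  have [_ e0 rr] := xP i; have [] := rr (x i).2 (ltac:(by rewrite e0 lexx)).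
  by rewrite (pw i).2.
pose e1 i j := `[< connected_component (over G v (cone dir1 w)) (b1 i) (b1 j) >].
pose e2 i j := `[< connected_component (over G v (cone dir2 w)) (b2 i) (b2 j) >].
have sym U (b : 'I_m.+1 -> R[i]) : symmetric (fun i j => `[< connected_component U (b i) (b j) >]).
  by move=> i j; apply/asboolP/asboolP; exact: connected_component_sym.
have trans U (b : 'I_m.+1 -> R[i]) : transitive (fun i j => `[< connected_component U (b i) (b j) >]).
  by move=> i j k /asboolP h1 /asboolP h2; apply/asboolP; exact: connected_component_trans h1 h2.
have [||||rep1 rep1P c1] := @reps m.+1 e1 n1.
- by move=> i; apply/asboolP; apply: connected_component_refl; exact: (Ob i).1.
- exact: sym.
- exact: trans.
- move=> n s hs; apply: (H1 w n (fun i => b1 (s i)) w0) => [i|i j h]; first exact: (Ob _).1.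
  by apply: hs; apply/asboolP.
have [||||rep2 rep2P c2] := @reps m.+1 e2 n2.
- by move=> i; apply/asboolP; apply: connected_component_refl; exact: (Ob i).2.
- exact: sym.
- exact: trans.
- move=> n s hs; apply: (H2 w n (fun i => b2 (s i)) w0) => [i|i j h]; first exact: (Ob _).2.
  by apply: hs; apply/asboolP.
apply: leq_trans (leq_mul c1 c2); rewrite -cardsX.
have inj : injective (fun i => (rep1 i, rep2 i)).
  move=> i j [/rep1P/asboolP h1 /rep2P/asboolP h2]; apply: pinj; apply/eqP; apply: contrapT => /negP ne.
  apply: (no_double (pw i).1 (pw j).1 ne _ (xP i) (xP j)); rewrite (pw i).2 //; by rewrite (pw j).2.
rewrite -[m.+1 in X in (X <= _)%N]card_ord -cardsT -(card_imset [set: 'I_m.+1]%SET inj); apply: subset_leq_card.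
by apply/fintype.subsetP => _ /imsetP[i _ ->]; rewrite inE /=; apply/andP; split; apply: imset_f.
Qed.

End Fix.
End FiniteValence.

(** * Properness *)

Section Proper.
Context {R : realType}.
Implicit Types (z w y b c : R[i]) (e s t p d : R) (S X D T W U : set R[i]).

Lemma multi_bolzano n (u : nat -> 'I_n -> R[i]) (M : R) : (forall k j, N (u k j) <= M) ->
  exists f (l : 'I_n -> R[i]), incr f /\ forall j, tendsto (fun k => u (f k) j) (l j).
Proof.
move=> uM; suff H m : exists f (l : 'I_n -> R[i]), incr f /\ forall j : 'I_n, (j < m)%N -> tendsto (fun k => u (f k) j) (l j).
  by have [f [l [If h]]] := H n; exists f, l; split => // j; apply: h.
elim: m => [|m [f [l [If h]]]]; first by exists id, (fun=> 0); split => // k; exact: leqnn.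
have [mn|nm] := ltnP m n; last by exists f, l; split => // j _; apply: h; apply: leq_trans (ltn_ord j) nm.
pose jm := Ordinal mn.
have [x [g [Ig hg]]] := @bolzano R (fun k => u (f k) jm) M (fun k => uM _ _).
exists (f \o g), (fun j => if j == jm then x else l j); split; first exact: incr_comp.
move=> j; case: eqP => [-> _|ne]; first exact: hg.
rewrite ltnS leq_eqVlt => /orP[/eqP jE|jm']; first by case: ne; exact: val_inj.
exact: (tendsto_sub Ig (h j jm')).
Qed.

Lemma N_prod (I : Type) (s : seq I) (P : pred I) (f : I -> R[i]) :
  N (\prod_(i <- s | P i) f i) = \prod_(i <- s | P i) N (f i).
Proof. by apply: (big_morph N _ N1) => x y; exact: NM. Qed.

Lemma prod_le_factor (I : finType) (P : pred I) (f : I -> R) i : P i ->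
  (forall j, P j -> 0 <= f j <= 1) -> \prod_(j | P j) f j <= f i.
Proof.
move=> Pi f01; rewrite (bigD1 i) //=; have /andP[f0 _] := f01 i Pi.
rewrite ler_piMr //; apply: prodr_ile1 => j /andP[Pj _]; exact: f01.
Qed.

Lemma holo_prod (I : Type) (s : seq I) (P : pred I) (U : set R[i]) (f : I -> R[i] -> R[i]) :
  (forall i, holo U (f i)) -> holo U (fun w => \prod_(i <- s | P i) f i w).
Proof.
move=> hf w Uw; elim: s => [|a s [m hm]].
  by exists 0; apply: der_near (der_cst 1 w); apply: filterS (@filterT _ (nbhs w) _) => y _; rewrite big_nil.
have [l hl] := hf a w Uw.
case Pa: (P a).
  exists (l * (\prod_(i <- s | P i) f i w) + f a w * m); apply: der_near (derM hl hm).
  by apply: filterS (@filterT _ (nbhs w) _) => y _; rewrite big_cons Pa.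
by exists m; apply: der_near hm; apply: filterS (@filterT _ (nbhs w) _) => y _; rewrite big_cons Pa.
Qed.

(** The exterior of a disc is the image of a half-plane under [cexp]. *)
Lemma conn_exterior (x : R) : 0 < x -> connected [set z : R[i] | x < N z].
Proof.
move=> x0; have -> : [set z : R[i] | x < N z] = cexp @` [set w | ln x < Re w].
  apply/seteqP; split => [z /= xz|_ [w /= xw <-]]; last first.
    by rewrite N_cexp -[x]lnK ?posrE // ltr_expR.
  have z0 : z != 0 by rewrite -N_gt0P (lt_trans x0).
  have [w wz] := cexp_surj z0; exists w => //; rewrite /mkset.
  by rewrite -ltr_expR lnK ?posrE // -N_cexp wz.
apply: connected_continuous_connected.
  apply: conn_convx => a b t /= xa xb /andP[t0 t1]; rewrite ReD ReM /= mul0r subr0 ReB.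
  have [->|t0'] := eqVneq t 0; first by rewrite mul0r addr0.
  have tp : 0 < t by rewrite lt_neqAle eq_sym t0'.
  have h1 : 0 <= (1 - t) * (Re a - ln x) by rewrite mulr_ge0 ?subr_ge0 // ltW.
  have h2 : 0 < t * (Re b - ln x) by rewrite mulr_gt0 // subr_gt0.
  by move: h1 h2; clear; nra.
apply: continuous_subspaceT => w B /nbhsCP[e e0 eB]; apply/nbhsCP.
have [d d0 Hd] := iffLR (ccE _ _) (der_cc (der_cexp w)) e e0.
by exists d => // y /Hd; exact: eB.
Qed.

Section Fix.
Variables (F : R[i] -> R[i]) (r : R) (G : set R[i]) (v : R[i] -> R[i]).
Hypothesis H : tract F r G v.

Definition simple z := exists (p : R) (g : R[i] -> R[i]), 0 < p /\ order_form v z p 0 g.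

Lemma simple_der z : simple z -> exists2 l, der v z l & l != 0.
Proof.
move=> [p [g [p0 [gh g0 gE]]]]; exists (g z) => //; apply: derI.
  by apply/nbhsCP; exists p => // y yz; rewrite gE // expr1 addrC addKr mulrC.
exact: holo_cc gh (oball_center z p0).
Qed.

Lemma inj_simple z (p : R) : G z -> 0 < p ->
  (forall y y', N (y - z) < p -> N (y' - z) < p -> v y = v y' -> y = y') -> simple z.
Proof.
move=> Gz p0 inj; have [p' [k [g [p'0 _ ord]]]] := tr_order H Gz.
case: k ord => [|k] ord; first by exists p', g.
have [w [z1 [z2 [_ ne [h1 h2] [e1 e2]]]]] := two_preimages p'0 ord p0 ltr01.
by case/eqP: ne; apply: inj => //; rewrite e1 e2.
Qed.

(** Existence comes from the open mapping theorem and uniqueness from [local_inj]. Differentiability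
    at every nearby [w] holds because injectivity makes all points of the ball simple. *)
Lemma tr_inverse z0 (p : R) : G z0 -> simple z0 -> 0 < p -> exists (d p1 : R) (tau : R[i] -> R[i]),
  [/\ 0 < d, 0 < p1 <= p, oball z0 p1 `<=` G,
     forall w, N (w - v z0) < d -> [/\ N (tau w - z0) < p1, v (tau w) = w & exists l, der tau w l] &
     forall z, N (z - z0) < p1 -> N (v z - v z0) < d -> tau (v z) = z].
Proof.
move=> Gz0 [p' [g [p'0 ord]]] p0; have [e e0 He] := tr_op H Gz0.
have [d1 d10 inj] := local_inj p'0 ord.
pose p1 := Num.min p (Num.min e d1).
have p10 : 0 < p1 by rewrite !lt_min p0 e0.
have [p1p p1e p1d] : [/\ p1 <= p, p1 <= e & p1 <= d1] by rewrite /p1 !ge_min !lexx !orbT.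
have {}inj y y' : N (y - z0) < p1 -> N (y' - z0) < p1 -> v y = v y' -> y = y'.
  by move=> h1 h2; apply: inj; [exact: lt_le_trans h1 p1d|exact: lt_le_trans h2 p1d].
have pG : oball z0 p1 `<=` G by move=> z zp; apply: He; exact: lt_le_trans zp p1e.
have [d d0 Hd] := open_mapping p'0 ord p10.
have Ht w : exists z, N (w - v z0) < d -> N (z - z0) < p1 /\ v z = w.
  by have [/Hd[z h1 h2]|_] := ltP (N (w - v z0)) d; [exists z|exists 0].
pose tau w := sval (cid (Ht w)).
have tauP w : N (w - v z0) < d -> N (tau w - z0) < p1 /\ v (tau w) = w := svalP (cid (Ht w)).
exists d, p1, tau; split => //; first by rewrite p10.
  move=> w wd; have [t1 t2] := tauP w wd; split => //.
  have Gt : G (tau w) by exact: pG.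
  have g0 : 0 < p1 - N (tau w - z0) by rewrite subr_gt0.
  have inb y : N (y - tau w) < p1 - N (tau w - z0) -> N (y - z0) < p1.
    by have := NBD (tau w) y z0; lra.
  have /simple_der[l hl l0] : simple (tau w).
    by apply: (inj_simple Gt g0) => y y' /inb h1 /inb h2; exact: inj.
  have wd0 : 0 < d - N (w - v z0) by rewrite subr_gt0.
  have near y : N (y - w) < d - N (w - v z0) -> N (y - v z0) < d by have := NBD w y (v z0); lra.
  exists l^-1; apply: (der_inv _ _ hl l0); last first.
    by apply/nbhsCP; exists (d - N (w - v z0)) => // y /near/tauP[].
  apply/ccE => e1 e10; have [p2 [k [g2 [p20 _ ord2]]]] := tr_order H Gt.
  have m0 : 0 < Num.min e1 (p1 - N (tau w - z0)) by rewrite lt_min e10.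
  have [d2 d20 Hd2] := open_mapping p20 ord2 m0.
  exists (Num.min d2 (d - N (w - v z0))); first by rewrite lt_min d20.
  move=> y; rewrite lt_min => /andP[yd2 /near/tauP[h1 h2]].
  have [z] := Hd2 y (ltac:(by rewrite t2)); rewrite lt_min => /andP[ze /inb zp] vz.
  by rewrite -(inj z (tau y)) // h2.
move=> z zp vz; have [h1 h2] := tauP _ vz; exact: inj.
Qed.

Definition pre w n (zs : 'I_n -> R[i]) := injective zs /\ forall i, G (zs i) /\ v (zs i) = w.

Lemma pre_add w n (zs : 'I_n -> R[i]) z : pre w zs -> G z -> v z = w -> (forall j, zs j != z) ->
  pre w (fun i : 'I_n.+1 => if unlift ord0 i is Some j then zs j else z).
Proof.
move=> [zi zG] Gz vz ne; split=> [i j|i]; last by case: unliftP => [j _|_] //; exact: zG.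
case: unliftP => [i' ->|->]; case: unliftP => [j' ->|->] //.
- by move=> /zi ->.
- by move=> /eqP; rewrite (negbTE (ne i')).
- by move=> /esym/eqP; rewrite (negbTE (ne j')).
Qed.

Lemma family_sep n (zs : 'I_n -> R[i]) : injective zs -> exists2 e, 0 < e &
  forall i j, i != j -> 2 * e <= N (zs i - zs j).
Proof.
move=> zi; have Hx (ij : 'I_n * 'I_n) : exists e : R, 0 < e /\ (ij.1 != ij.2 -> 2 * e <= N (zs ij.1 - zs ij.2)).
  have [->|ne] := eqVneq ij.1 ij.2; first by exists 1.
  exists (N (zs ij.1 - zs ij.2) / 2); split=> [|_]; last by rewrite mulrCA divff ?mulr1.
  by rewrite divr_gt0 // N_gt0P subr_eq0; apply: contra_neq ne => /zi.
pose x ij := sval (cid (Hx ij)).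
have xP ij : 0 < x ij /\ (ij.1 != ij.2 -> 2 * x ij <= N (zs ij.1 - zs ij.2)) := svalP (cid (Hx ij)).
have [e [e0 eE]] : exists e : R, 0 < e /\ forall ij, e <= x ij.
  exists (\big[Num.min/1]_ij x ij); split; last by move=> ij; exact: bigmin_le_cond.
  by apply/bigmin_gtP; split => // ij _; case: (xP ij).
exists e => // i j ne; have [_ /(_ ne)] := xP (i, j); have := eE (i, j); rewrite /=; lra.
Qed.

Section Max.
Variables (wst : R[i]) (rho : R) (n : nat).
Hypothesis Hmax : forall w m (zs : 'I_m -> R[i]), N (w - wst) < rho -> pre w zs -> (m <= n)%N.

Lemma pre_all w (zs : 'I_n -> R[i]) z : N (w - wst) < rho -> pre w zs -> G z -> v z = w ->
  exists j, z = zs j.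
Proof.
move=> wr hz Gz vz; apply: contrapT => h.
have ne j : zs j != z by apply/eqP => E; apply: h; exists j.
by have := Hmax wr (pre_add hz Gz vz ne); rewrite ltnn.
Qed.

(** At a critical member some nearby value has two preimages close to [zs j] and one close to each
    other member, which exceeds the maximum [n]. *)
Lemma pre_simple w (zs : 'I_n -> R[i]) j : N (w - wst) < rho -> pre w zs -> simple (zs j).
Proof.
move=> wr [zi zG]; have [p [k [g [p0 pG ord]]]] := tr_order H (zG j).1.
case: k ord => [|k] ord; first by exists p, g.
exfalso; have [e e0 He] := family_sep zi.
have Hx i : exists d : R, 0 < d /\ forall w', N (w' - w) < d -> exists2 z, G z /\ N (z - zs i) < e & v z = w'.
  have [p' [k' [g' [p'0 p'G ord']]]] := tr_order H (zG i).1.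
  have m0 : 0 < Num.min e p' by rewrite lt_min e0.
  have [d d0 Hd] := open_mapping p'0 ord' m0; exists d; split => // w'.
  rewrite -(zG i).2 => /Hd[z]; rewrite lt_min => /andP[h1 h2] h3; exists z => //.
  by split => //; exact: p'G.
pose x i := sval (cid (Hx i)); have xP i := svalP (cid (Hx i)).
have [d [d0 dE]] : exists d : R, 0 < d /\ forall i, d <= x i.
  exists (\big[Num.min/1]_i x i); split; last by move=> i; exact: bigmin_le_cond.
  by apply/bigmin_gtP; split => // i _; case: (xP i).
have m0 : 0 < Num.min e p by rewrite lt_min e0.
have d'0 : 0 < Num.min d (rho - N (w - wst)) by rewrite lt_min d0 subr_gt0.
have [w' [z1 [z2 [+ ne [+ +] [v1 v2]]]]] := two_preimages p0 ord m0 d'0.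
rewrite (zG j).2 !lt_min => /andP[wd wr'] /andP[z1e z1p] /andP[z2e z2p].
have Hy i : exists y, [/\ G y, N (y - zs i) < e, v y = w' & i = j -> y = z1].
  have [->|ij] := eqVneq i j; first by exists z1; split => //; exact: pG.
  have [_ /(_ w' (lt_le_trans wd (dE i)))[y [Gy ye] vy]] := xP i.
  by exists y; split => // E; rewrite E eqxx in ij.
pose ys i := sval (cid (Hy i)).
have ysP i : [/\ G (ys i), N (ys i - zs i) < e, v (ys i) = w' & i = j -> ys i = z1] := svalP (cid (Hy i)).
have preY : pre w' ys.
  split=> [a b E|i]; last by have [? _ ? _] := ysP i.
  apply/eqP; apply: contrapT => /negP/He; have [_ h1 _ _] := ysP a; have [_ h2 _ _] := ysP b.
  move: h1 h2; rewrite -/(ys a) -/(ys b) E => h1 h2.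
  by have := NBD (ys b) (zs a) (zs b); rewrite (NC (zs a) (ys b)); lra.
have : (n.+1 <= n)%N.
  apply: (Hmax (w := w')); first by apply: le_lt_trans (NBD w w' wst) _; rewrite -ltrBrDr.
  apply: (pre_add (z := z2) preY (pG _ z2p)) => // i; apply/eqP => E.
  have [ij|ij] := eqVneq i j.
    by have [_ _ _ /(_ ij) E'] := ysP i; rewrite -/(ys i) E in E'; rewrite E' eqxx in ne.
  have := He _ _ ij; have [_ h1 _ _] := ysP i; rewrite -/(ys i) E in h1.
  by have := NBD z2 (zs i) (zs j); rewrite (NC (zs i) z2); lra.
by rewrite ltnn.
Qed.

(** The local inverses at the members have disjoint ranges, so their values form a maximal family
    for every nearby point. *)
Lemma pre_branches w (zs : 'I_n -> R[i]) : N (w - wst) < rho -> pre w zs ->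
  exists (d : R) (tau : 'I_n -> R[i] -> R[i]), [/\ 0 < d,
    forall w', N (w' - w) < d -> N (w' - wst) < rho /\ pre w' (fun j => tau j w') &
    forall j, holo (oball w d) (tau j)].
Proof.
move=> wr hz; have [zi zG] := hz; have [e e0 He] := family_sep zi.
have Hx j : exists x : R * (R[i] -> R[i]), 0 < x.1 /\ forall w', N (w' - w) < x.1 ->
    [/\ G (x.2 w'), N (x.2 w' - zs j) < e, v (x.2 w') = w' & exists l, der x.2 w' l].
  have [d [p1 [tau [d0 /andP[p10 p1e] pG h1 _]]]] := tr_inverse (zG j).1 (pre_simple j wr hz) e0.
  exists (d, tau); split => //= w'; rewrite -(zG j).2 => /h1[a1 a2 a3].
  by split => //; [exact: pG|exact: lt_le_trans a1 p1e].
pose x i := sval (cid (Hx i)); have xP i := svalP (cid (Hx i)).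
have [d [d0 dE]] : exists d : R, 0 < d /\ forall i, d <= (x i).1.
  exists (\big[Num.min/1]_i (x i).1); split; last by move=> i; exact: bigmin_le_cond.
  by apply/bigmin_gtP; split => // i _; case: (xP i).
have r0 : 0 < rho - N (w - wst) by rewrite subr_gt0.
exists (Num.min d (rho - N (w - wst))), (fun i => (x i).2); split.
- by rewrite lt_min d0.
- move=> w'; rewrite lt_min => /andP[w1 w2]; split; first by have := NBD w w' wst; lra.
  have hx i := (xP i).2 w' (lt_le_trans w1 (dE i)).
  split=> [a b E|i]; last by have [? _ ? _] := hx i.
  apply/eqP; apply: contrapT => /negP/He; have [_ h1 _ _] := hx a; have [_ h2 _ _] := hx b.
  move: h1 h2; rewrite -/(x a) -/(x b) E => h1 h2.
  by have := NBD ((x b).2 w') (zs a) (zs b); rewrite (NC (zs a) ((x b).2 w')); lra.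
- move=> j w'; rewrite /oball /= lt_min => /andP[w1 _].
  by have [_ _ _] := (xP j).2 w' (lt_le_trans w1 (dE j)).
Qed.

End Max.
End Fix.
End Proper.

(** * The discriminant of the preimages and properness of [v] *)

Section Properness.
Context {R : realType}.
Implicit Types (z w y b c : R[i]) (e s t p d : R) (X D T W U : set R[i]).

Section Disc.
Variables (h : R[i] -> R[i]) (n : nat).

(* Vanishes exactly when two members of the family coincide or some [h z_j] is [0]. *)
Definition discr (zs : 'I_n -> R[i]) : R[i] :=
  (\prod_j h (zs j)) * \prod_(ij : 'I_n * 'I_n | ij.1 != ij.2) (h (zs ij.1) - h (zs ij.2)).

(** Taking ordered pairs in the discriminant leaves no sign, so it depends only on the set of
    preimages. *)
Lemma discr_perm zs (sg : 'I_n -> 'I_n) : injective sg -> discr (fun j => zs (sg j)) = discr zs.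
Proof.
move=> si; congr (_ * _); first by rewrite [RHS](reindex_inj si).
have pi_inj : injective (fun ij : 'I_n * 'I_n => (sg ij.1, sg ij.2)).
  by move=> [a b] [a' b'] /= [/si -> /si ->].
rewrite [RHS](reindex_inj pi_inj) /=; apply: eq_bigl => ij; by rewrite (inj_eq si).
Qed.

Lemma discr_le zs : (forall j, N (h (zs j)) <= 1 / 2) ->
  [/\ N (discr zs) <= 1, forall j, N (discr zs) <= N (h (zs j)) &
      forall i j, i != j -> N (discr zs) <= N (h (zs i) - h (zs j))].
Proof.
move=> h2; rewrite /discr NM !N_prod.
have b1 j : true -> 0 <= N (h (zs j)) <= 1 by rewrite N_ge0 /= => _; have := h2 j; lra.
have b2 (ij : 'I_n * 'I_n) : ij.1 != ij.2 -> 0 <= N (h (zs ij.1) - h (zs ij.2)) <= 1.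
  rewrite N_ge0 /= => _; apply: le_trans (NB _ _) _; have := h2 ij.1; have := h2 ij.2; lra.
have p1 : 0 <= \prod_j N (h (zs j)) <= 1.
  by rewrite prodr_ge0 ?prodr_ile1 // => j _; exact: N_ge0.
have p2 : 0 <= \prod_(ij : 'I_n * 'I_n | ij.1 != ij.2) N (h (zs ij.1) - h (zs ij.2)) <= 1.
  by rewrite prodr_ge0 ?prodr_ile1 // => j _; exact: N_ge0.
case/andP: p1 => p10 p11; case/andP: p2 => p20 p21; split.
- by apply: le_trans (ler_piMr p10 p21) p11.
- by move=> j; apply: le_trans (ler_piMr p10 p21) _; exact: (prod_le_factor (f := fun j => N (h (zs j)))).
- move=> i j ij; apply: le_trans (ler_piMl p20 p11) _.
  exact: (@prod_le_factor _ _ (fun ij => ij.1 != ij.2) (fun ij => N (h (zs ij.1) - h (zs ij.2))) (i, j)).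
Qed.

Lemma discr_neq0 zs : injective zs -> (forall j, h (zs j) != 0) ->
  (forall i j, h (zs i) = h (zs j) -> zs i = zs j) -> discr zs != 0.
Proof.
move=> zi h0 hi; apply: mulf_neq0; apply/prodf_neq0; first by move=> j _; exact: h0.
by move=> ij ne; rewrite subr_eq0; apply: contra_neq ne => /hi/zi.
Qed.

End Disc.

Section Fix.
Variables (F : R[i] -> R[i]) (r : R) (G : set R[i]) (v : R[i] -> R[i]).
Hypothesis H : tract F r G v.

(** An inversion about a point [c] with [|F c| > r], hence at positive distance from [G]. The
    normalization to [|h| <= 1 / 2] makes every factor of the discriminant at most 1 in modulus, and
    [h] is small only far out. *)
Lemma outer_function : exists (h : R[i] -> R[i]) (ka : R) c, [/\ 0 < ka,
  forall z, G z -> N (h z) <= 1 / 2 /\ h z != 0,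
  forall z, G z -> N (h z) * (2 * N (z - c)) = ka,
  forall z z', G z -> G z' -> h z = h z' -> z = z' &
  holo G h].
Proof.
have [c _ Fc] := tr_unbounded H 0.
have FNc := rcc_N (holo_cc (z := c) (tr_F H) I).
have [ka ka0 Hk] := FNc _ (ltac:(by rewrite subr_gt0; exact: Fc) : 0 < N (F c) - r).
have Gk z : G z -> ka <= N (z - c).
  move=> Gz; rewrite leNgt; apply/negP => /(Hk z I); rewrite ltr_norml => /andP[h1 _].
  by have := tr_sub H Gz; lra.
have ne z : G z -> z - c != 0 by move=> /Gk h; rewrite -N_gt0P; lra.
have kc : ka%:C != 0 :> R[i] by rewrite -N_gt0P NReal normr_gt0 gt_eqF.
have N2 : N (2 : R[i]) = 2 by rewrite (_ : 2 = 2%:C) ?NReal ?ger0_norm // rmorph_nat.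
exists (fun z => ka%:C / (2 * (z - c))), ka, c; split=> //.
- move=> z Gz; have n0 : 0 < N (z - c) by rewrite N_gt0P ne.
  split; last by rewrite mulf_neq0 ?invr_eq0 ?mulf_neq0 ?ne ?pnatr_eq0.
  rewrite NM NV NM N2 NReal gtr0_norm // ler_pdivrMr ?mulr_gt0 //.
  by rewrite mulrA divfK ?pnatr_eq0 // mul1r; exact: Gk.
- move=> z Gz; have n0 : 0 < N (z - c) by rewrite N_gt0P ne.
  by rewrite NM NV NM N2 NReal gtr0_norm // divfK // gt_eqF // mulr_gt0.
- move=> z z' Gz Gz' /(mulfI kc)/invr_inj/mulfI E; have two : 2 != 0 :> R[i] by rewrite pnatr_eq0.
  by have /addIr := E two.
- move=> z Gz; eexists; apply: derZ; apply: (derV (h := fun y => 2 * (y - c))).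
    by rewrite mulf_neq0 ?ne ?pnatr_eq0.
  by apply: derZ; apply: derBc; exact: der_id.
Qed.

Hypothesis valence : exists n0 : nat, forall m (zs : 'I_m -> R[i]) w, pre G v w zs -> (m <= n0)%N.

Theorem proper wst : 0 < Re wst ->
  exists e Rb : R, 0 < e /\ forall z, G z -> N (v z - wst) < e -> N z <= Rb.
Proof.
move=> w0; apply: contrapT => notprop.
(* The least [n] bounding the number of preimages over some disc about [wst]; by minimality points
   with exactly [n] preimages accumulate at [wst]. *)
pose Q n := `[< exists rho : R, [/\ 0 < rho, rho <= Re wst / 2 &
  forall w m (zs : 'I_m -> R[i]), N (w - wst) < rho -> pre G v w zs -> (m <= n)%N] >].
have Qex : exists n, Q n.
  have [n0 Hn0] := valence; exists n0; apply/asboolP; exists (Re wst / 2); split => //; first by lra.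
  by move=> w m zs _; exact: Hn0.
case: (ex_minnP Qex) => n /asboolP[rho [rho0 rhow Hmax]] nmin.
have dense rho' : 0 < rho' -> rho' <= rho -> exists w (zs : 'I_n -> R[i]), N (w - wst) < rho' /\ pre G v w zs.
  move=> r'0 r'r; apply: contrapT => hn.
  case: n Hmax nmin hn => [|k] Hmax nmin hn.
    by apply: hn; exists wst, (fun=> 0); rewrite subrr N0; split => //; split=> [[]|[]].
  suff /nmin : Q k by rewrite ltnn.
  apply/asboolP; exists rho'; split=> [//||w m zs wr hz]; first exact: le_trans rhow.
  have mk : (m <= k.+1)%N by apply: (Hmax w m zs) => //; exact: lt_le_trans wr r'r.
  rewrite leqNgt; apply/negP => km; have mE : m = k.+1 by apply/eqP; rewrite eqn_leq mk.
  by subst m; apply: hn; exists w, zs.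
pose p := rho / 20; have p0 : 0 < p by rewrite divr_gt0.
have [h [ka [c [ka0 h12 hE hinj hh]]]] := outer_function.
have preG w (zs : 'I_n -> R[i]) : pre G v w zs -> forall j, N (h (zs j)) <= 1 / 2.
  by move=> [_ zG] j; have [] := h12 _ (zG j).1.
have pre0 w (zs : 'I_n -> R[i]) : pre G v w zs -> discr h zs != 0.
  move=> [zi zG]; apply: discr_neq0 => // [j|i j]; first by have [] := h12 _ (zG j).1.
  by apply: hinj; [exact: (zG i).1|exact: (zG j).1].
pose Om := [set w | N (w - wst) < rho /\ exists zs : 'I_n -> R[i], pre G v w zs].
have Hz w : exists zs : 'I_n -> R[i], Om w -> pre G v w zs.
  by have [[_ [zs hz]]|nO] := pselect (Om w); [exists zs|exists (fun=> 0)].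
pose zw w := sval (cid (Hz w)); have zwP w : Om w -> pre G v w (zw w) := svalP (cid (Hz w)).
(* The modulus of the discriminant, extended by 0 to points with fewer than [n] preimages. *)
pose Pw := ext Om (fun w => N (discr h (zw w))).
have Pw1 w : Pw w <= 1.
  rewrite /Pw; have [ow|nO] := pselect (Om w); last by rewrite ext_out.
  by rewrite ext_in //; have [] := discr_le (preG _ _ (zwP w ow)).
have Pwin w : 0 < Pw w -> Om w.
  by move=> P0; apply: contrapT => nO; move: P0; rewrite /Pw ext_out // ltxx.
(* Near a point with [n] preimages, [Pw] is the modulus of a zero-free value of a holomorphic
   function of the inverse branches; the chosen enumerations may differ, but only by
   permutations. *)
have local w : Om w -> exists (d : R) (f : R[i] -> R[i]), [/\ 0 < d, holo (oball w d) f, f w != 0 &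
   forall w', N (w' - w) < d -> Om w' /\ Pw w' = N (f w')].
  move=> [wr [zs hz]]; have [d [tau [d0 Ht th]]] := pre_branches H Hmax wr hz.
  have tG w' j : N (w' - w) < d -> G (tau j w') by move=> /Ht[_ [_ /(_ j)[]]].
  have Hw : holo (oball w d) (fun w' => discr h (fun j => tau j w')).
    have hk j : holo (oball w d) (fun w' => h (tau j w')).
      move=> w' w'd; have [l hl] := th j w' w'd; have [m hm] := hh _ (tG w' j w'd).
      by exists (m * l); exact: der_comp hl hm.
    have g1 := @holo_prod R 'I_n (index_enum 'I_n) predT _ _ hk.
    have hk2 (ij : 'I_n * 'I_n) : holo (oball w d) (fun w' => h (tau ij.1 w') - h (tau ij.2 w')).
      move=> w' w'd; have [l hl] := hk ij.1 w' w'd; have [m hm] := hk ij.2 w' w'd.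
      by exists (l - m); exact: derB.
    have g2 := @holo_prod R _ (index_enum _) (fun ij : 'I_n * 'I_n => ij.1 != ij.2) _ _ hk2.
    move=> w' w'd; have [l hl] := g1 w' w'd; have [m hm] := g2 w' w'd.
    by eexists; exact: (derM hl hm).
  exists d, (fun w' => discr h (fun j => tau j w')); split => //.
    by have [_ /pre0] := Ht w (oball_center w d0).
  move=> w' w'd; have [w'r prt] := Ht w' w'd.
  have ow' : Om w' by split => //; exists (fun j => tau j w').
  split => //; rewrite /Pw ext_in //; have [zi zG] := zwP w' ow'.
  have Hs j := pre_all Hmax w'r prt (zG j).1 (zG j).2.
  pose sg j := sval (cid (Hs j)); have sgP j : zw w' j = tau (sg j) w' := svalP (cid (Hs j)).
  have si : injective sg by move=> i j E; apply: zi; rewrite !sgP E.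
  by rewrite -(discr_perm h (fun j => tau j w') si); congr (N (discr h _)); apply/funext.
have inv_gt0 (k : nat) : 0 < k.+1%:R^-1 :> R by rewrite invr_gt0 ltr0n.
have x00 : 0 < Re wst / 2 by lra.
have Rew w : N (w - wst) < rho -> Re wst / 2 <= Re w.
  by move=> wr; have := le_lt_trans (Re_le_N (w - wst)) wr; rewrite ReB ltr_norml => /andP[? _]; lra.
have Pwc w : N (w - wst) < rho -> rcc Pw w.
  move=> wr; have [ow|nO] := pselect (Om w).
    have [d [f [d0 fh f0 fE]]] := local w ow.
    apply: rcc_near (rcc_N (holo_cc fh (oball_center w d0))).
    by apply/nbhsCP; exists d => // y /fE[_ ->].
  (* If [Pw] did not tend to 0 at a point with fewer preimages, the families at nearby points would
     stay bounded, since [|h| >= e], and separated, and in the limit would give [n] distinct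
     preimages. *)
  move=> e e0; apply: contrapT => hn.
  have Hw k : exists y, [/\ N (y - w) < k.+1%:R^-1, N (y - wst) < rho, Om y & e <= N (discr h (zw y))].
    apply: contrapT => h'; apply: hn.
    exists (Num.min k.+1%:R^-1 (rho - N (w - wst))); first by rewrite lt_min inv_gt0 subr_gt0.
    move=> y _; rewrite lt_min => /andP[y1 y2]; rewrite /Pw (ext_out _ nO) subr0.
    have [oy|noy] := pselect (Om y); last by rewrite ext_out // normr0.
    rewrite ext_in // ger0_norm ?N_ge0 // ltNge; apply/negP => le.
    by apply: h'; exists y; split => //; have := NBD w y wst; lra.
  pose ws k := sval (cid (Hw k)).
  have wsP k : [/\ N (ws k - w) < k.+1%:R^-1, N (ws k - wst) < rho, Om (ws k) & e <= N (discr h (zw (ws k)))] := svalP (cid (Hw k)).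
  have uG k j : [/\ G (zw (ws k) j), v (zw (ws k) j) = ws k & e <= N (h (zw (ws k) j))].
    have [_ _ ok ek] := wsP k; have [_ zG] := zwP _ ok; have [? ?] := zG j; split => //.
    by apply: le_trans ek _; have [_ le _] := discr_le (preG _ _ (zwP _ ok)).
  have uB k j : N (zw (ws k) j) <= ka / e + N c.
    have [Gz _ ez] := uG k j; have E := hE _ Gz.
    have : N (zw (ws k) j - c) <= ka / e.
      rewrite ler_pdivlMr // -E; have := N_ge0 (zw (ws k) j - c); move: ez e0; clear.
      move: (N (h _)) (N (_ - c)) => a b ea e0 b0; have := ler_wpM2l b0 ea.
      have : 0 <= b * a by rewrite mulr_ge0 // (le_trans (ltW e0)).
      lra.
    by have := N_sub (zw (ws k) j) c; lra.
  have [f [l [If lim]]] := multi_bolzano uB.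
  have lG j : G (l j).
    have : closure [set y | G y /\ Re wst / 2 <= Re (v y)] (l j).
      apply/clE => e1 e10; have [K HK] := lim j e1 e10.
      have [Gz vz _] := uG (f K) j; have [_ wr' _ _] := wsP (f K).
      by exists (zw (ws (f K)) j); [split; rewrite ?vz //; exact: Rew|exact: HK].
    by case/(tr_clRe H x00).
  have lv j : v (l j) = w.
    apply: contrapT => /eqP; rewrite -subr_eq0 -N_gt0P => nz.
    have nz2 : 0 < N (v (l j) - w) / 2 by rewrite divr_gt0.
    have [d d0 Hd] := iffLR (ccE v (l j)) (tr_cc H (lG j)) _ nz2.
    have [K HK] := lim j d d0; have [K' HK'] := ltr_add_invr nz2; rewrite add0r in HK'.
    pose k := maxn K K'; have [_ vk _] := uG (f k) j; have [wk _ _ _] := wsP (f k).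
    have h1 := Hd _ (HK k (leq_maxl _ _)); rewrite vk in h1.
    have le : (f k).+1%:R^-1 <= K'.+1%:R^-1 :> R.
      rewrite lef_pV2 ?posrE ?ltr0n // ler_nat ltnS; apply: leq_trans (incr_ge If k); exact: leq_maxr.
    have h2 := lt_trans (lt_le_trans wk le) HK'.
    have h3 := NBD (ws (f k)) (v (l j)) w; rewrite (NC (v (l j)) (ws (f k))) in h3.
    by move: h1 h2 h3; clear; move: (N (ws _ - w)) (N (ws _ - v _)) (N (v _ - w)) => a1 a2 a3; lra.
  have li : injective l.
    move=> i j E; apply/eqP; apply: contrapT => /negP ne.
    have e4 : 0 < e / 4 by rewrite divr_gt0.
    have [d d0 Hd] := iffLR (ccE h (l i)) (holo_cc hh (lG i)) _ e4.
    have [K HK] := lim i d d0; have [K' HK'] := lim j d d0.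
    pose k := maxn K K'.
    have h1 := Hd _ (HK k (leq_maxl _ _)); have := Hd (zw (ws (f k)) j); rewrite E => h2.
    have {}h2 := h2 (HK' k (leq_maxr _ _)); rewrite -E in h2.
    have [_ _ ok ek] := wsP (f k).
    have [_ _ /(_ i j ne) le] := discr_le (preG _ _ (zwP _ ok)).
    have := NBD (h (l i)) (h (zw (ws (f k)) i)) (h (zw (ws (f k)) j)).
    by rewrite (NC (h (l i))); lra.
  by apply: nO; split => //; exists l; split => // j.
have sc L (A : set R[i]) w : N (w - wst) < rho -> rcont A (fun w => ln (Num.max (Pw w) (expR (- L)))) w.
  move=> wr; apply: rcc_rcont; apply: rcc_ln; first by rewrite lt_max expR_gt0 orbT.
  by apply: rcc_max; exact: Pwc.
have p10 : 10 * p = rho / 2 by rewrite /p; field.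
(* A circle on which every point has [n] preimages; otherwise [capacity], applied to the truncated
   logarithm of [Pw], contradicts [Pw y > 0]. *)
have [t [tp tE]] : exists t, p <= t <= 2 * p /\ forall w, N (w - wst) = t -> Om w.
  apply: contrapT => hn.
  have [y [zs [yr hz]]] := dense p p0 (ltac:(rewrite /p; lra)).
  have oy : Om y by split; [rewrite /p in yr; lra|exists zs].
  have Py : 0 < Pw y by rewrite /Pw ext_in // N_gt0P; apply: pre0; exact: zwP.
  have lPy : ln (Pw y) <= 0 by rewrite -ln1 ler_ln ?posrE.
  (* Then [- (L / 20) = ln (Pw y) - 1], which is less than [ln (Pw y)]. *)
  pose L := 20 * (1 - ln (Pw y)); have L0 : 0 < L by rewrite /L; lra.
  have mx w : 0 < Num.max (Pw w) (expR (- L)) by rewrite lt_max expR_gt0 orbT.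
  suff : ln (Num.max (Pw y) (expR (- L))) <= - (L / 20).
    have : ln (Pw y) <= ln (Num.max (Pw y) (expR (- L))) by rewrite ler_ln ?posrE // le_max lexx.
    by rewrite /L; lra.
  apply: (@capacity R (fun w => ln (Num.max (Pw w) (expR (- L)))) wst p L p0 L0); last by lra.
  - by move=> w; rewrite /cball /= p10 => wp; apply: sc; lra.
  - move=> w _; rewrite -ln1 ler_ln ?posrE // ge_max Pw1 -[leRHS]expR0 ler_expR; lra.
  - move=> w wo sw; have PL : expR (- L) < Pw w.
      by rewrite ltNge; apply/negP => le; move: sw; rewrite (max_idPr le) expRK ltxx.
    have ow : Om w by apply: Pwin; apply: lt_trans PL; exact: expR_gt0.
    have [d [f [d0 fh f0 fE]]] := local w ow.
    have wr : N (w - wst) < rho by move: wo; rewrite /oball /= p10; lra.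
    have [d' d'0 Hd'] := Pwc w wr _ (ltac:(by rewrite subr_gt0; exact: PL) : 0 < Pw w - expR (- L)).
    apply: (smp_near (s1 := fun w => 1 * ln (N (f w)))); last exact: smp_ln d0 fh f0.
    apply/nbhsCP; exists (Num.min d d'); first by rewrite lt_min d0.
    move=> w'; rewrite lt_min => /andP[/fE[_ <-] /(Hd' w' I)]; rewrite ltr_norml => /andP[h1 _].
    have lt : expR (- L) < Pw w' by lra.
    by rewrite mul1r (max_idPl (ltW lt)).
  - move=> t tp; apply: contrapT => h2; apply: hn; exists t; split => // w wt.
    apply: contrapT => nO; apply: h2; exists w => //.
    by rewrite /Pw ext_out // (max_idPr (ltW (expR_gt0 _))) expRK.
have t0 : 0 < t by lra.
pose Ct := [set w | N (w - wst) = t].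
have cCt : clN Ct.
  move=> z hz; apply: contrapT => /eqP ne; have g0 : 0 < `|N (z - wst) - t| by rewrite normr_gt0 subr_eq0.
  have [y /= yt yz] := hz _ g0; have := N_sub_abs (y - wst) (z - wst); rewrite yt distrC.
  rewrite (_ : y - wst - (z - wst) = y - z); [lra|ring].
have bCt : bdN Ct by exists (t + N wst) => z /= zt; have := NBD wst z 0; rewrite !subr0 zt.
have neCt : Ct !=set0 by exists (circ wst t 0); rewrite /Ct /= N_circ // ltW.
have tr : t < rho by case/andP: tp => _; rewrite /p; lra.
have [w1 w1t w1m] := EVTmin (s := Pw) cCt bCt neCt (fun w (wt : Ct w) => @rcc_rcont _ _ _ _ (Pwc w (ltac:(by rewrite wt)))).
have Pm : 0 < Pw w1.
  have ow := tE w1 w1t; rewrite /Pw ext_in // N_gt0P; apply: pre0; exact: zwP.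
(* On the compact circle [Pw] has a positive minimum, so [|h|] is bounded below on the preimages,
   which are therefore bounded. *)
have bdv z : G z -> N (v z - wst) = t -> N z <= ka / Pw w1 + N c.
  move=> Gz vt; have ow := tE _ vt; have wr : N (v z - wst) < rho by rewrite vt.
  have [j zE] := pre_all Hmax wr (zwP _ ow) Gz erefl.
  have le : Pw w1 <= N (h z).
    apply: le_trans (w1m (v z) vt) _; rewrite /Pw ext_in // {2}zE.
    by have [_ le _] := discr_le (preG _ _ (zwP _ ow)).
  have : N (z - c) <= ka / Pw w1.
    rewrite ler_pdivlMr // -(hE z Gz); have := N_ge0 (z - c); move: le Pm; clear.
    move: (N (h _)) (N (_ - c)) (Pw w1) => a b x xa x0 b0; have := ler_wpM2l b0 xa.
    have : 0 <= b * a by rewrite mulr_ge0 // (le_trans (ltW x0)).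
    lra.
  by have := N_sub z c; lra.
pose Rb := ka / Pw w1 + N c.
have Rb0 : 0 < Rb by rewrite /Rb ltr_pwDl ?divr_gt0 // N_ge0.
have [z0 [Gz0 vz0 z0R]] : exists z, [/\ G z, N (v z - wst) < t & Rb < N z].
  apply: contrapT => hn; apply: notprop; exists t, Rb; split => // z Gz vz.
  by rewrite leNgt; apply/negP => Rz; apply: hn; exists z.
(* Outside radius [Rb] the set over the open disc has no boundary points, as these would lie over
   the circle. Containing [z0], it contains the whole connected exterior, including this point with
   [|F| > r]. *)
have [z1 z1R Fz1] := tr_unbounded H Rb.
have : G z1 /\ N (v z1 - wst) < t.
  apply: (connP (P := fun z => G z /\ N (v z - wst) < t) (conn_exterior Rb0) _ z0R z1R) => // z zR.
  have [[Gz vz]|nP] := pselect (G z /\ N (v z - wst) < t).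
    have [d d0 Hd] := tr_op H Gz.
    have [d' d'0 Hd'] := iffLR (ccE v z) (tr_cc H Gz) _ (ltac:(by rewrite subr_gt0; exact: vz) : 0 < t - N (v z - wst)).
    exists (Num.min d d'); first by rewrite lt_min d0.
    move=> y _; rewrite lt_min => /andP[/Hd Gy /Hd' vy]; split => // _; split => //.
    by have := NBD (v z) (v y) wst; lra.
  apply: contrapT => hn; apply: nP.
  have cz d : 0 < d -> exists y, [/\ G y, N (v y - wst) < t & N (y - z) < d].
    move=> d0; apply: contrapT => h'; apply: hn; exists d => // y yR yz.
    split=> [[Gy vy]|[Gy vy]]; exfalso; apply: h'; first by exists y.
    by exists z; rewrite subrr N0.
  have Gz : G z.
    have : closure [set y | G y /\ Re wst / 2 <= Re (v y)] z.
      apply/clE => d /cz[y [Gy vy yz]]; exists y => //; split => //; apply: Rew; exact: lt_trans vy tr.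
    by case/(tr_clRe H x00).
  split => //; rewrite ltNge; apply/negP => le.
  have [vt|vt] := eqVneq (N (v z - wst)) t; first by have := bdv z Gz vt; move: zR; rewrite /= /Rb; lra.
  have lt : 0 < N (v z - wst) - t by rewrite subr_gt0 lt_neqAle eq_sym vt.
  have [d d0 Hd] := iffLR (ccE v z) (tr_cc H Gz) _ lt.
  have [y [Gy vy yz]] := cz d d0; have := Hd y yz; rewrite NC.
  by have := NBD (v y) (v z) wst; lra.
by move=> [/(tr_sub H)]; lra.
Qed.

End Fix.
End Properness.

(** * Half-plane tracts *)

Section HalfPlane.
Context {R : realType}.
Implicit Types (z w y b c : R[i]) (e s t p d M : R) (X D T W U Q A : set R[i]).

Definition HM M : set R[i] := [set w | M < Re w].

Lemma opN_HM M : opN (HM M).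
Proof.
move=> w wM; exists (Re w - M); first by rewrite subr_gt0.
move=> y yw; have := le_lt_trans (Re_le_N (y - w)) yw.
by rewrite ReB ltr_norml /HM /= => /andP[? _]; lra.
Qed.

Lemma convx_HM M : convx (HM M).
Proof.
move=> a b t aM bM /andP[t0 t1]; rewrite /HM /= ReD ReM /= mul0r subr0 ReB.
have [->|t0'] := eqVneq t 0; first by rewrite mul0r addr0.
have tp : 0 < t by rewrite lt_neqAle eq_sym t0'.
have h1 : 0 <= (1 - t) * (Re a - M) by rewrite mulr_ge0 ?subr_ge0 // ltW.
have h2 : 0 < t * (Re b - M) by rewrite mulr_gt0 // subr_gt0.
by move: h1 h2; clear; nra.
Qed.

Section Fix.
Variables (F : R[i] -> R[i]) (r : R) (G : set R[i]) (v : R[i] -> R[i]).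
Hypothesis H : tract F r G v.
Hypothesis valence : exists n0 : nat, forall m (zs : 'I_m -> R[i]) w, pre G v w zs -> (m <= n0)%N.
Hypothesis Gne : exists x : R[i], G x.

Let cmp M z := connected_component (over G v (HM M)) z.

Lemma cmp_over M z y : cmp M z y -> over G v (HM M) y.
Proof. exact: connected_component_sub. Qed.

Lemma oO M : opN (over G v (HM M)).
Proof. by apply: (over_open H); exact: opN_HM. Qed.

Lemma cmp_onto M z w : 0 < M -> over G v (HM M) z -> M < Re w -> exists2 y, cmp M z y & v y = w.
Proof.
move=> M0 Oz Mw; apply: (comp_onto H (@opN_HM M) (conn_convx (@convx_HM M)) M0) => //.
  by move=> w' /ltW.
move=> w' Mw'; have [e [Rb [e0 hp]]] := proper H valence (lt_trans M0 Mw' : 0 < Re w').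
by exists e, Rb; split => // y /cmp_over[Gy _]; exact: hp.
Qed.

Lemma cmp_mono M M' z y : M <= M' -> cmp M' z y -> cmp M z y.
Proof.
move=> MM C; have Oz : over G v (HM M') z.
  by apply: contrapT => nO; move: C; rewrite /cmp connected_component_out.
have sub : cmp M' z `<=` over G v (HM M).
  by move=> u /cmp_over[Gu Mu]; split => //; exact: le_lt_trans MM Mu.
exact: (connected_component_max (connected_component_refl Oz) sub (@component_connected _ _ _) C).
Qed.

Definition separated_family M n (p : 'I_n -> R[i]) :=
  (forall i, over G v (HM M) (p i)) /\ forall i j, cmp M (p i) (p j) -> i = j.

(* [M] maximizes the number of components of [{Re v > M}]; these cannot split any more. *)
Lemma stable_component : exists M x, [/\ 0 < M, over G v (HM M) x &
  forall M' z y, M <= M' -> cmp M x z -> cmp M x y -> M' < Re (v z) -> M' < Re (v y) -> cmp M' z y].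
Proof.
have [n0 Hn0] := valence.
pose Q n := `[< exists M (p : 'I_n -> R[i]), 0 < M /\ separated_family M p >].
have Q1 : Q 1%N.
  have [x Gx] := Gne; have x0 := tr_Re H Gx.
  apply/asboolP; exists (Re (v x) / 2), (fun=> x); split; first by lra.
  by split=> [_|i j _]; [split => //; rewrite /HM /=; lra|rewrite !ord1].
have Qb n : Q n -> (n <= n0)%N.
  move=> /asboolP[M [p [M0 [pO psep]]]].
  have MM : M < Re ((M + 1)%:C : R[i]) by rewrite /= ltrDl.
  (* Each component contributes its own preimage of the same point [M + 1], so the valence bounds
     the number of components. *)
  have Hz i : exists z, cmp M (p i) z /\ v z = (M + 1)%:C.
    by have [z h1 h2] := cmp_onto M0 (pO i) MM; exists z.
  pose zs i := sval (cid (Hz i)).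
  have zP i : cmp M (p i) (zs i) /\ v (zs i) = (M + 1)%:C := svalP (cid (Hz i)).
  apply: (Hn0 n zs (M + 1)%:C); split=> [i j E|i]; last by have [/cmp_over[? _] ?] := zP i.
  apply: psep; apply: connected_component_trans (zP i).1 _; rewrite E.
  by apply: connected_component_sym; exact: (zP j).1.
case: (ex_maxnP (ex_intro (fun n => Q n) 1%N Q1) Qb) => n /asboolP[M [p [M0 [pO psep]]]] nmax.
case: n p pO psep nmax => [|n] p pO psep nmax; first by have := nmax _ Q1.
exists M, (p ord0); split => // M' z y MM Cz Cy Mz My; apply: contrapT => nC.
(* One point of [Re v > M'] in each old component, namely [z] in the component under study. If [y]
   were not joined to [z], adding it would give [n + 2] separated points. *)
have Hq j : exists q, [/\ cmp M (p j) q, over G v (HM M') q & j = ord0 -> q = z].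
  have [->|j0] := eqVneq j ord0; first by exists z; split => //; have [Gz _] := cmp_over Cz.
  have Mw : M < Re ((M' + 1)%:C : R[i]) by rewrite /=; lra.
  have [q Cq vq] := cmp_onto M0 (pO j) Mw; exists q; split => //; last by move=> E; rewrite E eqxx in j0.
  by have [Gq _] := cmp_over Cq; split => //; rewrite vq /HM /=; lra.
pose q j := sval (cid (Hq j)).
have qP j : [/\ cmp M (p j) (q j), over G v (HM M') (q j) & j = ord0 -> q j = z] := svalP (cid (Hq j)).
suff /nmax : Q n.+2 by rewrite ltnn.
have bad j : ~ (cmp M' (q j) y).
  have [c1 _ qz] := qP j => c; have c2 := cmp_mono MM c.
  have j0 : j = ord0.
    apply: psep; apply: connected_component_trans c1 _; apply: connected_component_trans c2 _.
    by apply: connected_component_sym.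
  by apply: nC; rewrite -(qz j0).
apply/asboolP; exists M', (fun i => if unlift ord0 i is Some j then q j else y); split; first exact: lt_le_trans M0 MM.
split=> [i|i j].
  case: unliftP => [j _|_]; first by have [] := qP j.
  by have [Gy _] := cmp_over Cy.
case: unliftP => [i' ->|->]; case: unliftP => [j' ->|->] //.
- have [ci _ _] := qP i'; have [cj _ _] := qP j' => c; congr lift; apply: psep.
  apply: connected_component_trans ci _; apply: connected_component_trans (cmp_mono MM c) _.
  by apply: connected_component_sym.
- by move=> /bad.
- by move=> /connected_component_sym/bad.
Qed.

Lemma stable_simple M x z0 : 0 < M -> over G v (HM M) x ->
  (forall M' z y, M <= M' -> cmp M x z -> cmp M x y -> M' < Re (v z) -> M' < Re (v y) -> cmp M' z y) ->
  cmp M x z0 -> simple v z0.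
Proof.
move=> M0 Ox stab Cz0; have [G0 Mz0] := cmp_over Cz0.
have [p [k [g [p0 pG ord]]]] := tr_order H G0.
case: k ord => [|k] ord; first by exists p, g.
exfalso; have [ph [e [e0 hr]]] := local_rays_order p0 pG ord.
set kp : R := k.+2%:R in hr; have kp2 : 2 <= kp by rewrite ler_nat.
have pi0 := pi_gt0 R; have kp0 : 0 < kp by lra.
have ki0 : 0 < kp^-1 by rewrite invr_gt0.
have ki2 : kp^-1 <= 2^-1 by rewrite lef_pV2 ?posrE.
have Ru (u : R[i]) : N u <= 1 / 10 -> - (1 / 10) <= Re u <= 1 / 10.
  by move=> h; rewrite -ler_norml; apply: le_trans (Re_le_N u) h.
have ReZ (t : R) (u : R[i]) : Re (t%:C * u) = t * Re u by rewrite ReM /= mul0r subr0.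
have up ps s : cos ps = 1 -> 0 < s <= e -> over G v (HM (Re (v z0))) (circ z0 s ((ps - ph) / kp)).
  move=> c1 /(hr ps s)[Gs [t [u [t0 /Ru u1 E]]]]; split => //.
  by rewrite /HM /= -subr_gt0 -ReB E ReZ ReD /= c1 mulr_gt0 //; lra.
have dn ps s : cos ps = -1 -> 0 < s <= e -> G (circ z0 s ((ps - ph) / kp)) /\ Re (v (circ z0 s ((ps - ph) / kp))) < Re (v z0).
  move=> c1 /(hr ps s)[Gs [t [u [t0 /Ru u1 E]]]]; split => //.
  by rewrite -subr_lt0 -ReB E ReZ ReD /= c1 pmulr_rlt0 //; lra.
have cos2 : cos (pi *+ 2) = 1 :> R := cos2pi R.
have cos3 : cos (pi + pi *+ 2) = -1 :> R by rewrite cosD2pi cospi.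
(* In the image the four directions are [0, pi, 2 pi, 3 pi], alternately increasing and decreasing
   [Re v]; at a critical point [kp >= 2], so they span at most [3 / 2 * pi] at [z0]. *)
pose al1 := (0 - ph) / kp; pose be := (pi - ph) / kp.
pose al2 := (pi *+ 2 - ph) / kp; pose be' := (pi + pi *+ 2 - ph) / kp.
have rayO al : (forall s, 0 < s <= e -> over G v (HM (Re (v z0))) (circ z0 s al)) ->
    ray z0 al e `<=` [set z | G z /\ Re (v z0) <= Re (v z)].
  move=> h _ [s /andP[s0 se] <-]; have [->|s0'] := eqVneq s 0; first by rewrite /circ mul0r addr0.
  by have [Gs /ltW] := h s (ltac:(by rewrite lt_neqAle eq_sym s0' s0)).
have r1 := rayO al1 (fun s hs => up 0 s (cos0 R) hs).
have r2 := rayO al2 (fun s hs => up _ s cos2 hs).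
have eself : 0 < e <= e by rewrite e0 lexx.
have tip al : ray z0 al e `<=` [set z | G z /\ Re (v z0) <= Re (v z)] -> cmp M x (circ z0 e al).
  move=> h; rewrite /cmp (same_connected_component Cz0).
  apply: (connected_component_max _ _ (@conn_ray R z0 al e)).
  - by exists 0; rewrite /= ?lexx ?ltW // /circ mul0r addr0.
  - by move=> z /h[Gz le]; split => //; exact: lt_le_trans Mz0 le.
  - by exists e; rewrite /= ?lexx ?ltW.
have [X [X1 X2 X3 X4 [X5 X6]]] : exists X, [/\ clN X, bdN X, connected X, X `<=` over G v (HM (Re (v z0))) & X (circ z0 e al1) /\ X (circ z0 e al2)].
  have [_ u1] := up 0 e (cos0 R) eself; have [_ u2] := up _ e cos2 eself.
  have C12 := stab (Re (v z0)) _ _ (ltW Mz0) (tip _ r1) (tip _ r2) u1 u2.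
  apply: (conn_compact (@oO _) (connected_component_refl _) C12).
  exact: up (cos0 R) eself.
have X0 : ~ X z0 by move=> /X4[_]; rewrite /HM /= ltxx.
have lt12 : al1 < be < al2 by rewrite !ltr_pM2r // mulr2n; apply/andP; split; lra.
have lt34 : al2 < be' < al1 + pi *+ 2.
  apply/andP; split; first by rewrite ltr_pM2r // mulr2n; lra.
  rewrite -ltrBlDl /al1 /be' -mulrBl (_ : pi + pi *+ 2 - ph - (0 - ph) = 3 * pi); last by rewrite mulr2n; ring.
  apply: (@le_lt_trans _ _ (3 * pi * 2^-1)); first by rewrite ler_pM2l // mulr_gt0.
  by rewrite (mulr2n pi); lra.
have [d d0 Hd] := two_sectors X1 X2 X3 X0 e0 lt12 lt34 X5 X6.
pose t := Num.min e (d / 2).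
have [t0 te td] : [/\ 0 < t, t <= e & t < d].
  split; [by rewrite lt_min e0 divr_gt0|by rewrite ge_min lexx|rewrite gt_min; apply/orP; right; lra].
have le z : (X `|` (ray z0 al1 e `|` ray z0 al2 e)) z -> N (F z) <= r * expR (- Re (v z0)).
  have Ge y : G y -> Re (v z0) <= Re (v y) -> N (F y) <= r * expR (- Re (v z0)).
    by move=> Gy h; rewrite (tr_N H Gy) ler_pM2l ?(tr_r H) // ler_expR lerN2.
  by case=> [/X4[Gz /ltW]|[/r1[Gz]|/r2[Gz]]]; exact: Ge.
have esc ps : cos ps = -1 -> escapes (X `|` (ray z0 al1 e `|` ray z0 al2 e)) (circ z0 t ((ps - ph) / kp)).
  move=> /dn h; have [Gt lt] := h t (ltac:(by rewrite t0 te)); apply: (tr_esc H le).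
  by rewrite (tr_N H Gt) ltr_pM2l ?(tr_r H) // ltr_expR ltrN2.
exact: (Hd t (ltac:(by rewrite t0 td)) (esc _ (cospi R)) (esc _ cos3)).
Qed.

Section Injective.
Variables (M : R) (x : R[i]).
Hypothesis M0 : 0 < M.
Hypothesis Ox : over G v (HM M) x.
Hypothesis simp : forall z, cmp M x z -> simple v z.
Let C := cmp M x.

Lemma simple_inj z : C z -> exists2 d, 0 < d & forall y y', N (y - z) < d -> N (y' - z) < d -> v y = v y' -> y = y'.
Proof. by move=> /simp[p [g [p0 ord]]]; exact: local_inj p0 ord. Qed.

Lemma cC z : C z -> cc v z. Proof. by move=> /cmp_over[Gz _]; exact: (tr_cc H Gz). Qed.

(** Where two lifts agree, local injectivity of [v] keeps them equal nearby; where they differ,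
    continuity keeps them apart. *)
Lemma section_uniq A (f g : R[i] -> R[i]) w0 w : connected A ->
  (forall w, A w -> [/\ C (f w), v (f w) = w, v (g w) = w, ccont A f w & ccont A g w]) ->
  A w0 -> A w -> f w0 = g w0 -> f w = g w.
Proof.
move=> cA HA A0 Aw E; apply: (connP (P := fun w => f w = g w) cA _ A0 Aw E) => w1 Aw1.
have [Cf vf vg fc gc] := HA w1 Aw1; have [fg|fg] := eqVneq (f w1) (g w1).
  have [d d0 inj] := simple_inj Cf; have [d1 d10 H1] := fc d d0; have [d2 d20 H2] := gc d d0.
  exists (Num.min d1 d2); first by rewrite lt_min d10.
  move=> y Ay; rewrite lt_min => /andP[/(H1 y Ay) h1 /(H2 y Ay) h2]; split=> // _.
  by have [_ v1 v2 _ _] := HA y Ay; apply: inj; rewrite ?fg ?v1 ?v2 // -fg.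
have e0 : 0 < N (f w1 - g w1) / 2 by rewrite divr_gt0 // N_gt0P subr_eq0.
have [d1 d10 H1] := fc _ e0; have [d2 d20 H2] := gc _ e0.
exists (Num.min d1 d2); first by rewrite lt_min d10.
move=> y Ay; rewrite lt_min => /andP[/(H1 y Ay) h1 /(H2 y Ay) h2]; split=> E1.
  exfalso; have := NBD (f y) (f w1) (g w1); rewrite (NC (f w1) (f y)); rewrite -E1 in h2; lra.
by rewrite E1 eqxx in fg.
Qed.

Definition local_section (e : R) z (f : R[i] -> R[i]) := f (v z) = z /\
  forall w, N (w - v z) < e -> [/\ C (f w), v (f w) = w & cc f w].

Lemma local_section_ex z : C z -> exists (e d : R) f, [/\ 0 < e, 0 < d, local_section e z f &
   forall y, N (y - z) < d -> C y -> f (v y) = y].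
Proof.
move=> Cz; have [Gz Mz] := cmp_over Cz.
have [d [p1 [f [d0 /andP[p10 _] pG Hf uf]]]] := tr_inverse H Gz (simp Cz) ltr01.
have [d' d'0 Hd'] := iffLR (ccE v z) (cC Cz) _ d0.
have [e' e'0 He'] := opN_HM Mz.
pose e := Num.min d e'; have e0 : 0 < e by rewrite lt_min d0.
have fz : f (v z) = z by apply: uf; rewrite subrr N0.
exists e, (Num.min p1 d'), f; split => //; first by rewrite lt_min p10.
  split => // w we; have [we1 we2] : N (w - v z) < d /\ N (w - v z) < e' by move: we; rewrite lt_min => /andP.
  have [f1 f2 [l fl]] := Hf w we1; split => //; last exact: der_cc fl.
  apply: (connP (P := fun w => C (f w)) (conn_convx (@convx_oball R (v z) e)) _ (z := v z)) => //;
    [|exact: oball_center|by rewrite fz].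
  move=> w1 w1e; have [w1d w1e'] : N (w1 - v z) < d /\ N (w1 - v z) < e' by move: w1e; rewrite /oball /= lt_min => /andP.
  have [g1 g2 [l1 gl]] := Hf w1 w1d.
  have Ow1 : over G v (HM M) (f w1) by split; [exact: pG|rewrite g2; exact: He'].
  have [a a0 Ha] := @oO M _ Ow1; have [b b0 Hb] := iffLR (ccE f w1) (der_cc gl) _ a0.
  exists b => // w2 _ /Hb fw; split=> Cf.
    apply: connected_component_trans Cf _; apply: connected_component_sym.
    exact: (comp_ball a0 Ha (connected_component_refl Ow1)).
  exact: (comp_ball a0 Ha Cf).
move=> y; rewrite lt_min => /andP[yp yd] Cy; apply: uf => //; exact: Hd'.
Qed.

Lemma compact_fibre (m Rq : R) : M < m -> exists Rb, forall z, C z -> m <= Re (v z) -> N (v z) <= Rq -> N z <= Rb.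
Proof.
move=> Mm; apply: contrapT => hn.
have Hk (k : nat) : exists z, [/\ C z, m <= Re (v z), N (v z) <= Rq & k%:R < N z].
  apply: contrapT => h'; apply: hn; exists k%:R => z Cz mz Nz; rewrite leNgt; apply/negP => lt.
  by apply: h'; exists z.
pose u k := sval (cid (Hk k)).
have uP k : [/\ C (u k), m <= Re (v (u k)), N (v (u k)) <= Rq & k%:R < N (u k)] := svalP (cid (Hk k)).
have [w wcl] : exists w, forall e, 0 < e -> forall m0, exists2 k, (m0 <= k)%N & N (v (u k) - w) < e.
  by apply: (@cluster_point R (fun k => v (u k)) Rq) => k; have [] := uP k.
have w0 : 0 < Re w.
  rewrite ltNge; apply/negP => le; have m0 : 0 < m by exact: lt_trans Mm.
  have [k _ hk] := wcl m m0 0%N; have [_ mk _ _] := uP k.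
  by have := le_lt_trans (Re_le_N _) hk; rewrite ReB ltr_norml => /andP[_]; lra.
have [e [Rb [e0 hp]]] := proper H valence w0.
have [k kb hk] := wcl e e0 (Num.bound Rb).
have [/cmp_over[Gk _] _ _ lt] := uP k; have := hp _ Gk hk.
have : Rb < k%:R.
  apply: le_lt_trans (ler_norm Rb) _; apply: lt_le_trans (archi_boundP (normr_ge0 Rb)) _.
  by rewrite ler_nat; apply: leq_trans kb; rewrite /Num.bound normr_id.
lra.
Qed.

(** A Lebesgue number argument: centres without sections of radius [1 / (k + 1)] would accumulate,
    by [compact_fibre], at a point of [C] whose own section serves all nearby centres. *)
Lemma uniform_section (m Rq : R) : M < m -> exists2 e, 0 < e & forall z, C z -> m <= Re (v z) -> N (v z) <= Rq ->
  exists f, local_section e z f.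
Proof.
move=> Mm; have [Rb hRb] := compact_fibre Rq Mm; apply: contrapT => hn.
have inv_gt0 (k : nat) : 0 < k.+1%:R^-1 :> R by rewrite invr_gt0 ltr0n.
have Hk (k : nat) : exists z, [/\ C z, m <= Re (v z), N (v z) <= Rq & forall f, ~ local_section k.+1%:R^-1 z f].
  apply: contrapT => h'; apply: hn; exists k.+1%:R^-1 => // z Cz mz Nz.
  by apply: contrapT => hf; apply: h'; exists z; split => // f lf; apply: hf; exists f.
pose u k := sval (cid (Hk k)).
have uP k : [/\ C (u k), m <= Re (v (u k)), N (v (u k)) <= Rq & forall f, ~ local_section k.+1%:R^-1 (u k) f] := svalP (cid (Hk k)).
have [|z zcl] := @cluster_point R u Rb; first by move=> k; have [? ? ? _] := uP k; exact: hRb.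
have m0 : 0 < m by exact: lt_trans Mm.
have [Gz mz] : G z /\ m <= Re (v z).
  apply: (tr_clRe H m0); apply/clE => e e0; have [k _ ke] := zcl e e0 0%N; exists (u k) => //.
  by have [/cmp_over[? _] ? _ _] := uP k.
have Cz : C z.
  apply: comp_closure; [exact: oO|by split => //; exact: lt_le_trans Mm mz|].
  by apply/clE => e e0; have [k _ ke] := zcl e e0 0%N; exists (u k) => //; have [] := uP k.
have [e [d [f [e0 d0 [fz Hf] uf]]]] := local_section_ex Cz.
have e2 : 0 < e / 2 by rewrite divr_gt0.
have [d' d'0 Hd'] := iffLR (ccE v z) (cC Cz) _ e2.
have [K HK] := ltr_add_invr e2; rewrite add0r in HK.
have dd : 0 < Num.min d d' by rewrite lt_min d0.
have [k kK] := zcl _ dd K; rewrite lt_min => /andP[k1 k2].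
have [Ck _ _ /(_ f)] := uP k; apply; split; first exact: uf.
move=> w wk; apply: Hf; have := NBD (v (u k)) w (v z); have := Hd' _ k2.
have : k.+1%:R^-1 <= K.+1%:R^-1 :> R by rewrite lef_pV2 ?posrE ?ltr0n // ler_nat.
move: HK wk; clear; move: (k.+1%:R^-1 : R) (K.+1%:R^-1 : R) => a1 a2.
by move: (N (v (u k) - v z)) (N (w - v z)) (N (w - v (u k))) => b1 b2 b3; lra.
Qed.

End Injective.
End Fix.
End HalfPlane.

(** * Global sections and injectivity on a half-plane tract *)

Section Sections.
Context {R : realType}.
Implicit Types (z w y b c : R[i]) (e s t p d : R) (X D T W U Q A : set R[i]).

Section Fix.
Variables (F : R[i] -> R[i]) (r : R) (G : set R[i]) (v : R[i] -> R[i]).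
Hypothesis H : tract F r G v.
Hypothesis valence : exists n0 : nat, forall m (zs : 'I_m -> R[i]) w, pre G v w zs -> (m <= n0)%N.
Variables (M : R) (x : R[i]).
Hypothesis M0 : 0 < M.
Let C := connected_component (over G v (HM M)) x.
Hypothesis simp : forall z, C z -> simple v z.

Lemma lerpB a b t t' : lerp a b t' - lerp a b t = (t' - t)%:C * (b - a) :> R[i].
Proof. by rewrite /lerp rmorphB /=; ring. Qed.

Lemma lerpBr (a b b' : R[i]) t : lerp a b' t - lerp a b t = t%:C * (b' - b).
Proof. by rewrite /lerp; ring. Qed.

Lemma lerp_refl (a : R[i]) t : lerp a a t = a.
Proof. by rewrite /lerp subrr mulr0 addr0. Qed.

(* The section is obtained by lifting the segments from [v z1] in equal small steps. *)
Lemma global_section (m Rq : R) z1 (Q := [set w | m <= Re w /\ N w <= Rq]) : M < m -> C z1 -> Q (v z1) ->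
  exists f : R[i] -> R[i], f (v z1) = z1 /\ forall w, Q w -> [/\ C (f w), v (f w) = w & ccont Q f w].
Proof.
move=> Mm Cz1 Q1; set w0 := v z1 in Q1 *.
have [e e0 He] := uniform_section H valence M0 simp Rq Mm.
have Hf z : exists f : R[i] -> R[i], C z -> Q (v z) -> local_section G v M x e z f.
  have [Cz|nC] := pselect (C z); last by exists id.
  have [[q1 q2]|nQ] := pselect (Q (v z)); last by exists id.
  by have [f hf] := He z Cz q1 q2; exists f.
pose tau z := sval (cid (Hf z)).
have tauP z : C z -> Q (v z) -> local_section G v M x e z (tau z) := svalP (cid (Hf z)).
have Rq0 : 0 <= Rq by apply: le_trans Q1.2; exact: N_ge0.
(* Segments from [v z1] within [Q] have length at most [2 * Rq], so [K + 1] equal steps are each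
   shorter than the uniform radius [e]. *)
have [K HK] : exists K : nat, 2 * Rq < e * K.+1%:R.
  exists (Num.bound (2 * Rq / e)); rewrite (mulrC e) -ltr_pdivrMr //.
  apply: le_lt_trans (ler_norm _) _; apply: lt_trans (archi_boundP (normr_ge0 _)) _.
  by rewrite ltr_nat ltnS /Num.bound normr_id.
have K0 : 0 < K.+1%:R :> R by rewrite ltr0n.
pose tt (k : nat) : R := k%:R / K.+1%:R.
have tt01 k : (k <= K.+1)%N -> 0 <= tt k <= 1.
  by move=> kK; rewrite divr_ge0 //= ler_pdivrMr // mul1r ler_nat.
have Qc : convx Q.
  move=> a b t [a1 a2] [b1 b2] t01; split.
    have := @convx_half R 1 m a b t; rewrite /= !mul1r; exact.
  have := @N_lerp R a b 0 t Rq; rewrite !subr0; exact.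
have step w k : Q w -> N (lerp w0 w (tt k.+1) - lerp w0 w (tt k)) < e.
  move=> [_ Nw]; rewrite lerpB NM NReal /tt -mulrBl -natr1 addrC addKr mul1r gtr0_norm ?invr_gt0 //.
  rewrite mulrC ltr_pdivrMr //; apply: le_lt_trans HK; have := NB w w0; have := Q1.2; lra.
suff HS k : (k <= K.+1)%N -> exists f : R[i] -> R[i], f w0 = z1 /\
    forall w, Q w -> [/\ C (f w), v (f w) = lerp w0 w (tt k) & ccont Q f w].
  have [f [f1 f2]] := HS K.+1 (leqnn _); exists f; split => // w Qw.
  by have [h1 h2 h3] := f2 w Qw; split => //; rewrite h2 /tt divff ?gt_eqF // lerp1.
elim: k => [|k IH] kK.
  exists (fun=> z1); split => // w Qw; split => //; last exact: ccont_cst.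
  by rewrite /tt mul0r lerp0.
have [f [f1 f2]] := IH (ltnW kK).
exists (fun w => tau (f w) (lerp w0 w (tt k.+1))); split.
  by rewrite lerp_refl f1; exact: (tauP z1 Cz1 Q1).1.
move=> w Qw; have lQ w' k' : Q w' -> (k' <= K.+1)%N -> Q (lerp w0 w' (tt k')).
  by move=> Qw' k'K; apply: Qc => //; exact: tt01.
have ls w' : Q w' -> local_section G v M x e (f w') (tau (f w')) /\ N (lerp w0 w' (tt k.+1) - v (f w')) < e.
  move=> Qw'; have [Cf vf _] := f2 w' Qw'; split; last by rewrite vf; exact: step.
  by apply: tauP; rewrite // vf; apply: lQ => //; exact: ltnW.
have [[l1 l2] l3] := ls w Qw; have [Cf vf fc] := f2 w Qw.
have [h1 h2 h3] := l2 _ l3; split => //.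
set z := f w in l1 l2 l3 Cf vf fc h1 h2 h3 *.
(* members of the family [tau] at nearby points agree, so that the new lift is continuous *)
have [d1 d10 inj] := simple_inj simp Cf.
have vz0 : N (v z - v z) < e by rewrite subrr N0.
have [_ _ cz] := l2 _ vz0.
have [d2 d20 H2] := iffLR (ccE _ _) cz _ d10; rewrite l1 in H2.
have me : 0 < Num.min e d2 by rewrite lt_min e0.
have [d3 d30 H3] := iffLR (ccE v z) (cC H Cf) _ me.
have m13 : 0 < Num.min d1 d3 by rewrite lt_min d10.
have [d4 d40 H4] := fc _ m13.
have [d5 d50 H5] := opN_oball l3.
move=> e1 e10; have [d6 d60 H6] := iffLR (ccE _ _) h3 _ e10.
exists (Num.min d4 (Num.min d5 d6)); first by rewrite !lt_min d40 d50.
move=> w' Qw'; rewrite !lt_min => /and3P[w4 w5 w6].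
have := H4 w' Qw' w4; rewrite lt_min => /andP[z1' z3']; set z' := f w' in z1' z3' *.
have := H3 _ z3'; rewrite lt_min => /andP[v1 v2].
have [[l1' l2'] l3'] := ls w' Qw'; rewrite -/z' in l1' l2' l3'.
have near_l (d : R) : N (w' - w) < d -> N (lerp w0 w' (tt k.+1) - lerp w0 w (tt k.+1)) < d.
  move=> h; apply: le_lt_trans h; rewrite lerpBr NM NReal; have /andP[t0 t1] := tt01 _ kK.
  by rewrite ger0_norm // ler_piMl ?N_ge0.
have tz' : tau z (v z') = z'.
  have [_ vt _] := l2 _ v1; apply: inj => //; exact: H2.
have -> : tau z' (lerp w0 w' (tt k.+1)) = tau z (lerp w0 w' (tt k.+1)).
  apply: (@section_uniq R G v M x simp (oball (v z) e `&` oball (v z') e) _ _ (v z')).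
  - by apply: conn_convx; apply: convxI; exact: convx_oball.
  - move=> u [u1 u2]; have [a1 a2 a3] := l2' u u2; have [b1 b2 b3] := l2 u u1.
    by split => //; exact: cc_within.
  - by split => //; rewrite /oball /= subrr N0.
  - by split => //; apply: H5; exact: near_l.
  - by rewrite l1' tz'.
by apply: H6; exact: near_l.
Qed.

(** Join [z1] to [z2] by a compact connected [X] in [C] and take the section [f] with
    [f (v z1) = z1] over a convex set containing the image of [X]. The identity [f (v z) = z]
    spreads along [X] to [z2], and [v z1 = v z2]. *)
Lemma tract_inj z1 z2 : C z1 -> C z2 -> v z1 = v z2 -> z1 = z2.
Proof.
move=> C1 C2 v12.
have C12 : connected_component (over G v (HM M)) z1 z2.
  by apply: connected_component_trans C2; exact: connected_component_sym.
have [X [X1 X2 X3 X4 [X5 X6]]] := conn_compact (@oO _ F r G v H M) (connected_component_refl (cmp_over C1)) C12.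
have XC : X `<=` C.
  by rewrite /C (same_connected_component C1); exact: connected_component_max.
have rv z : X z -> cc v z by move=> /XC Cz; exact: (cC H Cz).
have [a Xa am] := EVTmin (s := fun z => Re (v z)) X1 X2 (ex_intro _ z1 X5) (fun z Xz => @rcc_rcont _ _ _ _ (rcc_Re (rv z Xz))).
have [b Xb bm] := EVTmax (s := fun z => N (v z)) X1 X2 (ex_intro _ z1 X5) (fun z Xz => @rcc_rcont _ _ _ _ (rcc_N (rv z Xz))).
have Ma : M < Re (v a) by have [] := X4 a Xa.
have XQ z : X z -> Re (v a) <= Re (v z) /\ N (v z) <= N (v b) by move=> Xz; split; [exact: am|exact: bm].
have [f [f1 f2]] := global_section Ma C1 (XQ z1 X5).
suff : f (v z2) = z2 by rewrite -v12 f1.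
apply: (connP (P := fun z => f (v z) = z) X3 _ X5 X6) => // z Xz.
have [Cf vf fc] := f2 _ (XQ z Xz).
have fvc e : 0 < e -> exists2 d, 0 < d & forall y, X y -> N (y - z) < d -> N (f (v y) - f (v z)) < e /\ N (y - z) < e.
  move=> e0; have [d d0 Hd] := fc e e0; have [d' d'0 Hd'] := iffLR (ccE v z) (rv z Xz) _ d0.
  exists (Num.min d' e); first by rewrite lt_min d'0.
  by move=> y Xy; rewrite lt_min => /andP[/Hd' h1 h2]; split => //; apply: Hd => //; exact: XQ.
have [E|ne] := eqVneq (f (v z)) z.
  have [d d0 inj] := simple_inj simp (XC z Xz); have [d' d'0 Hd'] := fvc d d0.
  exists d' => // y Xy /(Hd' y Xy)[h1 h2]; split=> // _.
  by have [_ vfy _] := f2 _ (XQ y Xy); apply: inj => //; rewrite -{1}E.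
have e0 : 0 < N (f (v z) - z) / 2 by rewrite divr_gt0 // N_gt0P subr_eq0.
have [d d0 Hd] := fvc _ e0; exists d => // y Xy /(Hd y Xy)[h1 h2]; split=> E; exfalso.
  rewrite E in h1; have := NBD y (f (v z)) z; rewrite (NC (f (v z)) y); lra.
by rewrite E eqxx in ne.
Qed.

End Fix.

Theorem half_plane_tract (F : R[i] -> R[i]) (r : R) G (v : R[i] -> R[i]) : tract F r G v ->
  (exists n0 : nat, forall m (zs : 'I_m -> R[i]) w, pre G v w zs -> (m <= n0)%N) -> (exists z, G z) ->
  exists (M : R) z0 (phi : R[i] -> R[i]), let C := connected_component (over G v (HM M)) z0 in
  [/\ 0 < M, over G v (HM M) z0, forall z, C z -> phi (v z) = z,
      forall w, M < Re w -> C (phi w) /\ v (phi w) = w & forall w, M < Re w -> cc phi w].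
Proof.
move=> H val Gne; have [M [x [M0 Ox stab]]] := stable_component H val Gne.
have simp := stable_simple H M0 Ox stab.
set C := connected_component (over G v (HM M)) x.
have inj := tract_inj H val M0 simp.
have Hp w : exists z, M < Re w -> C z /\ v z = w.
  have [Mw|nM] := pselect (M < Re w); last by exists 0.
  by have [z h1 h2] := cmp_onto H val M0 Ox Mw; exists z.
pose phi w := sval (cid (Hp w)).
have phiP w : M < Re w -> C (phi w) /\ v (phi w) = w := svalP (cid (Hp w)).
have phiv z : C z -> phi (v z) = z.
  by move=> Cz; have [_ Mz] := cmp_over Cz; have [h1 h2] := phiP _ Mz; exact: inj.
exists M, x, phi; split => // w Mw; have [Cw vw] := phiP w Mw.
have [e [d [f [e0 _ [_ Hf] _]]]] := local_section_ex H simp Cw; rewrite vw in Hf.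
have w0 : N (w - w) < e by rewrite subrr N0.
have [_ _ fc] := Hf w w0.
have fE y : N (y - w) < e -> f y = phi y.
  by move=> /Hf[Cf vf _]; rewrite -{2}vf phiv.
rewrite /cc -(fE w w0); apply: tC_eq fc; apply/nbhsCP; by exists e.
Qed.

End Sections.

(** * The covering *)

Section Covering.
Context {R : realType}.
Implicit Types (z w y b c a : R[i]) (e s t d : R) (X D T W U Q A V : set R[i]) (f h : R[i] -> R[i]).

Lemma within_cont (E : topologicalType) (S : set E) (h : E -> R[i]) :
  (forall p : E, S p -> tC (within S (nbhs p)) h (h p)) -> {within S, continuous h}.
Proof.
by move=> hc; apply/subspace_continuousP => p Sp B /nbhsCP[e e0 eB]; apply: filterS (hc p Sp e e0) => q; exact: eB.
Qed.

Lemma within_ccont A h : (forall z, A z -> ccont A h z) -> {within A, continuous h}.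
Proof. by move=> hc; apply: within_cont => z Az; apply/ccontP; exact: hc. Qed.

Lemma tC_within (E : topologicalType) (S : set E) (h : E -> R[i]) (p : E) l :
  tC (nbhs p) h l -> tC (within S (nbhs p)) h l.
Proof. by move=> hc e e0; apply: filterS (hc e e0) => q hq _. Qed.

Section HalfPlaneImage.
Variables (C : set R[i]) (M : R) (v phi : R[i] -> R[i]).
Hypothesis vC : forall z, C z -> M < Re (v z) /\ phi (v z) = z.
Hypothesis vcc : forall z, C z -> cc v z.
Hypothesis phiC : forall w, M < Re w -> C (phi w) /\ v (phi w) = w.
Hypothesis phicc : forall w, M < Re w -> cc phi w.

Lemma lerp_HM a b t : M < Re a -> M < Re b -> M < Re (lerp a b (cl t)).
Proof. by move=> Ma Mb; apply: (@convx_HM R M a b) => //; exact: cl01. Qed.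

(** Straight segments and the straight-line contraction in the half-plane are carried back by
    [phi]. *)
Lemma half_plane_simply_connected : C !=set0 -> simply_connected R C.
Proof.
move=> C0; split.
  split=> // z y Cz Cy; have [Mz pz] := vC Cz; have [My py] := vC Cy.
  exists (fun t => phi (lerp (v z) (v y) (cl t))); split.
  - apply: within_cont => t _; apply: tC_within; apply: tC_comp; last exact: phicc (lerp_HM t Mz My).
    by apply: tCD; [exact: tC_cst|apply: tCM; [apply: tC_real; exact: cl_cont|exact: tC_cst]].
  - by move=> _ [t _ <-]; have [] := phiC (lerp_HM t Mz My).
  - by rewrite cl_id ?lexx ?ler01 // lerp0.
  - by rewrite cl_id ?lexx ?ler01 // lerp1.
move=> z g Cz [gc gC g0 g1]; have [Mz pz] := vC Cz.
have gcl s : C (g (cl s)) by apply: gC; exists (cl s) => //=; rewrite in_itv /= cl01.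
have gt s : tC (nbhs s) (fun s => g (cl s)) (g (cl s)).
  move=> e e0; have cs : (`[0, 1]%classic : set R) (cl s) by rewrite /= in_itv /= cl01.
  have nb : nbhs (g (cl s)) [set y | N (y - g (cl s)) < e] by apply/nbhsCP; exists e.
  move/subspace_continuousP: (gc) => gw; have h1 := gw (cl s) cs _ nb.
  have h2 : nbhs s [set s' | (`[0, 1]%classic : set R) (cl s') -> N (g (cl s') - g (cl s)) < e] := cl_cont h1.
  apply: filterS h2 => s' h; apply: h.
  by rewrite /= in_itv /= cl01.
have Mg s : M < Re (v (g (cl s))) by have [] := vC (gcl s).
exists (fun st => phi (lerp (v (g (cl st.1))) (v z) (cl st.2))); split.
- apply: within_cont => -[s t] _; apply: tC_within; apply: tC_comp; last exact: phicc (lerp_HM t (Mg s) Mz).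
  have f1 (k : R -> R[i]) l : tC (nbhs s) k l -> tC (nbhs (s, t)) (fun st => k st.1) l.
    by move=> hk e e0; exact: (cvg_fst (hk e e0)).
  have f2 (k : R -> R[i]) l : tC (nbhs t) k l -> tC (nbhs (s, t)) (fun st => k st.2) l.
    by move=> hk e e0; exact: (cvg_snd (hk e e0)).
  have c1 : tC (nbhs (s, t)) (fun st => v (g (cl st.1))) (v (g (cl s))).
    apply: (f1 (fun s => v (g (cl s)))); apply: tC_comp; [exact: gt|exact: vcc].
  apply: tCD; first exact: c1.
  apply: tCM; last by apply: tCB; [exact: tC_cst|exact: c1].
  by apply: (f2 (fun t => (cl t)%:C)); apply: tC_real; exact: cl_cont.
- by move=> _ [[s t] _ <-]; have [] := phiC (lerp_HM t (Mg s) Mz).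
- move=> s; rewrite in_itv /= => s01; rewrite !cl_id ?lexx ?ler01 //.
  have Cs : C (g s) by rewrite -(cl_id s01).
  by rewrite lerp0 lerp1 pz; have [_ ->] := vC Cs.
- move=> t; rewrite in_itv /= => t01; rewrite !cl_id ?lexx ?ler01 // g0 g1.
  by rewrite lerp_refl pz.
Qed.

Variables (f : R[i] -> R[i]) (a : R[i]) (r : R).
Hypothesis r0 : 0 < r.
Hypothesis oC : opN C.
Hypothesis fcc : forall z, cc f z.
Hypothesis fv : forall z, C z -> f z - a = r%:C * cexp (- v z).

Let r' := r * expR (- M).

Lemma punctured_exp w : (disc a r' `\ a) (a + r%:C * cexp (- w)) <-> M < Re w.
Proof.
have ne : a + r%:C * cexp (- w) <> a.
  move=> /eqP; rewrite -subr_eq0 addrC addKr mulf_eq0 (negbTE (cexp_neq0 _)) orbF => /eqP E.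
  by have := NReal r; rewrite E N0 gtr0_norm // => r00; have := r0; rewrite -r00 ltxx.
have E : (N (a + r%:C * cexp (- w) - a) < r') = (M < Re w).
  by rewrite addrC addKr NM NReal gtr0_norm // N_cexp /r' ltr_pM2l // ltr_expR ReN ltrN2.
split=> [[/discP]|h]; first by rewrite E.
by split; [apply/discP; rewrite E|exact: ne].
Qed.

Lemma log_coordinate y : (disc a r' `\ a) y -> exists w, y = a + r%:C * cexp (- w) /\ M < Re w.
Proof.
move=> Dy; have rC : r%:C != 0 :> R[i] by rewrite -N_gt0P NReal normr_gt0 gt_eqF.
have ya : (y - a) / r%:C != 0.
  by rewrite mulf_neq0 ?invr_eq0 // subr_eq0; apply/eqP; case: Dy.
have [w wE] := cexp_surj ya.
have yE : y = a + r%:C * cexp (- - w) by rewrite opprK wE mulrCA divff // mulr1 addrC subrK.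
by exists (- w); split => //; apply/punctured_exp; rewrite -yE.
Qed.

Lemma half_plane_covering : covering_on C (disc a r' `\ a) f.
Proof.
have fE z : C z -> f z = a + r%:C * cexp (- v z) by move=> /fv <-; rewrite addrC subrK.
have rC : r%:C != 0 :> R[i] by rewrite -N_gt0P NReal normr_gt0 gt_eqF.
split.
- by apply: within_ccont => z _; exact: cc_within.
- apply/seteqP; split=> [_ [z Cz <-]|y /log_coordinate[w [-> Mw]]].
    by rewrite fE //; apply/punctured_exp; have [] := vC Cz.
  by have [Cw vw] := phiC Mw; exists (phi w) => //; rewrite fE // vw.
move=> y0 Dy0; have [w0 [y0E Mw0]] := log_coordinate Dy0.
have ya0 : y0 - a != 0 by rewrite subr_eq0; apply/eqP; case: Dy0.
pose U := [set y | (disc a r' `\ a) y /\ N (y - y0) < N (y0 - a)].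
have quot y : U y -> slit ((y - a) / (y0 - a)).
  move=> [_ yU]; apply: slit_near1.
  have -> : (y - a) / (y0 - a) - 1 = (y - y0) / (y0 - a) by field.
  by rewrite NM NV ltr_pdivrMr ?N_gt0P // mul1r.
(* the branch of [log (r / (y - a))] on [U] *)
pose la y := w0 - Log ((y - a) / (y0 - a)).
have laE y : U y -> a + r%:C * cexp (- la y) = y.
  move=> Uy; rewrite /la opprB cexpB cexp_Log ?quot //.
  have -> : (y0 - a) = r%:C * cexp (- w0) by rewrite {1}y0E addrC addKr.
  by rewrite cexpN; field; rewrite rC cexp_neq0.
have laM y (k : int) : U y -> M < Re (la y + tpi k).
  move=> Uy; have : (disc a r' `\ a) (a + r%:C * cexp (- la y)) by rewrite laE //; case: Uy.
  by move=> /punctured_exp; rewrite ReD /= addr0.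
have la_cc y : U y -> cc la y.
  move=> Uy; apply: tCB; first exact: tC_cst.
  apply: (cc_comp (k := fun y => (y - a) / (y0 - a))); last by apply: Log_cont; exact: quot.
  by apply: tCM; [exact: (der_cc (derBc a (der_id y)))|exact: tC_cst].
have oU : opN U.
  move=> y [[/discP yr ya] yU].
  have g1 : 0 < r' - N (y - a) by rewrite subr_gt0.
  have g2 : 0 < N (y - a) by rewrite N_gt0P subr_eq0; apply/eqP.
  have g3 : 0 < N (y0 - a) - N (y - y0) by rewrite subr_gt0.
  exists (Num.min (r' - N (y - a)) (Num.min (N (y - a)) (N (y0 - a) - N (y - y0)))); first by rewrite !lt_min g1 g2.
  move=> u; rewrite !lt_min => /and3P[u1 u2 u3]; split; last by have := NBD y u y0; lra.
  split; first by apply/discP; have := NBD y u a; lra.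
  by move=> E; move: u2; rewrite E NC ltxx.
exists U; split.
- by split => //; rewrite subrr N0 N_gt0P.
- by split=> [y []//|]; apply: open_subspaceW; apply/openCP.
pose V (k : int) := [set z | [/\ C z, U (f z) & v z = la (f z) + tpi k]].
have tpiB (k k' : int) : tpi k - tpi k' = tpi (k - k') :> R[i].
  by apply: complex_eq; rewrite ?ReB ?ImB /= ?subr0 // mulrzBr.
have VUf (k : int) y : U y -> V k (phi (la y + tpi k)) /\ f (phi (la y + tpi k)) = y.
  move=> Uy; have [Cp vp] := phiC (laM y k Uy).
  have fy : f (phi (la y + tpi k)) = y.
    by rewrite fE // vp opprD cexpB cexp_tpi divr1 laE.
  by split => //; split => //; rewrite fy.
have sheet z : C z -> U (f z) -> exists k, v z = la (f z) + tpi k.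
  move=> Cz Uz; have E : cexp (- v z) = cexp (- la (f z)).
    by apply: (mulfI rC); apply: (addrI a); exact: (etrans (esym (fE z Cz)) (esym (laE (f z) Uz))).
  have [k kE] := cexp_eq E; exists (- k).
  have -> : tpi (- k) = - tpi k :> R[i] by rewrite -[- k]add0r -tpiB tpi0 sub0r.
  by rewrite -[v z]opprK kE opprD opprK.
exists (range V); split.
- move=> _ [k _ <-]; split=> [z []//|]; apply: open_subspaceW; apply/openCP => z [Cz Uz vz].
  have [d1 d10 H1] := oC Cz; have [d2 d20 H2] := oU _ Uz.
  have [d3 d30 H3] := iffLR (ccE f z) (fcc z) _ d20.
  have gc : cc (fun z => v z - la (f z)) z.
    by apply: tCB; [exact: vcc|exact: (cc_comp (fcc z) (la_cc _ Uz))].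
  have [d4 d40 H4] := iffLR (ccE _ z) gc _ ltr01.
  exists (Num.min d1 (Num.min d3 d4)); first by rewrite !lt_min d10 d30.
  move=> y; rewrite !lt_min => /and3P[/H1 Cy /H3/H2 Uy /H4 H0].
  have [k' vy] := sheet y Cy Uy; split => //; rewrite vy; congr (_ + _); move: H0.
  have -> : v y - la (f y) = tpi k' by rewrite vy addrC addKr.
  have -> : v z - la (f z) = tpi k by rewrite vz addrC addKr.
  rewrite tpiB => lt; suff /eqP : k' - k = 0 by rewrite subr_eq0 => /eqP ->.
  by apply: (@N_tpi_lt R); apply: lt_trans lt _; have := pi_ge2 R; rewrite mulr2n; lra.
- move=> _ _ [k _ <-] [k' _ <-] [z [[_ _ h1] [_ _ h2]]].
  have E : tpi k = tpi k' :> R[i] by move: h2; rewrite h1 => /addrI.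
  by rewrite /= /V E.
- apply/seteqP; split=> [z [_ [k _ <-] [Cz Uz _]]//|z [Cz Uz]].
  by have [k vz] := sheet z Cz Uz; exists (V k) => //; exists k.
- move=> _ [k _ <-]; split.
  + split=> [z []//|z z' /set_mem[Cz Uz vz] /set_mem[Cz' Uz' vz'] E|y Uy].
      by have [_ <-] := vC Cz; have [_ <-] := vC Cz'; rewrite vz vz' E.
    by have [h1 h2] := VUf k y Uy; exists (phi (la y + tpi k)).
  + by apply: within_ccont => z _; exact: cc_within.
  + exists (fun y => phi (la y + tpi k)); split.
      by move=> z /set_mem[Cz Uz vz]; rewrite -vz; have [] := vC Cz.
    apply: within_ccont => y Uy; apply: cc_within.
    apply: (cc_comp (k := fun y => la y + tpi k)); last by apply: phicc; exact: laM.
    by apply: tCD; [exact: la_cc|exact: tC_cst].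
Qed.

End HalfPlaneImage.
End Covering.

Lemma finite_order_bound (R : realType) (f : R[i] -> R[i]) (a : R[i]) : finite_order f ->
  exists (B : R) (q : nat), 0 <= B /\ forall z, N (f z - a) <= expR (B * (1 + N z) ^+ q).
Proof.
move=> [C [rho [C0 rho0 fC]]].
pose q := Num.bound rho; have rq : rho <= q%:R by apply: ltW; apply: archi_boundP; exact: ltW.
exists (C + N a + 1), q; have a0 := N_ge0 a; split=> [|z]; first by lra.
have z0 := N_ge0 z; set Y := (1 + N z) ^+ q.
have Y1 : 1 <= Y by apply: exprn_ege1; lra.
have h1 : N z `^ rho <= Y.
  rewrite /Y -powR_mulrn; last by lra.
  apply: (@le_trans _ _ ((1 + N z) `^ rho)); last by apply: ler_powR => //; lra.
  by apply: ge0_ler_powR; rewrite ?nnegrE; lra.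
have h2 : N (f z) <= C * expR Y by apply: le_trans (fC z) _; rewrite ler_pM2l // ler_expR.
have eY : 1 <= expR Y by rewrite -[leLHS]expR0 ler_expR; lra.
have h3 : N a <= N a * expR Y by rewrite ler_peMr.
apply: (@le_trans _ _ ((C + N a) * expR Y)).
  by apply: le_trans (NB _ _) _; rewrite mulrDl lerD.
apply: (@le_trans _ _ (expR (C + N a) * expR Y)).
  by rewrite ler_wpM2r ?expR_ge0 //; have := expR_ge1Dx (C + N a); lra.
by rewrite -expRD ler_expR; nra.
Qed.

Theorem theorem4 (R : realType) (f : R[i] -> R[i]) (a : R[i])
    (hf : transcendental_entire f) (hord : finite_order f)
    (ha : locally_omitted f a) :
  logarithmic_singularity f a.
Proof.
have [fent npoly] := hf; have [r [G [r0 [x Ux ->] f_ne]]] := ha.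
have hof : holo setT f by move=> z _; exact: derivable_der.
pose F z := f z - a.
have hF : holo setT F by move=> z _; have [l hl] := hof z I; exists l; exact: derBc.
have Fnc : exists z, F z != F 0.
  apply: contrapT => h; apply: npoly; exists (f 0)%:P => z; rewrite hornerC.
  apply/eqP; apply: contrapT => /negP ne; apply: h; exists z; rewrite /F.
  by apply: contra_neq ne => /addIr.
have preE s : f @^-1` disc a s = [set z | N (F z) < s].
  by apply/seteqP; split => z /discP.
rewrite preE in Ux f_ne.
have [v H] : exists v, tract F r (connected_component [set z | N (F z) < r] x) v.
  by apply: tract_exists => // z /f_ne; rewrite /F subr_eq0.
set G0 := connected_component _ x in H f_ne.
have Gx : G0 x by exact: connected_component_refl.
have [B [q [B0 FB]]] := finite_order_bound a hord.
have [A _ growth] := tr_growth H B0 FB.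
have val : exists n0 : nat, forall m (zs : 'I_m -> R[i]) w, pre G0 v w zs -> (m <= n0)%N.
  by have [n0 Hn0] := finite_valence H growth; exists n0 => m zs w [zi zG]; exact: Hn0 zi zG.
have [M [z0 [phi [M0 Oz0 phiv phiC phicc]]]] := half_plane_tract H val (ex_intro _ x Gx).
set C := connected_component _ z0 in phiv phiC.
have CO z : C z -> over G0 v (HM M) z := @connected_component_sub _ _ _ z.
have Cz0 : C z0 by exact: connected_component_refl.
have CG z : C z -> G0 z by case/CO.
have FM z : G0 z -> (N (F z) < r * expR (- M)) = (M < Re (v z)).
  by move=> Gz; rewrite (tr_N H Gz) ltr_pM2l // ltr_expR ltrN2.
exists (r * expR (- M)), C; split.
- by rewrite mulr_gt0 // expR_gt0.
- have [Gz0 Mz0] := Oz0.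
  have Fz0 : N (F z0) < r * expR (- M) by rewrite FM.
  exists z0; rewrite preE //; apply/seteqP; split.
    apply: connected_component_max => //; last exact: component_connected.
    by move=> z /CO[Gz Mz] /=; rewrite FM.
  pose D := connected_component [set z | N (F z) < r * expR (- M)] z0.
  have Dc : connected D by exact: component_connected.
  have Dz0 : D z0 by exact: connected_component_refl.
  have DF z : D z -> N (F z) < r * expR (- M) := @connected_component_sub _ _ _ z.
  have DG : D `<=` G0.
    apply: (tr_max H Dc Dz0 Gz0) => z /DF lt; apply: lt_trans lt _.
    by rewrite gtr_pMr // -[ltRHS]expR0 ltr_expR oppr_lt0.
  apply: connected_component_max => // z Dz; split; first exact: DG.
  by have := DF z Dz; rewrite FM //; exact: DG.
- by move=> z /CG/f_ne.
have vC z : C z -> M < Re (v z) /\ phi (v z) = z by move=> Cz; split; [case: (CO z Cz)|exact: phiv].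
have vcc z : C z -> cc v z by move=> /CG Gz; exact: (tr_cc H Gz).
split; last by apply: (half_plane_simply_connected vC vcc phiC phicc); exists z0.
apply: (half_plane_covering vC vcc phiC phicc r0).
- by apply: comp_open; apply: (over_open H); exact: opN_HM.
- by move=> z; exact: holo_cc hof I.
- move=> z /CG Gz; rewrite -/(F z) cexpN (tr_exp H Gz) invf_div mulrC divfK //.
  by rewrite -N_gt0P NReal normr_gt0 gt_eqF.
Qed.
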